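(* Assume that $\eta$ is finitely degenerate. Let $D=\{u\in L^p(\Omega,(\hat w_p)^{p-1}):\overline F(u)<+\infty\}$. Then $$D=\mathrm{Dom}_{r,w},$$ and the relaxed functional has the representation $$\overline F(u)=\begin{cases}\displaystyle\int_{I_{\Omega,w}}|\nabla u|^p\,w\,dx & \text{if }u\in \mathrm{Dom}_{r,w}\cap L^p(\Omega,(\hat w_p)^{p-1}),\\[2mm] +\infty & \text{if }u\in L^p(\Omega,(\hat w_p)^{p-1})\setminus\mathrm{Dom}_{r,w}.\end{cases}$$
   Context: Setting. Let $d\ge 1$ be an integer, $1<p<\infty$. Let $0\le a<b<\infty$ and let $\Omega=\{x\in\mathbb R^d:|x|<b\}$ or $\Omega=\{x\in\mathbb R^d: a<|x|<b\}$. Let $\eta\ge 0$ a.e., $\eta\in L^1_{\rm loc}([0,+\infty))$ with compact support, and let $w(x)=\eta(|x|)$. The support $\mathrm{supp}(\eta)$ is identified with the bounded open interval $(a,b)$. Let $$I_{p,\mathrm{supp}(\eta)}=\{r\in(\mathrm{supp}(\eta))^\circ:\ \exists\,\epsilon>0,\ \eta^{-1/(p-1)}\in L^1((r-\epsilon,r+\epsilon))\},$$ an open set, written as the disjoint union of its components $(a_i,b_i)$, $i=1,\dots,N_\eta$, $N_\eta\le+\infty$ ($N_\eta=0$ if the set is empty). $\eta$ (or $w$) is called finitely degenerate if $1\le N_\eta<+\infty$. Put $I_{\Omega,w}=\{x\in\Omega:|x|\in I_{p,\mathrm{supp}(\eta)}\}$ and, for $a_i\le\alpha<\beta\le b_i$,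 $I_{\alpha,\beta}=\{x\in I_{\Omega,w}:\alpha<|x|<\beta\}$. Auxiliary weight. Write $k(y)=[|y|^{(d-1)p}w(y)]^{-1/(p-1)}$ and $m_i=\frac{a_i+b_i}{2}$. The radial weight $\hat w_p:\Omega\to[0,\infty)$ is: $\hat w_p(x)=\big(\int_{I_{|x|,m_i}}k\,dy\big)^{-1}$ if $a_i<|x|\le\frac{3a_i+b_i}{4}$; $\hat w_p(x)=\big(\int_{I_{(3a_i+b_i)/4,(a_i+3b_i)/4}}k\,dy\big)^{-1}$ if $\frac{3a_i+b_i}{4}<|x|<\frac{a_i+3b_i}{4}$; $\hat w_p(x)=\big(\int_{I_{m_i,|x|}}k\,dy\big)^{-1}$ if $\frac{a_i+3b_i}{4}\le|x|<b_i$; at $|x|=a_i$ (resp. $|x|=b_i$) it is the limit of the first (resp. third) expression as $|x|\to a_i^+$ (resp. $|x|\to b_i^-$); $\hat w_p=0$ on $\Omega\setminus\overline{I_{\Omega,w}}$. $X=L^p(\Omega,(\hat w_p)^{p-1})$ is the space of measurable $u$ with $\int_\Omega|u|^p(\hat w_p)^{p-1}dx<\infty$, with its usual norm, functions being identified when they agree a.e. with respect to $(\hat w_p)^{p-1}dx$. Spaces. $\mathrm{Dom}_\eta$ is the set of $v:\mathrm{supp}(\eta)\to\mathbb R$ with $v\in W^{1,1}_{\rm loc}(I_{p,\mathrm{supp}(\eta)})$ and $\int_{I_{p,\mathrm{supp}(\eta)}}r^{d-1}|v'(r)|^p\eta(r)\,dr<\infty$. $\mathrm{Dom}_{r,w}$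 is the set of measurable $u:\Omega\to\mathbb R$ with $u(x)=v(|x|)$ for some $v\in\mathrm{Dom}_\eta$ (equality being for $x\in\Omega$ with $|x|\in\mathrm{supp}(\eta)$). $AC^d_r(\Omega)$ is the set of measurable $u:\Omega\to\mathbb R$ with $u\in W^{1,1}_{\rm loc}(I_{\Omega,w})$ and $u(x)=v(|x|)$ in $I_{\Omega,w}$ for some $v$ absolutely continuous on $\mathrm{supp}(\eta)$; when $\int_\Omega|\nabla u|^pw\,dx$ is written for such $u$, it is understood that $u(x)=v(|x|)$ for all $x\in\Omega$ with $|x|\in\mathrm{supp}(\eta)$, so $\nabla u(x)=v'(|x|)x/|x|$ a.e. there, while $w=0$ elsewhere. Relaxed functional. $F:X\to[0,+\infty]$ is $F(u)=\int_\Omega|\nabla u|^pw\,dx$ if $u\in AC^d_r(\Omega)$ and $F(u)=+\infty$ if $u\in X\setminus AC^d_r(\Omega)$. $\overline F$ is the lower semicontinuous envelope of $F$ with respect to the norm topology of $X$ (the largest lower semicontinuous functional on $X$ that is $\le F$). Membership of an element of $X$ in $\mathrm{Dom}_{r,w}$ or $AC^d_r(\Omega)$ means that it has a representative in that set. *)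

(* Defs.v *)
(* Measurability is Borel measurability throughout, as in the library; every
   class of Lebesgue measurable functions has a Borel representative.  Functions
   with a restricted domain are total functions, constrained on that domain
   only. *)
From HB Require Import structures.
From mathcomp Require Import all_boot all_order all_algebra.
From mathcomp Require Import all_classical all_reals all_analysis.

Set Implicit Arguments.
Unset Strict Implicit.
Unset Printing Implicit Defensive.

Import Order.TTheory GRing.Theory Num.Theory.
Import numFieldNormedType.Exports.

Local Open Scope classical_set_scope.
Local Open Scope ring_scope.

Definition mx_display : measure_display -> measure_display.
Proof. exact. Qed.

Section measurable_matrix.
Context {disp : measure_display} {T : measurableType disp}.
Variables m n : nat.

Definition mx_cylinder : set (set 'M[T]_(m, n)) :=
  [set B | exists (i : 'I_m) (j : 'I_n) (A : set T),
     measurable A /\ B = [set M : 'M[T]_(m, n) | A (M i j)]].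

(* For 'rV[R]_n the coordinate sigma-algebra is the Borel one. *)
HB.instance Definition _ := @isMeasurable.Build (mx_display disp)
  'M[T]_(m, n) <<s mx_cylinder >> (@sigma_algebra0 _ _ _)
  (@sigma_algebraC _ _) (@sigma_algebra_bigcup _ _ _).

Lemma measurable_coord i j :
  measurable_fun [set: 'M[T]_(m, n)] (fun M : 'M[T]_(m, n) => M i j).
Proof.
move=> _ A mA; rewrite setTI; apply: sub_sigma_algebra.
by exists i, j, A; split.
Qed.

Lemma measurable_fun_coordP disp' (S : measurableType disp')
    (f : S -> 'M[T]_(m, n)) :
  (forall i j, measurable_fun [set: S] (fun x => f x i j)) ->
  measurable_fun [set: S] f.
Proof.
move=> mf _ B mB; rewrite setTI.
pose H := [set B : set 'M[T]_(m, n) | measurable (f @^-1` B)].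
suff: <<s mx_cylinder >> `<=` H by apply.
apply: smallest_sub.
  split; rewrite /H/=.
  - by rewrite preimage_set0.
  - by move=> A mA; rewrite setTD preimage_setC; exact: measurableC.
  - by move=> A mA; rewrite preimage_bigcup; exact: bigcup_measurable.
move=> _ [i [j [A [mA ->]]]]; rewrite /H/=.
by have := mf i j measurableT _ mA; rewrite setTI.
Qed.

End measurable_matrix.

Section lebesgue_rV.
Context {R : realType}.

Definition rV_cons n (z : (R * 'rV[R]_n)%type) : 'rV[R]_n.+1 := row_mx (z.1)%:M z.2.

Definition rV_uncons n (x : 'rV[R]_n.+1) : (R * 'rV[R]_n)%type :=
  (x ord0 ord0, \row_i x ord0 (lift ord0 i)).

Lemma rV_consK n : cancel (@rV_cons n) (@rV_uncons n).
Proof.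
move=> [t x]; rewrite /rV_uncons /rV_cons /=.
have -> : (ord0 : 'I_n.+1) = lshift n (ord0 : 'I_1) by exact/val_inj.
rewrite (row_mxEl (t%:M : 'M[R]_1) x) mxE eqxx mulr1n; congr (_, _).
apply/rowP => i; rewrite mxE.
have -> : lift (lshift n (ord0 : 'I_1)) i = rshift 1 i by exact/val_inj.
by rewrite (row_mxEr (t%:M : 'M[R]_1) x).
Qed.

Lemma measurable_rV_cons n : measurable_fun [set: (R * 'rV[R]_n)%type] (@rV_cons n).
Proof.
apply: measurable_fun_coordP => i j; rewrite (ord1 i).
case: (unliftP ord0 j) => [k ->|->].
- rewrite (_ : (fun x => rV_cons x ord0 (lift ord0 k)) =
      (fun M : 'rV[R]_n => M ord0 k) \o snd).
    exact: measurableT_comp (measurable_coord _ _) measurable_snd.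
  apply/funext => z /=; have := congr1 snd (rV_consK z).
  by move=> /= /rowP /(_ k); rewrite mxE.
- rewrite (_ : (fun x => rV_cons x ord0 ord0) = fst).
    exact: measurable_fst.
  by apply/funext => z /=; exact: (congr1 fst (rV_consK z)).
Qed.

Lemma measurable_rV_uncons n :
  measurable_fun [set: 'rV[R]_n.+1] (@rV_uncons n).
Proof.
apply/measurable_fun_pairP; split => /=; first exact: measurable_coord.
apply: measurable_fun_coordP => i j.
rewrite (_ : (fun x => _) = (fun M : 'rV[R]_n.+1 => M ord0 (lift ord0 j))).
  exact: measurable_coord.
by apply/funext => x /=; rewrite mxE.
Qed.

Section step.
Variables (n : nat) (mu : {sigma_finite_measure set 'rV[R]_n -> \bar R}).

Definition leb_step : set 'rV[R]_n.+1 -> \bar R :=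
  pushforward (lebesgue_measure \x mu)%E (@rV_cons n).

Let leb_step0 : leb_step set0 = 0%E.
Proof. by rewrite /leb_step /pushforward preimage_set0 measure0. Qed.

Let leb_step_ge0 A : (0 <= leb_step A)%E.
Proof. by rewrite /leb_step /pushforward; exact: measure_ge0. Qed.

Let leb_step_sigma_additive : semi_sigma_additive leb_step.
Proof.
move=> F mF tF mUF; rewrite /leb_step /pushforward preimage_bigcup.
have mpre A : measurable A -> measurable (@rV_cons n @^-1` A).
  by move=> mA; rewrite -[X in measurable X]setTI; exact: measurable_rV_cons.
apply: measure_semi_sigma_additive.
- by move=> k; exact: mpre.
- apply/trivIsetP => /= i j _ _ ij; rewrite -preimage_setI.
  by move/trivIsetP : tF => /(_ _ _ _ _ ij) ->//; rewrite preimage_set0.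
- by rewrite -preimage_bigcup; exact: mpre.
Qed.

HB.instance Definition _ := isMeasure.Build _ _ _
  leb_step leb_step0 leb_step_ge0 leb_step_sigma_additive.

Lemma leb_step_sigma_finite : sigma_finite setT leb_step.
Proof.
have /sigma_finiteP[F [FT ndF Foo]] := sigma_finiteT (@lebesgue_measure R).
have /sigma_finiteP[G [GT ndG Goo]] := sigma_finiteT mu.
exists (fun k => @rV_uncons n @^-1` (F k `*` G k)).
  apply/esym; rewrite -subTset => x _ /=.
  have [i _ Fi] : (\bigcup_i F i) (rV_uncons x).1 by rewrite -FT.
  have [j _ Gj] : (\bigcup_j G j) (rV_uncons x).2 by rewrite -GT.
  exists (maxn i j) => //; split => /=.
  - by move: Fi; exact/subsetPset/ndF/leq_maxl.
  - by move: Gj; exact/subsetPset/ndG/leq_maxr.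
move=> k; have [mF Fk] := Foo k; have [mG Gk] := Goo k; split.
  rewrite -[X in measurable X]setTI; apply: measurable_rV_uncons => //.
  exact: measurableX.
rewrite /leb_step /pushforward -comp_preimage.
rewrite (_ : _ \o _ = id); last by apply/funext => z; exact: rV_consK.
by rewrite preimage_id product_measure1E// lte_mul_pinfty// ge0_fin_numE.
Qed.
HB.instance Definition _ :=
  Measure_isSigmaFinite.Build _ _ _ leb_step leb_step_sigma_finite.

End step.

Fixpoint leb n : {sigma_finite_measure set 'rV[R]_n -> \bar R} :=
  match n with
  | 0 => dirac (0 : 'rV[R]_0)
  | n'.+1 => leb_step (leb n')
  end.

End lebesgue_rV.

(* The library norm on 'rV[R]_n is the sup norm. *)
Definition enorm {R : realType} {n : nat} (x : 'rV[R]_n) : R :=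
  Num.sqrt (\sum_(i < n) x ord0 i ^+ 2).

Definition eball {R : realType} {n : nat} (b : R) : set 'rV[R]_n :=
  [set x | enorm x < b].

Definition annulus {R : realType} {n : nat} (a b : R) : set 'rV[R]_n :=
  [set x | a < enorm x < b].

(* C^oo in finite dimension: all iterated directional derivatives exist and are
   continuous. *)
Definition smooth {R : realType} {V : normedModType R} (phi : V -> R) :=
  forall s : seq V,
    let psi := foldr (fun v f => 'D_v f) phi s in
    continuous psi /\ forall x v, derivable psi x v.

Definition test_function {R : realType} {V : normedModType R} (U : set V)
    (phi : V -> R) :=
  smooth phi /\
  exists2 K, compact K /\ K `<=` U & forall x, ~ K x -> phi x = 0.

Definition weak_derivative {R : realType} (J : set R) (v v' : R -> R) :=
  [/\ locally_integrable J v, locally_integrable J v' &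
    forall phi : R -> R, test_function J phi ->
      (\int[lebesgue_measure]_(r in J) (v r * derive1 phi r)%:E =
       - \int[lebesgue_measure]_(r in J) (v' r * phi r)%:E)%E].

Definition locally_integrable_rV {R : realType} {n : nat} (U : set 'rV[R]_n)
    (u : 'rV[R]_n -> R) :=
  [/\ measurable_fun U u, open U &
    forall K, K `<=` U -> compact K ->
      (\int[leb n]_(x in K) `|u x|%:E < +oo)%E].

Definition weak_gradient {R : realType} {n : nat} (U : set 'rV[R]_n)
    (u : 'rV[R]_n -> R) (G : 'rV[R]_n -> 'rV[R]_n) :=
  locally_integrable_rV U u /\
  forall i : 'I_n, locally_integrable_rV U (fun x => G x ord0 i) /\
    forall phi : 'rV[R]_n -> R, test_function U phi ->
      (\int[leb n]_(x in U) (u x * 'D_(delta_mx ord0 i) phi x)%:E =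
       - \int[leb n]_(x in U) (G x ord0 i * phi x)%:E)%E.

Definition W11loc {R : realType} {n : nat} (U : set 'rV[R]_n)
    (u : 'rV[R]_n -> R) := exists G, weak_gradient U u G.

Definition abs_continuous {R : realType} (a b : R) (v : R -> R) :=
  forall e : R, 0 < e -> exists2 delta : R, 0 < delta &
    forall (n : nat) (s t : 'I_n -> R),
      (forall i, a < s i /\ s i <= t i /\ t i < b) ->
      trivIset [set: 'I_n] (fun i => `]s i, t i[%classic) ->
      \sum_(i < n) (t i - s i) < delta ->
      \sum_(i < n) `|v (t i) - v (s i)| < e.

Section profile.
Context {R : realType}.
Variables (p a b : R) (eta : R -> R).

Definition L1loc_halfline :=
  measurable_fun (`[0, +oo[%classic : set R) eta /\
  forall K : set R, K `<=` `[0, +oo[ -> compact K ->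
    lebesgue_measure.-integrable K (EFin \o eta).

(* Points of [0, +oo[ with no neighbourhood on which eta vanishes a.e. *)
Definition ess_support : set R :=
  [set r | 0 <= r /\ forall e, 0 < e ->
    ~ {ae lebesgue_measure, forall s, 0 <= s -> `|s - r| < e -> eta s = 0}].

(* t ^ (- 1 / (p - 1)), equal to +oo at t = 0: the inverse is the one of \bar R
   since powR 0 is 0 for every nonzero exponent. *)
Definition inv_pow (t : R) : \bar R := ((t `^ (p - 1)^-1)%:E)^-1%E.

(* I_{p, supp eta}, where supp eta stands for ]a, b[. *)
Definition regular_set : set R :=
  [set r | a < r < b /\ exists2 e, 0 < e &
    lebesgue_measure.-integrable `]r - e, r + e[%classic (fun s => inv_pow (eta s))].

(* Pairs (a_i, b_i) of endpoints of the components of regular_set. *)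
Definition regular_components : set (R * R) :=
  [set c | exists2 r, regular_set r &
    connected_component regular_set r = `]c.1, c.2[%classic].

Definition finitely_degenerate :=
  regular_components !=set0 /\ finite_set regular_components.

Definition Dom_eta (d : nat) (v : R -> R) :=
  exists2 v', weak_derivative regular_set v v' &
    (\int[lebesgue_measure]_(r in regular_set)
       (r ^+ d.-1 * `|v' r| `^ p * eta r)%:E < +oo)%E.

End profile.

Section radial.
Context {R : realType}.
Variables (d : nat) (p a b : R) (eta : R -> R) (Omega : set 'rV[R]_d).

Local Notation mu := (leb d).

Definition w (x : 'rV[R]_d) : R := eta (enorm x).

Definition I_Omega : set 'rV[R]_d :=
  [set x | Omega x /\ regular_set p a b eta (enorm x)].

Definition I_shell (alpha beta : R) : set 'rV[R]_d :=
  [set x | I_Omega x /\ alpha < enorm x < beta].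

Definition kernel_k (y : 'rV[R]_d) : \bar R :=
  inv_pow p (enorm y `^ (d.-1%:R * p) * w y).

Definition inv_int_k (alpha beta : R) : \bar R :=
  ((\int[mu]_(y in I_shell alpha beta) kernel_k y)^-1)%E.

Definition what_left (c : R * R) (r : R) : \bar R :=
  inv_int_k r ((c.1 + c.2) / 2).

Definition what_right (c : R * R) (r : R) : \bar R :=
  inv_int_k ((c.1 + c.2) / 2) r.

Definition what_inside (c : R * R) (r : R) : \bar R :=
  if r <= (3 * c.1 + c.2) / 4 then what_left c r
  else if r < (c.1 + 3 * c.2) / 4 then
    inv_int_k ((3 * c.1 + c.2) / 4) ((c.1 + 3 * c.2) / 4)
  else what_right c r.

Local Notation comps := (regular_components p a b eta).

(* A radius that is an endpoint of two components gets the value prescribed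
   there by the right one; this concerns finitely many spheres. *)
Definition what_profile (r : R) : \bar R :=
  if `[< exists2 c, comps c & c.1 < r < c.2 >] then
    what_inside (get [set c | comps c /\ c.1 < r < c.2]) r
  else if `[< exists2 c, comps c & c.1 = r >] then
    let c := get [set c | comps c /\ c.1 = r] in
    lim (what_left c s @[s --> c.1^'+])
  else if `[< exists2 c, comps c & c.2 = r >] then
    let c := get [set c | comps c /\ c.2 = r] in
    lim (what_right c s @[s --> c.2^'-])
  else 0%E.

Definition what (x : 'rV[R]_d) : R := fine (what_profile (enorm x)).

Definition weight (x : 'rV[R]_d) : R := what x `^ (p - 1).

(* Elements of X are handled through representatives; eqX is a.e. equality for
   the measure with density weight. *)
Definition int_pow (u : 'rV[R]_d -> R) : \bar R :=
  (\int[mu]_(x in Omega) (`|u x| `^ p * weight x)%:E)%E.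

Definition normX (u : 'rV[R]_d -> R) : \bar R := (int_pow u `^ p^-1)%E.

Definition X : set ('rV[R]_d -> R) :=
  [set u | measurable_fun Omega u /\ (int_pow u < +oo)%E].

Definition eqX (u u' : 'rV[R]_d -> R) :=
  exists N : set 'rV[R]_d, [/\ measurable N,
    (\int[mu]_(x in Omega `&` N) (weight x)%:E = 0)%E &
    forall x, Omega x -> u x <> u' x -> N x].

Definition classes_of (S : set ('rV[R]_d -> R)) : set ('rV[R]_d -> R) :=
  [set u | measurable_fun Omega u /\ exists2 u', eqX u u' & S u'].

(* A lower semicontinuous G takes the same value at eqX-equal elements of X,
   since their distance is 0. *)
Definition lscX (G : ('rV[R]_d -> R) -> \bar R) :=
  forall u, X u -> forall t : R, (t%:E < G u)%E ->
    exists2 e : R, 0 < e &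
      forall u', X u' -> (normX (u' \- u)%R < e%:E)%E -> (t%:E < G u')%E.

Definition lsc_envelope (F : ('rV[R]_d -> R) -> \bar R)
    (u : 'rV[R]_d -> R) : \bar R :=
  ereal_sup [set G u | G in
    [set G | lscX G /\ forall u', X u' -> (G u' <= F u')%E]].

Definition Dom_rw : set ('rV[R]_d -> R) :=
  [set u | measurable_fun Omega u /\ exists2 v, Dom_eta p a b eta d v &
    forall x, Omega x -> a < enorm x < b -> u x = v (enorm x)].

Definition ACd_profile (u : 'rV[R]_d -> R) (v : R -> R) :=
  [/\ measurable_fun Omega u, W11loc I_Omega u, abs_continuous a b v &
    forall x, I_Omega x -> u x = v (enorm x)].

(* Outside of a < |x| < b the weight w vanishes a.e. and v is irrelevant. *)
Definition radial_gradient (v : R -> R) (x : 'rV[R]_d) : 'rV[R]_d :=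
  if a < enorm x < b then (derive1 v (enorm x) / enorm x) *: x else 0.

Definition energy (U : set 'rV[R]_d) (G : 'rV[R]_d -> 'rV[R]_d) : \bar R :=
  (\int[mu]_(x in U) (enorm (G x) `^ p * w x)%:E)%E.

(* An element of X determines the absolutely continuous profile v only on
   regular_set, whereas the energy involves v on the whole of ]a, b[; the value
   at a class is therefore the infimum over its admissible profiles.  It is
   +oo when there is none, i.e. when the class does not meet AC^d_r(Omega). *)
Definition F (u : 'rV[R]_d -> R) : \bar R :=
  ereal_inf [set energy Omega (radial_gradient v) | v in
    [set v | exists2 u', eqX u u' & ACd_profile u' v]].

Definition Fbar : ('rV[R]_d -> R) -> \bar R := lsc_envelope F.

End radial.

(* Main.v *)
(* Let I be the regular set, kappa = (r^(d-1) eta)^(-1/(p-1)), which is locally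
   integrable on I, and sigma the area of the unit sphere.  A radial function
   with profile v on I, v' = f, has the energy sigma int_I |f|^p kappa^(1-p).
   Let G u be the infimum of these energies over the profiles of u.

   Lower bound.  By Hoelder |v y - v x|^p <= E (int_x^y kappa)^(p-1) for a
   profile of energy E, so profiles of bounded energy are equicontinuous on the
   compact subsets of I.  Since the weight is positive on I, fast convergence in
   X forces pointwise convergence of the profiles on I; absolute continuity
   passes to the limit, and so does the energy, being the limit of its dyadic
   sums |v t' - v t|^p / (int_t^t' kappa)^(p-1).  Hence G is lower
   semicontinuous, and G <= F.

   Upper bound.  The definition of the weight and Hoelder give a bound of
   |v r|^p what(r)^(p-1) by the energy.  Let v be constant at distance less than
   h from the ends of each component, and join these constants to 0 within
   delta of each end e.  Off ]a, b[ this costs nothing; otherwise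
   eta^(-1/(p-1)) is not integrable near e, so that some g <= eta^(-1/(p-1))
   has a large integral Z, and the transition of density g / Z costs at most
   C Z^(1-p).  The functions obtained have absolutely continuous profiles on
   ]a, b[ and converge to u in X as delta, then h, tend to 0.

   Weak gradients being unique, all profiles of u have the energy of its weak
   gradient, which is therefore the value of G u. *)

(* The obstacle is that F only sees profiles absolutely continuous across the degenerate radii,
   while a profile on I may be unbounded at the ends of a component. The weight is tuned so that |v
   q|^p what(r)^(p-1) is bounded for all q between r and the midpoint of its component, by a
   constant that does not depend on h; this controls the function frozen at distance h.

   The lower bound needs no weak compactness. With kappa, the energy density |f|^p kappa^(1-p) =
   (|f| / kappa)^p kappa is the perspective of a convex power, and Jensen's inequality on each
   dyadic cell bounds the energy from below by an expression in finitely many values of v. Pointwise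
   limits pass through it at each level, and refining the subdivision recovers the energy by Fatou's
   lemma.

   An element of X is a class of functions of d variables, hence the detours through the area of
   spheres, through pointwise representatives of weak derivatives and through integration by parts
   for radial functions. *)
From HB Require Import structures.
From mathcomp Require Import all_boot all_order all_algebra.
From mathcomp Require Import all_classical all_reals all_analysis.
From mathcomp Require Import measurable_realfun lra ring.
Require Import Defs.

Set Implicit Arguments.
Unset Strict Implicit.
Unset Printing Implicit Defensive.

Import Order.TTheory GRing.Theory Num.Theory.
Import numFieldNormedType.Exports.
Import HBSimple HBNNSimple.

Local Open Scope classical_set_scope.
Local Open Scope ring_scope.

(** * Integration in polar coordinates *)

Section off_null.
Local Open Scope ereal_scope.
Context d (T : measurableType d) (R : realType).
Variable mu : {measure set T -> \bar R}.
Implicit Types (D N : set T) (f g : T -> \bar R).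

(* No measurability of [f] and [g] is needed: the integral of a nonnegative
   function is a supremum over the simple functions below it. *)
Lemma ge0_le_integral_off_null D N f g : measurable N -> mu N = 0 ->
  (forall x, D x -> 0 <= f x) -> (forall x, D x -> 0 <= g x) ->
  (forall x, D x -> ~ N x -> f x <= g x) ->
  \int[mu]_(x in D) f x <= \int[mu]_(x in D) g x.
Proof.
move=> mN N0 f0 g0 fg.
rewrite (ge0_integralE _ f0) (ge0_integralE _ g0).
apply: ge_ereal_sup => _ [/= h hf <-].
have mNc : measurable (~` N) by exact: measurableC.
pose k := mul_nnsfun h (indic_nnsfun R mNc).
apply: ereal_sup_ubound; exists k => /=.
  move=> x; rewrite /k /= /mindic indicE; case: (boolP (x \in ~` N)) => [xN|xN].
    rewrite mulr1; apply: (le_trans (hf x)); rewrite !patchE.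
    case: ifPn => // xD; apply: fg; first by rewrite inE in xD.
    by rewrite inE in xN.
  by rewrite mulr0 patchE; case: ifPn => // /set_mem/g0.
rewrite -(integralT_nnsfun mu h) -integralT_nnsfun.
apply: ge0_ae_eq_integral => //.
- by apply/measurable_EFinP; exact: measurable_funPT.
- by apply/measurable_EFinP; exact: measurable_funPT.
- by move=> x _; rewrite lee_fin.
- by move=> x _; rewrite lee_fin.
exists N; split => // x /=; apply: contra_notP => xN _.
by rewrite /mindic indicE mem_set ?mulr1.
Qed.

(** Two comparisons off N for the positive parts, and two for the negative parts. *)
Lemma eq_integral_off_null D N f g : measurable N -> mu N = 0 ->
  (forall x, D x -> ~ N x -> f x = g x) ->
  \int[mu]_(x in D) f x = \int[mu]_(x in D) g x.
Proof.
move=> mN N0 fg.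
have H (f1 g1 : T -> \bar R) : (forall x, D x -> 0 <= f1 x) ->
    (forall x, D x -> 0 <= g1 x) ->
    (forall x, D x -> ~ N x -> f1 x = g1 x) ->
    \int[mu]_(x in D) f1 x = \int[mu]_(x in D) g1 x.
  move=> f0 g0 e; apply/eqP; rewrite eq_le; apply/andP; split;
    apply: (ge0_le_integral_off_null mN N0) => // x Dx Nx.
    by rewrite e.
  by rewrite e.
rewrite integralE [RHS]integralE; congr (_ - _); apply: H => //.
- by move=> x Dx Nx; rewrite !funeposE fg.
- by move=> x Dx Nx; rewrite !funenegE fg.
Qed.

End off_null.

Section measurable_rV.
Context {R : realType}.

Lemma measurable_enorm n : measurable_fun setT (@enorm R n).
Proof.
apply: measurableT_comp; first by apply: continuous_measurable_fun; exact: sqrt_continuous.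
apply: measurable_sum => i; apply: measurable_funX; exact: measurable_coord.
Qed.

Definition obox n (al be : 'I_n -> R) : set 'rV[R]_n :=
  [set x | forall i, al i < x ord0 i < be i].

Definition cbox n (al be : 'I_n -> R) : set 'rV[R]_n :=
  [set x | forall i, al i <= x ord0 i <= be i].

Lemma measurable_obox n (al be : 'I_n -> R) : measurable (obox al be).
Proof.
rewrite (_ : obox _ _ = \bigcap_(i in [set: 'I_n])
   [set x | `]al i, be i[%classic (x ord0 i)]).
  apply: fin_bigcap_measurable => // i _.
  have := @measurable_coord _ R 1 n ord0 i measurableT
    `]al i, be i[%classic (measurable_itv _).
  by rewrite setTI.
by apply/seteqP; split => [x qx i _|x qx i]; have := qx i; rewrite /= in_itv //=; exact.
Qed.

Definition rat_lower n (q : {ffun 'I_n -> rat * rat}) i : R := ratr (q i).1.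
Definition rat_upper n (q : {ffun 'I_n -> rat * rat}) i : R := ratr (q i).2.

(** Rational corners leave countably many boxes, so null sets can be collected over them; the closed
    box lies in [U], as the supports of test functions must. *)
Lemma open_rat_box n (U : set 'rV[R]_n) x : open U -> U x ->
  exists2 q : {ffun 'I_n -> rat * rat},
    obox (rat_lower q) (rat_upper q) x & cbox (rat_lower q) (rat_upper q) `<=` U.
Proof.
move=> oU Ux.
have /nbhs_ballP[e /= e0 xe] : nbhs x U by exact: open_nbhs_nbhs.
have ex (i : 'I_n) : exists q : rat * rat,
    [&& x ord0 i - e < ratr q.1, ratr q.1 < x ord0 i, x ord0 i < ratr q.2 &
        ratr q.2 < x ord0 i + e].
  have [q1 /itvP q1P] := @rat_in_itvoo R (x ord0 i - e) (x ord0 i) ltac:(lra).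
  have [q2 /itvP q2P] := @rat_in_itvoo R (x ord0 i) (x ord0 i + e) ltac:(lra).
  by exists (q1, q2); rewrite /= !q1P !q2P.
exists [ffun i => xchoose (ex i)].
  move=> i; rewrite /rat_lower /rat_upper ffunE.
  by have /and4P[_ -> -> _] := xchooseP (ex i).
move=> y /= yq; apply: xe; rewrite /ball/=; split => // i j.
rewrite (ord1 i) /ball/=; have := yq j; have := xchooseP (ex j).
rewrite /rat_lower /rat_upper ffunE => /and4P[h1 h2 h3 h4] /andP[h5 h6].
by rewrite ltr_norml; apply/andP; split; lra.
Qed.

Lemma obox_cbox n (al be : 'I_n -> R) : obox al be `<=` cbox al be.
Proof. by move=> x H i; have /andP[/ltW -> /ltW ->] := H i. Qed.

(** The sigma-algebra is generated by the coordinates, not by the open sets; an open set belongs to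
    it as a countable union of rational boxes. *)
Lemma open_measurable_rV n (U : set 'rV[R]_n) : open U -> measurable U.
Proof.
move=> oU.
pose B (q : {ffun 'I_n -> rat * rat}) := obox (rat_lower q) (rat_upper q).
have -> : U = \bigcup_q (if `[< B q `<=` U >] then B q else set0).
  apply/seteqP; split => [x Ux|x [q _]]; last by case: asboolP => // qU; exact: qU.
  have [q Bq qU] := open_rat_box oU Ux.
  by exists q => //; rewrite ifT//; apply/asboolP; exact: subset_trans (@obox_cbox _ _ _) qU.
apply: countable_bigcupT_measurable; first exact: countableP.
by move=> q; case: ifPn => // _; exact: measurable_obox.
Qed.

Lemma continuous_measurable_rV n (f : 'rV[R]_n -> R) :
  continuous f -> measurable_fun setT f.
Proof.
move=> /continuousP cf; apply: (measurability _ (RGenOpens.measurableE R)).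
move=> _ [_ [a [b [-> <-]]]]; rewrite setTI.
by apply: open_measurable_rV; apply: cf; exact: interval_open.
Qed.

Lemma ge0_integral_leb_step n (f : 'rV[R]_n.+1 -> \bar R) :
  measurable_fun [set: 'rV[R]_n.+1] f -> (forall x, (0 <= f x)%E) ->
  (\int[leb n.+1]_x f x =
   \int[lebesgue_measure]_t \int[leb n]_x f (rV_cons (t, x)))%E.
Proof.
move=> mf f0.
rewrite /= /leb_step ge0_integral_pushforward//; last exact: measurable_rV_cons.
rewrite preimage_setT fubini_tonelli1//; last by move=> z; exact: f0.
exact: measurableT_comp mf (@measurable_rV_cons R n).
Qed.

End measurable_rV.

Section density_measure.
Local Open Scope ereal_scope.
Context d (T : measurableType d) (R : realType).
Variables (mu : {measure set T -> \bar R}) (g : {mfun T >-> R}).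
Hypothesis g0 : forall x, (0 <= g x)%R.

(** The proof of nonnegativity is an argument, so that the measure structure declared below, which
    depends on it, can be recovered from the term. *)
Definition density_measure of (forall x, (0 <= g x)%R) := fun A : set T => \int[mu]_(x in A) (g x)%:E.

Local Notation nu := (density_measure g0).

Let nu0 : nu set0 = 0. Proof. exact: integral_set0. Qed.

Let nu_ge0 A : 0 <= nu A.
Proof. by apply: integral_ge0 => x _; rewrite lee_fin. Qed.

Let nu_sigma_additive : semi_sigma_additive nu.
Proof.
apply: semi_sigma_additive_nng_induced; last by move=> x; rewrite lee_fin.
by apply/measurable_EFinP.
Qed.

HB.instance Definition _ := isMeasure.Build _ _ _ nu nu0 nu_ge0 nu_sigma_additive.


Lemma ge0_integral_density (f : T -> \bar R) : measurable_fun setT f ->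
  (forall x, 0 <= f x) ->
  \int[nu]_x f x = \int[mu]_x (f x * (g x)%:E).
Proof.
move=> mf f0.
pose f_ := nnsfun_approx measurableT mf.
have cf x : EFin \o f_^~ x @ \oo --> f x by apply: cvg_nnsfun_approx => // y _.
have fE x : f x = lim ((EFin \o f_^~ x) n @[n --> \oo]) by apply/esym/cvg_lim.
have fgE x : f x * (g x)%:E = lim ((f_ n x)%:E * (g x)%:E @[n --> \oo]).
  by apply/esym/cvg_lim => //; apply: cvgeZr => //; exact: cf.
rewrite (_ : \int[nu]_x f x = \int[nu]_x lim ((EFin \o f_^~ x) n @[n --> \oo])); last first.
  by apply: eq_integral => x _; rewrite fE.
rewrite (_ : \int[mu]_x (f x * (g x)%:E) =
    \int[mu]_x lim ((f_ n x)%:E * (g x)%:E @[n --> \oo])); last first.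
  by apply: eq_integral => x _; rewrite fgE.
rewrite monotone_convergence//; last 3 first.
  by move=> n; apply/measurable_EFinP; exact: measurable_funPT.
  by move=> n x _; rewrite lee_fin.
  by move=> x _ m n mn; rewrite lee_fin; exact/lefP/nd_nnsfun_approx.
rewrite monotone_convergence//; last 3 first.
  move=> n; apply: emeasurable_funM; apply/measurable_EFinP => //.
  by move=> n x _; rewrite mule_ge0// lee_fin.
  move=> x _ m n mn; apply: lee_wpmul2r; rewrite ?lee_fin//.
  exact/lefP/nd_nnsfun_approx.
apply: (congr1 (fun u : nat -> \bar R => limn u)); apply/funext => n.
under eq_integral do rewrite /= fimfunE -fsumEFin//.
under [RHS]eq_integral => x _.
  rewrite fimfunE -fsumEFin// ge0_mule_fsuml; last first.
    by move=> y; exact: nnfun_muleindic_ge0.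
  over.
have mi r : measurable (f_ n @^-1` [set r]) by exact: measurable_funPTI.
rewrite ge0_integral_fsum//; last 2 first.
  by move=> y; apply/measurable_EFinP/measurable_funM.
  by move=> y x _; exact: nnfun_muleindic_ge0.
rewrite ge0_integral_fsum//; last 2 first.
  move=> y; apply: emeasurable_funM; apply/measurable_EFinP => //.
  exact: measurable_funM.
  by move=> y x _; apply: mule_ge0; [exact: nnfun_muleindic_ge0|rewrite lee_fin].
apply: eq_fsbigr => r /set_mem [t _ rE].
under eq_integral do rewrite EFinM.
under [RHS]eq_integral do rewrite EFinM -muleA.
have r0 : (0 <= r)%R by rewrite -rE.
rewrite ge0_integralZl//; last by apply/measurable_EFinP.
  rewrite [RHS]ge0_integralZl//; last 2 first.
    by apply: emeasurable_funM; apply/measurable_EFinP => //.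
    by move=> x _; rewrite mule_ge0 ?lee_fin.
  rewrite integral_indic// setIT; congr (_ * _).
  rewrite [LHS]integral_mkcond; apply: eq_integral => x _.
  by rewrite patchE indicE; case: ifPn; rewrite ?mul1e ?mul0e.
Qed.

End density_measure.

Section scaling.
Context {R : realType}.
Local Open Scope ereal_scope.

(** The image of the Lebesgue measure under multiplication by c, times c, gives each interval its
    length; by uniqueness it is the Lebesgue measure. *)
Lemma ge0_integral_scale1 (f : R -> \bar R) (c : R) : (0 < c)%R ->
  measurable_fun setT f -> (forall x, 0 <= f x) ->
  \int[lebesgue_measure]_t f (c * t)%R =
  (c^-1)%:E * \int[lebesgue_measure]_t f t.
Proof.
move=> c0 mf f0.
have ci : (0 <= c)%R by exact: ltW.
have mc : measurable_fun [set: measurableTypeR R] ( *%R c : measurableTypeR R -> measurableTypeR R).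
  exact: measurable_funM.
have [nu [nuE nuI]] : exists nu : {measure set (measurableTypeR R) -> \bar R},
    (forall A, nu A = c%:E * lebesgue_measure ( *%R c @^-1` A)) /\
    \int[nu]_t f t = c%:E * \int[lebesgue_measure]_t f (c * t)%R.
  unshelve refine (ex_intro _ (mscale (NngNum ci) (pushforward (@lebesgue_measure R)
    ( *%R c : measurableTypeR R -> measurableTypeR R)) : {measure set (measurableTypeR R) -> \bar R}) _).
    exact: mc.
  by split => //; rewrite ge0_integral_mscale// ge0_integral_pushforward.
have lebE A : measurable A -> lebesgue_measure A = nu A.
  apply: lebesgue_measure_unique => _ [[a b] _ <-] /=.
  rewrite nuE (_ : *%R c @^-1` `]a, b] = `](a / c)%R, (b / c)%R]%classic); last first.
    apply/seteqP; split => x /=; rewrite !in_itv/=;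
      by rewrite ltr_pdivrMr// ler_pdivlMr// mulrC.
  rewrite !lebesgue_measure_itv/= !lte_fin ltr_pM2r ?invr_gt0//.
  case: ifP => _; last by rewrite mule0.
  by rewrite -EFinM; congr EFin; field; rewrite gt_eqF.
rewrite [in RHS](@eq_measure_integral _ _ _ _ nu) => [|A mA _]; last exact: lebE.
by rewrite nuI muleA -EFinM mulVf ?gt_eqF// mul1e.
Qed.

Lemma rV_consZ n (c t : R) (x : 'rV[R]_n) :
  (c *: rV_cons (t, x) = rV_cons ((c * t)%R, c *: x))%R.
Proof. by rewrite /rV_cons /= (@scale_row_mx R 1 1 n) scale_scalar_mx. Qed.

Lemma ge0_integral_leb_scale n (f : 'rV[R]_n -> \bar R) (c : R) : (0 < c)%R ->
  measurable_fun [set: 'rV[R]_n] f -> (forall x, 0 <= f x) ->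
  \int[leb n]_x f (c *: x)%R = ((c^-1) ^+ n)%:E * \int[leb n]_x f x.
Proof.
move=> c0; elim: n f => [|n ih] f mf f0.
  rewrite expr0 mul1e; apply: eq_integral => x _; congr f.
  by apply/rowP => -[].
have mcons := @measurable_rV_cons R n.
have msc : measurable_fun [set: 'rV[R]_n.+1] (fun x : 'rV[R]_n.+1 => c *: x)%R.
  apply: measurable_fun_coordP => i j.
  rewrite (_ : (fun x => _) = (fun x : 'rV[R]_n.+1 => c * x i j)%R).
    apply: measurable_funM => //; exact: measurable_coord.
  by apply/funext => x; rewrite mxE.
rewrite ge0_integral_leb_step//; last exact: measurableT_comp.
under eq_integral => t _.
  under eq_integral => x _.
    rewrite rV_consZ; over.
  have := ih (fun x => f (rV_cons ((c * t)%R, x))) _ _ => /= -> //; first over.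
  by apply: measurableT_comp mf _; apply: measurableT_comp mcons _;
     exact: measurable_pair1.
rewrite ge0_integralZl//; last 3 first.
- have H : measurable_fun setT (fun s => \int[leb n]_x f (rV_cons (s, x))).
    have HH := (measurable_fun_fubini_tonelli_F (m2 := leb n) _
      (measurableT_comp mf mcons) (fun z => f0 _)).
    exact: HH.
  exact: measurableT_comp H _.
- by move=> t _; exact: integral_ge0.
- by rewrite lee_fin exprn_ge0// invr_ge0 ltW.
rewrite (@ge0_integral_scale1 (fun s => \int[leb n]_x f (rV_cons (s, x))))//.
- by rewrite muleA -EFinM -exprSr -ge0_integral_leb_step.
- exact: (measurable_fun_fubini_tonelli_F (m2 := leb n) _
      (measurableT_comp mf mcons) (fun z => f0 _)).
- by move=> s; exact: integral_ge0.
Qed.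

Lemma measurable_cube n (A : set R) : measurable A ->
  measurable [set x : 'rV[R]_n | forall i, A (x ord0 i)].
Proof.
move=> mA.
rewrite (_ : mkset _ = \bigcap_(i in [set: 'I_n]) [set x : 'rV[R]_n | A (x ord0 i)]).
  apply: fin_bigcap_measurable => // i _.
  by have := @measurable_coord _ R 1 n ord0 i measurableT A mA; rewrite setTI.
by apply/seteqP; split => [x H i _|x H i]; exact: H.
Qed.

Lemma leb_cube n (A : set R) : measurable A ->
  leb n [set x | forall i, A (x ord0 i)] = lebesgue_measure A ^+ n.
Proof.
move=> mA; elim: n => [|n ih].
  rewrite expe0 /= diracE mem_set//= => -[] //.
rewrite expeS -ih /= /leb_step /pushforward.
rewrite -product_measure1E//.
  congr (product_measure1 _ _ _); apply/seteqP; split => -[t x] /=.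
  - move=> H; have := rV_consK (t, x); rewrite /rV_uncons => -[tE /rowP xE]; split.
      by have := H ord0; rewrite -{2}tE.
    by move=> i; have := H (lift ord0 i); have := xE i; rewrite mxE => ->.
  - move=> [tA xA] i; have := rV_consK (t, x); rewrite /rV_uncons => -[tE /rowP xE].
    case: (unliftP ord0 i) => [k ->|->]; last by rewrite tE.
    by have := xE k; rewrite mxE => ->; exact: xA.
exact: measurable_cube.
Qed.

End scaling.


Section polar.
Context {R : realType}.
Local Open Scope ereal_scope.

Lemma enorm_ge0 n (x : 'rV[R]_n) : (0 <= enorm x)%R.
Proof. exact: sqrtr_ge0. Qed.

Lemma enormZ n (c : R) (x : 'rV[R]_n) : enorm (c *: x) = (`|c| * enorm x)%R.
Proof.
rewrite /enorm -sqrtr_sqr -sqrtrM ?sqr_ge0// mulr_sumr; congr Num.sqrt.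
by apply: eq_bigr => i _; rewrite mxE exprMn.
Qed.

Lemma ler_coord_enorm n (x : 'rV[R]_n) i : (`|x ord0 i| <= enorm x)%R.
Proof.
rewrite -sqrtr_sqr /enorm ler_sqrt ?sumr_ge0// => [|j _]; last exact: sqr_ge0.
by rewrite (bigD1 i)//= lerDl sumr_ge0// => j _; exact: sqr_ge0.
Qed.

Lemma ler_enorm_sum n (x : 'rV[R]_n) : (enorm x <= \sum_i `|x ord0 i|)%R.
Proof.
rewrite -(ger0_norm (sumr_ge0 _ (fun i _ => normr_ge0 (x ord0 i)))) -sqrtr_sqr.
rewrite /enorm ler_sqrt ?sqr_ge0// expr2 mulr_suml ler_sum// => i _.
rewrite -[leLHS]ger0_norm ?sqr_ge0// normrX expr2.
by rewrite ler_wpM2l// (bigD1 i)//= lerDl sumr_ge0.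
Qed.

Lemma measurable_eball n (r : R) : measurable (eball r : set 'rV[R]_n).
Proof.
have := @measurable_enorm R n measurableT `]-oo, r[%classic (measurable_itv _).
by rewrite setTI; congr (measurable _); apply/seteqP; split => x /=; rewrite in_itv.
Qed.

Lemma leb_eballZ n (r : R) : (0 < r)%R ->
  leb n (eball r) = (r ^+ n)%:E * leb n (eball 1).
Proof.
move=> r0; have ri : (0 < r^-1)%R by rewrite invr_gt0.
have := ge0_integral_leb_scale ri (f := fun x => (\1_(eball 1 : set 'rV[R]_n) x)%:E).
rewrite invrK (integral_indic _ _ (measurable_eball _)) // setIT.
move=> <-; last 2 first.
- by apply/measurable_EFinP; apply: measurable_indic; exact: measurable_eball.
- by move=> x; rewrite lee_fin.
rewrite -(setIT (eball r)) -integral_indic//; last exact: measurable_eball.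
apply: eq_integral => x _; congr (_%:E); rewrite !indicE; congr (nat_of_bool _)%:R.
apply/idP/idP; rewrite !inE /eball /= enormZ gtr0_norm// mulrC ltr_pdivrMr//;
  by rewrite mul1r.
Qed.

Lemma leb_eball1_gt0 n : 0 < leb n (eball 1 : set 'rV[R]_n).
Proof.
(* The Euclidean norm is at most the sum of the n absolute coordinates, so the cube of half-side 1 /
   (n + 1) lies in the unit ball. *)
pose e : R := (n.+1%:R^-1)%R.
have e0 : (0 < e)%R by rewrite invr_gt0 ltr0n.
apply: (@lt_le_trans _ _ (leb n [set x : 'rV[R]_n | forall i, [set` `](- e)%R, e[] (x ord0 i)])).
  rewrite leb_cube// lebesgue_measure_itv/= lte_fin ifT; last by lra.
  by rewrite -EFinD expe_gt0// lte_fin; lra.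
apply: le_measure; rewrite ?inE.
- exact: measurable_cube.
- exact: measurable_eball.
move=> x H; rewrite /eball/=; apply: le_lt_trans (ler_enorm_sum x) _.
apply: (@le_lt_trans _ _ (\sum_(i < n) e)%R).
  apply: ler_sum => i _; have := H i; rewrite /= in_itv/= => /andP[h1 h2].
  by rewrite ler_norml ltW//= ltW.
rewrite sumr_const card_ord -mulr_natl /e ltr_pdivrMr ?ltr0n// mul1r ltr_nat.
exact: ltnSn.
Qed.

Lemma leb_eball1_lty n : leb n (eball 1 : set 'rV[R]_n) < +oo.
Proof.
apply: (@le_lt_trans _ _ (leb n [set x : 'rV[R]_n | forall i, [set` `](-1)%R, 1%R[] (x ord0 i)])).
  apply: le_measure; rewrite ?inE.
  - exact: measurable_eball.
  - exact: measurable_cube.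
  move=> x; rewrite /eball/= => x1 i; rewrite in_itv/= -ltr_norml.
  exact: le_lt_trans (ler_coord_enorm x i) _.
rewrite leb_cube// lebesgue_measure_itv/= lte_fin ifT -?EFinD; last by lra.
by rewrite ltey_eq fin_numX.
Qed.

(** The area of the unit sphere, read off as the derivative at r = 1 of the volume of the ball of
    radius r, so that no surface measure enters. *)
Definition sphere_area n : R := (n%:R * fine (leb n (eball 1 : set 'rV[R]_n)))%R.

Lemma sphere_area_gt0 n : (0 < n)%N -> (0 < sphere_area n)%R.
Proof.
move=> n0; rewrite mulr_gt0 ?ltr0n// fine_gt0// leb_eball1_gt0.
exact: leb_eball1_lty.
Qed.

Definition radial_density n : R -> R := (fun r => sphere_area n * r ^+ n.-1)%R \_ `]0%R, +oo[.

Lemma radial_density_ge0 n r : (0 < n)%N -> (0 <= radial_density n r)%R.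
Proof.
move=> n0; rewrite /radial_density patchE; case: ifPn => //; rewrite inE/= in_itv/= andbT.
by move=> r0; rewrite mulr_ge0 ?exprn_ge0 ?ltW// sphere_area_gt0.
Qed.

Lemma measurable_radial_density n : measurable_fun setT (radial_density n).
Proof.
apply/(measurable_restrictT _ _).1 => //.
apply: measurable_funTS; apply: measurable_funM => //; exact: measurable_funX.
Qed.

Lemma integral_radial_density n (x : R) : (0 < n)%N -> (0 < x)%R ->
  \int[lebesgue_measure]_(r in `]-oo, x[) (radial_density n r)%:E =
  (x ^+ n)%:E * leb n (eball 1 : set 'rV[R]_n).
Proof.
move=> n0 x0.
rewrite (_ : leb n (eball 1) = (fine (leb n (eball 1)))%:E); last first.
  by rewrite fineK// ge0_fin_numE// leb_eball1_lty.
set om := fine _.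
rewrite integral_mkcond.
transitivity (\int[lebesgue_measure]_(r in `]0%R, x[) (sphere_area n * r ^+ n.-1)%:E).
  rewrite [RHS]integral_mkcond; apply: eq_integral => r _.
  rewrite !patchE /radial_density patchE.
  case: ifPn; rewrite ?inE/= ?in_itv/=.
    move=> rx; case: ifPn; rewrite ?inE/= ?in_itv/= ?andbT => r0.
      by rewrite mem_set//= in_itv/= r0.
    by rewrite memNset//= in_itv/= => /andP[r0' _]; case/negP: r0; rewrite inE/= in_itv/= r0'.
  move=> rx; rewrite memNset//= in_itv/= => /andP[_ r0'].
  by case/negP: rx; rewrite inE/= in_itv.
have mr : measurable_fun `]0%R, x[ (EFin \o (fun r : R => sphere_area n * r ^+ n.-1)%R).
  by apply/measurable_EFinP; apply: measurable_funTS; apply: measurable_funM.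
rewrite integral_itv_obnd_cbnd// integral_itv_bndo_bndc//; last first.
  by apply/measurable_EFinP; apply: measurable_funTS; apply: measurable_funM.

have cpow k (c : R) : continuous (fun r : R => c * r ^+ k)%R.
  move=> r; apply: (@continuousM _ _ (cst c) (fun r : R => r ^+ k)%R); first exact: cst_continuous.
  exact: exprn_continuous.
rewrite (@continuous_FTC2 _ _ (fun r => om * r ^+ n)%R)//.
- by rewrite expr0n gtn_eqF//= mulr0 sube0 -EFinM mulrC.
- exact/continuous_subspaceT/cpow.
- split.
  + by move=> r _; apply: (@derivableM _ _ (cst om) (fun r : R => r ^+ n)%R) => //; exact: exprn_derivable.
  + apply: cvg_at_right_filter; exact: cpow.
  + apply: cvg_at_left_filter; exact: cpow.
- move=> r _; rewrite derive1E (@deriveM _ _ (cst om) (fun r : R => r ^+ n)%R)//=; last exact: exprn_derivable.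
  rewrite derive_cst scaler0 addr0 exp_derive.
  by rewrite /sphere_area -/om /GRing.scale/=; ring.
Qed.

(** The image of [leb n] under [enorm] and the measure of density [radial_density n] agree on the
    half-lines []-oo, x[], where both give the volume of a ball; half-lines are stable under
    intersection and generate the Borel sets. *)
Lemma ge0_integral_radial n (h : R -> \bar R) : (0 < n)%N ->
  measurable_fun setT h -> (forall r, 0 <= h r) ->
  \int[leb n]_x h (enorm x) =
  \int[lebesgue_measure]_r (h r * (radial_density n r)%:E).
Proof.
move=> n0 mh h0.
have mg : measurable_fun [set: measurableTypeR R]
    (radial_density n : measurableTypeR R -> R) := @measurable_radial_density n.
pose g : {mfun (measurableTypeR R) >-> R} :=
  HB.pack (radial_density n : measurableTypeR R -> R)
    (isMeasurableFun.Build _ _ _ _ _ mg).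
have g0 x : (0 <= g x)%R by exact: radial_density_ge0.
pose nu := density_measure (@lebesgue_measure R) g0.
have [nu' [nuE nuI]] : exists nu' : {measure set (measurableTypeR R) -> \bar R},
    (forall A, nu' A = leb n (@enorm R n @^-1` A)) /\
    \int[nu']_t h t = \int[leb n]_x h (enorm x).
  unshelve refine (ex_intro _ (pushforward (leb n)
    (@enorm R n : _ -> measurableTypeR R) : {measure set (measurableTypeR R) -> \bar R}) _).
    exact: measurable_enorm.
  split; first by [].
  rewrite ge0_integral_pushforward; [|exact: measurable_enorm|exact: measurableT|exact: mh|by move=> y _; exact: h0].
  by [].
rewrite -nuI (@eq_measure_integral _ _ _ _ nu) => [|A mA _].
  by rewrite ge0_integral_density.
apply: (@measure_unique _ R (measurableTypeR R) (@RGenInftyO.G R)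
  (fun k : nat => `]-oo, (k%:R)%R[%classic) _ _ _ _ nu' nu) => //.
- exact: RGenInftyO.measurableE.
- move=> _ _ [x ->] [y ->]; exists (Num.min x y).
  by apply/seteqP; split => z /=; rewrite !in_itv/= lt_min => /andP.
- by move=> k; exists k%:R.
- apply/seteqP; split => // x _.
  exists (Num.truncn `|x|).+1 => //=; rewrite in_itv/=.
  by rewrite (le_lt_trans (ler_norm _))// truncnS_gt.
- move=> _ [x ->]; rewrite nuE [RHS](_ : _ =
    \int[lebesgue_measure]_(r in `]-oo, x[) (radial_density n r)%:E); last by [].
  have [x0|x0] := ltP 0%R x.
    rewrite integral_radial_density// -leb_eballZ//; congr (leb n _).
  rewrite integral0_eq.
    rewrite (_ : _ @^-1` _ = set0) ?measure0// -subset0 => y /=; rewrite in_itv/=.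
    by move=> /lt_le_trans/(_ x0); rewrite ltNge enorm_ge0.
  move=> r /=; rewrite in_itv/= => rx; rewrite /radial_density patchE memNset//=.
  by rewrite in_itv/= andbT; apply/negP; rewrite -leNgt (le_trans (ltW rx)).
- move=> k; rewrite nuE; apply: (@le_lt_trans _ _ (leb n (eball k.+1%:R))).
    apply: le_measure; rewrite ?inE; last 1 first.
    + by move=> y /=; rewrite in_itv/= /eball/= => /lt_trans; apply; rewrite ltr_nat.
    + by have := @measurable_enorm R n measurableT _ (measurable_itv `]-oo, (k%:R)%R[); rewrite setTI.
    + exact: measurable_eball.
  by rewrite leb_eballZ// lte_mul_pinfty ?lee_fin ?exprn_ge0// leb_eball1_lty.
Qed.

End polar.

(** * Absolutely continuous functions of one variable *)

Section acc.
Context {R : realType}.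
Implicit Types (al be : R) (v : R -> R).

(** [abs_continuous] on a closed segment: its ends are allowed as division points, as the dyadic
    subdivision requires. *)
Definition acc al be v := forall e : R, 0 < e -> exists2 delta : R, 0 < delta &
  forall (n : nat) (s t : 'I_n -> R),
    (forall i, al <= s i /\ s i <= t i /\ t i <= be) ->
    trivIset [set: 'I_n] (fun i => `]s i, t i[%classic) ->
    \sum_(i < n) (t i - s i) < delta ->
    \sum_(i < n) `|v (t i) - v (s i)| < e.

Lemma sum_blocks_le (F : nat -> R) q (c : R) r :
  (forall j, (j < r)%N -> \sum_(j * q <= k < j * q + q) F k <= c) ->
  \sum_(0 <= k < r * q) F k <= r%:R * c.
Proof.
elim: r => [H|r ih H]; first by rewrite mul0n big_geq// mul0r.
rewrite mulSn addnC (@big_cat_nat _ _ _ (r * q))//=; last exact: leq_addr.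
rewrite -[r.+1]addn1 natrD mulrDl mul1r lerD ?H//.
by apply: ih => j jr; apply: H; exact: ltnW.
Qed.

(** * The density of an absolutely continuous function, from dyadic difference quotients *)

Section dyadic.
Variables (al be : R) (v : R -> R).
Hypothesis albe : al < be.

Definition mesh n : R := (be - al) / 2 ^+ n.
Definition node n k : R := al + mesh n * k%:R.
Definition cell n k : set R := `]node n k, node n k.+1].
Definition incr n k : R := v (node n k.+1) - v (node n k).
(** The integral over A of the step function that equals, on each dyadic cell, the difference
    quotient of [v] there. *)
Definition dyadic_charge n (A : set R) : R :=
  \sum_(k < 2 ^ n) incr n k / mesh n * fine (lebesgue_measure (A `&` cell n k)).

Lemma mesh_gt0 n : 0 < mesh n.
Proof. by rewrite divr_gt0 ?subr_gt0// exprn_gt0. Qed.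

Lemma meshD m k : mesh (m + k) * 2 ^+ k = mesh m.
Proof.
have h : (2 : R) ^+ k != 0 by rewrite expf_neq0.
by rewrite /mesh exprD invfM mulrA -mulrA mulVf// mulr1.
Qed.

Lemma mesh_cvg0 (e : R) : 0 < e -> exists m, forall n, (m <= n)%N -> mesh n < e.
Proof.
move=> e0; exists (Num.truncn ((be - al) / e)).+1 => n mn.
rewrite /mesh ltr_pdivrMr ?exprn_gt0// -ltr_pdivrMl// mulrC.
apply: (lt_le_trans (truncnS_gt _)).
by rewrite -natrX ler_nat (leq_trans mn)// ltnW// ltn_expl.
Qed.

Lemma node0 n : node n 0 = al.
Proof. by rewrite /node mulr0 addr0. Qed.

Lemma node_last n : node n (2 ^ n) = be.
Proof.
have h : (2 : R) ^+ n != 0 by rewrite expf_neq0.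
by rewrite /node /mesh natrX -mulrA mulVf// mulr1 addrC subrK.
Qed.

Lemma nodeS n k : node n k.+1 = node n k + mesh n.
Proof. by rewrite /node -addn1 natrD mulrDr mulr1 addrA. Qed.

Lemma node_le n j k : (j <= k)%N -> node n j <= node n k.
Proof.
by move=> jk; rewrite /node lerD2l ler_wpM2l ?ler_nat// ltW// mesh_gt0.
Qed.

Lemma cell_disjoint n j k x : cell n j x -> cell n k x -> j = k.
Proof.
rewrite /cell/= !in_itv/= => /andP[h1 h2] /andP[h3 h4].
case: (ltngtP j k) => // jk.
- by exfalso; have := node_le n jk; lra.
- by exfalso; have := node_le n jk; lra.
Qed.

Lemma measurable_cell n k : measurable (cell n k).
Proof. exact: measurable_itv. Qed.

Lemma lebesgue_cell n k : lebesgue_measure (cell n k) = (mesh n)%:E.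
Proof.
rewrite /cell lebesgue_measure_itv/= lte_fin nodeS ltrDl mesh_gt0 -EFinD.
by rewrite addrAC subrr add0r.
Qed.

Lemma cell_sub n k : (k < 2 ^ n)%N -> cell n k `<=` `]al, be].
Proof.
move=> kn x; rewrite /cell/= !in_itv/= => /andP[h1 h2]; apply/andP; split.
  by apply: le_lt_trans h1; rewrite -(node0 n) node_le.
by apply: le_trans h2 _; rewrite -(node_last n) node_le.
Qed.

Lemma fin_cell n k A : measurable A ->
  lebesgue_measure (A `&` cell n k) \is a fin_num.
Proof.
move=> mA; rewrite ge0_fin_numE//; apply: le_lt_trans (ltry (mesh n)).
rewrite -(lebesgue_cell n k); apply: le_measure; rewrite ?inE//.
- by apply: measurableI => //; exact: measurable_cell.
- exact: measurable_cell.
Qed.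

Lemma fine_cell_le n k A : measurable A ->
  fine (lebesgue_measure (A `&` cell n k)) <= mesh n.
Proof.
move=> mA; rewrite -lee_fin fineK; last exact: fin_cell.
rewrite -(lebesgue_cell n k); apply: le_measure; rewrite ?inE//.
- by apply: measurableI => //; exact: measurable_cell.
- exact: measurable_cell.
Qed.

Lemma sum_cell_le n (P : pred 'I_(2 ^ n)) A : measurable A ->
  ((\sum_(k < 2 ^ n | P k) fine (lebesgue_measure (A `&` cell n k)))%:E <=
    lebesgue_measure (A `&` `]al, be]))%E.
Proof.
move=> mA; rewrite -sumEFin.
under eq_bigr do rewrite fineK ?fin_cell//.
rewrite -measure_bigsetU_ord_cond//.
- apply: le_measure; rewrite ?inE//.
  + by apply: bigsetU_measurable => k _; apply: measurableI => //; exact: measurable_cell.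
  + exact: measurableI.
  + elim/big_ind : _ => //= [B C BA CA|k _]; first by rewrite subUset.
    by move=> x [Ax kx]; split => //; exact: cell_sub kx.
- by move=> k _; apply: measurableI => //; exact: measurable_cell.
- move=> j k _ _ [x [[_ jx] [_ kx]]]; apply: val_inj; exact: cell_disjoint jx kx.
Qed.

Lemma dyadic_chargeU n A B : measurable A -> measurable B -> A `&` B = set0 ->
  dyadic_charge n (A `|` B) = dyadic_charge n A + dyadic_charge n B.
Proof.
move=> mA mB AB; rewrite /dyadic_charge -big_split/=; apply: eq_bigr => k _.
rewrite -mulrDr -fineD ?fin_cell// setIUl measureU//.
- by apply: measurableI => //; exact: measurable_cell.
- by apply: measurableI => //; exact: measurable_cell.
- by rewrite setIACA setIid AB set0I.
Qed.

Lemma dyadic_charge0 n A : measurable A -> lebesgue_measure A = 0%E ->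
  dyadic_charge n A = 0.
Proof.
move=> mA A0; rewrite /dyadic_charge big1// => k _.
rewrite (subset_measure0 _ _ _ A0) ?mulr0//.
by apply: measurableI => //; exact: measurable_cell.
Qed.

Hypothesis acv : acc al be v.

Lemma acc_cells (e : R) : 0 < e -> exists2 delta : R, 0 < delta &
  forall n (P : pred nat), \sum_(k < 2 ^ n | P k) mesh n < delta ->
    \sum_(k < 2 ^ n | P k) `|incr n k| < e.
Proof.
move=> /acv[delta delta0 H]; exists delta => // n P Pd.
pose s (k : 'I_(2 ^ n)) := node n k.
(* A cell outside [P] is replaced by a degenerate interval, so the family stays indexed by all cells
   and adds nothing to either sum. *)
pose t (k : 'I_(2 ^ n)) := if P k then node n k.+1 else node n k.
have := H _ s t; rewrite [X in X < delta](_ : _ = \sum_(k < 2 ^ n | P k) mesh n).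
  rewrite [X in X < e](_ : _ = \sum_(k < 2 ^ n | P k) `|incr n k|).
    apply => //.
      move=> k; rewrite /s /t; split; first by rewrite -(node0 n) node_le.
      split; first by case: ifPn => // _; rewrite node_le.
      by rewrite -(node_last n); case: ifPn => _; rewrite node_le// ltnW.
    apply/trivIsetP => j k _ _ jk; rewrite -subset0 => x [].
    rewrite /s /t /= !in_itv/= => /andP[h1 h2] /andP[h3 h4].
    have h5 : x < node n j.+1.
      by apply: lt_le_trans h2 _; case: ifPn => // _; rewrite node_le.
    have h6 : x < node n k.+1.
      by apply: lt_le_trans h4 _; case: ifPn => // _; rewrite node_le.
    move/eqP : jk; apply; apply: val_inj; apply: (@cell_disjoint n _ _ x);
      by rewrite /cell/= in_itv/= ?h1 ?h3/= ltW.
  rewrite [RHS]big_mkcond; apply: eq_bigr => k _; rewrite /t /s.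
  by case: ifPn => // _; rewrite subrr normr0.
rewrite [RHS]big_mkcond; apply: eq_bigr => k _; rewrite /t /s.
by case: ifPn => // _; rewrite ?subrr// nodeS addrAC subrr add0r.
Qed.

(** Uniform integrability of the step functions. Cells of slope above M are so short in total that
    absolute continuity makes their variation small; on the others the density is at most M. *)
Lemma dyadic_charge_ui (e : R) : 0 < e -> exists (delta : R) (m : nat), 0 < delta /\
  forall n A, (m <= n)%N -> measurable A ->
   (lebesgue_measure (A `&` `]al, be]) < delta%:E)%E -> `|dyadic_charge n A| <= e.
Proof.
move=> e0.
have [d1 d10 H1] := acc_cells (e := e / 2) ltac:(lra).
have [d2 d20 H2] := acc_cells (e := 1) ltr01.
have [m Hm] : exists m, mesh m < d2.
  by have [m Hm] := mesh_cvg0 d20; exists m; exact: Hm.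
(* Each of the [2 ^ m] cells of level m is shorter than [d2], so its finer cells carry a variation
   below 1; hence r bounds the variation at every level beyond m. *)
pose r : R := (2 ^ m)%:R.
have r0 : 0 < r by rewrite ltr0n expn_gt0.
have Hr n : (m <= n)%N -> \sum_(k < 2 ^ n) `|incr n k| <= r.
  move=> mn; rewrite -(big_mkord xpredT (fun k => `|incr n k|)).
  have -> : (2 ^ n = 2 ^ m * 2 ^ (n - m))%N by rewrite -expnD subnKC.
  rewrite -[leRHS]mulr1; apply: sum_blocks_le => j jm.
  have jn : (j * 2 ^ (n - m) + 2 ^ (n - m) <= 2 ^ n)%N.
    by rewrite -mulSnr -{2}(subnKC mn) expnD leq_mul2r jm orbT.
  rewrite (big_nat_widen _ _ (2 ^ n))// (big_nat_widenl _ 0)//= big_mkord.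
  apply/ltW/(H2 n (fun k => (k < j * 2 ^ (n - m) + 2 ^ (n - m)) && (j * 2 ^ (n - m) <= k))%N).
  rewrite -(big_mkord (fun k => (k < j * 2 ^ (n - m) + 2 ^ (n - m)) &&
    (j * 2 ^ (n - m) <= k))%N (fun=> mesh n)).
  rewrite [X in X < _](_ : _ =
      \sum_(j * 2 ^ (n - m) <= k < j * 2 ^ (n - m) + 2 ^ (n - m)) mesh n); last first.
    by rewrite [RHS](big_nat_widen _ _ (2 ^ n))// [RHS](big_nat_widenl _ 0).
  rewrite big_const_nat iter_addr addr0 addKn -mulr_natl natrX mulrC.
  by rewrite -{1}(subnKC mn) meshD.
(* The cells of slope above M have total length at most r / M = d1 / 2. *)
pose M : R := 2 * r / d1.
have M0 : 0 < M by rewrite /M; apply: divr_gt0 => //; lra.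
exists (e / (2 * M)), m; split; first by rewrite divr_gt0// mulr_gt0.
move=> n A mn mA Ad.
pose P := [pred k : nat | M * mesh n < `|incr n k|].
have KP : \sum_(k < 2 ^ n | P k) `|incr n k| < e / 2.
  apply: H1.
  have : M * (\sum_(k < 2 ^ n | P k) mesh n) <= r.
    apply: le_trans (Hr _ mn); rewrite mulr_sumr big_mkcond/=.
    by apply: ler_sum => k _; case: ifPn => // /ltW.
  move=> h; rewrite -(ltr_pM2l M0); apply: (le_lt_trans h).
  by rewrite /M divfK ?gt_eqF//; lra.
rewrite /dyadic_charge; apply: (le_trans (ler_norm_sum _ _ _)).
rewrite (bigID (fun k : 'I_(2 ^ n) => P k))/=.
have h0 := mesh_gt0 n.
apply: (@le_trans _ _ (e / 2 + e / 2)); last by lra.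
apply: lerD.
  apply: le_trans (ltW KP); apply: ler_sum => k _.
  have a0 : 0 <= fine (lebesgue_measure (A `&` cell n k)) by rewrite fine_ge0.
  rewrite normrM normrM normfV (gtr0_norm h0) (ger0_norm a0) -mulrA.
  by rewrite ler_piMr// mulrC ler_pdivrMr// mul1r fine_cell_le.
apply: (@le_trans _ _ (M * \sum_(k < 2 ^ n | ~~ P k)
    fine (lebesgue_measure (A `&` cell n k)))).
  rewrite mulr_sumr; apply: ler_sum => k; rewrite /P /= -leNgt => Pk.
  have a0 : 0 <= fine (lebesgue_measure (A `&` cell n k)) by rewrite fine_ge0.
  rewrite normrM (ger0_norm a0) ler_wpM2r//.
  by rewrite normrM normfV (gtr0_norm h0) ler_pdivrMr.
rewrite mulrC -ler_pdivlMr//.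
rewrite -lee_fin; apply: (le_trans (sum_cell_le _ mA)); apply: (le_trans (ltW Ad)).
by rewrite lee_fin le_eqVlt; apply/orP; left; apply/eqP; field; rewrite gt_eqF.
Qed.

Lemma eq_dyadic_charge n A B : A `&` `]al, be] = B `&` `]al, be] ->
  dyadic_charge n A = dyadic_charge n B.
Proof.
move=> AB; apply: eq_bigr => k _; congr (_ * fine (lebesgue_measure _)).
have <- : `]al, be] `&` cell n k = cell n k by apply/setIidr/cell_sub.
by rewrite !setIA AB.
Qed.

Lemma acc_modulus (e : R) : 0 < e -> exists2 delta : R, 0 < delta &
  forall x y, al <= x -> x <= y -> y <= be -> y - x < delta -> `|v y - v x| < e.
Proof.
move=> /acv[delta d0 H]; exists delta => // x y ax xy yb xyd.
have := H 1%N (fun=> x) (fun=> y); rewrite !big_ord1; apply => //.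
by apply/trivIsetP => i j _ _; rewrite !ord1 eqxx.
Qed.

(** Cells to the right of x telescope up to [be]; the single cell that contains x contributes at
    most its own increment, which is small by uniform continuity. *)
Lemma dyadic_charge_itv x : al <= x -> x <= be ->
  dyadic_charge n `]x, +oo[ @[n --> \oo] --> v be - v x.
Proof.
move=> ax xb; apply/cvgrPdist_le => e e0.
have [d d0 Hd] := acc_modulus (e := e / 2) ltac:(lra).
have [m Hm] := mesh_cvg0 d0.
near=> n.
have h0 := mesh_gt0 n.
have hd : mesh n < d by apply: Hm; near: n; exact: nbhs_infty_ge.
have cell0 k : node n k.+1 <= x -> `]x, +oo[ `&` cell n k = set0.
  move=> kx; rewrite -subset0 => y []; rewrite /cell/= !in_itv/= andbT.
  by move=> xy /andP[_ yk]; lra.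
have cell1 k : x <= node n k -> `]x, +oo[ `&` cell n k = cell n k.
  move=> kx; apply/setIidr => y; rewrite /cell/= !in_itv/= andbT.
  by move=> /andP[ky _]; lra.
have [xbe|bex] := ltP x be; last first.
  have -> : v be - v x = 0.
    by rewrite (_ : x = be) ?subrr//; apply/eqP; rewrite eq_le xb.
  rewrite add0r normrN /dyadic_charge big1 ?normr0 ?ltW// => k _.
  rewrite cell0 ?measure0 ?mulr0//; apply: le_trans bex.
  by rewrite -(node_last n) node_le.
pose j := Num.truncn ((x - al) / mesh n).
have xa0 : 0 <= (x - al) / mesh n by rewrite divr_ge0 ?subr_ge0// ltW.
have jx : node n j <= x.
  by rewrite /node -lerBrDl mulrC -ler_pdivlMr// /j truncn_le.
have xj : x < node n j.+1.
  by rewrite /node -ltrBlDl mulrC -ltr_pdivrMr// /j truncnS_gt.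
have jN : (j < 2 ^ n)%N.
  rewrite ltnNge; apply/negP => Nj; have := node_le n Nj; rewrite node_last.
  by move=> ?; lra.
rewrite /dyadic_charge (bigD1 (Ordinal jN))//=.
rewrite (eq_bigr (fun k : 'I_(2 ^ n) => if (j < k)%N then incr n k else 0)); last first.
  move=> k kj; case: ifPn => jk.
    rewrite cell1; first by rewrite lebesgue_cell/= divfK// gt_eqF.
    exact: (le_trans (ltW xj) (node_le _ jk)).
  rewrite cell0 ?measure0 ?mulr0//; apply: le_trans jx; apply: node_le.
  by rewrite ltn_neqAle leqNgt jk andbT.
have -> : \sum_(k < 2 ^ n | k != Ordinal jN) (if (j < k)%N then incr n k else 0) =
    v be - v (node n j.+1).
  rewrite -big_mkcondr/=.
  rewrite (eq_bigl (fun k : 'I_(2 ^ n) => j < k)%N); last first.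
    by move=> k; case: ltngtP => // jk; rewrite ?andbT ?andbF//; apply/eqP => kj; rewrite kj ltnn in jk.
  transitivity (\sum_(j.+1 <= k < 2 ^ n) incr n k).
    by rewrite [RHS](big_nat_widenl _ 0)//= big_mkord.
  by rewrite /incr telescope_sumr// node_last.
set c := fine _.
have c0 : 0 <= c by rewrite fine_ge0.
have c1 : c <= mesh n by apply: fine_cell_le; exact: measurable_itv.
have j1b : node n j.+1 <= be by rewrite -(node_last n) node_le.
have aj : al <= node n j by rewrite -(node0 n) node_le.
have h1 : `|v (node n j.+1) - v x| <= e / 2.
  by apply/ltW/Hd => //; [exact: ltW|move: xj; rewrite nodeS; lra].
have h2 : `|incr n j| <= e / 2.
  by apply/ltW/Hd => //; rewrite nodeS; lra.
have h3 : `|incr n j / mesh n * c| <= e / 2.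
  apply: le_trans h2; rewrite !normrM normfV (gtr0_norm h0) (ger0_norm c0) -mulrA.
  by rewrite ler_piMr// mulrC ler_pdivrMr// mul1r.
rewrite (_ : _ - _ = (v (node n j.+1) - v x) - incr n j / mesh n * c); last by ring.
by apply: le_trans (ler_normB _ _) _; lra.
Unshelve. all: by end_near. Qed.

(** Continuity from above of the finite measure on []al, be]]: the remainders of the union decrease
    to the empty set. *)
Lemma tail_small (F : (set (measurableTypeR R))^nat) (delta : R) :
  (forall i, measurable (F i)) -> 0 < delta ->
  exists N0, forall N, (N0 <= N)%N ->
   (lebesgue_measure ((\bigcup_i F i `\` \big[setU/set0]_(i < N) F i) `&` `]al, be])
     < delta%:E)%E.
Proof.
move=> mF d0.
pose H N := (\bigcup_i F i `\` \big[setU/set0]_(i < N) F i) `&` `]al, be].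
have mH N : measurable (H N).
  apply: measurableI => //; apply: measurableD.
    exact: bigcup_measurable.
  exact: bigsetU_measurable.
have : lebesgue_measure \o H @ \oo --> lebesgue_measure (\bigcap_N H N).
  apply: nonincreasing_cvg_mu => //.
  - apply: le_lt_trans (ltry (be - al)).
    rewrite (_ : (be - al)%:E = lebesgue_measure (`]al, be]%classic : set R)).
      by apply: le_measure; rewrite ?inE//; exact: subIsetr.
    by rewrite lebesgue_measure_itv/= lte_fin albe.
  - exact: bigcap_measurable.
  - move=> M N MN; apply/subsetPset; apply: setSI; apply: setDS.
    exact: subset_bigsetU.
rewrite (_ : \bigcap_N H N = set0) ?measure0; last first.
  rewrite -subset0 => x Hx; have [[[i _ Fix _] _]] := Hx 0%N I.
  have [[_ +] _] := Hx i.+1 I; apply.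
  by rewrite big_ord_recr/=; right.
move=> /fine_cvgP[Hfin]/cvgrPdist_lt/(_ _ d0) Hlt.
have [N0 _ HN0] : \forall N \near \oo, (lebesgue_measure (H N) < delta%:E)%E.
  near=> N.
  have fN : lebesgue_measure (H N) \is a fin_num by near: N.
  rewrite -(fineK fN) lte_fin; apply: le_lt_trans (ler_norm _) _.
  rewrite -normrN -sub0r; near: N; exact: Hlt.
by exists N0 => N NN; exact: HN0.
Unshelve. all: by end_near. Qed.

Lemma dyadic_charge_bigsetU n (F : (set (measurableTypeR R))^nat) N :
  (forall i, measurable (F i)) -> trivIset setT F ->
  dyadic_charge n (\big[setU/set0]_(i < N) F i) = \sum_(i < N) dyadic_charge n (F i).
Proof.
move=> mF tF; elim: N => [|N ih].
  by rewrite !big_ord0 dyadic_charge0.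
rewrite !big_ord_recr/= dyadic_chargeU; [by rewrite ih| |exact: mF|].
  by apply: bigsetU_measurable => i _; exact: mF.
rewrite -subset0 => x []; rewrite -bigcup_mkord => -[i /= iN Fix FNx].
have : i = N by apply: (tF _ _ I I); exists x.
by move=> iE; rewrite iE ltnn in iN.
Qed.

Lemma bigcup_split (F : (set (measurableTypeR R))^nat) N :
  \bigcup_i F i = \big[setU/set0]_(i < N) F i `|`
    (\bigcup_i F i `\` \big[setU/set0]_(i < N) F i).
Proof.
apply/esym/setDUK => x; rewrite -bigcup_mkord => -[i _ Fix].
by exists i.
Qed.

(** The sets along which the charges converge form a Dynkin class containing the half-lines.
    Stability under disjoint countable unions is where uniform integrability acts: the tail of the
    union is negligible uniformly in n. *)
Lemma is_cvg_dyadic_charge (A : set (measurableTypeR R)) :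
  measurable A -> cvgn (dyadic_charge ^~ A).
Proof.
rewrite (@RGenOInfty.measurableE R); move: A; apply: dynkin_induction.
- exact: RGenOInfty.measurableE.
- move=> _ _ [x ->] [y ->]; exists (Num.max x y).
  by apply/seteqP; split => z /=; rewrite !in_itv/= !andbT gt_max => /andP.
- rewrite (_ : dyadic_charge ^~ _ = dyadic_charge ^~ `]al, +oo[%classic).
    apply/cvg_ex; exists (v be - v al); apply: dyadic_charge_itv => //.
    exact: ltW.
  apply/funext => n; apply: eq_dyadic_charge; rewrite setTI; apply/seteqP.
  split => x /=; rewrite !in_itv/= andbT; last by case.
  by move=> /andP[h1 h2]; rewrite h1 h2.
- move=> _ [x ->].
  (* Only the trace on []al, be]] matters, so x may be projected onto [[al, be]]. *)
  rename x into x0; pose x : R := x0; rewrite -/x; pose y := Num.min be (Num.max al x).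
  rewrite (_ : dyadic_charge ^~ _ = dyadic_charge ^~ `]y, +oo[%classic).
    apply/cvg_ex; exists (v be - v y); apply: dyadic_charge_itv => //.
      by rewrite /y le_min ltW//= le_max lexx.
    by rewrite /y ge_min lexx.
  apply/funext => n; apply: eq_dyadic_charge; apply/seteqP.
  split => z /=; rewrite !in_itv/= !andbT => -[h1 /andP[h2 h3]]; rewrite h2 h3; split => //.
    by rewrite /y gt_min gt_max h1 h2 orbT.
  by move: h1; rewrite /y gt_min gt_max h2/= => /orP[|//]; rewrite ltNge h3.
- move=> A mA cA.
  rewrite (_ : dyadic_charge ^~ _ =
      dyadic_charge ^~ `]al, +oo[%classic \- dyadic_charge ^~ A).
    apply: is_cvgB => //; apply/cvg_ex; exists (v be - v al).
    by apply: dyadic_charge_itv => //; exact: ltW.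
  apply/funext => n /=; apply/eqP; rewrite eq_sym subr_eq -dyadic_chargeU//.
  + apply/eqP/eq_dyadic_charge; rewrite setvU setTI; apply/seteqP.
    by split => x /=; rewrite !in_itv/= andbT; [move=> [_]|move=> /andP[h1 h2]; rewrite h1 h2].
  + exact: measurableC.
  + exact: setICl.
- move=> F mF tF cF.
  apply/cauchy_cvgP/cauchy_exP => e e0.
  have e2 : 0 < e / 2 by lra.
  have [d [m [d0 Hd]]] := dyadic_charge_ui e2.
  have [N HN] := tail_small mF d0.
  have cN : cvgn (dyadic_charge ^~ (\big[setU/set0]_(i < N) F i)).
    rewrite (_ : dyadic_charge ^~ _ = fun n => \sum_(i < N) dyadic_charge n (F i)).
      elim: N {HN} => [|N ih]; first by under eq_fun do rewrite big_ord0; exact: is_cvg_cst.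
      by under eq_fun do rewrite big_ord_recr/=; exact: is_cvgD.
    by apply/funext => n; exact: dyadic_charge_bigsetU.
  exists (limn (dyadic_charge ^~ (\big[setU/set0]_(i < N) F i))).
  move/cvgrPdist_lt : cN => /(_ _ e2) cN.
  suff : \forall n \near \oo, `|limn (dyadic_charge ^~ (\big[setU/set0]_(i < N) F i)) -
      dyadic_charge n (\bigcup_k F k)| < e by [].
  near=> n.
  rewrite (bigcup_split F N) dyadic_chargeU ?setDIK//.
  + rewrite opprD addrA; apply: le_lt_trans (ler_normB _ _) _.
    rewrite (_ : e = e / 2 + e / 2); last by lra.
    apply: ltr_leD; first by near: n.
    apply: Hd; first by near: n; exact: nbhs_infty_ge.
      by apply: measurableD; [apply: bigcup_measurable => i _; exact: mF|
        apply: bigsetU_measurable => i _; exact: mF].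
    exact: HN.
  + by apply: bigsetU_measurable => i _; exact: mF.
  + by apply: measurableD; [apply: bigcup_measurable => i _; exact: mF|
        apply: bigsetU_measurable => i _; exact: mF].
Unshelve. all: by end_near. Qed.

Let nu (A : set (measurableTypeR R)) : \bar R := (limn (dyadic_charge ^~ A))%:E.

Let nu_ui (e : R) : 0 < e -> exists2 delta : R, 0 < delta & forall A : set (measurableTypeR R),
  measurable A -> (lebesgue_measure (A `&` `]al, be]) < delta%:E)%E ->
  `|limn (dyadic_charge ^~ A)| <= e.
Proof.
move=> /dyadic_charge_ui[d [m [d0 H]]]; exists d => // A mA Ad.
have cA := is_cvg_dyadic_charge mA.
rewrite -(lim_norm cA); apply: limr_le; first exact: is_cvg_norm.
by exists m => // n mn; exact: H.
Qed.

Let nu0 : nu set0 = 0%E.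
Proof.
rewrite /nu (_ : dyadic_charge ^~ _ = cst 0) ?lim_cst//.
by apply/funext => n; rewrite dyadic_charge0.
Qed.

Let nuU (A B : set (measurableTypeR R)) : measurable A -> measurable B ->
  A `&` B = set0 -> limn (dyadic_charge ^~ (A `|` B)) =
  limn (dyadic_charge ^~ A) + limn (dyadic_charge ^~ B).
Proof.
move=> mA mB AB; rewrite -limD; [|exact: is_cvg_dyadic_charge..].
by congr (limn _); apply/funext => n; rewrite dyadic_chargeU.
Qed.

Let nu_sigma_additive : semi_sigma_additive nu.
Proof.
move=> F mF tF mUF.
rewrite (_ : (fun n => _) = EFin \o (fun n => limn (dyadic_charge ^~ (\big[setU/set0]_(i < n) F i)))).
  apply: cvg_EFin; first exact: nearW.
  apply/cvgrPdist_le => e /nu_ui[d d0 H].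
  have [N HN] := tail_small mF d0.
  near=> n.
  rewrite (bigcup_split F n) nuU; [| | |exact: setDIK].
  - rewrite addrAC subrr add0r; apply: H.
      by apply: measurableD => //; apply: bigsetU_measurable => i _; exact: mF.
    by apply: HN; near: n; exact: nbhs_infty_ge.
  - by apply: bigsetU_measurable => i _; exact: mF.
  - by apply: measurableD => //; apply: bigsetU_measurable => i _; exact: mF.
apply/funext => n /=; rewrite big_mkord.
elim: n => [|n ih]; first by rewrite !big_ord0 -nu0.
rewrite !big_ord_recr/= ih /nu nuU; [by rewrite EFinD| |exact: mF|].
  by apply: bigsetU_measurable => i _; exact: mF.
rewrite -subset0 => x []; rewrite -bigcup_mkord => -[i /= iN Fix FNx].
have : i = n by apply: (tF _ _ I I); exists x.
by move=> iE; rewrite iE ltnn in iN.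
Unshelve. all: by end_near. Qed.

(** The limit of the dyadic charges is a charge dominated by the Lebesgue measure that gives []x,
    +oo[] the mass [v be - v x]; the density is its Radon-Nikodym derivative. *)
Lemma acc_density : exists2 f : R -> R, lebesgue_measure.-integrable setT (EFin \o f) &
  forall x, al <= x <= be -> v x - v al = \int[lebesgue_measure]_(r in `[al, x]) f r.
Proof.
pose NU : {charge set (measurableTypeR R) -> \bar R} :=
  HB.pack nu (isCharge.Build _ _ _ nu nu0 (fun A _ => isT) nu_sigma_additive).
have dom : NU `<< (@lebesgue_measure R).
  apply/null_content_dominatesP => A mA A0; rewrite /NU/= /nu.
  rewrite (_ : dyadic_charge ^~ _ = cst 0) ?lim_cst//.
  by apply/funext => n; rewrite dyadic_charge0.
pose f := Radon_Nikodym NU (@lebesgue_measure R).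
have fE A : measurable A -> limn (dyadic_charge ^~ A) = \int[lebesgue_measure]_(r in A) fine (f r).
  move=> mA; rewrite /Rintegral; have := Radon_Nikodym_integral dom mA.
  move=> /(congr1 fine)/= ->; congr fine; apply: eq_integral => r _.
  by rewrite fineK// Radon_Nikodym_fin_num.
have intf : lebesgue_measure.-integrable setT (EFin \o (fine \o f)).
  apply: eq_integrable (Radon_Nikodym_integrable dom) => // r _.
  by rewrite /= fineK// Radon_Nikodym_fin_num.
exists (fine \o f) => // x /andP[ax xb].
have := fE `]x, +oo[%classic (measurable_itv _).
have := fE `]al, +oo[%classic (measurable_itv _).
rewrite (cvg_lim _ (dyadic_charge_itv (lexx _) (ltW albe)))//.
rewrite (cvg_lim _ (dyadic_charge_itv ax xb))//.
move=> h1 h2; rewrite (_ : v x - v al = (v be - v al) - (v be - v x)); last by ring.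
rewrite h1 h2 -(@Rintegral_itvB _ (fine \o f) (BRight al) (BInfty _ false) x)/=.
- rewrite opprB addrC subrK -(@Rintegral_itv_obnd_cbnd _ _ _ (fine \o f))//.
  exact: integrableS intf.
- exact: integrableS intf.
- by rewrite bnd_simp.
- by rewrite bnd_simp.
Qed.

End dyadic.
End acc.

(** * Primitives of integrable functions and their derivatives *)

Section primitive.
Context {R : realType}.
Local Notation mu := (@lebesgue_measure R).
Implicit Types (J : set R) (v f : R -> R).

(** Only segments inside J are tested: additive constants are free on each component of J, and [f]
    may fail to be integrable near the boundary of J. *)
Definition primitive_on J v f := forall x y, x <= y -> `[x, y] `<=` J ->
  mu.-integrable `[x, y] (EFin \o f) /\
  v y - v x = \int[mu]_(r in `[x, y]) f r.

Lemma primitive_onS J J' v f : J' `<=` J -> primitive_on J v f -> primitive_on J' v f.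
Proof. by move=> JJ' H x y xy xyJ; apply: H => //; exact: subset_trans xyJ JJ'. Qed.

Lemma Rintegral_itv_cat f (x y z : R) : x <= y -> y <= z ->
  mu.-integrable `[x, z] (EFin \o f) ->
  \int[mu]_(r in `[x, z]) f r =
    \int[mu]_(r in `[x, y]) f r + \int[mu]_(r in `[y, z]) f r.
Proof.
move=> xy yz fi.
have := @Rintegral_itvB _ f (BLeft x) (BRight z) y fi.
rewrite !bnd_simp => /(_ xy yz).
rewrite Rintegral_itv_obnd_cbnd => [h|]; last first.
  by apply: integrableS fi => //; apply: subset_itvr; rewrite bnd_simp.
by apply/eqP; rewrite addrC -subr_eq h.
Qed.

Lemma near_continuous (g h : R -> R) x : (\forall t \near x, g t = h t) ->
  {for x, continuous g} -> {for x, continuous h}.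
Proof.
move=> gh cg; rewrite /prop_for /continuous_at -(nbhs_singleton gh).
by apply: cvg_trans cg; apply: near_eq_cvg.
Qed.

Lemma near_itvoo (x y z : R) : x < y -> y < z -> \forall t \near y, x <= t <= z.
Proof.
move=> xy yz; have : y \in `]x, z[ by rewrite in_itv/= xy.
move/near_in_itvoo; apply: filterS => t.
by rewrite in_itv/= => /andP[/ltW -> /ltW ->].
Qed.

Lemma primitive_continuous v f (al be x : R) : primitive_on `[al, be] v f ->
  al < x -> x < be -> {for x, continuous v}.
Proof.
move=> H ax xb; have ab := lt_trans ax xb.
have [fi _] := H al be (ltW ab) (fun _ => id).
have := parameterized_integral_continuous (ltW ab) fi.
move=> /(continuous_within_itvP _ ab)[/(_ x) + _ _].
rewrite in_itv/= ax xb => /(_ isT) cF.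
apply: (@near_continuous (fun t => v al + parameterized_integral mu al t f)); last first.
  by apply: cvgD; [exact: cvg_cst|exact: cF].
near=> t.
have /andP[at_ tb] : al <= t <= be by near: t; exact: near_itvoo.
have [|_ e] := H al t at_; first by apply: subset_itvl; rewrite bnd_simp.
by rewrite /parameterized_integral -e addrC subrK.
Unshelve. all: by end_near. Qed.

(** Lebesgue's differentiation theorem; the null set is exhibited so that it can be united with
    others and handed to [eq_integral_off_null]. *)
Lemma ae_is_derive_primitive v f (al be : R) : primitive_on `[al, be] v f ->
  exists2 N : set R, measurable N /\ mu N = 0%E &
    forall x, al < x < be -> ~ N x -> is_derive x 1 v (f x).
Proof.
move=> H; have [ab|ba] := ltP al be; last first.
  by exists set0 => // x /andP[ax xb]; exfalso; lra.
have [fi _] := H al be (ltW ab) (fun _ => id).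
pose g := f \_ `[al, be].
have lg : locally_integrable setT g by exact: integrable_locally_restrict.
have ig y : mu.-integrable `[al, y] (EFin \o g).
  rewrite /g -restrict_EFin; apply/integrable_restrict => //.
  by apply: (integrableS _ _ (@subIsetr _ _ _) fi) => //; exact: measurableI.
have [N [mN N0 HN]] := FTC1 ig lg.
exists N => // x /andP[ax xb] Nx.
have [dF F'] : derivable (fun y : R => \int[mu]_(t in `[al, y]) g t) x 1 /\
    derive1 (fun y : R => \int[mu]_(t in `[al, y]) g t) x = g x.
  apply: contrapT => Hx; apply: Nx; apply: HN => /= /(_ _)/Hx; apply.
  by rewrite lte_fin.
have gx : g x = f x by rewrite /g patchE mem_set//= in_itv/= !ltW.
apply: (@near_eq_is_derive _ _ _ (fun y => v al + \int[mu]_(t in `[al, y]) g t)).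
  near=> t.
  have /andP[at_ tb] : al <= t <= be by near: t; exact: near_itvoo.
  have [|_ e] := H al t at_; first by apply: subset_itvl; rewrite bnd_simp.
  rewrite (_ : \int[mu]_(t in `[al, t]) g t = v t - v al); first by rewrite addrC subrK.
  rewrite e; apply: eq_Rintegral => z; rewrite inE/= in_itv/= => /andP[az zt].
  by rewrite /g patchE mem_set//= in_itv/= az (le_trans zt tb).
rewrite -gx -F' derive1E -[X in is_derive _ _ _ X]add0r; apply: is_deriveD.
exact/derivableP.
Unshelve. all: by end_near. Qed.

(* Upper limit of difference quotients: a Borel function equal to the derivative
   wherever it exists. *)
Definition rderiv v (x : R) : R :=
  fine (limn_esup (fun n : nat => (n.+1%:R * (v (x + n.+1%:R^-1) - v x))%:E)).

Lemma measurable_rderiv v : measurable_fun setT v -> measurable_fun setT (rderiv v).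
Proof.
move=> mv; apply: measurableT_comp => //.
apply: measurable_fun_limn_esup => n; apply/measurable_EFinP.
apply: measurable_funM => //; apply: measurable_funB => //.
apply: measurableT_comp mv _; exact: measurable_funD.
Qed.

Lemma rderivE v (x l : R) : is_derive x 1 v l -> rderiv v x = l.
Proof.
move=> dv; rewrite /rderiv.
suff /cvg_limn_einf_sup[_ ->] : (n.+1%:R * (v (x + n.+1%:R^-1) - v x))%:E @[n --> \oo] --> l%:E.
  by [].
apply: cvg_EFin; first exact: nearW.
have [dx <-] := dv.
have h0 : (fun n : nat => (n.+1%:R^-1 : R)) @ \oo --> (0 : R)^'.
  move=> A /nbhs_ballP[e /= e0 eA].
  have /cvgrPdist_lt/(_ _ e0) := @cvg_harmonic R.
  rewrite nearE /=; apply: filterS => n h; apply: eA => //=.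
have := cvg_comp _ _ h0 dx; apply: cvg_trans; apply: near_eq_cvg.
by near=> n; rewrite /= invrK /GRing.scale/= mulr1 [_ + x]addrC.
Unshelve. all: by end_near. Qed.

(** [acc_density] yields a density for each segment separately; [rderiv v] agrees almost everywhere
    with all of them and is a single function. *)
Lemma acc_primitive J v : measurable_fun setT v ->
  (forall x y, x < y -> `[x, y] `<=` J -> acc x y v) ->
  primitive_on J v (rderiv v).
Proof.
move=> mv H x y; rewrite le_eqVlt => /predU1P[<- _|xy xyJ].
  split; last by rewrite subrr set_itv1 Rintegral_set1.
  rewrite set_itv1; apply/integrableP; split.
    exact: measurable_fun_set1.
  by rewrite integral_set1.
have [f fi fE] := acc_density xy (H _ _ xy xyJ).
have pf : primitive_on `[x, y] v f.
  move=> s t st /[dup] /(_ s)/= + /(_ t)/=; rewrite !in_itv/= !lexx st/=.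
  move=> /(_ isT)/andP[xs sy] /(_ isT)/andP[xt ty]; split.
    exact: integrableS fi.
  have <- : (v t - v x) - (v s - v x) = v t - v s by ring.
  rewrite !fE ?xs ?xt//= (@Rintegral_itv_cat f x s t)//.
    by rewrite addrAC subrr add0r.
  exact: integrableS fi.
have [N [mN N0] HN] := ae_is_derive_primitive pf.
have e D (h : R -> R) : D `<=` `]x, y[ ->
    (\int[mu]_(r in D) (h (rderiv v r))%:E = \int[mu]_(r in D) (h (f r))%:E)%E.
  move=> Dxy; apply: (@eq_integral_off_null _ (measurableTypeR R) R mu D N _ _ mN N0) => r /Dxy.
  by rewrite /= in_itv/= => rxy Nr; rewrite (rderivE (HN _ rxy Nr)).
have mr := measurable_rderiv mv.
have mf : measurable_fun setT f by case/integrableP : fi => /measurable_EFinP.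
split.
  apply/integrableP; split; first by apply/measurable_EFinP; exact: measurable_funTS.
  rewrite -integral_itv_bndo_bndc; last first.
    by apply/measurable_EFinP; apply: measurable_funTS; exact: measurableT_comp.
  rewrite -integral_itv_obnd_cbnd; last first.
    by apply/measurable_EFinP; apply: measurable_funTS; exact: measurableT_comp.
  rewrite (e _ (fun z => `|z|))//.
  have /integrableP[_] : mu.-integrable `]x, y[ (EFin \o f) by exact: integrableS fi.
  by [].
have [_ ->] := pf x y (ltW xy) (fun _ => id).
rewrite /Rintegral; congr fine.
rewrite -(integral_itv_bndo_bndc (f := EFin \o f)); last first.
  by apply/measurable_EFinP; apply: measurable_funTS.
rewrite -(integral_itv_bndo_bndc (f := EFin \o rderiv v)); last first.
  by apply/measurable_EFinP; apply: measurable_funTS.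
rewrite -(integral_itv_obnd_cbnd (f := EFin \o f)); last first.
  by apply/measurable_EFinP; apply: measurable_funTS.
rewrite -(integral_itv_obnd_cbnd (f := EFin \o rderiv v)); last first.
  by apply/measurable_EFinP; apply: measurable_funTS.
by rewrite /= (e _ id).
Qed.

Lemma abs_continuous_acc (a b x y : R) v : abs_continuous a b v -> a < x -> y < b ->
  acc x y v.
Proof.
move=> H ax yb e /H[d d0 Hd]; exists d => // n s t st.
apply: Hd => i; have [h1 [h2 h3]] := st i; split; first exact: lt_le_trans h1.
by split => //; exact: le_lt_trans yb.
Qed.

(** Integrability of [f] on the whole line gives one modulus for families of intervals that approach
    a or b. *)
Lemma integral_abs_continuous (a b : R) v f : mu.-integrable setT (EFin \o f) ->
  primitive_on `]a, b[ v f -> abs_continuous a b v.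
Proof.
move=> fi pf e e0; have [d [d0 Hd]] := integral_normr_continuous fi e0.
exists d => // n s t st tst std.
have mst (i : 'I_n) : measurable (`]s i, t i[%classic : set R) by [].
have sub (A : set R) : measurable A -> mu.-integrable A (EFin \o f).
  by move=> mA; exact: integrableS fi.
have mU : measurable (\big[setU/set0]_(i < n) `]s i, t i[%classic : set R).
  exact: bigsetU_measurable.
have /Hd : (mu (\big[setU/set0]_(i < n) `]s i, t i[%classic) < d%:E)%E.
  rewrite measure_bigsetU_ord//.
  rewrite (eq_bigr (fun i => (t i - s i)%:E)) ?sumEFin// => i _.
  apply: (etrans (lebesgue_measure_itv `]s i, t i[)) => /=.
  rewrite lte_fin; case: ltP => // ts.
  have [_ [st' _]] := st i; rewrite (_ : t i = s i) ?subrr//.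
  by apply/eqP; rewrite eq_le ts.
move=> /(_ mU); apply: le_lt_trans.
have fU : (\int[mu]_(r in \big[setU/set0]_(i < n) `]s i, t i[%classic) `|f r|%:E < +oo)%E.
  by have /integrableP[] := sub _ mU.
rewrite -lee_fin /Rintegral fineK; last by rewrite ge0_fin_numE// integral_ge0.
have mf : measurable_fun setT f by case/integrableP : fi => /measurable_EFinP.
rewrite ge0_integral_bigsetU//; last 3 first.
- exact: index_enum_uniq.
- by apply: sub_trivIset tst => i.
- by apply/measurable_EFinP; apply: measurable_funTS; exact: measurableT_comp.
rewrite -sumEFin; apply: lee_sum => i _.
have [h1 [h2 h3]] := st i.
have [|gi ->] := pf _ _ h2.
  by apply: subset_itv; rewrite bnd_simp.
rewrite -Rintegral_itv_bndo_bndc; last by apply: sub.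
rewrite -Rintegral_itv_obnd_cbnd; last by apply: sub.
rewrite EFin_normr_Rintegral//; last exact: sub.
by apply: le_abse_integral => //; apply/measurable_EFinP; exact: measurable_funTS.
Qed.

End primitive.

(** * One-dimensional energies *)

Section powR_facts.
Context {R : realType}.
Implicit Types (x c p : R).

(** The convex function x^p lies above its tangent at c; this is Young's inequality for x and c^(p -
    1). *)
Lemma powR_tangent x c p : 0 <= x -> 0 <= c -> 1 < p ->
  p * x * c `^ (p - 1) - (p - 1) * c `^ p <= x `^ p.
Proof.
move=> x0 c0 p1.
pose q := p / (p - 1).
have p10 : p - 1 != 0 by rewrite gt_eqF//; lra.
have q0 : 0 < q by rewrite divr_gt0//; lra.
have p0 : 0 < p by lra.
have pn0 : p != 0 by rewrite gt_eqF.
have pq : p^-1 + q^-1 = 1 by rewrite /q invf_div; field; rewrite pn0.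
have := conjugate_powR x0 (powR_ge0 c (p - 1)) p0 q0 pq.
rewrite -powRrM (_ : (p - 1) * q = p); last by rewrite /q mulrCA divff ?mulr1.
rewrite -(ler_pM2l p0) => h.
have e : p * (x `^ p / p + c `^ p / q) = x `^ p + (p - 1) * c `^ p.
  by rewrite /q; field; rewrite pn0 p10.
by move: h; rewrite e mulrA; lra.
Qed.

Lemma continuous_powR p : 0 < p -> continuous (fun x : R => `|x| `^ p).
Proof.
move=> p0 x; have [->|x0] := eqVneq x 0.
  rewrite /continuous_at normr0 powR0 ?gt_eqF//.
  apply/cvgrPdist_lt => e e0; near=> y.
  rewrite sub0r normrN ger0_norm ?powR_ge0//.
  rewrite -[ltRHS](powRr1 (ltW e0)) -(mulVf (lt0r_neq0 p0)) powRrM.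
  rewrite gt0_ltr_powR// ?nnegrE ?powR_ge0//.
  have : `|0 - y| < e `^ p^-1.
    by near: y; exists (e `^ p^-1) => //=; exact: powR_gt0.
  by rewrite sub0r normrN.
have nx : 0 < `|x| by rewrite normr_gt0.
apply: (@near_continuous _ (fun y => expR (p * ln `|y|))).
  near=> y; rewrite /powR ifF//; apply/negbTE; rewrite normr_eq0.
  apply/eqP => y0; have : `|x - y| < `|x| by near: y; exists `|x|.
  by rewrite y0 subr0 ltxx.
apply: continuous_comp; last exact: continuous_expR.
apply: continuousM; first exact: cst_continuous.
apply: continuous_comp; first exact: norm_continuous.
exact: continuous_ln.
Unshelve. all: by end_near. Qed.

(** The perspective form of the energy density: multiplied by c, the tangent to the p-th power at a
    constant becomes linear in the pair (x, c) and can be integrated. *)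
Lemma powR_perspective x c p : 0 <= x -> 0 < c ->
  x `^ p * c `^ (1 - p) = (x / c) `^ p * c.
Proof.
move=> x0 c0; have ci : 0 <= c^-1 by rewrite invr_ge0 ltW.
rewrite powRM// -mulrA; congr (_ * _).
have -> : c^-1 `^ p = c `^ (- p).
  by rewrite -(powR_inv1 (ltW c0)) -powRrM mulN1r.
rewrite -[X in _ = _ * X](powRr1 (ltW c0)) -powRD ?(gt_eqF c0) ?implybT//.
by rewrite addrC.
Qed.

End powR_facts.

Lemma integral_gt0 d (T : measurableType d) (R : realType)
    (mu : {measure set T -> \bar R}) (D : set T) (f : T -> R) :
  measurable D -> measurable_fun D f -> (0 < mu D)%E -> (forall x, D x -> 0 < f x) ->
  (0 < \int[mu]_(x in D) (f x)%:E)%E.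
Proof.
move=> mD mf D0 f0.
have If : (0 <= \int[mu]_(x in D) (f x)%:E)%E.
  by apply: integral_ge0 => x /f0/ltW; rewrite lee_fin.
rewrite lt_neqAle If andbT; apply/negP => /eqP/esym I0.
have : (\int[mu]_(x in D) `|(f x)%:E| = 0)%E.
  by rewrite -I0; apply: eq_integral => x /set_mem/f0/ltW fx; rewrite gee0_abs// lee_fin.
move=> /(ae_eq_integral_abs mu mD (proj2 (measurable_EFinP D f) mf))[N [mN N0 DN]].
have : D `<=` N.
  move=> x Dx; apply: DN => /= /(_ Dx)[fx]; have := f0 _ Dx.
  by rewrite fx ltxx.
move=> /(subset_measure0 mD mN)/(_ N0) D00.
by move: D0; rewrite D00 ltxx.
Qed.

Lemma lebesgue_itvcc_gt0 {R : realType} (x y : R) : x < y ->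
  (0 < lebesgue_measure (`[x, y]%classic : set R))%E.
Proof.
by move=> xy; rewrite lebesgue_measure_itv/= lte_fin xy -EFinB lte_fin subr_gt0.
Qed.

(** The straddle lemma: the difference quotient is taken over an interval around r, as for the
    dyadic cell that contains r, instead of one ending at r. *)
Lemma is_derive_straddle {R : realType} (V : R -> R) (r D e : R) :
  is_derive r 1 V D -> 0 < e -> exists2 d, 0 < d &
    forall s t, s <= r -> r <= t -> s < t -> t - s < d ->
      `|(V t - V s) / (t - s) - D| <= e.
Proof.
move=> [dV <-] e0.
move/cvgrPdist_le : dV => /(_ _ e0).
rewrite near_withinE => /nbhs_ballP[d /= d0 H].
exists d => // s t sr rt st std.
have K h : `|h| < d -> `|V (r + h) - V r - 'D_1 V r * h| <= e * `|h|.
  have [->|h0] := eqVneq h 0; first by rewrite addr0 subrr mulr0 subr0 normr0 mulr0.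
  move=> hd; have := H h; rewrite /ball/= sub0r normrN => /(_ hd h0).
  rewrite /= /GRing.scale/= mulr1 => H1.
  have -> : V (r + h) - V r - 'D_1 V r * h = - ('D_1 V r - h^-1 * (V (h + r) - V r)) * h.
    by rewrite [r + h]addrC; field.
  by rewrite normrM normrN ler_wpM2r.
have Kt := K (t - r); have Ks := K (s - r).
have ts0 : 0 < t - s by rewrite subr_gt0.
rewrite -(ler_pM2r ts0) -[X in _ * X](gtr0_norm ts0) -normrM.
have -> : ((V t - V s) / (t - s) - 'D_1 V r) * (t - s) =
    (V (r + (t - r)) - V r - 'D_1 V r * (t - r)) - (V (r + (s - r)) - V r - 'D_1 V r * (s - r)).
  by rewrite !(addrC r) !subrK; field; rewrite gt_eqF.
apply: (le_trans (ler_normB _ _)).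
have -> : e * (t - s) = e * `|t - r| + e * `|s - r|.
  by rewrite ger0_norm ?subr_ge0// ler0_norm ?subr_le0//; ring.
rewrite lerD//.
  by apply: Kt; rewrite ger0_norm ?subr_ge0//; lra.
by apply: Ks; rewrite ler0_norm ?subr_le0//; lra.
Qed.

Lemma le_limn_einf {R : realType} (u u' : (\bar R)^nat) : (forall n, u n <= u' n)%E ->
  (limn_einf u <= limn_einf u')%E.
Proof.
move=> uu'; rewrite !limn_einf_lim; apply: lee_lim; [exact: is_cvg_einfs..|].
apply: nearW => n; apply: le_ereal_inf_tmp => _ [k nk <-].
by apply: le_trans (uu' k); apply: ereal_inf_lbound; exists k.
Qed.

Lemma le_limn_einf_cst {R : realType} (l : \bar R) (u : (\bar R)^nat) :
  (forall n, l <= u n)%E -> (l <= limn_einf u)%E.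
Proof.
move=> lu; have cl : (fun _ : nat => l) @ \oo --> l by exact: cvg_cst.
by rewrite -(cvg_limn_einf_sup cl).1; exact: le_limn_einf.
Qed.

Lemma limn_einf_le_cst {R : realType} (l : \bar R) (u : (\bar R)^nat) :
  (forall n, u n <= l)%E -> (limn_einf u <= l)%E.
Proof.
move=> ul; have cl : (fun _ : nat => l) @ \oo --> l by exact: cvg_cst.
by rewrite -[leRHS](cvg_limn_einf_sup cl).1; exact: le_limn_einf.
Qed.

(** * Jensen's inequality and dyadic sums for the energy *)

Section jensen.
Context {R : realType}.
Local Notation mu := (@lebesgue_measure R).
Variables (p : R) (ka : R -> R).
Hypothesis p1 : 1 < p.
Hypothesis ka0 : forall r, 0 < ka r.
Hypothesis mka : measurable_fun setT ka.

Definition penergy (f : R -> R) (D : set R) : \bar R :=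
  (\int[mu]_(r in D) (`|f r| `^ p * ka r `^ (1 - p))%:E)%E.

Lemma penergy_ge0 f D : (0 <= penergy f D)%E.
Proof. by apply: integral_ge0 => r _; rewrite lee_fin mulr_ge0// powR_ge0. Qed.

Lemma measurable_penergy (f : R -> R) (D : set R) : measurable_fun D f ->
  measurable_fun D (fun r => (`|f r| `^ p * ka r `^ (1 - p))%:E).
Proof.
move=> mf; apply/measurable_EFinP; apply: measurable_funM.
  apply: (@measurableT_comp _ _ _ _ _ _ (fun x : R => x `^ p)) => //.
  exact: measurableT_comp.
apply: (@measurableT_comp _ _ _ _ _ _ (fun x : R => x `^ (1 - p))) => //.
exact: measurable_funTS.
Qed.

Lemma Rint_ka_gt0 x y : x < y -> mu.-integrable `[x, y] (EFin \o ka) ->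
  0 < \int[mu]_(r in `[x, y]) ka r.
Proof.
move=> xy ki; apply: fine_gt0; have mk : measurable_fun `[x, y] ka by exact: measurable_funTS.
apply/andP; split.
  by apply: integral_gt0 => //; exact: lebesgue_itvcc_gt0.
have : (\int[mu]_(r in `[x, y]) (ka r)%:E)%E \is a fin_num by apply: integrable_fin_num ki.
by rewrite fin_numElt => /andP[].
Qed.

Lemma jensen_powR f x y : x < y ->
  mu.-integrable `[x, y] (EFin \o f) -> mu.-integrable `[x, y] (EFin \o ka) ->
  ((`|\int[mu]_(r in `[x, y]) f r| `^ p)%:E <=
   penergy f `[x, y] * ((\int[mu]_(r in `[x, y]) ka r) `^ (p - 1))%:E)%E.
Proof.
move=> xy fi ki.
pose K := \int[mu]_(r in `[x, y]) ka r.
have K0 : 0 < K by exact: Rint_ka_gt0.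
pose A : R := `|\int[mu]_(r in `[x, y]) f r|.
(* The ratio f / ka that a function of constant ratio with the same integral would have: the tangent
   at this point gives the sharp inequality. *)
pose c : R := A / K.
have c0 : 0 <= c by apply: divr_ge0; [exact: normr_ge0|exact: ltW].
have nfi := integrable_norm fi.
have AN : A <= \int[mu]_(r in `[x, y]) `|f r| by exact: le_normr_Rintegral.
pose L (r : R) := p * c `^ (p - 1) * `|f r| - (p - 1) * c `^ p * ka r.
have i1 : mu.-integrable `[x, y] (EFin \o (fun r => p * c `^ (p - 1) * `|f r|)).
  rewrite (_ : EFin \o _ = fun r => ((p * c `^ (p - 1))%:E * (`|f r|)%:E)%E)//.
  by apply: integrableZl.
have i2 : mu.-integrable `[x, y] (EFin \o (fun r => (p - 1) * c `^ p * ka r)).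
  rewrite (_ : EFin \o _ = fun r => (((p - 1) * c `^ p)%:E * (ka r)%:E)%E)//.
  by apply: integrableZl.
have Li : mu.-integrable `[x, y] (EFin \o L).
  have mD : measurable (`[x, y]%classic : set (measurableTypeR R)) by [].
  exact: (integrableB mD i1 i2).
have LE : c `^ p * K <= \int[mu]_(r in `[x, y]) L r.
  rewrite RintegralB// RintegralZl// RintegralZl// -/K.
  have -> : c `^ p * K = p * c `^ (p - 1) * A - (p - 1) * c `^ p * K.
    have -> : A = c * K by rewrite /c divfK// gt_eqF.
    have -> : c `^ p = c * c `^ (p - 1) by rewrite mulr_powRB1// (lt_trans ltr01 p1).
    by ring.
  by rewrite lerB// ler_wpM2l// mulr_ge0 ?powR_ge0// ltW// (lt_trans ltr01 p1).
have LP r : L r <= `|f r| `^ p * ka r `^ (1 - p).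
  rewrite powR_perspective//.
  have := powR_tangent (divr_ge0 (normr_ge0 (f r)) (ltW (ka0 r))) c0 p1.
  rewrite -(ler_pM2r (ka0 r)); apply: le_trans.
  rewrite le_eqVlt; apply/orP; left; apply/eqP; rewrite /L.
  by field; rewrite gt_eqF.
have AE : A `^ p = c `^ p * K * K `^ (p - 1).
  have -> : A = c * K by rewrite /c divfK// gt_eqF.
  by rewrite powRM ?(ltW K0)// -mulrA mulr_powRB1 ?(ltW K0)// (lt_trans ltr01 p1).
rewrite -/A -/K AE EFinM; apply: lee_wpmul2r; first by rewrite lee_fin powR_ge0.
have mf : measurable_fun `[x, y] f by move/measurable_int : fi => /measurable_EFinP.
have mP := measurable_penergy mf.
have [Pfin|] := ltP (penergy f `[x, y]) +oo%E; last by rewrite leye_eq => /eqP ->; rewrite leey.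
have Pi : mu.-integrable `[x, y] (EFin \o (fun r => `|f r| `^ p * ka r `^ (1 - p))).
  apply/integrableP; split; first exact: mP.
  apply: le_lt_trans Pfin; apply: ge0_le_integral => //.
  - exact: measurableT_comp.
  - by move=> r _ /=; rewrite lee_fin ger0_norm// mulr_ge0// powR_ge0.
apply: (@le_trans _ _ (\int[mu]_(r in `[x, y]) L r)%:E); first by rewrite lee_fin.
rewrite /Rintegral fineK; last exact: integrable_fin_num.
by apply: le_integral => // r _; rewrite lee_fin.
Qed.


Definition psum al be (v : R -> R) m : R :=
  \sum_(k < 2 ^ m) `|incr al be v m k| `^ p /
    (\int[mu]_(r in `[node al be m k, node al be m k.+1]) ka r) `^ (p - 1).

(** The energy density of the function with the increments of [v] on the cells and, inside each
    cell, a derivative proportional to [ka]: the minimizer with these node values. Its integral is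
    [psum]. *)
Definition pstep al be (v : R -> R) m (r : R) : \bar R :=
  \sum_(k < 2 ^ m) ((`|incr al be v m k| /
    (\int[mu]_(s in `[node al be m k, node al be m k.+1]) ka s)) `^ p *
    ka r * \1_(cell al be m k) r)%:E.

Lemma ge0_integral_itvoc_itvcc (g : R -> R) (x y : R) : measurable_fun setT g ->
  (\int[mu]_(r in `]x, y]) (g r)%:E = \int[mu]_(r in `[x, y]) (g r)%:E)%E.
Proof.
move=> mg; apply: integral_itv_obnd_cbnd.
by apply/measurable_EFinP; exact: measurable_funTS.
Qed.

Section interval.
Variables (al be : R).
Hypothesis albe : al < be.
Hypothesis ki : mu.-integrable `[al, be] (EFin \o ka).

Lemma node_subset m k : (k < 2 ^ m)%N ->
  `[node al be m k, node al be m k.+1] `<=` `[al, be].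
Proof.
move=> km; apply: subset_itv; rewrite bnd_simp.
- by rewrite -{1}(node0 al be m) node_le.
- by rewrite -{2}(node_last al be m) node_le.
Qed.

Lemma node_lt m k : node al be m k < node al be m k.+1.
Proof. by rewrite nodeS ltrDl mesh_gt0. Qed.

Lemma integrable_cell m k : (k < 2 ^ m)%N ->
  mu.-integrable `[node al be m k, node al be m k.+1] (EFin \o ka).
Proof. by move=> km; apply: integrableS ki => //; exact: node_subset. Qed.

Lemma psum_le_penergy v f m : primitive_on `[al, be] v f -> measurable_fun `[al, be] f ->
  ((psum al be v m)%:E <= penergy f `[al, be])%E.
Proof.
move=> vf mf; rewrite /psum -sumEFin.
have cellI k : (k < 2 ^ m)%N -> cell al be m k `<=` `[al, be].
  move=> km; apply: (subset_trans (cell_sub albe km)).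
  by apply: subset_itvr; rewrite bnd_simp.
apply: (@le_trans _ _ (\sum_(k < 2 ^ m) penergy f (cell al be m k))).
  apply: lee_sum => k _.
  have kik := integrable_cell (ltn_ord k).
  have K0 := Rint_ka_gt0 (node_lt m k) kik.
  have [fi e] := vf _ _ (ltW (node_lt m k)) (@node_subset m k (ltn_ord k)).
  have := jensen_powR (node_lt m k) fi kik.
  rewrite -e -/(incr al be v m k) => h.
  rewrite EFinM lee_pdivrMr ?powR_gt0//; apply: (le_trans h).
  rewrite lee_wpmul2r ?lee_fin ?powR_ge0// /penergy /cell integral_itv_obnd_cbnd//.
  apply: measurable_penergy; apply: measurable_funS mf => //; exact: cellI.
rewrite /penergy -ge0_integral_bigsetU//=.
- apply: ge0_subset_integral => //.
  + by apply: bigsetU_measurable => k _; exact: measurable_cell.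
  + exact: measurable_penergy.
  + by move=> r _; rewrite lee_fin mulr_ge0// powR_ge0.
  + by elim/big_ind : _ => //= [B C BA CA|k _]; [rewrite subUset|exact: cellI].
- by move=> k; exact: measurable_cell.
- exact: index_enum_uniq.
- move=> j k _ _ [x [jx kx]]; apply: val_inj; exact: (cell_disjoint albe jx kx).
- apply: measurable_penergy; apply: measurable_funS mf => //.
  by elim/big_ind : _ => //= [B C BA CA|k _]; [rewrite subUset|exact: cellI].
- by move=> r _; rewrite lee_fin mulr_ge0// powR_ge0.
Qed.

Lemma pstep_ge0 v m r : (0 <= pstep al be v m r)%E.
Proof.
apply: sume_ge0 => k _; rewrite lee_fin; apply: mulr_ge0 => //.
by apply: mulr_ge0; [exact: powR_ge0|exact: ltW].
Qed.

Lemma measurable_pstep v m : measurable_fun setT (pstep al be v m).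
Proof.
apply: emeasurable_sum => k; apply/measurable_EFinP; apply: measurable_funM.
  exact: measurable_funM.
by apply: measurable_indic; exact: measurable_cell.
Qed.

Lemma integral_pstep v m : (\int[mu]_r pstep al be v m r = (psum al be v m)%:E)%E.
Proof.
rewrite /pstep ge0_integral_sum//; last 2 first.
- move=> k; apply/measurable_EFinP; apply: measurable_funM.
    exact: measurable_funM.
  by apply: measurable_indic; exact: measurable_cell.
- move=> k r _; rewrite lee_fin; apply: mulr_ge0 => //.
  by apply: mulr_ge0; [exact: powR_ge0|exact: ltW].
rewrite /psum -sumEFin; apply: eq_bigr => k _.
set K := Rintegral _ _ _.
have kik := integrable_cell (ltn_ord k).
have K0 : 0 < K := Rint_ka_gt0 (node_lt m k) kik.
transitivity (\int[mu]_(r in cell al be m k) (((`|incr al be v m k| / K) `^ p)%:E * (ka r)%:E))%E.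
  rewrite [RHS]integral_mkcond; apply: eq_integral => r _.
  by rewrite patchE indicE; case: ifPn => _; rewrite ?mulr1 ?mulr0// EFinM.
rewrite ge0_integralZl//; last 4 first.
- exact: measurable_cell.
- by apply/measurable_EFinP; exact: measurable_funTS.
- by move=> r _; rewrite lee_fin ltW.
- by rewrite lee_fin powR_ge0.
rewrite ge0_integral_itvoc_itvcc//.
have -> : (\int[mu]_(r in `[node al be m k, node al be m k.+1]) (ka r)%:E = K%:E)%E.
  by rewrite /K /Rintegral fineK//; exact: integrable_fin_num kik.
rewrite -EFinM; congr EFin.
by rewrite -powR_perspective// -opprB powRN.
Qed.

Lemma exists_cell r m : al < r <= be ->
  exists k, (k < 2 ^ m)%N /\ cell al be m k r.
Proof.
move=> /andP[ar rb].
have ex : exists j, r <= node al be m j by exists (2 ^ m)%N; rewrite node_last.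
case: (ex_minnP ex) => -[|k] rk kmin; first by move: rk; rewrite node0 leNgt ar.
have km : (k < 2 ^ m)%N by apply: kmin; rewrite node_last.
exists k; split => //; rewrite /cell/= in_itv/= rk andbT ltNge; apply/negP => /kmin.
by rewrite ltnn.
Qed.

(** In the cell that contains r, the increment of [v] over that of the primitive of [ka] is a
    quotient of two difference quotients straddling r, which tend to D and [ka r]. *)
Lemma cvg_pstep v D r : al < r < be -> is_derive r 1 v D ->
  is_derive r 1 (fun x => \int[mu]_(s in `[al, x]) ka s) (ka r) ->
  pstep al be v m r @[m --> \oo] --> (`|D| `^ p * ka r `^ (1 - p))%:E.
Proof.
move=> /andP[ar rb] dv dK.
have rab : al < r <= be by rewrite ar ltW.
have [k kP] := choice (fun m => exists_cell m rab).
pose K m := \int[mu]_(s in `[node al be m (k m), node al be m (k m).+1]) ka s.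
pose q m := incr al be v m (k m) / mesh al be m.
pose q' m := K m / mesh al be m.
have sr m : node al be m (k m) <= r.
  by have [_] := kP m; rewrite /cell/= in_itv/= => /andP[/ltW].
have rt m : r <= node al be m (k m).+1.
  by have [_] := kP m; rewrite /cell/= in_itv/= => /andP[].
have mE m : node al be m (k m).+1 - node al be m (k m) = mesh al be m.
  by rewrite nodeS addrAC subrr add0r.
have qD : q @ \oo --> D.
  apply/cvgrPdist_le => e e0; have [d d0 H] := is_derive_straddle dv e0.
  have [M HM] := @mesh_cvg0 _ al be _ d0.
  near=> m; rewrite distrC /q /incr -(mE m); apply: H => //; first exact: node_lt.
  by rewrite mE; apply: HM; near: m; exact: nbhs_infty_ge.
have q'k : q' @ \oo --> ka r.
  apply/cvgrPdist_le => e e0; have [d d0 H] := is_derive_straddle dK e0.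
  have [M HM] := @mesh_cvg0 _ al be _ d0.
  near=> m; rewrite distrC /q' -(mE m).
  have -> : K m = \int[mu]_(s in `[al, node al be m (k m).+1]) ka s -
      \int[mu]_(s in `[al, node al be m (k m)]) ka s.
    have [km _] := kP m.
    rewrite (@Rintegral_itv_cat _ _ al (node al be m (k m))).
    - by rewrite addrAC subrr add0r.
    - by rewrite -{1}(node0 al be m) node_le.
    - exact/ltW/node_lt.
    - apply: integrableS ki => //; apply: subset_itvl; rewrite bnd_simp.
      by rewrite -{2}(node_last al be m) node_le.
  apply: H => //; first exact: node_lt.
  by rewrite mE; apply: HM; near: m; exact: nbhs_infty_ge.
rewrite powR_perspective//.
have e m : pstep al be v m r = (`|q m / q' m| `^ p * ka r)%:E.
  have [km kr] := kP m; rewrite /pstep (bigD1 (Ordinal km))//= big1 ?adde0.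
    rewrite indicE mem_set// mulr1; congr (_ `^ _ * _)%:E.
    have m0 := mesh_gt0 albe m.
    have K0 : 0 < K m by apply: Rint_ka_gt0; [exact: node_lt|exact: integrable_cell].
    have -> : q m / q' m = incr al be v m (k m) / K m.
      by rewrite /q /q'; field; rewrite !gt_eqF.
    by rewrite -/(K m) normrM normfV (gtr0_norm K0).
  move=> j jk; rewrite indicE memNset ?mulr0// => jr.
  move/eqP : jk; apply; apply: val_inj => /=; exact: (cell_disjoint albe jr kr).
rewrite (_ : (fun m => _) = EFin \o (fun m => `|q m / q' m| `^ p * ka r)); last first.
  by apply/funext => m; rewrite e.
apply: cvg_EFin; first exact: nearW.
apply: cvgM; last exact: cvg_cst.
rewrite -(ger0_norm (ltW (ka0 r))) -normf_div.
apply: (continuous_cvg _ (continuous_powR (lt_trans ltr01 p1) (x := D / ka r))).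
by apply: cvgM => //; apply: cvgV => //; rewrite gt_eqF.
Unshelve. all: by end_near. Qed.

End interval.

(* Fatou's lemma for the step functions of a family of intervals. *)
Lemma penergy_le_psum (s : seq (R * R)) v (T : R) (f : R * R -> R -> R) :
  (forall c, c \in s -> [/\ c.1 < c.2, primitive_on `[c.1, c.2] v (f c) &
     mu.-integrable `[c.1, c.2] (EFin \o ka)]) ->
  (forall m, \sum_(c <- s) psum c.1 c.2 v m <= T) ->
  (penergy (rderiv v) [set r | exists2 c, c \in s & (c.1 < r < c.2)%R] <= T%:E)%E.
Proof.
move=> Hs HT.
pose h (r : R) := (`|rderiv v r| `^ p * ka r `^ (1 - p))%:E.
have Hae : {ae mu, forall r, forall c, c \in s -> c.1 < r < c.2 ->
    pstep c.1 c.2 v m r @[m --> \oo] --> h r}.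
  elim: s Hs {HT} => [_|c s ih Hs]; first by apply: aeW => r c.
  have [c12 vf ki] := Hs c (mem_head _ _).
  have [N [mN N0] HN] := ae_is_derive_primitive vf.
  have Kk : primitive_on `[c.1, c.2] (fun x => \int[mu]_(r in `[c.1, x]) ka r) ka.
    move=> x y xy xyc; split; first exact: integrableS ki.
    have := xyc x; have := xyc y; rewrite /= !in_itv/= !lexx xy /=.
    move=> /(_ isT)/andP[_ yc] /(_ isT)/andP[cx _].
    rewrite (@Rintegral_itv_cat _ ka c.1 x y)//; first by rewrite addrAC subrr add0r.
    by apply: integrableS ki => //; apply: subset_itvl; rewrite bnd_simp.
  have [N' [mN' N'0] HN'] := ae_is_derive_primitive Kk.
  have [A [mA A0 HA]] := ih (fun c' cs => Hs c' (ltac:(by rewrite inE cs orbT))).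
  exists (N `|` N' `|` A); split.
  - by apply: measurableU => //; exact: measurableU.
  - by apply: null_set_setU => //; [exact: measurableU|exact: null_set_setU].
  move=> r; apply: contra_notP => /not_orP[/not_orP[NN NN'] NA] c'.
  have Hr : forall c, c \in s -> c.1 < r < c.2 ->
      pstep c.1 c.2 v m r @[m --> \oo] --> h r.
    by apply: contrapT => /HA.
  rewrite inE => /predU1P[-> rc|]; last exact: Hr.
  rewrite /h; apply: (cvg_pstep c12 ki rc); last exact: HN'.
  by have dv := HN _ rc NN; rewrite (rderivE dv).
have [N [mN N0 HN]] := Hae.
pose g m r := (\sum_(c <- s) pstep c.1 c.2 v m r)%E.
have g0 m r : (0 <= g m r)%E.
  by apply: sume_ge0 => c _; exact: pstep_ge0.
have mg m : measurable_fun setT (g m).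
  by apply: emeasurable_sum => c; exact: measurable_pstep.
apply: (@le_trans _ _ (\int[mu]_r limn_einf (g ^~ r))%E); last first.
  apply: le_trans (fatou _ _ _ _) _ => //.
  apply: limn_einf_le_cst => m; rewrite /g.
  rewrite ge0_integral_sum//; last 2 first.
    by move=> c; exact: measurable_pstep.
    by move=> c r _; exact: pstep_ge0.
  rewrite -[leRHS]/(T%:E); apply: le_trans (_ : (\sum_(c <- s) psum c.1 c.2 v m)%:E <= _)%E; last first.
    by rewrite lee_fin.
  rewrite -sumEFin big_seq [leRHS]big_seq; apply: lee_sum => c cs.
  by have [c12 _ ki] := Hs c cs; rewrite integral_pstep.
rewrite /penergy integral_mkcond.
apply: (ge0_le_integral_off_null mN N0).
- by move=> r _; rewrite patchE; case: ifPn => // _; rewrite lee_fin mulr_ge0// powR_ge0.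
- by move=> r _; exact: le_limn_einf_cst.
move=> r _ Nr; rewrite patchE; case: ifPn => [|_]; last first.
  exact: le_limn_einf_cst.
rewrite inE => -[c cs rc].
have cv : pstep c.1 c.2 v m r @[m --> \oo] --> h r.
  by apply: contrapT => H; apply: Nr; apply: HN => /= /(_ _ cs rc).
rewrite -/(h r) -(cvg_limn_einf_sup cv).1; apply: le_limn_einf => m.
rewrite /g (big_rem c)//= leeDl//; apply: sume_ge0 => c' _; exact: pstep_ge0.
Qed.

End jensen.

(** * Test functions *)

(** Reduces a directional derivative to an ordinary one along a line, where the chain rule of one
    variable applies. *)
Lemma is_derive_lineP {R : realType} {V : normedModType R} (f : V -> R) (x v : V) (l : R) :
  is_derive (0 : R) 1 (fun h : R => f (h *: v + x)) l <-> is_derive x v f l.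
Proof.
have e : (fun h : R => h^-1 *: ((f \o shift x) (h *: v) - f x)) =
  (fun h : R => h^-1 *: (((fun h : R => f (h *: v + x)) \o shift 0) (h *: (1 : R)) -
     (fun h : R => f (h *: v + x)) 0)).
  by apply/funext => h /=; rewrite scale0r add0r /GRing.scale/= mulr1 addr0.
by split=> -[d0 <-]; split; move: d0; rewrite /derivable /derive e.
Qed.

Lemma is_derive_line {R : realType} {V : normedModType R} (f : V -> R) (x v : V) (l : R) :
  is_derive (0 : R) 1 (fun h : R => f (h *: v + x)) l -> is_derive x v f l.
Proof. by move/is_derive_lineP. Qed.

Lemma is_derive1_continuous {R : realType} (f : R -> R) (x l : R) :
  is_derive x 1 f l -> {for x, continuous f}.
Proof. by move=> [d _]; apply: differentiable_continuous; exact/derivable1_diffP. Qed.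

Section bump.
Context {R : realType}.

(** For n = 0 this is the classical smooth function exp(-1/x); the powers of 1/x make the family
    stable under differentiation. *)
Definition bump (n : nat) (x : R) : R :=
  if 0 < x then x^-1 ^+ n * expR (- x^-1) else 0.

Lemma bump_ge0 n x : 0 <= bump n x.
Proof.
rewrite /bump; case: ifPn => // x0.
by rewrite mulr_ge0 ?expR_ge0// exprn_ge0// invr_ge0 ltW.
Qed.

Lemma bump0_le1 x : bump 0 x <= 1.
Proof.
rewrite /bump; case: ifPn => // x0.
by rewrite expr0 mul1r -expR0 ler_expR oppr_le0 invr_ge0 ltW.
Qed.

Lemma bump_npos n x : x <= 0 -> bump n x = 0.
Proof. by move=> x0; rewrite /bump ltNge x0. Qed.

(** With y = 1/x, exp y exceeds the term of degree n + 2 of its series. Quadratic decay is what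
    gives a zero derivative at 0. *)
Lemma bump_le n x : bump n x <= n.+2`!%:R * x ^+ 2.
Proof.
rewrite /bump; case: ifPn => [x0|_]; last first.
  by apply: mulr_ge0; [exact: ler0n|exact: sqr_ge0].
have y0 : 0 < x^-1 by rewrite invr_gt0.
have f0 : 0 < n.+2`!%:R :> R by rewrite ltr0n fact_gt0.
have := expR_ge1Dxn n.+1 (ltW y0).
set y := x^-1 in y0 *; move=> h.
have {}h : y ^+ n.+2 <= expR y * n.+2`!%:R.
  by rewrite -ler_pdivrMr//; apply: le_trans h; rewrite lerDr.
rewrite expRN (_ : x ^+ 2 = (y ^+ 2)^-1); last by rewrite /y exprVn invrK.
rewrite ler_pdivrMr ?expR_gt0// mulrAC ler_pdivlMr ?exprn_gt0//.
by rewrite -exprD addn2 mulrC mulrC [X in _ <= X]mulrC.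
Qed.

Lemma cvg_bump0 y : 0 < y -> bump 0 (m.+1%:R * y) @[m --> \oo] --> (1 : R).
Proof.
move=> y0; have -> : (fun m => bump 0 (m.+1%:R * y)) = (fun m => expR (- (y^-1 * m.+1%:R^-1))).
  apply/funext => m; rewrite /bump mulr_gt0 ?ltr0n// expr0 mul1r invfM mulrC.
  by [].
rewrite -[X in _ --> X](@expR0 R).
apply: continuous_cvg; first exact: continuous_expR.
rewrite -oppr0; apply: cvgN; rewrite -[X in _ --> X](mulr0 y^-1).
by apply: cvgM; [exact: cvg_cst|exact: cvg_harmonic].
Qed.

Lemma is_derive_bump n (x : R) : is_derive x 1 (bump n) (bump n.+2 x - n%:R * bump n.+1 x).
Proof.
have [x0|x0|->] := ltgtP x 0.
- rewrite !bump_npos ?ltW// mulr0 subr0.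
  apply: (@near_eq_is_derive _ _ _ (cst 0)).
    by near=> y; rewrite bump_npos//= ltW//; near: y; exact: lt_nbhsl.
- have xn0 : x != 0 by rewrite gt_eqF.
  apply: (@near_eq_is_derive _ _ _ ((fun y : R => y^-1) ^+ n * (expR \o (fun y : R => - y^-1)))).
    near=> y; have y0 : 0 < y by near: y; exact: lt_nbhsr.
    by rewrite mulrfctE exprfctE /= /bump y0.
  have di : is_derive x 1 (fun y : R => y^-1) (- x ^- 2).
    have := is_deriveV xn0 (is_derive_id x 1).
    by move=> /is_derive_eq; apply; rewrite /GRing.scale/= mulr1.
  have := is_deriveM (is_deriveX n di)
     (@is_derive1_comp _ expR (fun y : R => - y^-1) _ _ _ (is_derive_expR _) (is_deriveN di)).
  move=> /is_derive_eq; apply; rewrite /bump x0 /GRing.scale/= opprK.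
  rewrite exprfctE.
  case: n => [|n]; first by rewrite !mul0r mulr0 subr0 addr0 expr0 -exprVn; ring.
  by rewrite -exprVn /= !exprS; ring.
- rewrite !bump_npos// mulr0 subr0.
  apply/is_derive1_caratheodory; exists (fun z => bump n z / z); split.
  + move=> z; rewrite subr0 (bump_npos _ (lexx 0)) subr0.
    by have [->|z0] := eqVneq z 0; [rewrite mulr0 bump_npos|rewrite divfK].
  + rewrite /continuous_at /prop_for invr0 mulr0.
    apply/cvgr0Pnorm_le => e e0; near=> z.
    have [->|z0] := eqVneq z 0; first by rewrite invr0 mulr0 normr0 ltW.
    rewrite normrM normfV ler_pdivrMr ?normr_gt0// ger0_norm ?bump_ge0//.
    apply: (le_trans (bump_le n z)); rewrite -real_normK ?num_real//.
    rewrite expr2 mulrA ler_wpM2r// -ler_pdivlMl ?ltr0n ?fact_gt0//.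
    have : `|0 - z| <= (n.+2)`!%:R^-1 * e.
      apply: ltW; near: z; exists ((n.+2)`!%:R^-1 * e) => //=.
      by rewrite mulr_gt0 ?invr_gt0 ?ltr0n ?fact_gt0.
    by rewrite sub0r normrN.
  + by rewrite invr0 mulr0.
Unshelve. all: by end_near. Qed.

End bump.

(* Smooth functions: the class is stable under directional derivatives. *)
Inductive bump_alg {R : realType} {V : normedModType R} : (V -> R) -> Prop :=
| bump_alg_cst (c : R) : bump_alg (fun=> c)
| bump_alg_bump (n : nat) (l : V -> R) (t : R) : continuous l ->
    (forall h v x, l (h *: v + x) = h * l v + l x) -> bump_alg (fun x => bump n (l x + t))
| bump_alg_add f g : bump_alg f -> bump_alg g -> bump_alg (fun x => f x + g x)
| bump_alg_mul f g : bump_alg f -> bump_alg g -> bump_alg (fun x => f x * g x).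

Section bump_alg.
Context {R : realType} {V : normedModType R}.
Implicit Types f : V -> R.

Lemma bump_alg_continuous f : bump_alg f -> continuous f.
Proof.
elim=> [c|n l t cl ll|{}f g _ cf _ cg|{}f g _ cf _ cg] x.
- exact: cst_continuous.
- apply: (@continuous_comp _ _ _ (fun x => l x + t)).
    by apply: continuousD; [exact: cl|exact: cst_continuous].
  exact: is_derive1_continuous (is_derive_bump _ _).
- by apply: continuousD; [exact: cf|exact: cg].
- by apply: continuousM; [exact: cf|exact: cg].
Qed.

Lemma bump_alg_derive f (v : V) : bump_alg f ->
  exists2 g, bump_alg g & forall x, is_derive x v f (g x).
Proof.
elim=> [c|n l t cl ll|{}f g bf [f' bf' df] bg [g' bg' dg]|{}f g bf [f' bf' df] bg [g' bg' dg]].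
- by exists (fun=> 0) => [|x]; [exact: bump_alg_cst|exact: is_derive_cst].
- exists (fun x => l v * (bump n.+2 (l x + t) + (- n%:R) * bump n.+1 (l x + t))).
    apply: bump_alg_mul; first exact: bump_alg_cst.
    apply: bump_alg_add; first exact: bump_alg_bump.
    by apply: bump_alg_mul; [exact: bump_alg_cst|exact: bump_alg_bump].
  move=> x; apply: is_derive_line.
  have e : is_derive (0 : R) 1 (fun h : R => l (h *: v + x) + t) (l v).
    have -> : (fun h : R => l (h *: v + x) + t) = (fun h => h * l v + (l x + t)).
      by apply/funext => h; rewrite ll addrA.
    have := is_deriveD (is_deriveM (is_derive_id (0 : R) 1) (is_derive_cst (l v) (0 : R) 1))
      (is_derive_cst (l x + t) (0 : R) 1).
    by move=> /is_derive_eq; apply; rewrite /GRing.scale/= mul0r mulr1 add0r addr0.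
  have := @is_derive1_comp _ (bump n) _ _ _ _ (is_derive_bump _ _) e.
  by move=> /is_derive_eq; apply; rewrite scale0r add0r mulNr mulrC.
- exists (fun x => f' x + g' x); first exact: bump_alg_add.
  by move=> x; exact: is_deriveD.
- exists (fun x => f x * g' x + g x * f' x).
    by apply: bump_alg_add; exact: bump_alg_mul.
  by move=> x; exact: is_deriveM.
Qed.

(** [bump_alg] contains all iterated derivatives of its members, and each member is continuous and
    derivable in every direction. *)
Lemma bump_alg_smooth f : bump_alg f -> smooth f.
Proof.
move=> bf s /=.
have : bump_alg (foldr (fun v f => 'D_v f) f s).
  elim: s => //= v s /(bump_alg_derive v)[g bg dg].
  by rewrite (_ : 'D_v _ = g)//; apply/funext => x; have [_ ->] := dg x.
move=> bs; split; first exact: bump_alg_continuous.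
by move=> x v; have [g _ /(_ x)[]] := bump_alg_derive v bs.
Qed.

Lemma bump_alg_prod (I : finType) (f : I -> V -> R) : (forall i, bump_alg (f i)) ->
  bump_alg (fun x => \prod_i f i x).
Proof.
move=> bf; elim: (index_enum I) => [|i s ih].
  by rewrite (_ : (fun x => _) = fun=> 1); [exact: bump_alg_cst|apply/funext => x; rewrite big_nil].
rewrite (_ : (fun x => _) = fun x => f i x * \prod_(j <- s) f j x).
  exact: bump_alg_mul.
by apply/funext => x; rewrite big_cons.
Qed.

End bump_alg.

Lemma null_set_bigcup d (T : measurableType d) (R : realType)
    (mu : {measure set T -> \bar R}) (I : countType) (N : I -> set T) :
  (forall i, measurable (N i) /\ mu (N i) = 0%E) ->
  measurable (\bigcup_i N i) /\ mu (\bigcup_i N i) = 0%E.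
Proof.
move=> HN; have mU : measurable (\bigcup_i N i).
  by apply: countable_bigcupT_measurable => [|i]; [exact: countableP|have [] := HN i].
split => //; apply/negligibleP => //.
have -> : \bigcup_i N i = \bigcup_k (if pickle_inv k is Some i then N i else set0).
  apply/seteqP; split => x [k _]; last by case: (pickle_inv k) => [i xi|//]; exists i.
  by move=> xk; exists (pickle k) => //; rewrite pickleK_inv.
apply: negligible_bigcup => k; case: pickle_inv => [i|]; last exact: negligible_set0.
by have [mN N0] := HN i; exists (N i); split.
Qed.

Section cutoff.
Local Open Scope ereal_scope.

Lemma cvg_integral_cutoff d (T : measurableType d) (R : realType)
    (mu : {measure set T -> \bar R}) (D O : set T) (g : T -> R) (phi : nat -> T -> R) :
  measurable D -> measurable O -> O `<=` D -> mu.-integrable D (EFin \o g) ->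
  (forall m, measurable_fun D (phi m)) ->
  (forall m x, (0 <= phi m x <= 1)%R) ->
  (forall x, phi m x @[m --> \oo] --> (\1_O x : R)) ->
  \int[mu]_(x in D) (g x * phi m x)%:E @[m --> \oo] --> \int[mu]_(x in O) (g x)%:E.
Proof.
move=> mD mO OD gi mphi phi01 cphi.
have mg : measurable_fun D g by move/measurable_int : gi => /measurable_EFinP.
have -> : \int[mu]_(x in O) (g x)%:E = \int[mu]_(x in D) (g x * \1_O x)%:E.
  rewrite [LHS]integral_mkcond [RHS]integral_mkcond; apply: eq_integral => x _.
  rewrite !patchE indicE; case: ifPn => [xO|]; last by rewrite mulr0; case: ifPn.
  by rewrite ifT ?mulr1// inE; apply: OD; rewrite inE in xO.
have /= [] := @dominated_convergence _ _ _ mu D mD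
  (fun m x => (g x * phi m x)%:E) (fun x => (g x * \1_O x)%:E) (fun x => `|(g x)%:E|) => //.
- by move=> m; apply/measurable_EFinP; exact: measurable_funM.
- apply/measurable_EFinP; apply: measurable_funM => //; exact: measurable_indic.
- apply: aeW => x _; apply: cvg_EFin; first exact: nearW.
  by apply: cvgM; [exact: cvg_cst|exact: cphi].
- exact: integrable_abse gi.
- apply: aeW => x m _; rewrite lee_fin normrM.
  have /andP[h0 h1] := phi01 m x.
  by rewrite ler_piMr// ger0_norm.
Qed.

End cutoff.

(* Products of the functions bump 0 (m L) converge to the indicator of the
   polyhedron where all the affine functionals L are positive. *)
Lemma polyhedron_test_functions {R : realType} {V : normedModType R} (I : finType)
    (l : I -> V -> R) (t : I -> R) (U K : set V) :
  (forall i, continuous (l i)) ->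
  (forall i h v x, l i (h *: v + x) = h * l i v + l i x) ->
  compact K -> K `<=` U -> (forall x, (forall i, 0 < l i x + t i) -> K x) ->
  exists phi : nat -> V -> R, forall m, [/\ bump_alg (phi m), test_function U (phi m),
    (forall x, 0 <= phi m x <= 1),
    (forall x, ~ (forall i, 0 < l i x + t i) -> phi m x = 0) &
    (forall x, phi m x @[m --> \oo] --> (\1_[set x | forall i, 0 < l i x + t i] x : R))].
Proof.
move=> cl ll cK KU HK.
pose phi m (x : V) : R := \prod_i bump 0 (m.+1%:R * (l i x + t i)).
have phi0 m x : ~ (forall i, 0 < l i x + t i) -> phi m x = 0.
  move/existsNP => [i] /negP; rewrite -leNgt => li; rewrite /phi (bigD1 i)//= bump_npos ?mul0r//.
  by rewrite mulr_ge0_le0.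
have aphi m : bump_alg (phi m).
  apply: bump_alg_prod => i.
  rewrite (_ : (fun x => _) = fun x => bump 0 (m.+1%:R * l i x + m.+1%:R * t i)).
    apply: (@bump_alg_bump _ _ _ (fun x => m.+1%:R * l i x)).
      by move=> x; apply: (@continuousM _ _ (fun=> m.+1%:R) (l i)); [exact: cst_continuous|exact: cl].
    by move=> h v x; rewrite ll; ring.
  by apply/funext => x; rewrite mulrDr.
exists phi => m; split => //.
- split; first exact: bump_alg_smooth (aphi m).
  by exists K; [split|move=> x Kx; apply: phi0 => /HK].
- move=> x; apply/andP; split; first by apply: prodr_ge0 => i _; exact: bump_ge0.
  by apply: prodr_ile1 => i _; rewrite bump_ge0 bump0_le1.
- exact: phi0.
move=> x; have [H|] := pselect (forall i, 0 < l i x + t i).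
  rewrite indicE mem_set// /phi; elim: (index_enum I) => [|i s ih].
    by rewrite (_ : (fun m => _) = fun=> 1); [exact: cvg_cst|apply/funext => k; rewrite big_nil].
  rewrite (_ : (fun m => _) = (fun m => bump 0 (m.+1%:R * (l i x + t i))) \*
    (fun m => \prod_(j <- s) bump 0 (m.+1%:R * (l j x + t j)))).
    by rewrite -[X in _ --> X](mulr1 1); apply: cvgM => //; exact: cvg_bump0.
  by apply/funext => k; rewrite big_cons.
move=> H; rewrite indicE memNset//; move/existsNP : H => [i /negP]; rewrite -leNgt => li.
rewrite (_ : (fun m => _) = fun=> 0); first exact: cvg_cst.
apply/funext => k; rewrite /phi (bigD1 i)//= bump_npos ?mul0r//.
by rewrite mulr_ge0_le0.
Qed.

(** * The fundamental lemma of the calculus of variations in several variables *)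

Section rV_zero.
Context {R : realType}.

Lemma cbox_compact n (al be : 'I_n -> R) : compact (cbox al be).
Proof.
have := @rV_compact R n (fun i => `[al i, be i]%classic) (fun i => @segment_compact _ _ _).
by congr compact; apply/seteqP; split => x H i; have := H i; rewrite /= in_itv.
Qed.

Lemma obox_test_functions n (al be : 'I_n -> R) (U : set 'rV[R]_n) :
  cbox al be `<=` U ->
  exists phi : nat -> 'rV[R]_n -> R, forall m, [/\ bump_alg (phi m), test_function U (phi m),
    (forall x, 0 <= phi m x <= 1), (forall x, ~ cbox al be x -> phi m x = 0) &
    (forall x, phi m x @[m --> \oo] --> (\1_(obox al be) x : R))].
Proof.
move=> QU.
pose l (i : 'I_n * bool) (x : 'rV[R]_n) : R := if i.2 then x ord0 i.1 else - x ord0 i.1.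
pose t (i : 'I_n * bool) : R := if i.2 then - al i.1 else be i.1.
have e x : (forall i, 0 < l i x + t i) <-> obox al be x.
  split=> [H i|H [i []]]; last 2 first.
  - by rewrite /l /t /= subr_gt0; have /andP[] := H i.
  - by rewrite /l /t /= addrC subr_gt0; have /andP[] := H i.
  have := H (i, true); have := H (i, false); rewrite /l /t /=.
  by rewrite addrC !subr_gt0 => -> ->.
have [||||phi Hphi] := @polyhedron_test_functions R 'rV[R]_n _ l t U (cbox al be) _ _ _ QU _.
- move=> [i []] x; rewrite /l/=; first exact: coord_continuous.
  by apply: continuousN; exact: coord_continuous.
- by move=> [i []] h v x; rewrite /l /= !mxE//; ring.
- exact: cbox_compact.
- by move=> x /e; exact: obox_cbox.
exists phi => m; have [h1 h2 h3 h4 h5] := Hphi m; split => // x.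
  by move=> Qx; apply: h4 => /e/obox_cbox.
rewrite (_ : obox al be = [set x | forall i, 0 < l i x + t i])//.
by apply/seteqP; split => y /e.
Qed.

Definition oboxes n : set (set 'rV[R]_n) :=
  [set B | exists al be : 'I_n -> R, B = obox al be].

Lemma oboxI n (a1 b1 a2 b2 : 'I_n -> R) : obox a1 b1 `&` obox a2 b2 =
  obox (fun i => Num.max (a1 i) (a2 i)) (fun i => Num.min (b1 i) (b2 i)).
Proof.
apply/seteqP; split => [x [H1 H2] i|x H].
  by have := H1 i; have := H2 i; rewrite gt_max lt_min => /andP[-> ->] /andP[-> ->].
by split => i; have := H i; rewrite gt_max lt_min => /andP[/andP[h1 h2] /andP[h3 h4]]; apply/andP.
Qed.

Lemma oboxesI n : setI_closed (@oboxes n).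
Proof. by move=> _ _ [a1 [b1 ->]] [a2 [b2 ->]]; rewrite oboxI; eexists; eexists. Qed.

Lemma bigcup_obox_nat n : \bigcup_k obox (fun=> - k%:R) (fun=> k%:R) = [set: 'rV[R]_n].
Proof.
apply/seteqP; split => // x _; exists (Num.trunc (enorm x)).+1 => // i.
rewrite -ltr_norml; apply: le_lt_trans (ler_coord_enorm x i) _.
exact: truncnS_gt.
Qed.

(** Open boxes are stable under intersection, so two measures can be compared on them. *)
Lemma measurable_oboxesE n : (@measurable _ 'rV[R]_n) = <<s @oboxes n>>.
Proof.
apply/seteqP; split => [A mA|]; last first.
  apply: smallest_sub; first exact: sigma_algebra_measurable.
  by move=> _ [al [be ->]]; exact: measurable_obox.
move: A mA; apply: smallest_sub; first exact: smallest_sigma_algebra.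
move=> _ [i [j [A [mA ->]]]]; rewrite (ord1 i) {i}.
have sG := @smallest_sigma_algebra _ [set: 'rV[R]_n] (@oboxes n).
have := RGenOpens.measurableE R; rewrite {1}/measurable /= => mE; move: A mA.
move=> A; rewrite -[measurable A]/(<<s @ocitv R>> A) mE; move: A.
pose H : set (set R) := [set A | <<s @oboxes n>> [set M : 'rV[R]_n | A (M ord0 j)]].
apply: (@smallest_sub _ _ _ H).
  split; rewrite /H/=.
  - have [+ _ _] := sG; congr (_ _); apply/seteqP; split => //.
  - by move=> A HA; case: sG => _ sGC _; exact: sGC HA.
  - by move=> F HF; have [_ _ /(_ _ HF)] := sG.
move=> _ [x [y ->]]; rewrite /H /=.
rewrite (_ : mkset _ = \bigcup_k obox (fun i => if i == j then x else - k%:R)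
    (fun i => if i == j then y else k%:R)).
  have [_ _] := sG; apply => k; apply: sub_sigma_algebra.
  by eexists; eexists.
apply/seteqP; split => [M /=|M [k _ /(_ j)]]; last by rewrite eqxx /= in_itv.
rewrite in_itv/= => Mxy.
have : [set: 'rV[R]_n] M by []. rewrite -bigcup_obox_nat => -[k _ kM].
by exists k => // i; case: eqP => [->//|_]; exact: kM.
Qed.

(** The finite measures with densities the positive and negative parts of [g] agree on boxes, hence
    on every Borel set; on the set where g > 0 the second one vanishes, so this set is null, and
    likewise for g < 0. *)
Lemma integrable_zero_on_oboxes n (g : 'rV[R]_n -> R) :
  (leb n).-integrable setT (EFin \o g) ->
  (forall al be, \int[leb n]_(x in obox al be) (g x)%:E = 0)%E ->
  exists2 N, measurable N /\ leb n N = 0%E & forall x, ~ N x -> g x = 0.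
Proof.
move=> gi g0.
have mg : measurable_fun setT g by move/measurable_int : gi => /measurable_EFinP.
have mp : measurable_fun setT (g^\+%R) by exact: measurable_funrpos.
have mn : measurable_fun setT (g^\-%R) by exact: measurable_funrneg.
pose gp : {mfun 'rV[R]_n >-> R} := HB.pack (g^\+%R) (isMeasurableFun.Build _ _ _ _ _ mp).
pose gn : {mfun 'rV[R]_n >-> R} := HB.pack (g^\-%R) (isMeasurableFun.Build _ _ _ _ _ mn).
have p0 x : 0 <= gp x by exact: funrpos_ge0.
have n0 x : 0 <= gn x by exact: funrneg_ge0.
have fin A : measurable A -> (\int[leb n]_(x in A) (gp x)%:E < +oo)%E /\
   (\int[leb n]_(x in A) (gn x)%:E < +oo)%E.
  move=> mA; have giA : (leb n).-integrable A (EFin \o g) by exact: integrableS gi.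
  split.
    have := integrable_pos_fin_num mA giA; rewrite fin_numElt => /andP[_].
    by rewrite funerpos.
  have := integrable_neg_fin_num mA giA; rewrite fin_numElt => /andP[_].
  by rewrite funerneg.
have E A : measurable A -> (\int[leb n]_(x in A) (gp x)%:E = \int[leb n]_(x in A) (gn x)%:E)%E.
  move=> mA.
  have := (@measure_unique _ R 'rV[R]_n (@oboxes n) (fun k => obox (fun=> - k%:R) (fun=> k%:R))
    (@measurable_oboxesE n) (@oboxesI n) _ (@bigcup_obox_nat n)
    (density_measure (leb n) p0) (density_measure (leb n) n0)); apply => //.
  - by move=> k; eexists; eexists.
  - move=> _ [al [be ->]]; have mO := measurable_obox al be.
    have [f1 f2] := fin _ mO; have := g0 al be.
    rewrite -[fun x => (g x)%:E]/(EFin \o g) integralE funerpos funerneg => /eqP.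
    rewrite sube_eq ?add0e; first by move/eqP.
      by rewrite ge0_fin_numE// integral_ge0// => x _; rewrite lee_fin funrpos_ge0.
    by rewrite fin_num_adde_defr.
  - by move=> k; exact: (fin _ (measurable_obox _ _)).1.
have mA B : measurable B -> measurable (g @^-1` B) by move=> mB; rewrite -[_ @^-1` _]setTI; exact: mg.
have Z (f f' : {mfun 'rV[R]_n >-> R}) (A : set 'rV[R]_n) : measurable A ->
    (\int[leb n]_(x in A) (f x)%:E = \int[leb n]_(x in A) (f' x)%:E)%E ->
    (forall x, A x -> 0 < f x) -> (forall x, A x -> f' x = 0) -> leb n A = 0%E.
  move=> mD ff' f0 f'0; apply/eqP; rewrite eq_le measure_ge0 andbT leNgt; apply/negP => D0.
  have := integral_gt0 mD (measurable_funTS (measurable_funPT f)) D0 f0.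
  by rewrite ff' integral0_eq ?ltxx// => x /f'0 ->.
exists (g @^-1` `]0, +oo[ `|` g @^-1` `]-oo, 0[).
  split; first by apply: measurableU; exact: mA.
  apply: null_set_setU; [exact: mA|exact: mA|..].
    apply: (Z gp gn); [exact: mA|exact: E (mA _ _)|..] => x; rewrite /= in_itv/= andbT => x0.
      by rewrite /funrpos lt_max x0.
    by rewrite /funrneg; apply/max_idPr; rewrite oppr_le0 ltW.
  apply: (Z gn gp); [exact: mA|by apply/esym/E; exact: mA|..] => x; rewrite /= in_itv/= => x0.
    by rewrite /funrneg lt_max oppr_gt0 x0.
  by rewrite /funrpos; apply/max_idPr; rewrite ltW.
move=> x /not_orP[]; rewrite /= !in_itv/= andbT => /negP; rewrite -leNgt => h1 /negP.
by rewrite -leNgt => h2; apply/eqP; rewrite eq_le h1.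
Qed.

(** Test functions converging to the indicator of a box make the integral of [g] on that box vanish;
    countably many rational boxes cover [U]. *)
Lemma zero_of_test_functions n (U : set 'rV[R]_n) (g : 'rV[R]_n -> R) :
  locally_integrable_rV U g ->
  (forall phi, test_function U phi -> \int[leb n]_(x in U) (g x * phi x)%:E = 0)%E ->
  exists2 N, measurable N /\ leb n N = 0%E & forall x, U x -> ~ N x -> g x = 0.
Proof.
move=> [mg oU gK] g0; have mU := open_measurable_rV oU.
have inQ al be : cbox al be `<=` U -> (leb n).-integrable (cbox al be) (EFin \o g).
  move=> QU; apply/integrableP; split; last exact: gK QU (@cbox_compact _ _ _).
  by apply/measurable_EFinP; exact: measurable_funS mg.
have mc al be : measurable (cbox al be : set 'rV[R]_n).
  rewrite (_ : cbox _ _ = \bigcap_(i in [set: 'I_n])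
     [set x | `[al i, be i]%classic (x ord0 i)]).
    apply: fin_bigcap_measurable => // i _.
    have := @measurable_coord _ R 1 n ord0 i measurableT
      `[al i, be i]%classic (measurable_itv _).
    by rewrite setTI.
  by apply/seteqP; split => [x qx i _|x qx i]; have := qx i; rewrite /= in_itv //=; exact.
have O0 al be : cbox al be `<=` U -> (\int[leb n]_(x in obox al be) (g x)%:E = 0)%E.
  move=> QU; have [phi Hphi] := obox_test_functions QU.
  have mphi m : measurable_fun setT (phi m).
    by have [/bump_alg_continuous/continuous_measurable_rV] := Hphi m.
  have := @cvg_integral_cutoff _ _ _ (leb n) (cbox al be) (obox al be) g phi
    (mc _ _) (measurable_obox _ _) (@obox_cbox _ _ _ _) (inQ _ _ QU)
    (fun m => measurable_funTS (mphi m)).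
  have -> : (fun m => \int[leb n]_(x in cbox al be) (g x * phi m x)%:E)%E = fun=> 0%E.
    apply/funext => m; have [_ tm _ m0 _] := Hphi m; rewrite -(g0 _ tm).
    rewrite [LHS]integral_mkcond [RHS]integral_mkcond; apply: eq_integral => x _.
    rewrite !patchE; case: ifPn => xQ; first by rewrite ifT// inE; apply: QU; rewrite inE in xQ.
    by case: ifPn => // _; rewrite m0 ?mulr0//; rewrite notin_setE in xQ.
  move=> /(_ (fun m x => let: And5 _ _ h _ _ := Hphi m in h x)).
  move=> /(_ (fun x => let: And5 _ _ _ _ h := Hphi 0%N in h x)) c0.
  by move/(cvg_unique _ (cvg_cst 0%E)) : c0 => /(_ _) <-.
pose B (q : {ffun 'I_n -> rat * rat}) : set 'rV[R]_n := obox (rat_lower q) (rat_upper q).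
have Hq q : exists N, (measurable N /\ leb n N = 0%E) /\
    (cbox (rat_lower q) (rat_upper q) `<=` U -> forall x, B q x -> ~ N x -> g x = 0).
  have [QU|] := pselect (cbox (rat_lower q) (rat_upper q) `<=` U); last first.
    by move=> QU; exists set0; split => //; split => //; exact: measure0.
  have gB : (leb n).-integrable (B q) (EFin \o g).
    by apply: integrableS (inQ _ _ QU) => //; [exact: measurable_obox|exact: obox_cbox].
  have [||N [mN N0] HN] := @integrable_zero_on_oboxes n (g \_ (B q)).
  - rewrite -restrict_EFin; apply/(integrable_restrict _ _ _ _).1 => //; last by rewrite setTI.
    exact: measurable_obox.
  - move=> al be.
    transitivity (\int[leb n]_(x in obox al be `&` B q) (g x)%:E)%E.
      rewrite setIC [RHS]integral_mkcondl; apply: eq_integral => x _.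
      by rewrite !patchE; case: ifPn.
    rewrite /B oboxI; apply: O0; apply: subset_trans QU => x H i; have := H i.
    by rewrite ge_max le_min => /andP[/andP[_ ->] /andP[_ ->]].
  exists N; split => // _ x Bx Nx; have := HN x Nx; by rewrite patchE mem_set.
have [N HN] := choice Hq.
exists (\bigcup_q N q); first by apply: null_set_bigcup => q; have [] := HN q.
move=> x Ux Nx; have [q qx qU] := open_rat_box oU Ux.
have [_ H] := HN q; apply: H qU _ qx _ => Nq; apply: Nx; by exists q.
Qed.

End rV_zero.

(** * Weak derivatives on the line *)

Section cumul.
Context {R : realType}.
Local Notation mu := (@lebesgue_measure R).

Lemma measurable_integrable (D : set R) (f : R -> R) :
  mu.-integrable D (EFin \o f) -> measurable_fun D f.
Proof. by move/measurable_int => /measurable_EFinP. Qed.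

Definition cumul (f : R -> R) (x : R) : R := \int[mu]_(r in `]-oo, x]) f r.

Lemma primitive_cumul f : mu.-integrable setT (EFin \o f) ->
  primitive_on setT (cumul f) f.
Proof.
move=> fi x y xy _; split; first exact: integrableS fi.
have fy : mu.-integrable `]-oo, y] (EFin \o f) by exact: integrableS fi.
have := @Rintegral_itvB _ f -oo%O (BRight y) x fy.
rewrite !bnd_simp /= => /(_ isT xy) e.
rewrite /cumul -[LHS]opprB -Rintegral_itv_obnd_cbnd; last exact: integrableS fi.
by rewrite -e; ring.
Qed.

Lemma continuous_cumul f : mu.-integrable setT (EFin \o f) -> continuous (cumul f).
Proof.
move=> /primitive_cumul pf x; apply: (@primitive_continuous _ _ f (x - 1) (x + 1)).
- exact: primitive_onS pf.
- by rewrite ltrBlDr ltrDl.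
- by rewrite ltrDl.
Qed.

Lemma measurable_cumul f : mu.-integrable setT (EFin \o f) -> measurable_fun setT (cumul f).
Proof. by move=> /continuous_cumul; exact: continuous_measurable_fun. Qed.

Lemma integrable_patch (f : R -> R) (A : set R) : measurable A ->
  mu.-integrable A (EFin \o f) -> mu.-integrable setT (EFin \o (f \_ A)).
Proof.
move=> mA fi; rewrite -restrict_EFin.
by have [+ _] := @integrable_mkcond _ (measurableTypeR R) R mu A (EFin \o f) mA; apply.
Qed.

(** Replaces a primitive known on a segment by one defined on the whole line, for which continuity
    and measurability come for free. *)
Lemma primitive_cumul_patch f v (al be : R) : primitive_on `[al, be] v f ->
  forall x, al <= x <= be -> v x = v al + cumul (f \_ `[al, be]) x.
Proof.
move=> pf x /andP[ax xb].
have ab := le_trans ax xb.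
have [fi _] := pf al be ab (fun _ => id).
have axs : `[al, x] `<=` `[al, be] by apply: subset_itvl; rewrite bnd_simp.
have [_ e] := pf al x ax axs.
rewrite /cumul -(subrK (v al) (v x)) addrC e; congr (_ + _).
rewrite /Rintegral; congr fine; rewrite [LHS]integral_mkcond [RHS]integral_mkcond.
apply: eq_integral => r _; rewrite !patchE !mem_setE !in_itv/=.
case: (leP r x) => rx; last by rewrite andbF.
by rewrite (le_trans rx xb) !andbT; case: ifP => // ->.
Qed.

Lemma primitive_acc v f (x y : R) : x < y -> primitive_on `[x, y] v f -> acc x y v.
Proof.
move=> xy pf; have [fi _] := pf x y (ltW xy) (fun _ => id).
have gi := integrable_patch (measurable_itv _) fi.
have H : acc x y (cumul (f \_ `[x, y])).
  apply: (@abs_continuous_acc _ (x - 1) (y + 1)).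
  - exact: integral_abs_continuous gi (primitive_onS (subsetT _) (primitive_cumul gi)).
  - by rewrite ltrBlDr ltrDl.
  - by rewrite ltrDl.
move=> e /H[d d0 Hd]; exists d => // n s t st tst std.
apply: le_lt_trans (Hd n s t st tst std); apply: ler_sum => i _.
have [xs [sti ty]] := st i.
rewrite (primitive_cumul_patch pf (x := t i)) ?ty ?(le_trans xs)//.
rewrite (primitive_cumul_patch pf (x := s i)) ?xs ?(le_trans sti)//.
by rewrite [X in `|X|](_ : _ = cumul (f \_ `[x, y]) (t i) - cumul (f \_ `[x, y]) (s i))//; ring.
Qed.

Lemma acc_bounded (x y : R) v f : primitive_on `[x, y] v f ->
  exists2 B, 0 <= B & forall r, x <= r <= y -> `|v r| <= B.
Proof.
move=> pf; have [xy|yx] := leP x y; last first.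
  by exists 0 => // r /andP[xr ry]; exfalso; lra.
have [fi _] := pf x y xy (fun _ => id).
exists (`|v x| + \int[mu]_(r in `[x, y]) `|f r|).
  by apply: addr_ge0 => //; apply: Rintegral_ge0.
move=> r /andP[xr ry].
have xrs : `[x, r] `<=` `[x, y] by apply: subset_itvl; rewrite bnd_simp.
have [fir e] := pf x r xr xrs.
rewrite -(subrK (v x) (v r)) addrC (le_trans (ler_normD _ _))// lerD// e.
apply: (le_trans (le_normr_Rintegral _ fir)) => //.
rewrite /Rintegral fine_le//.
- by apply: integrable_fin_num => //; exact: integrable_norm.
- by apply: integrable_fin_num => //; exact: integrable_norm.
apply: ge0_subset_integral => //; apply/measurable_EFinP.
by apply: measurableT_comp => //; exact: measurable_integrable.
Qed.

Lemma acc_mul (x y : R) u v f g : x < y -> primitive_on `[x, y] u f ->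
  primitive_on `[x, y] v g -> acc x y (u * v).
Proof.
move=> xy pu pv.
have [B B0 HB] := acc_bounded pu; have [C C0 HC] := acc_bounded pv.
have Au := primitive_acc xy pu; have Av := primitive_acc xy pv.
move=> e e0; pose e' := e / 2 / (B + C + 1).
have D0 : 0 < B + C + 1 by rewrite ltr_wpDl// addr_ge0.
have e'0 : 0 < e' by rewrite !divr_gt0.
have [d d0 Hd] := Au _ e'0; have [d' d'0 Hd'] := Av _ e'0.
exists (Num.min d d'); first by rewrite lt_min d0.
move=> n s t st tst; rewrite lt_min => /andP[std std'].
have h1 := Hd n s t st tst std; have h2 := Hd' n s t st tst std'.
apply: (@le_lt_trans _ _ (C * \sum_(i < n) `|u (t i) - u (s i)| +
    B * \sum_(i < n) `|v (t i) - v (s i)|)).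
  rewrite !mulr_sumr -big_split/=; apply: ler_sum => i _.
  have [xs [sti ty]] := st i.
  rewrite [X in `|X|](_ : _ = v (t i) * (u (t i) - u (s i)) + u (s i) * (v (t i) - v (s i))).
    rewrite (le_trans (ler_normD _ _))// !normrM lerD// ler_wpM2r//.
      by apply: HC; rewrite ty (le_trans xs).
    by apply: HB; rewrite xs (le_trans sti).
  by rewrite mulrfctE; ring.
apply: (@le_lt_trans _ _ (C * e' + B * e')).
  by rewrite lerD// ler_wpM2l// ltW.
have -> : C * e' + B * e' = (B + C) * e' by ring.
rewrite /e' mulrA ltr_pdivrMr//.
have : (B + C) * (e / 2) <= (B + C) * e.
  by rewrite ler_wpM2l ?addr_ge0// ler_pdivrMr// ler_peMr// ?ltW// ltr1n.
nra.
Qed.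

(** The product is absolutely continuous, hence a primitive of its own derivative, which the product
    rule computes off a null set. *)
Lemma primitive_onM J (u v f g : R -> R) : measurable_fun setT u -> measurable_fun setT v ->
  primitive_on J u f -> primitive_on J v g ->
  primitive_on J (u * v) (fun r => f r * v r + u r * g r).
Proof.
move=> mfu mfv pu pv x y xy xyJ.
have pa : primitive_on `[x, y] (u * v) (rderiv (u * v)).
  apply: acc_primitive; first exact: measurable_funM.
  move=> s t st stJ; apply: (acc_mul st).
    by apply: primitive_onS pu; exact: subset_trans stJ xyJ.
  by apply: primitive_onS pv; exact: subset_trans stJ xyJ.
have [ri ->] := pa x y xy (fun _ => id).
have [N [mN N0] HN] := ae_is_derive_primitive (primitive_onS xyJ pu).
have [M [mM M0] HM] := ae_is_derive_primitive (primitive_onS xyJ pv).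
(* The derivatives of [u] and [v] are only known inside the segment, hence the two ends. *)
pose Z : set R := N `|` M `|` [set x; y].
have mZ : measurable Z.
  by apply: measurableU; [exact: measurableU|exact: measurableU].
have Z0 : mu Z = 0%E.
  apply: null_set_setU; [exact: measurableU|exact: measurableU|exact: null_set_setU|].
  by apply: null_set_setU => //; exact: lebesgue_measure_set1.
have E r : `[x, y]%classic r -> ~ Z r -> rderiv (u * v) r = f r * v r + u r * g r.
  rewrite /= in_itv/= => /andP[xr ry] /not_orP[/not_orP[Nr Mr] /not_orP[/= rx ry']].
  have rxy : x < r < y.
    by rewrite !lt_neqAle xr ry !andbT eq_sym; apply/andP; split; exact/eqP.
  apply: rderivE; have := is_deriveM (HN _ rxy Nr) (HM _ rxy Mr).
  by move=> /is_derive_eq; apply; rewrite /GRing.scale/=; ring.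
have mfg : measurable_fun `[x, y] (fun r => f r * v r + u r * g r).
  have [fi _] := pu x y xy xyJ; have [gi _] := pv x y xy xyJ.
  apply: measurable_funD; apply: measurable_funM => //.
  - exact: measurable_integrable.
  - exact: measurable_funTS.
  - exact: measurable_funTS.
  - exact: measurable_integrable.
split.
  apply/integrableP; split; first exact/measurable_EFinP.
  have /integrableP[_] := ri; congr (_ < _)%E.
  by apply: (@eq_integral_off_null _ (measurableTypeR R) R mu _ Z _ _ mZ Z0) => r xr Zr /=; rewrite E.
rewrite /Rintegral; congr fine.
by apply: (@eq_integral_off_null _ (measurableTypeR R) R mu _ Z _ _ mZ Z0) => r xr Zr /=; rewrite E.
Qed.

Lemma primitive_C1 (phi phi' : R -> R) : (forall x : R, is_derive x 1 phi (phi' x)) ->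
  continuous phi' -> primitive_on setT phi phi'.
Proof.
move=> dphi cphi' x y; rewrite le_eqVlt => /predU1P[<- _|xy _].
  split; last by rewrite subrr set_itv1 Rintegral_set1.
  rewrite set_itv1; apply/integrableP; split; first exact: measurable_fun_set1.
  by rewrite integral_set1.
have cw : {within `[x, y], continuous phi'} by apply: continuous_subspaceT.
split; first by apply: continuous_compact_integrable => //; exact: segment_compact.
rewrite /Rintegral (continuous_FTC2 xy cw (F := phi))//.
  have cphi : continuous phi by move=> r; exact: is_derive1_continuous (dphi r).
  split; first by move=> r _; have [] := dphi r.
  - by apply: cvg_at_right_filter; exact: cphi.
  - by apply: cvg_at_left_filter; exact: cphi.
by move=> r _; rewrite derive1E; have [_ ->] := dphi r.
Qed.

End cumul.

Lemma eq_integral_support d (T : measurableType d) (R : realType)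
    (mu : {measure set T -> \bar R}) (K D D' : set T) (g : T -> \bar R) :
  K `<=` D -> K `<=` D' -> (forall x, ~ K x -> g x = 0%E) ->
  (\int[mu]_(x in D) g x = \int[mu]_(x in D') g x)%E.
Proof.
move=> KD KD' g0; rewrite [LHS]integral_mkcond [RHS]integral_mkcond.
apply: eq_integral => x _; rewrite !patchE.
have [Kx|Kx] := pselect (K x); first by rewrite !mem_set//; [exact: KD'|exact: KD].
by rewrite g0//; case: ifP; case: ifP.
Qed.

Lemma derive_support {R : realType} {V : normedModType R} (K : set V) (phi : V -> R) (v x : V) :
  closed K -> (forall x, ~ K x -> phi x = 0) -> ~ K x -> 'D_v phi x = 0.
Proof.
move=> cK phi0 Kx; suff [_ ->] : is_derive x v phi 0 by [].
apply: (@near_eq_is_derive _ _ _ (cst 0)).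
have : nbhs x (~` K) by apply: open_nbhs_nbhs; split => //; exact: closed_openC.
by apply: filterS => y /phi0 ->.
Qed.

Section one_dimension.
Context {R : realType}.
Local Notation mu := (@lebesgue_measure R).

Lemma smooth_C1 (phi : R -> R) : smooth phi ->
  (forall x : R, is_derive x 1 phi (derive1 phi x)) /\ continuous (derive1 phi).
Proof.
move=> sphi; split=> [x|].
  by split; [have [_] := sphi [::]; apply|rewrite derive1E].
have [/= cD _] := sphi [:: 1]; rewrite (_ : derive1 phi = 'D_1 phi)//.
by apply/funext => x; rewrite derive1E.
Qed.

Lemma compact_segment (K : set R) : compact K -> exists2 M, 0 < M & K `<=` `[- M, M].
Proof.
move=> /compact_bounded[M [_ HM]]; exists (`|M| + 1); first by rewrite ltr_wpDl.
move=> x Kx; rewrite /= in_itv/= -ler_norml; apply: HM Kx.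
by rewrite (le_lt_trans (ler_norm _))// ltrDl.
Qed.

Lemma ibp_test_function (V f phi : R -> R) (K D : set R) : measurable_fun setT V ->
  primitive_on setT V f -> smooth phi ->
  compact K -> K `<=` D -> (forall x, ~ K x -> phi x = 0) ->
  (\int[mu]_(r in D) (V r * derive1 phi r)%:E = - \int[mu]_(r in D) (f r * phi r)%:E)%E.
Proof.
move=> mV pV sphi cK KD phi0.
have [dphi cphi'] := smooth_C1 sphi.
have cphi : continuous phi by move=> x; exact: is_derive1_continuous (dphi x).
have [M M0 KM] := compact_segment cK.
have clK : closed K := compact_closed (@Rhausdorff R) cK.
have phi'0 x : ~ K x -> derive1 phi x = 0.
  by move=> Kx; rewrite derive1E (derive_support _ clK).
have mphi : measurable_fun setT phi by exact: continuous_measurable_fun.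
have pM := primitive_onM mV mphi pV (primitive_C1 dphi cphi').
(* One unit beyond the segment that contains the support, so that [phi] vanishes at both ends. *)
have MM : - (M + 1) <= M + 1 by lra.
have [i1 e1] := pM _ _ MM (@subsetT _ _).
have KM1 : K `<=` `[- (M + 1), M + 1].
  by apply: subset_trans KM _; apply: subset_itv; rewrite bnd_simp; lra.
have z x : ~ `[- M, M]%classic x -> phi x = 0 by move=> h; apply: phi0 => /KM.
have z1 : phi (M + 1) = 0 by apply: z; rewrite /= in_itv/=; apply/negP; rewrite negb_and -!ltNge; apply/orP; right; lra.
have z2 : phi (- (M + 1)) = 0 by apply: z; rewrite /= in_itv/=; apply/negP; rewrite negb_and -!ltNge; apply/orP; left; lra.
have [fi _] := pV _ _ MM (@subsetT _ _).
have i2 : mu.-integrable `[- (M + 1), M + 1] (EFin \o (fun r => V r * derive1 phi r)).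
  apply: continuous_compact_integrable; first exact: segment_compact.
  apply: continuous_subspaceT => r; apply: (@continuousM _ _ V (derive1 phi)); last exact: cphi'.
  apply: (@primitive_continuous _ _ f (r - 1) (r + 1)); first exact: primitive_onS pV.
    by rewrite ltrBlDr ltrDl.
  by rewrite ltrDl.
have i3 : mu.-integrable `[- (M + 1), M + 1] (EFin \o (fun r => f r * phi r)).
  have mD : measurable (`[- (M + 1), M + 1]%classic : set (measurableTypeR R)) by [].
  have := integrableB mD i1 i2.
  by apply: eq_integrable => // r _ /=; rewrite -EFinB addrK.
have E : \int[mu]_(r in `[- (M + 1), M + 1]) (f r * phi r) +
    \int[mu]_(r in `[- (M + 1), M + 1]) (V r * derive1 phi r) = 0.
  by rewrite -RintegralD// -e1 mulrfctE /= z1 z2 !mulr0 subr0.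
have -> : (\int[mu]_(r in D) (V r * derive1 phi r)%:E =
    \int[mu]_(r in `[(- (M + 1))%R, (M + 1)%R]) (V r * derive1 phi r)%:E)%E.
  apply: (@eq_integral_support _ (measurableTypeR R) R mu K) => // x Kx.
  by rewrite phi'0// mulr0.
have -> : (\int[mu]_(r in D) (f r * phi r)%:E =
    \int[mu]_(r in `[(- (M + 1))%R, (M + 1)%R]) (f r * phi r)%:E)%E.
  apply: (@eq_integral_support _ (measurableTypeR R) R mu K) => // x Kx.
  by rewrite phi0// mulr0.
move: E; rewrite /Rintegral => /eqP; rewrite addr_eq0 => /eqP E.
have F2 : (\int[mu]_(r in `[(- (M + 1))%R, (M + 1)%R]) (V r * derive1 phi r)%:E)%E \is a fin_num.
  exact: integrable_fin_num i2.
have F3 : (\int[mu]_(r in `[(- (M + 1))%R, (M + 1)%R]) (f r * phi r)%:E)%E \is a fin_num.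
  exact: integrable_fin_num i3.
by rewrite -(fineK F2) -(fineK F3) -EFinN E opprK.
Qed.

(** The primitive need not lie in [bump_alg], but its first derivatives do. The fold applies the
    last direction of the list first, hence an induction from the end of the list. *)
Lemma smooth_cumul (chi : R -> R) : bump_alg chi -> mu.-integrable setT (EFin \o chi) ->
  smooth (cumul chi) /\ forall x, derive1 (cumul chi) x = chi x.
Proof.
move=> bchi ichi; have cchi := bump_alg_continuous bchi.
have d1 (x : R) : is_derive x 1 (cumul chi) (chi x).
  have := @continuous_FTC1 R chi -oo%O x (x + 1).
  rewrite ltrDl => /(_ ltr01); case; [exact: integrableS ichi|by rewrite /Order.lt/=|exact: cchi|].
  by move=> d e; split; [exact: d|rewrite -derive1E; exact: e].
have dv (v x : R) : is_derive x v (cumul chi) (v * chi x).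
  apply: is_derive_line.
  have e : is_derive (0 : R) 1 (fun h : R => h *: v + x) v.
    have := is_deriveD (is_deriveM (is_derive_id (0 : R) 1) (is_derive_cst v (0 : R) 1))
      (is_derive_cst x (0 : R) 1).
    by move=> /is_derive_eq; apply; rewrite /GRing.scale/= mul0r mulr1 add0r addr0.
  have := @is_derive1_comp _ (cumul chi) _ _ _ _ (d1 _) e.
  by move=> /is_derive_eq; apply; rewrite scale0r add0r mulrC.
split; last by move=> x; rewrite derive1E; have [_ ->] := d1 x.
move=> s /=; elim/last_ind: s => [|s v _] /=.
  split; first exact: continuous_cumul.
  by move=> x v; have [] := dv v x.
rewrite foldr_rcons (_ : 'D_v (cumul chi) = fun x => v * chi x); last first.
  by apply/funext => x; have [_ ->] := dv v x.
by apply: bump_alg_smooth; apply: bump_alg_mul => //; exact: bump_alg_cst.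
Qed.

Lemma itvoo_test_functions (s t : R) : exists psi : nat -> R -> R,
  forall m, [/\ bump_alg (psi m), (forall x, 0 <= psi m x <= 1),
    (forall x, ~ (s < x < t) -> psi m x = 0) &
    (forall x, psi m x @[m --> \oo] --> (\1_(`]s, t[%classic : set R) x : R))].
Proof.
pose l (i : bool) (x : R) : R := if i then x else - x.
pose t' (i : bool) : R := if i then - s else t.
have e x : (forall i, 0 < l i x + t' i) <-> `]s, t[%classic x.
  rewrite /= in_itv/=; split=> [H|/andP[sx xt] []]; last 2 first.
  - by rewrite /l /t' /= subr_gt0.
  - by rewrite /l /t' /= addrC subr_gt0.
  have := H true; have := H false; rewrite /l /t' /=.
  by rewrite addrC !subr_gt0 => -> ->.
have [||||phi Hphi] := @polyhedron_test_functions R R _ l t' setT `[s, t]%classic _ _ _ (@subsetT _ _) _.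
- move=> [] x; rewrite /l/=; first exact: cvg_id.
  by apply: continuousN; exact: cvg_id.
- by move=> [] h v x; rewrite /l /= /GRing.scale/=; ring.
- exact: segment_compact.
- by move=> x /e; apply: subset_itvW.
exists phi => m; have [h1 h2 h3 h4 h5] := Hphi m; split => // x.
  by move=> Qx; apply: h4 => /e; rewrite /= in_itv.
by rewrite (_ : `]s, t[%classic = [set x | forall i, 0 < l i x + t' i])//; apply/seteqP; split => y /e.
Qed.

Lemma cvg_Rintegral_cutoff (D O : set R) (g : R -> R) (phi : nat -> R -> R) :
  measurable D -> measurable O -> O `<=` D -> mu.-integrable D (EFin \o g) ->
  (forall m, measurable_fun D (phi m)) ->
  (forall m x, (0 <= phi m x <= 1)%R) ->
  (forall x, phi m x @[m --> \oo] --> (\1_O x : R)) ->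
  \int[mu]_(x in D) (g x * phi m x) @[m --> \oo] --> \int[mu]_(x in O) g x.
Proof.
move=> mD mO OD gi mphi phi01 cphi; apply: fine_cvg.
rewrite /Rintegral fineK; last first.
  by apply: (@integrable_fin_num _ (measurableTypeR R)) => //; exact: (@integrableS _ (measurableTypeR R) R mu D O).
exact: (@cvg_integral_cutoff _ (measurableTypeR R) _ mu D O).
Qed.

Lemma fine_lebesgue_itvoo (x y : R) : x < y -> fine (mu `]x, y[) = y - x.
Proof.
move=> xy; have -> : mu `]x, y[ = (y - x)%:E; last by [].
by apply: (etrans (lebesgue_measure_itv `]x, y[)) => /=; rewrite lte_fin xy.
Qed.

Lemma Rintegral_itvcc_itvoo (x y : R) (f : R -> R) : mu.-integrable `[x, y] (EFin \o f) ->
  \int[mu]_(r in `[x, y]) f r = \int[mu]_(r in `]x, y[) f r.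
Proof.
move=> fi; rewrite -Rintegral_itv_bndo_bndc; last first.
  by apply: (@integrableS _ (measurableTypeR R) R mu `[x, y]) => //; apply: subset_itvl; rewrite bnd_simp.
rewrite Rintegral_itv_obnd_cbnd//.
by apply: (@integrableS _ (measurableTypeR R) R mu `[x, y]) => //; exact: subset_itvW.
Qed.

(** Two cutoff functions combined so as to have integral zero form the derivative of an admissible
    test function. As they tend to indicators, the mean of [w] over any []s1, t1[] is found to be
    its mean over []al, be[]. *)
Lemma dubois_reymond (al be : R) (w : R -> R) : al < be ->
  mu.-integrable `[al, be] (EFin \o w) ->
  (forall phi, smooth phi -> (forall x, ~ (al < x < be) -> phi x = 0) ->
     \int[mu]_(r in `[al, be]) (w r * derive1 phi r) = 0) ->
  exists2 c, exists2 N : set R, measurable N /\ mu N = 0%E &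
     forall x, al < x < be -> ~ N x -> w x = c & True.
Proof.
move=> albe wi w0.
have H s1 t1 : al <= s1 -> s1 < t1 -> t1 <= be ->
  (be - al) * \int[mu]_(r in `]s1, t1[) w r = (t1 - s1) * \int[mu]_(r in `]al, be[) w r.
  move=> als1 s1t1 t1be.
  have [p1 H1] := itvoo_test_functions s1 t1.
  have [p2 H2] := itvoo_test_functions al be.
  have sub1 : `[s1, t1] `<=` `[al, be] by apply: subset_itv; rewrite bnd_simp.
  have mp1 m : measurable_fun setT (p1 m).
    by have [/bump_alg_continuous/continuous_measurable_fun] := H1 m.
  have mp2 m : measurable_fun setT (p2 m).
    by have [/bump_alg_continuous/continuous_measurable_fun] := H2 m.
  have ci (f : R -> R) : continuous f -> mu.-integrable `[al, be] (EFin \o f).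
    move=> cf; apply: continuous_compact_integrable; first exact: segment_compact.
    exact: continuous_subspaceT.
  have oneI : mu.-integrable `[al, be] (EFin \o (fun=> 1 : R)).
    by apply: ci => ?; exact: cst_continuous.
  have sub1' : (`]s1, t1[ : set R) `<=` `[al, be].
    by apply: subset_trans sub1; exact: subset_itvW.
  have sub2' : (`]al, be[ : set R) `<=` `[al, be] by exact: subset_itvW.
  have c1 := cvg_Rintegral_cutoff (measurable_itv _) (measurable_itv _) sub1' wi
    (fun m => measurable_funTS (mp1 m)) (fun m x => let: And4 _ h _ _ := H1 m in h x)
    (fun x => let: And4 _ _ _ h := H1 0%N in h x).
  have c2 := cvg_Rintegral_cutoff (measurable_itv _) (measurable_itv _) sub2' wi
    (fun m => measurable_funTS (mp2 m)) (fun m x => let: And4 _ h _ _ := H2 m in h x)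
    (fun x => let: And4 _ _ _ h := H2 0%N in h x).
  have d1 := cvg_Rintegral_cutoff (measurable_itv _) (measurable_itv _) sub1' oneI
    (fun m => measurable_funTS (mp1 m)) (fun m x => let: And4 _ h _ _ := H1 m in h x)
    (fun x => let: And4 _ _ _ h := H1 0%N in h x).
  have d2 := cvg_Rintegral_cutoff (measurable_itv _) (measurable_itv _) sub2' oneI
    (fun m => measurable_funTS (mp2 m)) (fun m x => let: And4 _ h _ _ := H2 m in h x)
    (fun x => let: And4 _ _ _ h := H2 0%N in h x).
  have E m : \int[mu]_(x in `[al, be]) (1 * p2 m x) * \int[mu]_(x in `[al, be]) (w x * p1 m x) =
      \int[mu]_(x in `[al, be]) (1 * p1 m x) * \int[mu]_(x in `[al, be]) (w x * p2 m x).
    set A := \int[mu]_(x in _) (1 * p1 m x); set B := \int[mu]_(x in _) (1 * p2 m x).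
    have [b1 p101 p10 _] := H1 m; have [b2 p201 p20 _] := H2 m.
    (* The coefficients are the integrals of the other cutoff, so [chi] has integral zero and its
       primitive vanishes outside []al, be[]. *)
    pose chi (x : R) : R := B * p1 m x + - A * p2 m x.
    have bchi : bump_alg chi.
      by apply: bump_alg_add; apply: bump_alg_mul => //; exact: bump_alg_cst.
    have chi0 x : ~ (al < x < be) -> chi x = 0.
      move=> xI; rewrite /chi p20// p10 ?mulr0 ?addr0// => /andP[sx xt].
      by apply: xI; rewrite (le_lt_trans als1)// (lt_le_trans xt).
    have chi0' x : ~ (`]al, be[%classic : set R) x -> (chi x)%:E = 0%E.
      by move=> h; rewrite chi0// => xI; apply: h; rewrite /= in_itv.
    have cchi := bump_alg_continuous bchi.
    have ichi : mu.-integrable setT (EFin \o chi).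
      rewrite (_ : chi = chi \_ `[al, be]); first by apply: integrable_patch => //; exact: ci.
      apply/funext => x; rewrite patchE; case: ifPn => //; rewrite notin_setE => xI.
      by apply: chi0 => xI'; apply: xI; rewrite /= in_itv/=; case/andP: xI' => /ltW -> /ltW ->.
    have [sPhi dPhi] := smooth_cumul bchi ichi.
    have i1 : mu.-integrable `[al, be] (EFin \o (fun x => 1 * p1 m x)).
      by apply: ci => x; apply: (@continuousM _ _ (fun=> 1) (p1 m)); [exact: cst_continuous|exact: bump_alg_continuous].
    have i2 : mu.-integrable `[al, be] (EFin \o (fun x => 1 * p2 m x)).
      by apply: ci => x; apply: (@continuousM _ _ (fun=> 1) (p2 m)); [exact: cst_continuous|exact: bump_alg_continuous].
    have lin (u : R -> R) : mu.-integrable `[al, be] (EFin \o (fun x => u x * p1 m x)) ->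
        mu.-integrable `[al, be] (EFin \o (fun x => u x * p2 m x)) ->
        \int[mu]_(x in `[al, be]) (u x * chi x) =
        B * \int[mu]_(x in `[al, be]) (u x * p1 m x) - A * \int[mu]_(x in `[al, be]) (u x * p2 m x).
      move=> j1 j2; rewrite -RintegralZl// -RintegralZl// -RintegralB//.
      - by apply: eq_Rintegral => x _; rewrite /chi; ring.
      - have mD : measurable (`[al, be]%classic : set (measurableTypeR R)) by [].
        exact: (integrableZl mD B j1).
      - have mD : measurable (`[al, be]%classic : set (measurableTypeR R)) by [].
        exact: (integrableZl mD A j2).
    have Phi0 x : ~ (al < x < be) -> cumul chi x = 0.
      move=> xI; have [xal|alx] := leP x al.
        rewrite /cumul /Rintegral integral0_eq// => r; rewrite /= in_itv/= => rx.
        by rewrite chi0//; apply/negP; rewrite negb_and -leNgt (le_trans rx xal).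
      have bex : be <= x by move: xI => /negP; rewrite alx /= -leNgt.
      rewrite /cumul /Rintegral (@eq_integral_support _ (measurableTypeR R) R mu `]al, be[ _ `[al, be])//; last first.
        by apply: subset_itv; rewrite bnd_simp// ltW.
      have := lin (fun=> 1) i1 i2; rewrite -/A -/B [B * A]mulrC subrr /Rintegral => <-.
      by congr fine; apply: eq_integral => r _; rewrite mul1r.
    have wp (q : R -> R) : measurable_fun setT q -> (forall x, 0 <= q x <= 1) ->
        mu.-integrable `[al, be] (EFin \o (fun x => w x * q x)).
      move=> mq q01; have mw := measurable_integrable wi.
      apply: (@le_integrable _ (measurableTypeR R) R mu _ _ _ (EFin \o w)) => //.
        by apply/measurable_EFinP; apply: measurable_funM => //; exact: measurable_funTS.
      move=> x _ /=; rewrite lee_fin normrM; have /andP[q0 q1] := q01 x.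
      by rewrite ler_piMr// ger0_norm.
    have := lin w (wp _ (mp1 m) p101) (wp _ (mp2 m) p201).
    have -> : \int[mu]_(x in `[al, be]) (w x * chi x) =
        \int[mu]_(x in `[al, be]) (w x * derive1 (cumul chi) x).
      by apply: eq_Rintegral => x _; rewrite dPhi.
    by rewrite (w0 _ sPhi Phi0) => /esym/eqP; rewrite subr_eq0 => /eqP.
  have h1 := cvgM d2 c1; have h2 := cvgM d1 c2.
  have e : (fun m => \int[mu]_(x in `[al, be]) (1 * p2 m x)) \*
      (fun m => \int[mu]_(x in `[al, be]) (w x * p1 m x)) =
    (fun m => \int[mu]_(x in `[al, be]) (1 * p1 m x)) \*
      (fun m => \int[mu]_(x in `[al, be]) (w x * p2 m x)).
    by apply/funext => m; exact: E.
  rewrite e in h1; have := cvg_unique (@Rhausdorff R) (h1 _) (h2 _).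
  by rewrite !Rintegral_cst// !mul1r !fine_lebesgue_itvoo//; apply.
pose c := (\int[mu]_(r in `]al, be[) w r) / (be - al).
exists c => //.
(* All integrals of [w - c] vanish, so 0 is a primitive of it, and its derivative equals [w - c]
   almost everywhere. *)
have pc : primitive_on `[al, be] (fun=> 0) (fun r => w r - c).
  move=> x y; rewrite le_eqVlt => /predU1P[<- _|xy xyI].
    split; last by rewrite subrr set_itv1 Rintegral_set1.
    rewrite set_itv1; apply/integrableP; split; first exact: measurable_fun_set1.
    by rewrite integral_set1.
  have wi' : mu.-integrable `[x, y] (EFin \o w) by exact: integrableS wi.
  have ci : mu.-integrable `[x, y] (EFin \o (fun=> c)).
    apply: continuous_compact_integrable; first exact: segment_compact.
    by apply: continuous_subspaceT => ?; exact: cst_continuous.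
  have mD : measurable (`[x, y]%classic : set (measurableTypeR R)) by [].
  split; first exact: (integrableB mD wi' ci).
  rewrite RintegralB// (Rintegral_itvcc_itvoo wi') (Rintegral_itvcc_itvoo ci).
  rewrite Rintegral_cst// fine_lebesgue_itvoo// subrr.
  have alx : al <= x by have := xyI x; rewrite /= !in_itv/= lexx (ltW xy) => /(_ isT)/andP[].
  have ybe : y <= be by have := xyI y; rewrite /= !in_itv/= lexx (ltW xy) => /(_ isT)/andP[].
  have := H x y alx xy ybe; rewrite /c => h.
  have ba0 : be - al != 0 by rewrite subr_eq0 gt_eqF.
  apply: (mulfI ba0); rewrite mulr0 mulrBr h.
  by field.
have [N N0 HN] := ae_is_derive_primitive pc.
exists N => // x xI Nx; have [_ e0] := is_derive_cst (0 : R) x 1.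
by have [_ e] := HN x xI Nx; apply/eqP; rewrite -subr_eq0 -e -[X in _ == X]e0.
Qed.

End one_dimension.

Section weak_derivative.
Context {R : realType}.
Local Notation mu := (@lebesgue_measure R).

Lemma exists_off_null (a b : R) (N : set R) : a < b -> measurable N -> mu N = 0%E ->
  exists2 x, a < x < b & ~ N x.
Proof.
move=> ab mN N0; apply: contrapT => H.
have sub : `]a, b[ `<=` N.
  by move=> x; rewrite /= in_itv/= => xab; apply: contrapT => Nx; apply: H; exists x.
have : (mu `]a, b[ <= mu N)%E by apply: le_measure; rewrite ?inE.
rewrite N0 leNgt => /negP; apply.
apply: (@lt_le_trans _ _ (b - a)%:E); first by rewrite lte_fin subr_gt0.
rewrite le_eqVlt; apply/orP; left; apply/eqP/esym.
by apply: (etrans (lebesgue_measure_itv `]a, b[)) => /=; rewrite lte_fin ab.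
Qed.

Lemma locally_integrable_segment (J : set R) (f : R -> R) (al be : R) :
  locally_integrable J f -> `[al, be] `<=` J -> mu.-integrable `[al, be] (EFin \o f).
Proof.
move=> [mf oJ iK] sub; apply/integrableP; split.
  by apply/measurable_EFinP; apply: measurable_funS mf => //; exact: open_measurable.
exact: iK sub (@segment_compact _ _ _).
Qed.

Lemma open_segment_enlarge (J : set R) (x y : R) : open J -> x <= y -> `[x, y] `<=` J ->
  exists al be, [/\ al < x, y < be & `[al, be] `<=` J].
Proof.
move=> oJ xy xyJ.
have Jx : J x by apply: xyJ; rewrite /= in_itv/= lexx.
have Jy : J y by apply: xyJ; rewrite /= in_itv/= lexx xy.
have /nbhs_ballP[d /= d0 Hd] := open_nbhs_nbhs (conj oJ Jx).
have /nbhs_ballP[e /= e0 He] := open_nbhs_nbhs (conj oJ Jy).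
exists (x - d / 2), (y + e / 2); split; [by lra|by lra|].
move=> r; rewrite /= in_itv/= => /andP[h1 h2].
have [rx|xr] := ltP r x.
  by apply: Hd; rewrite /ball/= ltr_norml; apply/andP; split; lra.
have [ry|yr] := ltP y r; last by apply: xyJ; rewrite /= in_itv/= xr.
by apply: He; rewrite /ball/= ltr_norml; apply/andP; split; lra.
Qed.

(** The difference of [v] and a primitive of [v'] is orthogonal to the derivatives of test
    functions, hence constant almost everywhere. *)
Lemma weak_derivative_local (J : set R) (v v' : R -> R) (al be : R) :
  weak_derivative J v v' -> al < be -> `[al, be] `<=` J ->
  exists g, primitive_on `[al, be] g v' /\
    exists2 N : set R, measurable N /\ mu N = 0%E &
      forall x, al < x < be -> ~ N x -> v x = g x.
Proof.
move=> [lv lv' H] albe sub.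
have iv := locally_integrable_segment lv sub; have iv' := locally_integrable_segment lv' sub.
pose f := v' \_ `[al, be]; have fi : mu.-integrable setT (EFin \o f) by exact: integrable_patch.
have pf := primitive_cumul fi; have mc := measurable_cumul fi; have cc := continuous_cumul fi.
have mD : measurable (`[al, be]%classic : set (measurableTypeR R)) by [].
have ci (h : R -> R) : continuous h -> mu.-integrable `[al, be] (EFin \o h).
  move=> ch; apply: continuous_compact_integrable; first exact: segment_compact.
  exact: continuous_subspaceT.
have wi : mu.-integrable `[al, be] (EFin \o (fun x => v x - cumul f x)).
  exact: (integrableB mD iv (ci _ cc)).
have [phi sphi phi0|c [N N0 HN] _] := dubois_reymond albe wi.
  have [dphi cphi'] := smooth_C1 sphi.
  have phi0' x : ~ `[al, be]%classic x -> phi x = 0.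
    by move=> xI; apply: phi0 => xI'; apply: xI; rewrite /= in_itv/=; case/andP : xI' => /ltW -> /ltW ->.
  have tphi : test_function J phi.
    by split => //; exists `[al, be]%classic => //; split => //; exact: segment_compact.
  have phi'0 x : ~ `[al, be]%classic x -> derive1 phi x = 0.
    move=> xI; rewrite derive1E (derive_support _ _ phi0')//.
    exact: compact_closed (@segment_compact _ _ _).
  have E1 : (\int[mu]_(r in `[al, be]) (v r * derive1 phi r)%:E =
       - \int[mu]_(r in `[al, be]) (v' r * phi r)%:E)%E.
    have := H phi tphi.
    rewrite (@eq_integral_support _ (measurableTypeR R) R mu `[al, be] J `[al, be])//; last first.
      by move=> x xI; rewrite phi'0// mulr0.
    rewrite [X in (- X)%E](@eq_integral_support _ (measurableTypeR R) R mu `[al, be] J `[al, be])//.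
    by move=> x xI; rewrite phi0'// mulr0.
  have E2 := ibp_test_function mc pf sphi (@segment_compact _ al be) (@subset_refl _ _) phi0'.
  have E3 : (\int[mu]_(r in `[al, be]) (v r * derive1 phi r)%:E =
      \int[mu]_(r in `[al, be]) (cumul f r * derive1 phi r)%:E)%E.
    rewrite E1 E2; congr (- _)%E; apply: eq_integral => r rI.
    by rewrite /f patchE rI.
  have i1 : mu.-integrable `[al, be] (EFin \o (fun r => v r * derive1 phi r)).
    have [B [_ HB]] := compact_bounded (continuous_compact (continuous_subspaceT cphi') (@segment_compact _ al be)).
    have HB' r : `[al, be]%classic r -> `|derive1 phi r| <= B + 1.
      by move=> rI; apply: (HB (B + 1)); [rewrite ltrDl|exists r].
    have mv := measurable_integrable iv.
    have iB := integrableZl mD (B + 1) (integrable_norm iv).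
    apply: (le_integrable mD) iB.
      apply/measurable_EFinP; apply: measurable_funM => //.
      by apply: measurable_funTS; exact: continuous_measurable_fun.
    move=> r rI; rewrite /= lee_fin !normrM normr_id mulrC ler_wpM2r//.
    by apply: le_trans (HB' _ rI) _; exact: ler_norm.
  have i2 : mu.-integrable `[al, be] (EFin \o (fun r => cumul f r * derive1 phi r)).
    by apply: ci => r; apply: (@continuousM _ _ (cumul f) (derive1 phi)); [exact: cc|exact: cphi'].
  have -> : \int[mu]_(r in `[al, be]) ((v r - cumul f r) * derive1 phi r) =
      \int[mu]_(r in `[al, be]) (v r * derive1 phi r - cumul f r * derive1 phi r).
    by apply: eq_Rintegral => r _; rewrite mulrBl.
  by rewrite RintegralB// /Rintegral E3 subrr.
exists (fun x => cumul f x + c); split.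
  move=> x y xy xyI; have iI : mu.-integrable `[x, y] (EFin \o v') by exact: integrableS iv'.
  split => //.
  have [_ e] := pf x y xy (@subsetT _ _).
  rewrite opprD addrACA subrr addr0 e; apply: eq_Rintegral => r /set_mem/xyI rI.
  by rewrite /f patchE mem_set.
by exists N => // x xI Nx; rewrite -(HN _ xI Nx) addrC subrK.
Qed.

(** Local representatives are glued: on a common interval two of them agree at some point, since
    both equal [v] almost everywhere, and then everywhere, since both have the increments given by
    [v']. *)
Lemma weak_derivative_primitive (J : set R) (v v' : R -> R) : weak_derivative J v v' ->
  exists2 v0, primitive_on J v0 v' &
    exists2 N : set R, measurable N /\ mu N = 0%E &
      forall x, J x -> ~ N x -> v x = v0 x.
Proof.
move=> wd; have [[_ oJ _] _ _] := wd.
pose good al be (g : R -> R) := primitive_on `[al, be] g v' /\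
    exists2 N : set R, measurable N /\ mu N = 0%E &
      forall x, al < x < be -> ~ N x -> v x = g x.
pose P r (l : R) := exists al be g, [/\ al < r < be, good al be g & l = g r].
have uP r l l' : P r l -> P r l' -> l = l'.
  move=> [al [be [g [/andP[alr rbe] [pg [N [mN N0] HN]] ->]]]].
  move=> [al' [be' [g' [/andP[alr' rbe'] [pg' [N' [mN' N'0] HN']] ->]]]].
  have ab : Num.max al al' < Num.min be be'.
    by rewrite lt_min !gt_max (lt_trans alr rbe) (lt_trans alr rbe') (lt_trans alr' rbe) (lt_trans alr' rbe').
  have [|x] := exists_off_null ab (measurableU N N' mN mN'); first exact: null_set_setU.
  rewrite lt_min gt_max => /andP[/andP[alx al'x] /andP[xbe xbe']] /not_orP[Nx N'x].
  have e : g x = g' x by rewrite -HN ?alx// -HN' ?al'x.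
  have [xr|rx] := leP x r.
    have [|_ e1] := pg x r xr; first by apply: subset_itv; rewrite bnd_simp ltW.
    have [|_ e2] := pg' x r xr; first by apply: subset_itv; rewrite bnd_simp ltW.
    by rewrite -(subrK (g x) (g r)) e1 -e2 e subrK.
  have [|_ e1] := pg r x (ltW rx); first by apply: subset_itv; rewrite bnd_simp ltW.
  have [|_ e2] := pg' r x (ltW rx); first by apply: subset_itv; rewrite bnd_simp ltW.
  by rewrite -[g r]opprK -[g' r]opprK -(addrK (g x) (- g r)) [- g r + _]addrC e1 -e2 e; ring.
pose v0 r := get (P r).
have v0E al be g : good al be g -> forall r, al < r < be -> v0 r = g r.
  move=> gg r rI; have Pr : P r (g r) by exists al, be, g.
  by apply: (uP r _ _ _ Pr); exact: getI Pr.
exists v0.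
  move=> x y xy xyJ; have [al [be [alx ybe sub]]] := open_segment_enlarge oJ xy xyJ.
  have albe : al < be by rewrite (lt_trans alx)// (le_lt_trans xy).
  have [g gg] := weak_derivative_local wd albe sub.
  have [pg _] := gg.
  rewrite (v0E _ _ _ gg y) ?(lt_le_trans alx xy) ?ybe//.
  rewrite (v0E _ _ _ gg x) ?alx ?(le_lt_trans xy ybe)//.
  by apply: pg => //; apply: subset_itv; rewrite bnd_simp ltW.
have Hq (q : rat * rat) : exists N : set R, (measurable N /\ mu N = 0%E) /\
    ((`[ratr q.1, ratr q.2]%classic : set R) `<=` J -> forall x : R, ratr q.1 < x < ratr q.2 ->
       ~ N x -> v x = v0 x).
  have [sub|] := pselect ((`[ratr q.1, ratr q.2]%classic : set R) `<=` J); last first.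
    by move=> h; exists set0; split => //; split => //; exact: measure0.
  have [qq|qq] := ltP (ratr q.1 : R) (ratr q.2); last first.
    by exists set0; split => [|_ x /andP[h1 h2]]; [split => //; exact: measure0|exfalso; lra].
  have [g gg] := weak_derivative_local wd qq sub; have [_ [N N0 HN]] := gg.
  by exists N; split => // _ x xq Nx; rewrite (v0E _ _ _ gg)// HN.
have [N HN] := choice Hq.
exists (\bigcup_q N q); first by apply: (@null_set_bigcup _ (measurableTypeR R) R mu (rat * rat)%type N) => q; have [] := HN q.
move=> x Jx Nx.
have /nbhs_ballP[e /= e0 xe] : nbhs x J by exact: open_nbhs_nbhs.
have [q1 /itvP q1P] := @rat_in_itvoo R (x - e) x ltac:(lra).
have [q2 /itvP q2P] := @rat_in_itvoo R x (x + e) ltac:(lra).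
have [_ H] := HN (q1, q2); apply: H.
- move=> r; rewrite /= in_itv/= => /andP[h1 h2]; apply: xe; rewrite /ball/= ltr_norml.
  have h3 : x - e < ratr q1 by rewrite q1P.
  have h4 : ratr q2 < x + e by rewrite q2P.
  by apply/andP; split; lra.
- by rewrite /= q1P q2P.
- by move=> Nq; apply: Nx; exists (q1, q2).
Qed.

End weak_derivative.

(** * Radial integration by parts *)

Section rV_calculus.
Context {R : realType}.
Local Notation mu := (@lebesgue_measure R).

Lemma integral_leb_step n (f : 'rV[R]_n.+1 -> \bar R) :
  (leb n.+1).-integrable [set: 'rV[R]_n.+1] f ->
  (\int[leb n.+1]_x f x = \int[mu]_t \int[leb n]_x f (rV_cons (t, x)))%E /\
  (\int[leb n.+1]_x f x = \int[leb n]_x \int[mu]_t f (rV_cons (t, x)))%E.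
Proof.
move=> fi; have mf : measurable_fun [set: 'rV[R]_n.+1] f by exact: measurable_int fi.
have mc := @measurable_rV_cons R n.
have mfc : measurable_fun setT (f \o @rV_cons R n) by exact: measurableT_comp.
have pi : (mu \x leb n)%E.-integrable setT (f \o @rV_cons R n).
  apply/integrableP; split => //.
  have /integrableP[_] := fi; rewrite /= /leb_step ge0_integral_pushforward//.
  by apply: measurableT_comp => //.
have -> : (\int[leb n.+1]_x f x = \int[mu \x leb n]_z f (rV_cons z))%E.
  by rewrite /= /leb_step integral_pushforward.
by rewrite -(Fubini pi) -integral12_prod_meas1.
Qed.

Lemma rV_continuous (T : topologicalType) n (f : T -> 'rV[R]_n) :
  (forall j, continuous (fun z => f z ord0 j)) -> continuous f.
Proof.
move=> cf z; apply/cvg_ballP => e e0.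
have : \forall y \near z, forall j, ball (f z ord0 j) e (f y ord0 j).
  apply: filter_forall => j; have := cf j z.
  by move/cvg_ballP => /(_ _ e0).
apply: filterS => y H; split => // i j; rewrite (ord1 i); exact: H.
Qed.

Lemma rV_consE n (t : R) (x : 'rV[R]_n) :
  rV_cons (t, x) ord0 ord0 = t /\ forall j, rV_cons (t, x) ord0 (lift ord0 j) = x ord0 j.
Proof.
have := rV_consK (t, x); rewrite /rV_uncons => -[tE /rowP xE]; split => // j.
by have := xE j; rewrite mxE.
Qed.

Lemma continuous_rV_cons n (T : topologicalType) (a : T -> R) (b : T -> 'rV[R]_n) :
  continuous a -> continuous b -> continuous (fun z => rV_cons (a z, b z)).
Proof.
move=> ca cb; apply: rV_continuous => j z.
have [k ->|->] := unliftP ord0 j.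
  have -> : (fun z => rV_cons (a z, b z) ord0 (lift ord0 k)) = (fun z => b z ord0 k).
    by apply/funext => y; rewrite (rV_consE (a y) (b y)).2.
  by apply: (@continuous_comp _ _ _ b (fun M : 'rV[R]_n => M ord0 k)); [exact: cb|exact: coord_continuous].
have -> : (fun z => rV_cons (a z, b z) ord0 ord0) = a by apply/funext => y; rewrite (rV_consE (a y) (b y)).1.
exact: ca.
Qed.

Lemma measurable_cbox n (al be : 'I_n -> R) : measurable (cbox al be).
Proof.
rewrite (_ : cbox _ _ = \bigcap_(i in [set: 'I_n])
   [set x | `[al i, be i]%classic (x ord0 i)]).
  apply: fin_bigcap_measurable => // i _.
  have := @measurable_coord _ R 1 n ord0 i measurableT
    `[al i, be i]%classic (measurable_itv _).
  by rewrite setTI.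
by apply/seteqP; split => [x qx i _|x qx i]; have := qx i; rewrite /= in_itv /=; exact.
Qed.

Lemma leb_cbox_lty n (M : R) : (leb n (cbox (fun=> (- M)%R) (fun=> M%R)) < +oo)%E.
Proof.
have -> : cbox (fun=> - M) (fun=> M) = [set x : 'rV[R]_n | forall i, `[- M, M]%classic (x ord0 i)].
  by apply/seteqP; split => x H i; have := H i; rewrite /= in_itv.
rewrite leb_cube//; have -> : lebesgue_measure (`[- M, M]%classic : set R) = (Num.max (M - - M) 0)%:E.
  apply: (etrans (lebesgue_measure_itv _)) => /=; rewrite lte_fin.
  by case: ifPn => [h|]; [rewrite max_l// subr_ge0 ltW|rewrite -leNgt => h; rewrite max_r// subr_le0].
by rewrite -EFin_expe ltry.
Qed.

Lemma integrable_continuous_cbox n (h : 'rV[R]_n -> R) (M : R) : continuous h ->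
  (forall x, ~ cbox (fun=> - M) (fun=> M) x -> h x = 0) ->
  (leb n).-integrable setT (EFin \o h).
Proof.
move=> ch h0; set Q : set 'rV[R]_n := cbox _ _ in h0.
have [B [_ HB]] := compact_bounded (continuous_compact (continuous_subspaceT ch) (@cbox_compact _ _ _ _ : compact Q)).
have HB' x : Q x -> `|h x| <= `|B| + 1.
  by move=> Qx; apply: (HB (`|B| + 1)); [rewrite (le_lt_trans (ler_norm _))// ltrDl|exists x].
have mQ : measurable Q by exact: measurable_cbox.
have iQ : (leb n).-integrable setT (EFin \o (fun x => (`|B| + 1) * \1_Q x)).
  have i1 : (leb n).-integrable setT (EFin \o (\1_Q : 'rV[R]_n -> R)).
    apply/integrableP; split; first by apply/measurable_EFinP; exact: measurable_indic.
    rewrite (eq_integral (fun x => (\1_Q x)%:E)) => [|x _]; last by rewrite /= ger0_norm.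
    by rewrite integral_indic// setIT; exact: leb_cbox_lty.
  exact: integrableZl i1.
apply: le_integrable iQ => //.
  by apply/measurable_EFinP; exact: continuous_measurable_rV.
move=> x _; rewrite /= lee_fin.
have [Qx|Qx] := pselect (Q x); last by rewrite h0// normr0.
rewrite indicE mem_set// mulr1; apply: (le_trans (HB' _ Qx)); exact: ler_norm.
Qed.

Lemma rV_cons_shift n (t h : R) (x v : 'rV[R]_n) (s : R) :
  h *: rV_cons (s, v) + rV_cons (t, x) = rV_cons (h * s + t, h *: v + x).
Proof.
apply/rowP => j; rewrite [LHS]mxE [X in X + _ = _]mxE; have [k ->|->] := unliftP ord0 j.
  by rewrite (rV_consE s v).2 (rV_consE t x).2 (rV_consE _ (h *: v + x)).2 !mxE.
by rewrite (rV_consE s v).1 (rV_consE t x).1 (rV_consE _ (h *: v + x)).1.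
Qed.

Lemma delta_mx_rV_cons n : delta_mx ord0 ord0 = rV_cons (1, 0) :> 'rV[R]_n.+1 /\
  forall j, delta_mx ord0 (lift ord0 j) = rV_cons (0, delta_mx ord0 j) :> 'rV[R]_n.+1.
Proof.
split=> [|j]; apply/rowP => k; rewrite [LHS]mxE; have [l ->|->] := unliftP ord0 k.
- by rewrite (rV_consE _ _).2 mxE.
- by rewrite (rV_consE _ _).1.
- by rewrite (rV_consE _ _).2 mxE (inj_eq lift_inj).
- by rewrite (rV_consE _ _).1.
Qed.

(* Fubini's theorem and the fundamental theorem of calculus in the direction
   of the i-th coordinate. *)
Lemma integral_partial_derivative n (psi g : 'rV[R]_n -> R) (i : 'I_n) (M : R) :
  continuous g -> (forall x, is_derive x (delta_mx ord0 i) psi (g x)) ->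
  (forall x, ~ cbox (fun=> - M) (fun=> M) x -> psi x = 0 /\ g x = 0) ->
  (\int[leb n]_x (g x)%:E = 0)%E.
Proof.
elim: n psi g i => [_ _ []//|n ih psi g i cg dpsi z].
have gi : (leb n.+1).-integrable [set: 'rV[R]_n.+1] (EFin \o g).
  by apply: (integrable_continuous_cbox (M := M) cg) => x /z[].
have [e1 e2] := integral_leb_step gi.
have cI (t : R) (x : 'rV[R]_n) : cbox (fun=> - M) (fun=> M) (rV_cons (t, x)) ->
    `[- M, M]%classic t /\ cbox (fun=> - M) (fun=> M) x.
  move=> H; split; first by have := H ord0; rewrite (rV_consE t x).1 /= in_itv.
  by move=> j; have := H (lift ord0 j); rewrite (rV_consE t x).2.
have [j ij|i0] := unliftP ord0 i.
- rewrite e1 integral0_eq// => t _.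
  apply: (ih (fun x => psi (rV_cons (t, x))) (fun x => g (rV_cons (t, x))) j).
  + move=> x; apply: continuous_comp; last exact: cg.
    by apply: (@continuous_rV_cons n _ (fun=> t) id) => ?; [exact: cst_continuous|exact: cvg_id].
  + move=> x; apply: is_derive_line.
    have /is_derive_lineP := dpsi (rV_cons (t, x)).
    rewrite ij (delta_mx_rV_cons n).2; congr (is_derive _ _ _ _); apply/funext => h.
    by rewrite rV_cons_shift mulr0 add0r.
  + by move=> x xQ; apply: z => /cI[].
- rewrite e2 integral0_eq// => x _.
  have dp (t : R) : is_derive t 1 (fun t => psi (rV_cons (t, x))) (g (rV_cons (t, x))).
    have /is_derive_lineP := dpsi (rV_cons (t, x)).
    rewrite i0 (delta_mx_rV_cons n).1 => d; apply/is_derive_lineP; move: d.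
    congr (is_derive _ _ _ _); apply/funext => h.
    by rewrite rV_cons_shift scaler0 add0r.
  have cgt : continuous (fun t => g (rV_cons (t, x))).
    move=> t; apply: continuous_comp; last exact: cg.
    by apply: (@continuous_rV_cons n _ id (fun=> x)) => ?; [exact: cvg_id|exact: cst_continuous].
  have M0 : 0 <= `|M| by [].
  have MM : - (`|M| + 1) <= `|M| + 1 by lra.
  have [ii e] := primitive_C1 dp cgt MM (@subsetT _ _).
  have cM (t : R) : `[- M, M]%classic t -> - `|M| <= t <= `|M|.
    rewrite /= in_itv/= => /andP[h1 h2]; have := ler_norm M; have := ler_norm (- M).
    by rewrite normrN => h3 h4; apply/andP; split; lra.
  have zero (s : R) : ~ (- `|M| <= s <= `|M|) -> psi (rV_cons (s, x)) = 0.
    by move=> sM; have [] := z (rV_cons (s, x)) (fun H => sM (cM _ (cI _ _ H).1)).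
  rewrite (@eq_integral_support _ (measurableTypeR R) R mu `[- M, M] _ `[- (`|M| + 1), `|M| + 1])//.
  + have <- : (\int[mu]_(t in `[(- (`|M| + 1))%R, (`|M| + 1)%R]) g (rV_cons (t, x)))%:E =
        (\int[mu]_(t in `[(- (`|M| + 1))%R, (`|M| + 1)%R]) (g (rV_cons (t, x)))%:E)%E.
      by rewrite /Rintegral fineK//; exact: integrable_fin_num ii.
    rewrite -e !zero ?subrr//; apply/negP; rewrite negb_and -!ltNge; apply/orP; [left|right]; lra.
  + by move=> t /cM /andP[h1 h2]; rewrite /= in_itv/=; apply/andP; split; lra.
  + by move=> t tM /=; have [_ ->] := z (rV_cons (t, x)) (fun H => tM (cI _ _ H).1).
Qed.

End rV_calculus.

Section radial_calculus.
Context {R : realType}.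
Local Notation mu := (@lebesgue_measure R).

Lemma continuous_enorm n : continuous (@enorm R n).
Proof.
move=> x; apply: continuous_comp; last exact: sqrt_continuous.
have : forall s : seq 'I_n, {for x, continuous (fun x : 'rV[R]_n => \sum_(i <- s) x ord0 i ^+ 2)}.
  elim=> [|i s ih].
    by rewrite (_ : (fun x => _) = fun=> 0); [exact: cst_continuous|apply/funext => y; rewrite big_nil].
  rewrite (_ : (fun x => _) = (fun y : 'rV[R]_n => y ord0 i * y ord0 i + \sum_(i <- s) y ord0 i ^+ 2)).
    apply: continuousD ih; apply: continuousM; exact: coord_continuous.
  by apply/funext => y; rewrite big_cons expr2.
exact.
Qed.

Lemma is_derive_enorm n (x : 'rV[R]_n) (i : 'I_n) : 0 < enorm x ->
  is_derive x (delta_mx ord0 i) enorm (x ord0 i / enorm x).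
Proof.
move=> x0; apply/is_derive_lineP.
pose S : R := \sum_(k < n) x ord0 k ^+ 2.
pose q (h : R) : R := h * h + (2 * x ord0 i) * h + S.
have qE : (fun h : R => enorm (h *: delta_mx ord0 i + x)) = Num.sqrt \o q.
  apply/funext => h; rewrite /enorm /=; congr Num.sqrt.
  rewrite /q /S (bigD1 i)//= [in RHS](bigD1 i)//= !mxE !eqxx/= mulr1 [RHS]addrA; congr (_ + _).
    by ring.
  by apply: eq_bigr => k ki; rewrite !mxE (negbTE ki) andbF mulr0 add0r.
have S0 : 0 < S by rewrite -sqrtr_gt0.
have q0 : q 0 = S by rewrite /q !mulr0 !add0r.
have dq : is_derive (0 : R) 1 q (2 * x ord0 i).
  have := is_deriveD (is_deriveD (is_deriveM (is_derive_id (0 : R) 1) (is_derive_id (0 : R) 1))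
    (is_deriveM (is_derive_cst (2 * x ord0 i) (0 : R) 1) (is_derive_id (0 : R) 1)))
    (is_derive_cst S (0 : R) 1).
  by move=> /is_derive_eq; apply; rewrite /GRing.scale/=; ring.
rewrite qE.
have := @is_derive1_comp _ Num.sqrt q 0 _ _ (is_derive1_sqrt (x := q 0) ltac:(by rewrite q0)) dq.
move=> /is_derive_eq; apply; rewrite q0 -[Num.ExtraDef.sqrtr S]/(enorm x).
by field; rewrite gt_eqF.
Qed.

Lemma rV_compact_cbox n (K : set 'rV[R]_n) : compact K ->
  exists M, K `<=` cbox (fun=> - M) (fun=> M).
Proof.
move=> cK; have := continuous_compact (continuous_subspaceT (@continuous_enorm n)) cK.
move=> /compact_segment[M _ HM]; exists M => x Kx i.
rewrite -ler_norml; apply: (le_trans (ler_coord_enorm x i)).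
have : `[- M, M]%classic (enorm x) by apply: HM; exists x.
by rewrite /= in_itv/= => /andP[].
Qed.

Lemma integrable_continuous_compact n (h : 'rV[R]_n -> R) (K : set 'rV[R]_n) : continuous h ->
  compact K -> (forall x, ~ K x -> h x = 0) -> (leb n).-integrable setT (EFin \o h).
Proof.
move=> ch /rV_compact_cbox[M KM] h0.
by apply: (integrable_continuous_cbox (M := M)) => // x Mx; apply: h0 => /KM.
Qed.

Lemma smooth_partial n (phi : 'rV[R]_n -> R) (v : 'rV[R]_n) : smooth phi ->
  [/\ continuous phi, continuous ('D_v phi) & forall x, is_derive x v phi ('D_v phi x)].
Proof.
move=> sphi; have [c0 d0] := sphi [::]; have [/= c1 _] := sphi [:: v].
by split => // x; split => //; exact: d0.
Qed.

Lemma compact_closed_rV n (K : set 'rV[R]_n) : compact K -> closed K.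
Proof. by apply: compact_closed; exact: norm_hausdorff. Qed.

Lemma continuous_support (V : normedModType R) (U K : set V) (h : V -> R) : open U -> closed K ->
  K `<=` U -> (forall x, ~ K x -> h x = 0) -> (forall x, U x -> {for x, continuous h}) ->
  continuous h.
Proof.
move=> oU cK KU h0 ch x; have [/ch//|Ux] := pselect (U x).
have Kx : ~ K x by move=> /KU.
rewrite /continuous_at h0//.
have n0 : \forall y \near x, h y = 0.
  have : nbhs x (~` K) by apply: open_nbhs_nbhs; split => //; exact: closed_openC.
  by apply: filterS => y /h0.
exact: cvg_near_cst.
Qed.

Definition shell n (al be : R) : set 'rV[R]_n := [set x | al < enorm x < be].

Lemma open_shell n (al be : R) : open (@shell n al be).
Proof.
have -> : @shell n al be = enorm @^-1` `]al, be[ by apply/seteqP; split => x; rewrite /shell /= in_itv.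
by apply: open_comp; [move=> x _; exact: continuous_enorm|exact: interval_open].
Qed.

Section radial_ibp.
Variables (n : nat) (al be : R) (i : 'I_n) (phi : 'rV[R]_n -> R) (K : set 'rV[R]_n).
Hypotheses (al0 : 0 < al) (albe : al < be) (sphi : smooth phi) (cK : compact K).
Hypotheses (Ksh : K `<=` shell al be) (phi0 : forall x, ~ K x -> phi x = 0).

Local Notation E := (`[al, be]%classic : set R).
Local Notation Dphi := ('D_(delta_mx ord0 i) phi).

Lemma Dphi0 x : ~ K x -> Dphi x = 0.
Proof. by apply: (@derive_support R 'rV[R]_n K phi _ _ _ phi0); exact: compact_closed_rV. Qed.

Lemma continuous_radial_term (f : R -> R) : mu.-integrable setT (EFin \o f) ->
  continuous (fun x => cumul f (enorm x) * Dphi x).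
Proof.
move=> fi x; have [_ cD _] := smooth_partial (delta_mx ord0 i) sphi.
apply: (@continuousM _ _ (fun x => cumul f (enorm x)) Dphi); last exact: cD.
by apply: continuous_comp; [exact: continuous_enorm|exact: continuous_cumul].
Qed.

Lemma integrable_radial_term1 (f : R -> R) : mu.-integrable setT (EFin \o f) ->
  (leb n).-integrable setT (EFin \o (fun x => cumul f (enorm x) * Dphi x)).
Proof.
move=> fi; apply: (integrable_continuous_compact (continuous_radial_term fi) cK).
by move=> x Kx; rewrite Dphi0// mulr0.
Qed.

Lemma phi_bounded : exists2 B, 0 <= B & forall x, `|phi x| <= B.
Proof.
have [cphi _ _] := smooth_partial (delta_mx ord0 i) sphi.
have [B [_ HB]] := compact_bounded (continuous_compact (continuous_subspaceT cphi) cK).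
exists (`|B| + 1); first by rewrite addr_ge0.
move=> x; have [Kx|Kx] := pselect (K x); last by rewrite phi0// normr0 addr_ge0.
by apply: (HB (`|B| + 1)); [rewrite (le_lt_trans (ler_norm _))// ltrDl|exists x].
Qed.

Lemma n_gt0 : (0 < n)%N. Proof. by case: n i => // -[]. Qed.

Lemma area_ge0 : 0 <= sphere_area n * be ^+ n.-1 :> R.
Proof.
by rewrite mulr_ge0 ?exprn_ge0 ?(ltW (sphere_area_gt0 n_gt0))// (le_trans (ltW al0))// ltW.
Qed.

(** In polar coordinates the density is at most its value at the outer radius. *)
Lemma radial_patch_le (f : R -> R) : mu.-integrable E (EFin \o f) ->
  (\int[leb n]_x `|(f \_ E) (enorm x)|%:E <=
   (sphere_area n * be ^+ n.-1)%:E * \int[mu]_(r in E) `|f r|%:E)%E.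
Proof.
move=> fi; have gi := integrable_patch (measurable_itv _) fi.
have mg := measurable_integrable gi.
have mh : measurable_fun setT (fun r => `|(f \_ E) r|%:E).
  by apply/measurable_EFinP; exact: measurableT_comp.
rewrite (@ge0_integral_radial R n (fun r => `|(f \_ E) r|%:E) n_gt0)//.
rewrite -ge0_integralZl//; last 2 first.
- by apply/measurable_EFinP; apply: measurableT_comp => //; exact: measurable_integrable fi.
- by rewrite lee_fin area_ge0.
rewrite [leRHS]integral_mkcond; apply: ge0_le_integral => //.
- by move=> r _; rewrite mule_ge0// lee_fin radial_density_ge0// n_gt0.
- by apply: emeasurable_funM => //; apply/measurable_EFinP; exact: measurable_radial_density.
- apply/(measurable_restrictT _ _).1 => //; apply: emeasurable_funM => //.
  by apply/measurable_EFinP; apply: measurableT_comp => //; exact: measurable_integrable fi.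
- move=> r _; rewrite !patchE; case: ifPn => [|_]; last by rewrite normr0 mul0e.
  rewrite inE/= in_itv/= => /andP[h1 h2]; rewrite -!EFinM lee_fin mulrC ler_wpM2r//.
  rewrite /radial_density patchE mem_set/=; last by rewrite in_itv/= andbT (lt_le_trans al0 h1).
  rewrite ler_wpM2l ?(ltW (sphere_area_gt0 n_gt0))//.
  by rewrite lerXn2r// nnegrE ?(le_trans (ltW al0) h1)// (le_trans (ltW al0))// ltW.
Qed.

Local Notation term2 f := (fun x : 'rV[R]_n => (f \_ E) (enorm x) * (x ord0 i / enorm x) * phi x).

Lemma coord_div_enorm (x : 'rV[R]_n) : `|x ord0 i / enorm x| <= 1.
Proof.
rewrite normrM normfV (ger0_norm (enorm_ge0 x)).
have [->|x0] := eqVneq (enorm x) 0; first by rewrite invr0 mulr0.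
by rewrite ler_pdivrMr ?mul1r ?ler_coord_enorm// lt_neqAle eq_sym x0 enorm_ge0.
Qed.

Lemma integrable_radial_term2 (f : R -> R) : mu.-integrable E (EFin \o f) ->
  (leb n).-integrable setT (EFin \o term2 f).
Proof.
move=> fi; have [B B0 HB] := phi_bounded.
have gi := integrable_patch (measurable_itv _) fi; have mg := measurable_integrable gi.
have mge : measurable_fun [set: 'rV[R]_n] (fun x => (f \_ E) (enorm x)).
  exact: measurableT_comp mg (@measurable_enorm R n).
have [cphi _ _] := smooth_partial (delta_mx ord0 i) sphi.
have i1 : (leb n).-integrable setT (EFin \o (fun x : 'rV[R]_n => (f \_ E) (enorm x))).
  apply/integrableP; split; first exact/measurable_EFinP.
  apply: (le_lt_trans (radial_patch_le fi)); rewrite lte_mul_pinfty//.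
    by rewrite lee_fin area_ge0.
  by have /integrableP[] := fi.
have i2 := integrableZl measurableT B i1.
apply: le_integrable i2 => //.
  apply/measurable_EFinP; apply: measurable_funM; last exact: continuous_measurable_rV.
  apply: measurable_funM => //; apply: measurable_funM; first exact: measurable_coord.
  rewrite (_ : (fun x => _) = (fun x : 'rV[R]_n => enorm x `^ (-1))); last first.
    by apply/funext => x; rewrite powR_inv1// enorm_ge0.
  apply: (@measurableT_comp _ _ _ _ _ _ (fun r : R => r `^ (-1))) => //.
  exact: measurable_enorm.
move=> x _; rewrite /= lee_fin !normrM mulrC (ger0_norm B0) ler_pM//.
rewrite -[leRHS]mulr1 ler_wpM2l// -normrM; exact: coord_div_enorm.
Qed.

(** Its vanishing is the integration by parts formula for the radial function with radial derivative
    [f]. It is linear in [f] and continuous for the L^1 norm on [E], so continuous [f] suffice. *)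
Definition radial_defect (f : R -> R) : R :=
  \int[leb n]_x (cumul (f \_ E) (enorm x) * Dphi x) + \int[leb n]_x term2 f x.

Lemma cumul_le (f : R -> R) r : mu.-integrable E (EFin \o f) ->
  `|cumul (f \_ E) r| <= \int[mu]_(s in E) `|f s|.
Proof.
move=> fi; have gi := integrable_patch (measurable_itv _) fi.
have gi' : mu.-integrable `]-oo, r] (EFin \o (f \_ E)) by exact: integrableS gi.
apply: (le_trans (le_normr_Rintegral _ gi')) => //.
rewrite /Rintegral fine_le//.
- by apply: integrable_fin_num => //; exact: integrable_norm.
- by apply: integrable_fin_num => //; exact: integrable_norm.
rewrite [leRHS]integral_mkcond [leLHS]integral_mkcond; apply: ge0_le_integral => //.
- by move=> s _; rewrite patchE; case: ifP.
- apply/(measurable_restrictT _ _).1 => //; apply/measurable_EFinP.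
  by apply: measurableT_comp => //; exact: measurable_integrable gi'.
- apply/(measurable_restrictT _ _).1 => //; apply/measurable_EFinP.
  by apply: measurableT_comp => //; exact: measurable_integrable fi.
- move=> s _; apply: (@le_trans _ _ `|(f \_ E) s|%:E).
    by rewrite patchE; case: ifPn; rewrite ?lexx ?lee_fin.
  by rewrite [leRHS]patchE patchE; case: ifPn; rewrite ?normr0.
Qed.

Lemma radial_defect_le : exists2 C, 0 <= C & forall f, mu.-integrable E (EFin \o f) ->
  `|radial_defect f| <= C * \int[mu]_(r in E) `|f r|.
Proof.
have [B B0 HB] := phi_bounded.
have [cphi cD _] := smooth_partial (delta_mx ord0 i) sphi.
have Di : (leb n).-integrable setT (EFin \o Dphi).
  by apply: (integrable_continuous_compact cD cK) => x; exact: Dphi0.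
pose C1 := \int[leb n]_x `|Dphi x|.
have C10 : 0 <= C1 by exact: Rintegral_ge0.
pose C2 := sphere_area n * be ^+ n.-1.
have C20 : 0 <= C2 := area_ge0.
exists (C1 + B * C2) => [|f fi]; first by rewrite addr_ge0// mulr_ge0.
have gi := integrable_patch (measurable_itv _) fi.
set T := \int[mu]_(r in E) `|f r|.
have T0 : 0 <= T by exact: Rintegral_ge0.
rewrite mulrDl (le_trans (ler_normD _ _))// lerD//.
- have i1 := integrable_radial_term1 gi.
  apply: (le_trans (le_normr_Rintegral _ i1)) => //.
  rewrite mulrC -RintegralZl//; last exact: integrable_norm.
  apply: le_Rintegral => //.
  + exact: integrable_norm.
  + by have := integrableZl measurableT T (integrable_norm Di).
  + by move=> x _; rewrite normrM ler_wpM2r// cumul_le.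
- have i2 := integrable_radial_term2 fi.
  apply: (le_trans (le_normr_Rintegral _ i2)) => //.
  have T2 : (\int[leb n]_x `|term2 f x|%:E <= (B * C2 * T)%:E)%E.
    apply: (@le_trans _ _ (\int[leb n]_x (B%:E * `|(f \_ E) (enorm x)|%:E))%E).
      apply: ge0_le_integral => //.
      * by move/integrable_norm/measurable_int : i2.
      * apply: emeasurable_funM => //; apply/measurable_EFinP; apply: measurableT_comp => //.
        exact: measurableT_comp (measurable_integrable gi) (@measurable_enorm R n).
      * move=> x _; rewrite lee_fin !normrM mulrC ler_pM//.
        by rewrite -[leRHS]mulr1 ler_wpM2l// -normrM; exact: coord_div_enorm.
    rewrite ge0_integralZl//; last first.
      apply/measurable_EFinP; apply: measurableT_comp => //.
      exact: measurableT_comp (measurable_integrable gi) (@measurable_enorm R n).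
    rewrite -mulrA [leRHS]EFinM lee_wpmul2l ?lee_fin//.
    apply: (le_trans (radial_patch_le fi)); rewrite -/C2 [leRHS]EFinM lee_wpmul2l ?lee_fin//.
    by rewrite /T /Rintegral fineK//; apply: integrable_fin_num => //; exact: integrable_norm.
  rewrite -lee_fin /Rintegral fineK//.
  by apply: integrable_fin_num => //; have := integrable_norm i2.
Qed.

(** The radial function is then continuously differentiable on the shell, which contains the support
    of [phi]; the defect is the integral of a partial derivative of a compactly supported
    function. *)
Lemma radial_defect_continuous (g : R -> R) : continuous g -> radial_defect g = 0.
Proof.
move=> cg.
have gE : mu.-integrable E (EFin \o g).
  apply: continuous_compact_integrable; first exact: segment_compact.
  exact: continuous_subspaceT.
have gi := integrable_patch (measurable_itv _) gE.
have [cphi cD dphi] := smooth_partial (delta_mx ord0 i) sphi.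
have clK := compact_closed_rV cK.
have cr (r : R) : al < r < be -> {for r, continuous (g \_ E)}.
  move=> /andP[alr rbe]; apply: (@near_continuous _ g); last exact: cg.
  have := near_itvoo alr rbe; apply: filterS => t tI.
  by rewrite patchE mem_set//= in_itv.
have dV (r : R) : al < r < be -> is_derive r 1 (cumul (g \_ E)) (g r).
  move=> rI; have gr : (g \_ E) r = g r.
    by rewrite patchE mem_set//= in_itv/=; case/andP : rI => /ltW -> /ltW ->.
  have := @continuous_FTC1 R (g \_ E) -oo%O r (r + 1).
  rewrite ltrDl => /(_ ltr01); case; [exact: integrableS gi|by rewrite /Order.lt/=|exact: cr rI|].
  by rewrite gr => d e; split; [exact: d|rewrite -derive1E; exact: e].
have dU x : shell al be x -> is_derive x (delta_mx ord0 i) (fun x => cumul (g \_ E) (enorm x))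
    (g (enorm x) * (x ord0 i / enorm x)).
  move=> xs; have x0 : 0 < enorm x by case/andP : xs => h _; exact: lt_trans al0 h.
  apply/is_derive_lineP.
  have := @is_derive1_comp _ (cumul (g \_ E)) _ _ _ _ _ (proj2 (is_derive_lineP _ _ _ _) (is_derive_enorm i x0)).
  by apply; rewrite scale0r add0r; apply: dV.
pose G (x : 'rV[R]_n) : R := cumul (g \_ E) (enorm x) * Dphi x + term2 g x.
have G0 x : ~ K x -> G x = 0 by move=> Kx; rewrite /G Dphi0// phi0// !mulr0 addr0.
have cG : continuous G.
  apply: (@continuous_support 'rV[R]_n (shell al be) K G (@open_shell _ _ _) clK Ksh G0) => x xs.
  have x0 : 0 < enorm x by case/andP : xs => h _; exact: lt_trans al0 h.
  apply: continuousD; first exact: continuous_radial_term.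
  apply: continuousM; last exact: cphi.
  apply: continuousM; last first.
    apply: continuousM; first exact: coord_continuous.
    by apply: continuousV; [rewrite gt_eqF|exact: continuous_enorm].
  by apply: continuous_comp; [exact: continuous_enorm|exact: cr].
have [M KM] := rV_compact_cbox cK.
have := @integral_partial_derivative R n (fun x => cumul (g \_ E) (enorm x) * phi x) G i M cG.
rewrite /radial_defect -RintegralD//; last 2 first.
- exact: integrable_radial_term1.
- exact: integrable_radial_term2.
move=> H; rewrite /Rintegral (H _ _)//; last first.
  by move=> x Mx; have Kx : ~ K x by [move=> /KM]; rewrite G0// phi0// mulr0.
move=> x; have [Kx|Kx] := pselect (K x); last first.
  rewrite G0//; apply: (@near_eq_is_derive _ _ _ (cst 0)).
  have : nbhs x (~` K) by apply: open_nbhs_nbhs; split => //; exact: closed_openC.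
  by apply: filterS => y Ky; rewrite phi0// mulr0.
have := is_deriveM (dU _ (Ksh Kx)) (dphi x).
move=> /is_derive_eq; apply; rewrite /G patchE mem_set/=; last first.
  by have /andP[/ltW h1 /ltW h2] := Ksh Kx; rewrite in_itv/= h1.
by rewrite /GRing.scale/=; ring.
Qed.

Lemma radial_defectB (f g : R -> R) : mu.-integrable E (EFin \o f) ->
  mu.-integrable E (EFin \o g) ->
  radial_defect (fun r => f r - g r) = radial_defect f - radial_defect g.
Proof.
move=> fi gi.
have fi' := integrable_patch (measurable_itv _) fi; have gi' := integrable_patch (measurable_itv _) gi.
have pE r : ((fun r => f r - g r) \_ E) r = (f \_ E) r - (g \_ E) r.
  by rewrite !patchE; case: ifP; rewrite ?subrr.
have cE r : cumul ((fun r => f r - g r) \_ E) r = cumul (f \_ E) r - cumul (g \_ E) r.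
  rewrite /cumul -RintegralB//.
  - by apply: eq_Rintegral => s _; exact: pE.
  - exact: integrableS fi'.
  - exact: integrableS gi'.
rewrite /radial_defect opprD addrACA -!RintegralB//; try by first [exact: integrable_radial_term1|exact: integrable_radial_term2].
congr (_ + _); apply: eq_Rintegral => x _; first by rewrite cE mulrBl.
by rewrite pE !mulrBl.
Qed.

Lemma radial_ibp (f : R -> R) : mu.-integrable E (EFin \o f) -> radial_defect f = 0.
Proof.
move=> fi; have [C C0 HC] := radial_defect_le.
have mE : measurable E by [].
have Efin : (mu E < +oo)%E.
  have -> : mu E = (be - al)%:E; last by rewrite ltry.
  by apply: (etrans (lebesgue_measure_itv _)) => /=; rewrite lte_fin albe.
have [g_ [cg gi gf]] := approximation_continuous_integrable mE Efin fi.
have mE' : measurable (E : set (measurableTypeR R)) by [].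
have D m : `|radial_defect f| <= C * \int[mu]_(r in E) `|f r - g_ m r|.
  rewrite -[radial_defect f]subr0 -(radial_defect_continuous (cg m)) -radial_defectB//.
  by apply: HC; exact: (integrableB mE' fi (gi m)).
have d0 : \int[mu]_(r in E) `|f r - g_ m r| @[m --> \oo] --> 0 by exact: fine_cvg gf.
apply/eqP; rewrite -normr_le0; apply/ler_addgt0Pl => e e0; rewrite addr0.
have C1 : 0 < C + 1 by rewrite ltr_wpDl.
have /cvgrPdist_lt/(_ (e / (C + 1))) := d0.
rewrite divr_gt0// => /(_ isT)[m _ /(_ m (leqnn m))] /=.
rewrite sub0r normrN ger0_norm ?Rintegral_ge0// ltr_pdivlMr// => h.
apply: (le_trans (D m)); apply: le_trans (ltW h).
by rewrite mulrC ler_wpM2l ?Rintegral_ge0// lerDl.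
Qed.

End radial_ibp.

End radial_calculus.

(** * Gluing primitives *)

Section cutoff_primitive.
Context {R : realType}.
Local Notation mu := (@lebesgue_measure R).

Lemma integrableT_fun_linear (f g : R -> R) (c : R) : mu.-integrable setT (EFin \o f) ->
  mu.-integrable setT (EFin \o g) -> mu.-integrable setT (EFin \o (fun r => f r + c * g r)).
Proof.
move=> fi gi; have mT : measurable ([set: measurableTypeR R]) by [].
exact: (integrableD mT fi (integrableZl mT c gi)).
Qed.

Lemma cumul_linear (f g : R -> R) (c x : R) : mu.-integrable setT (EFin \o f) ->
  mu.-integrable setT (EFin \o g) ->
  cumul (fun r => f r + c * g r) x = cumul f x + c * cumul g x.
Proof.
move=> fi gi; have mD : measurable (`]-oo, x]%classic : set (measurableTypeR R)) by [].
have fi' : mu.-integrable `]-oo, x] (EFin \o f) by exact: integrableS fi.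
have gi' : mu.-integrable `]-oo, x] (EFin \o g) by exact: integrableS gi.
by rewrite /cumul RintegralD//; [rewrite RintegralZl|exact: (integrableZl mD c gi')].
Qed.

Lemma cumul0 (f : R -> R) (x : R) : (forall r, r < x -> f r = 0) -> cumul f x = 0.
Proof.
move=> f0; rewrite /cumul /Rintegral.
rewrite (@eq_integral_off_null _ (measurableTypeR R) R mu `]-oo, x] [set x] _ (cst 0%E)) ?integral_cst_0//.
- by rewrite integral0.
- exact: lebesgue_measure_set1.
- move=> r; rewrite /= in_itv/= => rx /eqP rx'; rewrite f0//.
  by rewrite lt_neqAle rx' rx.
Qed.

Lemma cumul_support (f : R -> R) (x : R) : (forall r, x < r -> f r = 0) ->
  cumul f x = \int[mu]_r f r.
Proof.
move=> f0; rewrite /cumul /Rintegral; congr fine.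
apply: (@eq_integral_support _ (measurableTypeR R) R mu `]-oo, x]) => // r.
by rewrite /= in_itv/= => /negP; rewrite -ltNge => /f0 ->.
Qed.

Definition transition (l0 l1 : R) (g : R -> R) :=
  [/\ mu.-integrable setT (EFin \o g), forall r, 0 <= g r,
      forall r, ~ (l0 < r < l1) -> g r = 0 & \int[mu]_r g r = 1].

Lemma transition_left l0 l1 g x : transition l0 l1 g -> x <= l0 -> cumul g x = 0.
Proof.
move=> [_ _ g0 _] xl; apply: cumul0 => r rx; apply: g0 => /andP[l0r _].
by have := lt_trans (lt_le_trans rx xl) l0r; rewrite ltxx.
Qed.

Lemma transition_right l0 l1 g x : transition l0 l1 g -> l1 <= x -> cumul g x = 1.
Proof.
move=> [_ _ g0 <-] xl; apply: cumul_support => r rx; apply: g0 => /andP[_ rl1].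
by have := lt_trans (le_lt_trans xl rx) rl1; rewrite ltxx.
Qed.

Lemma transition_itv l0 l1 g x : transition l0 l1 g -> 0 <= cumul g x <= 1.
Proof.
move=> [gi gp g0 g1]; have gx : mu.-integrable `]-oo, x] (EFin \o g) by exact: integrableS gi.
rewrite Rintegral_ge0//= -g1 /cumul /Rintegral fine_le//.
- exact: integrable_fin_num gx.
- exact: integrable_fin_num gi.
apply: ge0_subset_integral => //.
- exact: measurable_int gi.
- by move=> r _; rewrite lee_fin.
Qed.

Lemma transition_indic (l0 l1 : R) : l0 < l1 ->
  transition l0 l1 (fun r => (l1 - l0)^-1 * \1_(`]l0%R, l1%R[%classic : set R) r).
Proof.
move=> l01; have d0 : 0 < l1 - l0 by rewrite subr_gt0.
have mI : measurable (`]l0, l1[%classic : set (measurableTypeR R)) by [].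
have mE : (\int[mu]_x (\1_(`]l0%R, l1%R[%classic : set R) x)%:E = (l1 - l0)%:E)%E.
  rewrite integral_indic// setIT.
  by apply: (etrans (lebesgue_measure_itv `]l0, l1[)) => /=; rewrite lte_fin l01.
have i1 : mu.-integrable setT (EFin \o (\1_(`]l0%R, l1%R[%classic : set R) : R -> R)).
  apply/integrableP; split; first by apply/measurable_EFinP; exact: measurable_indic.
  have -> : (\int[mu]_x `|(EFin \o (\1_(`]l0%R, l1%R[%classic : set R) : R -> R)) x| =
      \int[mu]_x (\1_(`]l0%R, l1%R[%classic : set R) x)%:E)%E.
    by apply: eq_integral => x _; rewrite /= ger0_norm.
  by rewrite mE ltry.
have mT : measurable ([set: measurableTypeR R]) by [].
split.
- exact: (integrableZl mT _ i1).
- by move=> r; rewrite mulr_ge0// invr_ge0 ltW.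
- by move=> r rI; rewrite indicE memNset ?mulr0//= in_itv.
- rewrite RintegralZl// /Rintegral mE /=.
  by rewrite mulVf// gt_eqF.
Qed.

Section component.
Variables (v f : R -> R) (l0 al be r0 : R) (gl gr : R -> R).
Hypotheses (albe : al <= be) (pv : primitive_on `[al, be] v f).
Hypotheses (tl : transition l0 al gl) (tr : transition be r0 gr).

(** Its primitive rises from 0 to [v al] along [gl], follows [v] on [[al, be]], and returns from
    [v be] to 0 along [gr]. *)
Definition cutoff_density (r : R) : R :=
  (f \_ `[al, be]) r + v al * gl r + (- v be) * gr r.

Lemma integrable_cutoff_density : mu.-integrable setT (EFin \o cutoff_density).
Proof.
have [gli _ _ _] := tl; have [gri _ _ _] := tr.
have [fi _] := pv albe (fun _ => id).
do 2 (apply: integrableT_fun_linear => //).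
exact: integrable_patch fi.
Qed.

Lemma cumul_cutoff_densityE x : cumul cutoff_density x =
  cumul (f \_ `[al, be]) x + v al * cumul gl x + (- v be) * cumul gr x.
Proof.
have [gli _ _ _] := tl; have [gri _ _ _] := tr.
have [fi _] := pv albe (fun _ => id); have fi' := integrable_patch (measurable_itv _) fi.
by rewrite cumul_linear// ?cumul_linear//; exact: integrableT_fun_linear.
Qed.

Lemma cumul_patch_left x : x <= al -> cumul (f \_ `[al, be]) x = 0.
Proof.
move=> xal; apply: cumul0 => r rx; rewrite patchE memNset//= in_itv/=.
by rewrite leNgt (lt_le_trans rx xal).
Qed.

Lemma cumul_patch_right x : be <= x -> cumul (f \_ `[al, be]) x = v be - v al.
Proof.
move=> bex; have := primitive_cumul_patch pv (x := be); rewrite lexx albe => /(_ isT) ->.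
rewrite [RHS]addrC addKr !cumul_support// => r rb; rewrite patchE memNset//= in_itv/=.
- by apply/negP; rewrite negb_and orbC -ltNge rb.
- by apply/negP; rewrite negb_and orbC -ltNge (le_lt_trans bex).
Qed.

Lemma cutoff_inside x : al <= x <= be -> cumul cutoff_density x = v x.
Proof.
move=> /andP[alx xbe]; rewrite cumul_cutoff_densityE (transition_right tl alx).
rewrite (transition_left tr xbe) mulr0 mulr1 addr0 addrC.
by rewrite -(primitive_cumul_patch pv)// alx.
Qed.

Lemma cutoff_left x : x <= al -> cumul cutoff_density x = v al * cumul gl x.
Proof.
move=> xal; rewrite cumul_cutoff_densityE cumul_patch_left// add0r.
by rewrite (transition_left tr (le_trans xal albe)) mulr0 addr0.
Qed.

Lemma cutoff_right x : be <= x -> cumul cutoff_density x = v be * (1 - cumul gr x).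
Proof.
move=> bex; rewrite cumul_cutoff_densityE cumul_patch_right//.
by rewrite (transition_right tl (le_trans albe bex)); ring.
Qed.

Lemma cutoff_density_inside r : al <= r <= be -> cutoff_density r = f r.
Proof.
move=> /andP[alr rbe]; rewrite /cutoff_density patchE mem_set; last by rewrite /= in_itv/= alr.
have [_ _ gl0 _] := tl; have [_ _ gr0 _] := tr.
rewrite gl0 ?gr0 ?mulr0 ?addr0//.
- by move=> /andP[]; rewrite ltNge rbe.
- by move=> /andP[_]; rewrite ltNge alr.
Qed.

Lemma cutoff_density_outside r : ~ (l0 < r < r0) -> l0 <= al -> be <= r0 ->
  ~ (al <= r <= be) -> cutoff_density r = 0.
Proof.
move=> rI l0al ber0 rJ; rewrite /cutoff_density patchE memNset; last by rewrite /= in_itv.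
have [_ _ gl0 _] := tl; have [_ _ gr0 _] := tr.
rewrite gl0 ?gr0 ?mulr0 ?addr0// => /andP[h1 h2]; apply: rI.
  by rewrite h2 (le_lt_trans _ h1)// (le_trans l0al).
by rewrite h1 (lt_le_trans h2)// (le_trans albe).
Qed.

Lemma cutoff_outside x : (x <= l0 /\ l0 <= al) \/ (r0 <= x /\ be <= r0) ->
  cumul cutoff_density x = 0.
Proof.
case=> -[h1 h2].
  by rewrite cutoff_left ?(le_trans h1)// (transition_left tl h1) mulr0.
by rewrite cutoff_right ?(le_trans h2)// (transition_right tr h1) subrr mulr0.
Qed.

End component.

Lemma cumul_sum (s : seq (R * R)) (F : R * R -> R -> R) :
  (forall c, c \in s -> mu.-integrable setT (EFin \o F c)) ->
  mu.-integrable setT (EFin \o (fun r => \sum_(c <- s) F c r)) /\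
  forall x, cumul (fun r => \sum_(c <- s) F c r) x = \sum_(c <- s) cumul (F c) x.
Proof.
elim: s => [_|c s ih Hi].
  rewrite (_ : (fun r => _) = fun=> 0); last by apply/funext => r; rewrite big_nil.
  split; first by rewrite (_ : EFin \o _ = cst 0%E)//; exact: integrable0.
  by move=> x; rewrite big_nil cumul0.
have [|si sE] := ih; first by move=> c' c's; apply: Hi; rewrite inE c's orbT.
have ci := Hi c (mem_head _ _).
have e : (fun r => \sum_(c <- c :: s) F c r) = (fun r => F c r + 1 * \sum_(c <- s) F c r).
  by apply/funext => r; rewrite big_cons mul1r.
rewrite e; split; first exact: integrableT_fun_linear.
by move=> x; rewrite cumul_linear// sE big_cons mul1r.
Qed.

End cutoff_primitive.

Section open_cells.
Context {R : realType}.
Local Notation mu := (@lebesgue_measure R).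

(* [s] enumerates the components of the open set [J]. *)
Definition open_cells (J : set R) (s : seq (R * R)) :=
  [/\ open J, uniq s,
    (forall c, c \in s -> [/\ c.1 < c.2, `]c.1, c.2[ `<=` J, ~ J c.1 & ~ J c.2]) &
    forall r, J r -> exists2 c, c \in s & c.1 < r < c.2].

(** If two cells overlap, an end of one that is interior to the other would be a point of [J]; so
    they share both ends. *)
Lemma cells_order J s c c' : open_cells J s -> c \in s -> c' \in s -> c != c' ->
  c.2 <= c'.1 \/ c'.2 <= c.1.
Proof.
move=> [_ _ Hs _] /Hs[h1 h2 h3 h4] /Hs[h1' h2' h3' h4'] cc'.
have [|lt1] := leP c.2 c'.1; first by left.
have [|lt2] := leP c'.2 c.1; first by right.
case/negP : cc'.
have e1 : c.1 = c'.1.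
  case: (ltgtP c.1 c'.1) => // h; exfalso.
    by apply: h3'; apply: h2; rewrite /= in_itv/= h.
  by apply: h3; apply: h2'; rewrite /= in_itv/= h.
have e2 : c.2 = c'.2.
  case: (ltgtP c.2 c'.2) => // h; exfalso.
    by apply: h4; apply: h2'; rewrite /= in_itv/= h -e1 h1.
  by apply: h4'; apply: h2; rewrite /= in_itv/= h e1 h1'.
by move: e1 e2; case: c {h1 h2 h3 h4 lt1 lt2} => x y; case: c' {h1' h2' h3' h4'} => x' y' /= -> ->; exact: eqxx.
Qed.

Lemma compact_margin (J K : set R) : open J -> compact K -> K `<=` J ->
  exists2 d, 0 < d & forall x y, K x -> `|x - y| < d -> J y.
Proof.
move=> oJ /compact_near_coveringP cK KJ.
have := cK R (0^'+) (fun d x => forall y, `|x - y| < d -> J y) _.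
case=> [x Kx|d /= d0 Hd].
  have /nbhs_ballP[e /= e0 He] : nbhs x J by apply: open_nbhs_nbhs; split => //; exact: KJ.
  near=> z d => y yd; apply: He; rewrite /ball/=.
  have xz : `|x - z| < e / 2 by near: z; exists (e / 2) => //=; rewrite divr_gt0.
  have de : d < e / 2 by near: d; apply: nbhs_right_lt; rewrite divr_gt0.
  rewrite -(subrKA z); apply: (le_lt_trans (ler_normD _ _)).
  by rewrite [e]splitr ltrD// (lt_trans yd de).
exists (d / 2); first by rewrite divr_gt0.
move=> x y Kx xy; apply: (Hd (d / 2) _ _ x Kx y xy) => //=; last by rewrite divr_gt0.
by rewrite sub0r normrN gtr0_norm ?divr_gt0// ltr_pdivrMr// ltr_pMr// ltr1n.
Unshelve. all: by end_near. Qed.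

(** The factor 4 leaves at least half of each cell, midpoint included, after d is cut off at both
    ends. A common d exists because the cells are finitely many. *)
Lemma cells_margin (s : seq (R * R)) (d0 : R) : (forall c, c \in s -> c.1 < c.2) -> 0 < d0 ->
  exists d, [/\ 0 < d, d <= d0 & forall c, c \in s -> 4 * d <= c.2 - c.1].
Proof.
move=> Hs d00; elim: s Hs => [|c s ih] Hs; first by exists d0; split.
have [|d [dd dd0 Hd]] := ih; first by move=> c' c's; apply: Hs; rewrite inE c's orbT.
have c0 : c.1 < c.2 by apply: Hs; rewrite mem_head.
exists (Num.min d ((c.2 - c.1) / 4)); split.
- by rewrite lt_min dd/= divr_gt0// subr_gt0.
- by rewrite ge_min dd0.
move=> c'; rewrite inE => /predU1P[->|/Hd h].
  have : Num.min d ((c.2 - c.1) / 4) <= (c.2 - c.1) / 4 by rewrite ge_min lexx orbT.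
  lra.
have : Num.min d ((c.2 - c.1) / 4) <= d by rewrite ge_min lexx.
lra.
Qed.

Section glued.
Variables (v f : R -> R) (s : seq (R * R)) (l0 al be r0 : R * R -> R) (gl gr : R * R -> R -> R).
Hypothesis us : uniq s.
Hypothesis Hs : forall c, c \in s -> [/\ al c <= be c, primitive_on `[al c, be c] v f,
  transition (l0 c) (al c) (gl c) & transition (be c) (r0 c) (gr c)].
Hypothesis Hl : forall c, c \in s -> l0 c < al c /\ be c < r0 c.
Hypothesis Hd : forall c c', c \in s -> c' \in s -> c != c' -> r0 c' <= al c \/ be c <= l0 c'.

(** By [Hd] the transitions of one cell avoid the cores [[al c, be c]] of the others; transitions of
    neighbouring cells may overlap, and then simply add up. *)
Definition glued_density (r : R) : R :=
  \sum_(c <- s) cutoff_density v f (al c) (be c) (gl c) (gr c) r.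

Lemma integrable_glued : mu.-integrable setT (EFin \o glued_density) /\
  forall x, cumul glued_density x =
    \sum_(c <- s) cumul (cutoff_density v f (al c) (be c) (gl c) (gr c)) x.
Proof.
apply: cumul_sum => c /Hs[h1 h2 h3 h4]; exact: integrable_cutoff_density h1 h2 h3 h4.
Qed.

Lemma glued_inside c x : c \in s -> al c <= x <= be c ->
  cumul glued_density x = v x /\ glued_density x = f x.
Proof.
move=> cs xI; have [h1 h2 h3 h4] := Hs cs; have /andP[alx xbe] := xI.
rewrite integrable_glued.2 /glued_density !(bigD1_seq c)//=.
rewrite (cutoff_inside h1 h2 h3 h4 xI) (cutoff_density_inside v f h3 h4 xI).
suff H c' : c' \in s -> c' != c -> cumul (cutoff_density v f (al c') (be c') (gl c') (gr c')) x = 0 /\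
    cutoff_density v f (al c') (be c') (gl c') (gr c') x = 0.
  by rewrite !big1_seq ?addr0// => c' /andP[c'c /H[//|]].
move=> c's c'c; have [k1 k2 k3 k4] := Hs c's; have [m1 m2] := Hl c's.
have H : x <= l0 c' \/ r0 c' <= x.
  have [h|h] := Hd cs c's (ltac:(by rewrite eq_sym)).
    by right; rewrite (le_trans h).
  by left; rewrite (le_trans _ h).
split.
  by apply: (cutoff_outside k1 k2 k3 k4); case: H => H; [left|right]; split => //; exact: ltW.
have xI' : ~ (l0 c' < x < r0 c') by case: H => H; apply/negP; rewrite negb_and -!leNgt H ?orbT.
apply: (cutoff_density_outside v f k1 k3 k4 xI' (ltW m1) (ltW m2)).
case: H => H; apply/negP; rewrite negb_and -!ltNge.
  by rewrite (le_lt_trans H m1).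
by rewrite (lt_le_trans m2 H) orbT.
Qed.

Lemma glued_outside x : (forall c, c \in s -> ~ (l0 c < x < r0 c)) -> glued_density x = 0.
Proof.
move=> H; rewrite /glued_density big1_seq// => c /andP[_ cs].
have [h1 _ h3 h4] := Hs cs; have [m1 m2] := Hl cs.
apply: (cutoff_density_outside v f h1 h3 h4 (H c cs) (ltW m1) (ltW m2)) => /andP[k1 k2].
by apply: (H c cs); rewrite (lt_le_trans m1 k1) (le_lt_trans k2 m2).
Qed.

End glued.

(** A compact part of J keeps a positive distance from the complement, so it lies in the cores of
    cells cut slightly inside; the glued function is a primitive on the whole line of an integrable
    function that lives away from the origin. *)
Lemma localize_primitive (J K : set R) s (b : R) (v f : R -> R) : 0 < b -> J `<=` `]0, b[ ->
  open_cells J s -> primitive_on J v f -> compact K -> K `<=` J ->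
  exists F al be, [/\ 0 < al, al < be, mu.-integrable setT (EFin \o F),
    (forall r, ~ (al <= r <= be) -> F r = 0) &
    forall r, K r -> [/\ al < r < be, cumul F r = v r & F r = f r]].
Proof.
move=> b0 Jb cJ pv cK KJ; have [oJ us Hs Jc] := cJ.
have [d0 d00 Hd0] := compact_margin oJ cK KJ.
(* The bound by b makes [[d / 2, b]], outside of which the density vanishes, a nondegenerate
   segment. *)
have m0 : 0 < Num.min d0 b by rewrite lt_min d00.
have [|d [dd dd0 Hd]] := cells_margin (s := s) _ m0; first by move=> c /Hs[].
have [dd1 db] : d <= d0 /\ d <= b by move: dd0; rewrite le_min => /andP.
pose l0 (c : R * R) := c.1 + d / 2; pose al (c : R * R) := c.1 + d.
pose be (c : R * R) := c.2 - d; pose r0 (c : R * R) := c.2 - d / 2.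
have d20 : 0 < d / 2 by rewrite divr_gt0.
have d2d : d / 2 < d by rewrite ltr_pdivrMr// ltr_pMr// ltr1n.
have l0al c : l0 c < al c by rewrite /l0 /al ltrD2l.
have ber0 c : be c < r0 c by rewrite /be /r0 ltrD2l ltrN2.
have albe c : c \in s -> al c <= be c by move=> /Hd h; rewrite /al /be; lra.
pose gl c := fun r => (al c - l0 c)^-1 * \1_(`]l0 c, al c[%classic : set R) r.
pose gr c := fun r => (r0 c - be c)^-1 * \1_(`]be c, r0 c[%classic : set R) r.
have HS c : c \in s -> [/\ al c <= be c, primitive_on `[al c, be c] v f,
    transition (l0 c) (al c) (gl c) & transition (be c) (r0 c) (gr c)].
  move=> cs; have [c12 cJs _ _] := Hs c cs; split.
  - exact: albe.
  - apply: primitive_onS pv; apply: subset_trans cJs; apply: subset_itv; rewrite bnd_simp.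
      by rewrite /al ltrDl.
    by rewrite /be gtrBl.
  - exact: transition_indic.
  - exact: transition_indic.
have HL c : c \in s -> l0 c < al c /\ be c < r0 c by [].
have HD c c' : c \in s -> c' \in s -> c != c' -> r0 c' <= al c \/ be c <= l0 c'.
  move=> cs c's cc'; have [h|h] := cells_order cJ cs c's cc'.
    by right; rewrite /be /l0; lra.
  by left; rewrite /r0 /al; lra.
have Jpos r : J r -> 0 < r < b by move=> /Jb; rewrite /= in_itv.
have c1pos c : c \in s -> 0 <= c.1 /\ c.2 <= b.
  move=> /Hs[c12 cJs _ _]; split; rewrite leNgt; apply/negP => h.
    have [m1 m2] : c.1 < Num.min 0 c.2 /\ Num.min 0 c.2 <= 0 by rewrite lt_min h c12 ge_min lexx.
    have : J ((c.1 + Num.min 0 c.2) / 2).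
      apply: cJs; rewrite /= in_itv/=; have : Num.min 0 c.2 <= c.2 by rewrite ge_min lexx orbT.
      by move=> m3; apply/andP; split; lra.
    by move/Jpos => /andP[h1 _]; lra.
  have [m1 m2] : Num.max b c.1 < c.2 /\ b <= Num.max b c.1 by rewrite gt_max h c12 le_max lexx.
  have : J ((Num.max b c.1 + c.2) / 2).
    apply: cJs; rewrite /= in_itv/=; have : c.1 <= Num.max b c.1 by rewrite le_max lexx orbT.
    by move=> m3; apply/andP; split; lra.
  by move/Jpos => /andP[_ h1]; lra.
exists (glued_density v f s al be gl gr), (d / 2), b; split => //.
- exact: lt_le_trans d2d db.
- exact: (integrable_glued HS).1.
- move=> r rI; apply: (glued_outside HS HL) => c cs /andP[h1 h2].
  have [k1 k2] := c1pos c cs; apply: rI; move: h1 h2; rewrite /l0 /r0 => h1 h2.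
  by apply/andP; split; lra.
move=> r Kr; have [c cs /andP[c1r rc2]] := Jc r (KJ r Kr).
have [c12 cJs Jc1 Jc2] := Hs c cs.
have rI : al c <= r <= be c.
  apply/andP; split; rewrite leNgt; apply/negP => h.
    apply: Jc1; apply: (Hd0 r) => //; rewrite ger0_norm ?subr_ge0 1?ltW//.
    by move: h; rewrite /al; lra.
  apply: Jc2; apply: (Hd0 r) => //; rewrite distrC ger0_norm ?subr_ge0 1?ltW//.
  by move: h; rewrite /be; lra.
have [-> ->] := glued_inside us HS HL HD cs rI; split => //.
have [k1 k2] := c1pos c cs; move: rI; rewrite /al /be => /andP[h1 h2].
by apply/andP; split; lra.
Qed.

Lemma primitive_measurable (J : set R) (v f : R -> R) : open J -> primitive_on J v f ->
  measurable_fun J v.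
Proof.
move=> oJ pv; apply: open_continuous_measurable_fun => // x /set_mem Jx.
have [||al [be [alx xbe sub]]] := @open_segment_enlarge R J x x oJ; first by [].
  by move=> y; rewrite /= in_itv/= => /andP[h1 h2]; rewrite (_ : y = x)//; apply/eqP; rewrite eq_le h1 h2.
exact: primitive_continuous (primitive_onS sub pv) alx xbe.
Qed.

Lemma primitive_weak_derivative (J : set R) s (b : R) (v f : R -> R) : 0 < b -> J `<=` `]0, b[ ->
  open_cells J s -> measurable_fun J f -> primitive_on J v f -> weak_derivative J v f.
Proof.
move=> b0 Jb cJ mf pv; have [oJ _ _ _] := cJ.
have mJ : measurable J by exact: open_measurable.
split.
- split=> // [|K KJ cK]; first exact: primitive_measurable pv.
  have [F [al [be [_ _ Fi _ HF]]]] := localize_primitive b0 Jb cJ pv cK KJ.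
  have mK : measurable K := compact_measurable cK.
  have -> : (\int[mu]_(x in K) `|v x|%:E = \int[mu]_(x in K) `|(cumul F x)%:E|)%E.
    by apply: eq_integral => x /set_mem/HF[_ -> _].
  have : mu.-integrable K (EFin \o cumul F).
    apply: continuous_compact_integrable => //; apply: continuous_subspaceT; exact: continuous_cumul.
  by case/integrableP.
- split=> // K KJ cK.
  have [F [al [be [_ _ Fi _ HF]]]] := localize_primitive b0 Jb cJ pv cK KJ.
  have mK : measurable K := compact_measurable cK.
  have -> : (\int[mu]_(x in K) `|f x|%:E = \int[mu]_(x in K) `|(F x)%:E|)%E.
    by apply: eq_integral => x /set_mem/HF[_ _ ->].
  have : mu.-integrable K (EFin \o F) by exact: integrableS Fi.
  by case/integrableP.
move=> phi [sphi [K [cK KJ] phi0]].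
have [F [al [be [_ _ Fi _ HF]]]] := localize_primitive b0 Jb cJ pv cK KJ.
have := ibp_test_function (measurable_cumul Fi) (primitive_cumul Fi) sphi cK KJ phi0.
have clK : closed K := compact_closed (@Rhausdorff R) cK.
have -> : (\int[mu]_(r in J) (v r * derive1 phi r)%:E =
    \int[mu]_(r in J) (cumul F r * derive1 phi r)%:E)%E.
  apply: eq_integral => r _; have [Kr|Kr] := pselect (K r); first by have [_ ->] := HF r Kr.
  by rewrite derive1E (derive_support _ clK phi0)// !mulr0.
have -> // : (\int[mu]_(r in J) (f r * phi r)%:E = \int[mu]_(r in J) (F r * phi r)%:E)%E.
apply: eq_integral => r _; have [Kr|Kr] := pselect (K r); first by have [_ _ ->] := HF r Kr.
by rewrite phi0// !mulr0.
Qed.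

End open_cells.

(** * Weak gradients of radial functions *)

Section weak_gradient.
Context {R : realType}.
Local Notation mu := (@lebesgue_measure R).

Lemma compact_measurable_rV n (K : set 'rV[R]_n) : compact K -> measurable K.
Proof.
move=> /compact_closed_rV cK; rewrite -(setCK K); apply: measurableC.
by apply: open_measurable_rV; exact: closed_openC.
Qed.

Lemma test_function_bounded (V : normedModType R) (U : set V) (phi : V -> R) : test_function U phi ->
  exists2 B, 0 <= B & forall x, `|phi x| <= B.
Proof.
move=> [sphi [K [cK KU] phi0]]; have [cphi _] := sphi [::].
have [B [_ HB]] := compact_bounded (continuous_compact (continuous_subspaceT cphi) cK).
exists (`|B| + 1); first by rewrite addr_ge0.
move=> x; have [Kx|Kx] := pselect (K x); last by rewrite phi0// normr0 addr_ge0.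
by apply: (HB (`|B| + 1)); [rewrite (le_lt_trans (ler_norm _))// ltrDl|exists x].
Qed.

Lemma integrable_test_function n (U : set 'rV[R]_n) (g phi : 'rV[R]_n -> R) :
  locally_integrable_rV U g -> test_function U phi ->
  (leb n).-integrable U (EFin \o (fun x => g x * phi x)).
Proof.
move=> [mg oU gK] tphi; have [B B0 HB] := test_function_bounded tphi.
have [sphi [K [cK KU] phi0]] := tphi.
have [cphi _ _] := smooth_partial 0 sphi.
have mU := open_measurable_rV oU; have mK := compact_measurable_rV cK.
have mgp : measurable_fun U (fun x => g x * phi x).
  by apply: measurable_funM => //; apply: measurable_funTS; exact: continuous_measurable_rV.
apply/integrableP; split; first exact/measurable_EFinP.
rewrite (@eq_integral_support _ _ _ _ K U K)//; last by move=> x /phi0 e; rewrite /= e mulr0 normr0.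
apply: (@le_lt_trans _ _ (\int[leb n]_(x in K) (B%:E * `|g x|%:E))%E).
  apply: ge0_le_integral => //.
  - by apply: measurableT_comp => //; apply/measurable_EFinP; exact: measurable_funS mgp.
  - apply: emeasurable_funM => //; apply/measurable_EFinP; apply: measurableT_comp => //.
    exact: measurable_funS mg.
  - by move=> x _; rewrite /= lee_fin normrM mulrC ler_wpM2r.
rewrite ge0_integralZl//; last first.
  by apply/measurable_EFinP; apply: measurableT_comp => //; exact: measurable_funS mg.
by rewrite lte_mul_pinfty ?lee_fin//; exact: gK.
Qed.

Lemma weak_gradient_ae n (U : set 'rV[R]_n) (u u' : 'rV[R]_n -> R) G (N : set 'rV[R]_n) :
  measurable N -> leb n N = 0%E -> (forall x, U x -> ~ N x -> u x = u' x) ->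
  measurable_fun U u' -> weak_gradient U u G -> weak_gradient U u' G.
Proof.
move=> mN N0 uu' mu' [[mu oU uK] H]; split.
  split => // K KU cK; rewrite -(@eq_integral_off_null _ _ _ _ K N (fun x => `|u x|%:E))//.
    exact: uK.
  by move=> x /KU Ux Nx; rewrite uu'.
move=> i; have [h1 h2] := H i; split => // phi /h2 <-.
by apply: (eq_integral_off_null mN N0) => x Ux Nx; rewrite uu'.
Qed.

(** The fundamental lemma applied to each coordinate of the difference. *)
Lemma weak_gradient_unique n (U : set 'rV[R]_n) (u : 'rV[R]_n -> R) G G' :
  weak_gradient U u G -> weak_gradient U u G' ->
  exists2 N, measurable N /\ leb n N = 0%E & forall x, U x -> ~ N x -> G x = G' x.
Proof.
move=> [[_ oU _] H] [_ H'].
have mU := open_measurable_rV oU.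
have Hi (i : 'I_n) : exists N, (measurable N /\ leb n N = 0%E) /\
    forall x, U x -> ~ N x -> G x ord0 i = G' x ord0 i.
  have [[mg _ gK] h] := H i; have [[mg' _ gK'] h'] := H' i.
  have [||N N0 HN] := @zero_of_test_functions R n U (fun x => G x ord0 i - G' x ord0 i).
  - split => // [|K KU cK]; first exact: measurable_funB.
    have mK := compact_measurable_rV cK.
    apply: (@le_lt_trans _ _ (\int[leb n]_(x in K) (`|G x ord0 i|%:E + `|G' x ord0 i|%:E))%E).
      apply: ge0_le_integral => //.
      + apply/measurable_EFinP; apply: measurableT_comp => //.
        by apply: measurable_funB; [exact: measurable_funS mg|exact: measurable_funS mg'].
      + apply: emeasurable_funD; apply/measurable_EFinP; apply: measurableT_comp => //.
          exact: measurable_funS mg.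
        exact: measurable_funS mg'.
      + by move=> x _; rewrite -EFinD lee_fin ler_normB.
    rewrite ge0_integralD//; first by rewrite lte_add_pinfty//; [exact: gK|exact: gK'].
      by apply/measurable_EFinP; apply: measurableT_comp => //; exact: measurable_funS mg.
    by apply/measurable_EFinP; apply: measurableT_comp => //; exact: measurable_funS mg'.
  - move=> phi tphi.
    have i1 := @integrable_test_function n U _ phi (And3 mg oU gK) tphi.
    have i2 := @integrable_test_function n U _ phi (And3 mg' oU gK') tphi.
    have e : (\int[leb n]_(x in U) (G x ord0 i * phi x)%:E =
        \int[leb n]_(x in U) (G' x ord0 i * phi x)%:E)%E.
      by apply: oppe_inj; rewrite -h// -h'.
    rewrite (eq_integral (fun x => (G x ord0 i * phi x)%:E - (G' x ord0 i * phi x)%:E))%E; last first.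
      by move=> x _; rewrite -EFinB mulrBl.
    rewrite integralB// e subee//; exact: integrable_fin_num i2.
  - by exists N; split => // x Ux Nx; apply/eqP; rewrite -subr_eq0; apply/eqP; exact: HN.
have [N HN] := choice Hi.
exists (\bigcup_i N i); first by apply: null_set_bigcup => i; have [] := HN i.
move=> x Ux Nx; apply/rowP => i; have [_ h] := HN i; apply: h => // Nix.
by apply: Nx; exists i.
Qed.

Definition radial_field n (f : R -> R) (x : 'rV[R]_n) : 'rV[R]_n := (f (enorm x) / enorm x) *: x.

Lemma open_enorm_preimage n (J : set R) : open J -> open (@enorm R n @^-1` J).
Proof. by move=> oJ; apply: open_comp => // x _; exact: continuous_enorm. Qed.

Lemma compact_continuous_lty n (K : set 'rV[R]_n) (h : 'rV[R]_n -> R) : compact K ->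
  continuous h -> (\int[leb n]_(x in K) `|h x|%:E < +oo)%E.
Proof.
move=> cK ch; have mK := compact_measurable_rV cK.
have [B [_ HB]] := compact_bounded (continuous_compact (continuous_subspaceT ch) cK).
have HB' x : K x -> `|h x| <= `|B| + 1.
  by move=> Kx; apply: (HB (`|B| + 1)); [rewrite (le_lt_trans (ler_norm _))// ltrDl|exists x].
apply: (@le_lt_trans _ _ (\int[leb n]_(x in K) (`|B| + 1)%:E)%E).
  apply: ge0_le_integral => //.
  apply/measurable_EFinP; apply: measurableT_comp => //; apply: measurable_funTS.
  exact: continuous_measurable_rV.
rewrite integral_cst// lte_mul_pinfty ?lee_fin ?addr_ge0//.
have [M KM] := rV_compact_cbox cK; apply: le_lt_trans (leb_cbox_lty n M).
by apply: le_measure; rewrite ?inE//; exact: measurable_cbox.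
Qed.

(** On the support of a test function [v] and [f] may be replaced by a localized primitive and its
    density, to which [radial_ibp] applies. *)
Lemma primitive_weak_gradient n (J : set R) s (b : R) (v f : R -> R) : (0 < n)%N ->
  0 < b -> J `<=` `]0, b[ -> open_cells J s -> measurable_fun J f -> primitive_on J v f ->
  weak_gradient (@enorm R n @^-1` J) (v \o enorm) (radial_field f).
Proof.
move=> n0 b0 Jb cJ mf pv; have [oJ _ _ _] := cJ.
have mJ : measurable J by exact: open_measurable.
have oU := @open_enorm_preimage n J oJ; have mU := open_measurable_rV oU.
have mv := primitive_measurable oJ pv.
have mcomp (h : R -> R) : measurable_fun J h -> measurable_fun (@enorm R n @^-1` J) (h \o enorm).
  move=> mh; apply: (measurable_comp mJ) => //; first by move=> _ [x Jx <-].
  by apply: measurable_funTS; exact: measurable_enorm.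
have loc (K : set 'rV[R]_n) : compact K -> K `<=` @enorm R n @^-1` J ->
    exists F al be, [/\ 0 < al, al < be, mu.-integrable setT (EFin \o F),
      (forall r, ~ (al <= r <= be) -> F r = 0) &
      forall x, K x -> [/\ shell al be x, cumul F (enorm x) = v (enorm x) & F (enorm x) = f (enorm x)]].
  move=> cK KU; have cK' := continuous_compact (continuous_subspaceT (@continuous_enorm R n)) cK.
  have [|F [al [be [h1 h2 h3 h4 h5]]]] := localize_primitive b0 Jb cJ pv cK'.
    by move=> _ [x Kx <-]; exact: KU.
  by exists F, al, be; split => // x Kx; apply: h5; exists x.
split.
  split => //; first exact: mcomp.
  move=> K KU cK; have [F [al [be [_ _ Fi _ HF]]]] := loc K cK KU.
  have -> : (\int[leb n]_(x in K) `|(v \o enorm) x|%:E =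
      \int[leb n]_(x in K) `|cumul F (enorm x)|%:E)%E.
    by apply: eq_integral => x /set_mem/HF[_ /= -> _].
  apply: compact_continuous_lty => // x.
  by apply: continuous_comp; [exact: continuous_enorm|exact: continuous_cumul].
move=> i; split.
  split => //.
    rewrite (_ : (fun x => _) = (fun x => (f \o enorm) x * (enorm x `^ (-1) * x ord0 i))); last first.
      by apply/funext => x; rewrite mxE powR_inv1 ?enorm_ge0// mulrA.
    apply: measurable_funM; first exact: mcomp.
    apply: measurable_funTS; apply: measurable_funM; last exact: measurable_coord.
    apply: (@measurableT_comp _ _ _ _ _ _ (fun r : R => r `^ (-1))) => //.
    exact: measurable_enorm.
  move=> K KU cK; have [F [al [be [al0 albe Fi F0 HF]]]] := loc K cK KU.
  have mK := compact_measurable_rV cK.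
  have FiE : mu.-integrable `[al, be] (EFin \o F) by exact: integrableS Fi.
  have mF : measurable_fun setT (fun x : 'rV[R]_n => (F \_ `[al, be]) (enorm x)).
    apply: measurableT_comp (@measurable_enorm R n).
    exact: measurable_integrable (integrable_patch (measurable_itv _) FiE).
  apply: (@le_lt_trans _ _ (\int[leb n]_(x in K) `|(F \_ `[al, be]) (enorm x)|%:E)%E).
    apply: (ge0_le_integral_off_null measurable0 (measure0 _)) => // x Kx _.
    have [sx _ e] := HF x Kx; have /andP[h1 h2] := sx.
    rewrite patchE mem_set; last by rewrite /= in_itv/= !ltW.
    rewrite lee_fin mxE e mulrAC -mulrA normrM -[leRHS]mulr1 ler_wpM2l//.
    exact: coord_div_enorm.
  apply: (@le_lt_trans _ _ (\int[leb n]_x `|(F \_ `[al, be]) (enorm x)|%:E)%E).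
    apply: ge0_subset_integral => //.
    by apply/measurable_EFinP; exact: measurableT_comp.
  apply: (le_lt_trans (radial_patch_le i al0 albe FiE)).
  rewrite lte_mul_pinfty//; first by rewrite lee_fin (area_ge0 i al0 albe).
  by have /integrableP[] := FiE.
move=> phi [sphi [K [cK KU] phi0]].
have [F [al [be [al0 albe Fi F0 HF]]]] := loc K cK KU.
have Fa : F \_ `[al, be] = F.
  apply/funext => r; rewrite patchE; case: ifPn => // /negP rI; rewrite F0// => h.
  by apply: rI; rewrite inE /= in_itv.
have FiE : mu.-integrable `[al, be] (EFin \o F) by exact: integrableS Fi.
have Ksh : K `<=` shell al be by move=> x /HF[].
have := radial_ibp i al0 albe sphi cK Ksh phi0 FiE; rewrite /radial_defect Fa => E.
have i1 := integrable_radial_term1 i sphi cK phi0 Fi.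
have i2 := integrable_radial_term2 i al0 albe sphi cK phi0 FiE; rewrite Fa in i2.
have D0 x : ~ K x -> 'D_(delta_mx ord0 i) phi x = 0.
  by apply: (@derive_support R 'rV[R]_n K phi _ _ _ phi0); exact: compact_closed_rV.
have -> : (\int[leb n]_(x in enorm @^-1` J) ((v \o enorm) x * 'D_(delta_mx ord0 i) phi x)%:E =
    \int[leb n]_x (cumul F (enorm x) * 'D_(delta_mx ord0 i) phi x)%:E)%E.
  rewrite [RHS](@eq_integral_support _ _ _ _ K setT (enorm @^-1` J))//; last first.
    by move=> x Kx; rewrite D0// mulr0.
  apply: eq_integral => x _; have [Kx|Kx] := pselect (K x); last by rewrite D0// !mulr0.
  by have [_ /= -> _] := HF x Kx.
have -> : (\int[leb n]_(x in enorm @^-1` J) (radial_field f x ord0 i * phi x)%:E =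
    \int[leb n]_x (F (enorm x) * (x ord0 i / enorm x) * phi x)%:E)%E.
  rewrite [RHS](@eq_integral_support _ _ _ _ K setT (enorm @^-1` J))//; last first.
    by move=> x Kx; rewrite phi0// mulr0.
  apply: eq_integral => x _; have [Kx|Kx] := pselect (K x); last by rewrite phi0// !mulr0.
  have [_ _ ->] := HF x Kx; rewrite mxE; congr (_ * _)%:E; ring.
have F1 := integrable_fin_num measurableT i1; have F2 := integrable_fin_num measurableT i2.
move: E; rewrite /Rintegral => /eqP; rewrite addr_eq0 => /eqP E.
rewrite -(fineK F1) -(fineK F2) -EFinN; congr EFin; exact: E.
Qed.

End weak_gradient.

(** * The regular set and the auxiliary weight *)

Section regular_set.
Context {R : realType}.
Local Notation mu := (@lebesgue_measure R).
Variables (p a b : R) (eta : R -> R).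
Local Notation I := (regular_set p a b eta).
Local Notation comps := (regular_components p a b eta).

Lemma open_regular_set : open I.
Proof.
move=> r [/andP[ar rb] [e e0 ei]]; apply/nbhs_ballP.
exists (Num.min (e / 2) (Num.min (r - a) (b - r))) => /=.
  by rewrite !lt_min divr_gt0//= !subr_gt0 ar.
move=> s; rewrite /ball/= !lt_min ltr_norml => /andP[/andP[h1 h2]].
rewrite !ltr_norml => /andP[/andP[h3 h4] /andP[h5 h6]]; split.
  by apply/andP; split; lra.
exists (e / 2); first by rewrite divr_gt0.
by apply: integrableS ei => //; apply: subset_itv; rewrite bnd_simp; lra.
Qed.

Lemma regular_set_sub : I `<=` `]a, b[.
Proof. by move=> r [rab _]; rewrite /= in_itv. Qed.

Lemma open_interval_component (J : set R) (r : R) : open J -> has_lbound J -> has_ubound J -> J r ->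
  connected_component J r = `]inf (connected_component J r), sup (connected_component J r)[%classic.
Proof.
move=> oJ [l lJ] [u uJ] Jr; set C := connected_component J r.
have CJ : C `<=` J by exact: connected_component_sub.
have iC : is_interval C by apply/connected_intervalP; exact: component_connected.
have oC : open C.
  move=> x Cx; have Jx := CJ x Cx.
  have /nbhs_ballP[e /= e0 He] : nbhs x J by exact: open_nbhs_nbhs.
  apply/nbhs_ballP; exists e => //= y xy.
  have cb : connected (ball x e).
    apply/connected_intervalP => y1 y2; rewrite /ball/= !ltr_norml => /andP[h1 h2] /andP[h3 h4] z /andP[h5 h6].
    by rewrite ltr_norml; apply/andP; split; lra.
  rewrite /C (same_connected_component Cx).
  by apply: (connected_component_max _ He cb) => //; exact: ballxx.
have := interval_bounded_interior iC (ex_intro _ l (fun x Cx => lJ x (CJ x Cx)))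
  (ex_intro _ u (fun x Cx => uJ x (CJ x Cx))).
by rewrite (interior_id C).1// => ->; apply/seteqP; split => x; rewrite /= in_itv.
Qed.

(** An end that belonged to [J] would have a ball inside [J] meeting the component, hence be a point
    of the component. *)
Lemma component_endpoint (J : set R) (r : R) (c : R * R) : open J -> J r ->
  connected_component J r = `]c.1, c.2[%classic -> [/\ c.1 < c.2, ~ J c.1 & ~ J c.2].
Proof.
move=> oJ Jr e; have Cr : connected_component J r r by exact: connected_component_refl.
have /andP[c1r rc2] : c.1 < r < c.2 by move: Cr; rewrite e /= in_itv.
have c12 := lt_trans c1r rc2.
have H x : J x -> (forall d, 0 < d -> exists2 y, ball x d y & c.1 < y < c.2) -> c.1 < x < c.2.
  move=> Jx Hx; have /nbhs_ballP[d /= d0 Hd] : nbhs x J by exact: open_nbhs_nbhs.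
  have cb : connected (ball x d).
    apply/connected_intervalP => y1 y2; rewrite /ball/= !ltr_norml => /andP[h1 h2] /andP[h3 h4] z /andP[h5 h6].
    by rewrite ltr_norml; apply/andP; split; lra.
  have [y yd yc] := Hx d d0.
  have Cy : connected_component J r y by rewrite e /= in_itv.
  have : connected_component J r x.
    rewrite (same_connected_component Cy).
    by apply: (connected_component_max yd Hd cb); exact: ballxx.
  by rewrite e /= in_itv.
split => // Jc.
- have : c.1 < c.1 < c.2; last by rewrite ltxx.
  apply: H => // d d0; have m0 : 0 < Num.min (d / 2) ((c.2 - c.1) / 2).
    by rewrite lt_min !divr_gt0// subr_gt0.
  have m1 : Num.min (d / 2) ((c.2 - c.1) / 2) <= d / 2 by rewrite ge_min lexx.
  have m2 : Num.min (d / 2) ((c.2 - c.1) / 2) <= (c.2 - c.1) / 2 by rewrite ge_min lexx orbT.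
  exists (c.1 + Num.min (d / 2) ((c.2 - c.1) / 2)).
    by rewrite /ball/= opprD addNKr normrN gtr0_norm//; lra.
  by apply/andP; split; lra.
- have : c.1 < c.2 < c.2; last by rewrite ltxx andbF.
  apply: H => // d d0; have m0 : 0 < Num.min (d / 2) ((c.2 - c.1) / 2).
    by rewrite lt_min !divr_gt0// subr_gt0.
  have m1 : Num.min (d / 2) ((c.2 - c.1) / 2) <= d / 2 by rewrite ge_min lexx.
  have m2 : Num.min (d / 2) ((c.2 - c.1) / 2) <= (c.2 - c.1) / 2 by rewrite ge_min lexx orbT.
  exists (c.2 - Num.min (d / 2) ((c.2 - c.1) / 2)).
    by rewrite /ball/= opprB addrC subrK gtr0_norm//; lra.
  by apply/andP; split; lra.
Qed.

Lemma regular_open_cells : finite_set comps ->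
  exists2 s, open_cells I s & forall c, comps c <-> c \in s.
Proof.
move=> /finite_seqP[s0 sE]; exists (undup s0); last by move=> c; rewrite sE /= mem_undup.
have oI := open_regular_set; split => //; first exact: undup_uniq.
- move=> c; rewrite mem_undup => cs; have : comps c by rewrite sE.
  move=> [r Ir e]; have [h1 h2 h3] := component_endpoint oI Ir e; split => //.
  by rewrite -e; exact: connected_component_sub.
- move=> r Ir.
  have lI : has_lbound I by exists a => x /regular_set_sub; rewrite /= in_itv/= => /andP[/ltW].
  have uI : has_ubound I by exists b => x /regular_set_sub; rewrite /= in_itv/= => /andP[_ /ltW].
  have e := open_interval_component oI lI uI Ir.
  exists (inf (connected_component I r), sup (connected_component I r)).
    have : comps (inf (connected_component I r), sup (connected_component I r)) by exists r.
    by rewrite sE /= mem_undup.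
  have := connected_component_refl Ir; by rewrite {1}e /= in_itv.
Qed.

Lemma itvoo_shrink (r e z d : R) : `|r - z| < e / 2 -> d < e / 2 ->
  `]z - d, z + d[ `<=` `]r - e, r + e[.
Proof.
rewrite ltr_norml => /andP[h1 h2] de.
by apply: subset_itv; rewrite bnd_simp; lra.
Qed.

(** Compactness gives a common radius e; integrability then propagates along the segment in steps of
    e / 2. *)
Lemma locally_integrable_itv (g : R -> \bar R) (x y : R) :
  (forall r, x <= r <= y -> exists2 e, 0 < e & mu.-integrable `]r - e, r + e[ g) ->
  mu.-integrable `[x, y] g.
Proof.
move=> H; have /compact_near_coveringP cK := @segment_compact R x y.
have := cK R (0^'+) (fun d r => mu.-integrable `]r - d, r + d[ g) _.
case=> [r rI|d /= d0 Hd].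
  have [e e0 ei] := H r rI; near=> z d.
  have xz : `|r - z| < e / 2 by near: z; exists (e / 2) => //=; rewrite divr_gt0.
  have de : d < e / 2 by near: d; apply: nbhs_right_lt; rewrite divr_gt0.
  by apply: integrableS ei => //; exact: itvoo_shrink.
pose e := d / 2; have e0 : 0 < e by rewrite divr_gt0.
have He r : x <= r <= y -> mu.-integrable `]r - e, r + e[ g.
  move=> rI; apply: (Hd e) => //=.
  by rewrite sub0r normrN gtr0_norm// ltr_pdivrMr// ltr_pMr// ltr1n.
have step (n : nat) z : z <= y -> x <= z <= x + n%:R * (e / 2) -> mu.-integrable `[x, z] g.
  elim: n z => [|n ih] z zy /andP[xz].
    rewrite mul0r addr0 => zx; have -> : z = x by apply/eqP; rewrite eq_le zx.
    apply: integrableS (He x _) => //; last by rewrite lexx (le_trans xz zy).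
    by apply: subset_itv; rewrite bnd_simp; lra.
  move=> zn; have [zx|xz'] := leP z (x + e / 2).
    apply: integrableS (He x _) => //; last by rewrite lexx (le_trans xz zy).
    by apply: subset_itv; rewrite bnd_simp; lra.
  have i1 : mu.-integrable `[x, z - e / 2] g.
    apply: ih; first by lra.
    by move: zn; rewrite -natr1 mulrDl mul1r => zn; apply/andP; split; lra.
  have i2 : mu.-integrable `]z - e / 2, z] g.
    apply: integrableS (He z _) => //; last by rewrite xz.
    by apply: subset_itv; rewrite bnd_simp; lra.
  have -> : `[x, z]%classic = `[x, z - e / 2]%classic `|` `]z - e / 2, z]%classic.
    apply/seteqP; split => t; rewrite /= !in_itv/=.
      move=> /andP[xt tz]; case: (leP t (z - e / 2)) => h; [left|right]; by rewrite ?xt ?tz.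
    by case=> /andP[h1 h2]; apply/andP; split; lra.
  apply/integrableP; split.
    by apply/measurable_funU => //; split; [exact: measurable_int i1|exact: measurable_int i2].
  rewrite ge0_integral_setU//.
  - by apply: lte_add_pinfty; [have /integrableP[] := i1|have /integrableP[] := i2].
  - apply: measurableT_comp => //.
    by apply/measurable_funU => //; split; [exact: measurable_int i1|exact: measurable_int i2].
  - rewrite disj_set2E; apply/eqP/seteqP; split => // t [] /=; rewrite !in_itv/=.
    by move=> /andP[_ h1] /andP[h2 _]; have := le_lt_trans h1 h2; rewrite ltxx.
have [yx|xy] := ltP y x.
  rewrite set_itv_ge ?bnd_simp -?ltNge//; exact: integrable_set0.
have [n Hn] : exists n : nat, (y - x) / (e / 2) < n%:R.
  by exists (Num.trunc ((y - x) / (e / 2))).+1; exact: truncnS_gt.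
apply: (step n) => //; rewrite xy/=.
by move: Hn; rewrite ltr_pdivrMr ?divr_gt0// => /ltW; lra.
Unshelve. all: by end_near. Qed.

End regular_set.

Section radial_null.
Context {R : realType}.
Local Notation mu := (@lebesgue_measure R).

Lemma null_set_enorm n (N : set R) : (0 < n)%N -> measurable N -> mu N = 0%E ->
  measurable (@enorm R n @^-1` N) /\ leb n (enorm @^-1` N) = 0%E.
Proof.
move=> n0 mN N0; have mE : measurable (@enorm R n @^-1` N).
  by rewrite -[X in measurable X]setTI; exact: measurable_enorm.
split => //; rewrite -(setIT (enorm @^-1` N)) -integral_indic//.
have mI : measurable_fun setT (fun r => (\1_N r)%:E : \bar R).
  by apply/measurable_EFinP; exact: measurable_indic.
rewrite (@ge0_integral_radial R n (fun r => (\1_N r)%:E) n0 mI)//.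
rewrite (@eq_integral_off_null _ (measurableTypeR R) R mu setT N _ (cst 0%E))//.
  by rewrite integral0.
by move=> r _ Nr; rewrite indicE memNset// mul0e.
Qed.

(** Here [h] may be infinite on a null set, as the kernel of the weight is where [eta] vanishes; [g]
    is a measurable real version of [h] times the Jacobian. *)
Lemma integral_radial_ae n (D N : set R) (h : R -> \bar R) (g : R -> R) : (0 < n)%N ->
  measurable D -> D `<=` `]0, +oo[ -> measurable N -> mu N = 0%E ->
  measurable_fun D g -> (forall r, D r -> 0 <= g r) ->
  (forall r, D r -> ~ N r -> (h r * (r ^+ n.-1)%:E = (g r)%:E)%E) ->
  (\int[leb n]_(x in enorm @^-1` D) h (enorm x) =
   (sphere_area n)%:E * \int[mu]_(r in D) (g r)%:E)%E.
Proof.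
move=> n0 mD Dpos mN N0 mg g0 hg.
have [mN' N'0] := null_set_enorm n0 mN N0.
have mrn : measurable_fun setT (fun r : R => (r `^ (- n.-1%:R))%R) by exact: measurable_powR.
have Dr r : D r -> 0 < r by move=> /Dpos; rewrite /= in_itv/= andbT.
pose g' : R -> R := (fun r => g r * r `^ (- n.-1%:R)) \_ D.
have mg' : measurable_fun setT g'.
  apply/(measurable_restrictT _ _).1 => //; apply: measurable_funM => //; exact: measurable_funTS.
have g'0 r : 0 <= g' r.
  by rewrite /g' patchE; case: ifPn => // /set_mem/g0 h0; rewrite mulr_ge0// powR_ge0.
have g'E r : D r -> g' r * r ^+ n.-1 = g r.
  move=> Dr'; rewrite /g' patchE mem_set// -mulrA powRN powR_mulrn ?ltW ?Dr//.
  by rewrite mulVf ?mulr1// expf_neq0// gt_eqF// Dr.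
have -> : (\int[leb n]_(x in enorm @^-1` D) h (enorm x) =
    \int[leb n]_x (g' (enorm x))%:E)%E.
  rewrite [LHS]integral_mkcond.
  apply: (eq_integral_off_null mN' N'0) => x _ Nx; rewrite patchE.
  have [Dx|Dx] := pselect (D (enorm x)); last first.
    by rewrite memNset// /g' patchE memNset.
  rewrite mem_set//; have := hg _ Dx Nx; rewrite -(g'E _ Dx) EFinM.
  have e0 : 0 < enorm x ^+ n.-1 by rewrite exprn_gt0// Dr.
  move=> e; have := congr1 (fun z => (z * ((enorm x ^+ n.-1)^-1)%:E)%E) e.
  by rewrite -!muleA -!EFinM divff ?gt_eqF// mulr1 mule1.
rewrite (@ge0_integral_radial R n (fun r => (g' r)%:E) n0)//; last exact/measurable_EFinP.
rewrite -ge0_integralZl//; last 2 first.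
- by apply/measurable_EFinP.
- by rewrite lee_fin ltW// sphere_area_gt0.
rewrite [RHS]integral_mkcond; apply: eq_integral => r _; rewrite patchE -EFinM.
have [Dx|Dx] := pselect (D r).
  rewrite mem_set// -EFinM /radial_density patchE mem_set; last exact: Dpos.
  by rewrite mulrCA g'E.
by rewrite memNset// /g' patchE memNset// mul0r.
Qed.

End radial_null.

(** * The function kappa *)

Section kappa.
Context {R : realType}.
Local Notation mu := (@lebesgue_measure R).
Variables (d : nat) (p a b : R) (eta : R -> R).
Hypotheses (hp : 1 < p) (ha : 0 <= a).
Hypothesis eta_ge0 : {ae mu, forall r : R, 0 <= r -> 0 <= eta r}.
Hypothesis eta_L1loc : L1loc_halfline eta.
Local Notation I := (regular_set p a b eta).

(** A version of [eta] that is nonnegative everywhere and Borel on the whole line; [eta] itself is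
    only constrained on the half-line, and only almost everywhere in sign. *)
Definition eta_pos : R -> R := (fun r => Num.max (eta r) 0) \_ `[0, +oo[.

Lemma eta_pos_ge0 r : 0 <= eta_pos r.
Proof. by rewrite /eta_pos patchE; case: ifP => // _; rewrite le_max lexx orbT. Qed.

Lemma measurable_eta_pos : measurable_fun setT eta_pos.
Proof.
apply/(measurable_restrictT _ _).1 => //; apply: measurable_maxr => //.
by have [] := eta_L1loc.
Qed.

Lemma eta_pos_ae : exists2 N : set R, measurable N /\ mu N = 0%E &
  forall r, 0 <= r -> ~ N r -> eta r = eta_pos r.
Proof.
have [N [mN N0 HN]] := eta_ge0; exists N => // r r0 Nr.
have : 0 <= eta r by apply: contrapT => H; apply: Nr; apply: HN => /= /(_ r0).
by rewrite /eta_pos patchE mem_set; [move/max_l|rewrite /= in_itv/= r0].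
Qed.

Definition radial_weight (r : R) : R := r ^+ d.-1 * eta_pos r.

Lemma measurable_rho : measurable_fun setT radial_weight.
Proof. by apply: measurable_funM; [exact: measurable_funX|exact: measurable_eta_pos]. Qed.

Lemma rho_ge0 r : 0 <= r -> 0 <= radial_weight r.
Proof. by move=> r0; rewrite mulr_ge0 ?exprn_ge0// eta_pos_ge0. Qed.

(* On [regular_set] the value 1 is only taken on a null set. *)
Definition kappa (r : R) : R := if 0 < radial_weight r then radial_weight r `^ (- (p - 1)^-1) else 1.

Lemma kappa_gt0 r : 0 < kappa r.
Proof. by rewrite /kappa; case: ifPn => // h; rewrite powR_gt0. Qed.

Lemma measurable_kappa : measurable_fun setT kappa.
Proof.
apply: measurable_fun_ifT => //.
  by apply: measurable_fun_ltr => //; exact: measurable_rho.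
apply: (@measurableT_comp _ _ _ _ _ _ (fun x : R => x `^ (- (p - 1)^-1))) => //.
exact: measurable_rho.
Qed.

Lemma exponent_gt1 : 0 < p - 1. Proof. by rewrite subr_gt0. Qed.

Lemma inv_pow_gt0 (t : R) : 0 < t -> inv_pow p t = (t `^ (- (p - 1)^-1))%:E.
Proof. by move=> t0; rewrite /inv_pow inver gt_eqF ?powR_gt0// powRN. Qed.

Lemma inv_pow0 : inv_pow p 0 = +oo%E.
Proof. by rewrite /inv_pow powR0 ?inver ?eqxx// invr_neq0// gt_eqF// exponent_gt1. Qed.

Lemma kappa_rho r : 0 < radial_weight r -> kappa r `^ (1 - p) = radial_weight r.
Proof.
move=> h; rewrite /kappa h -powRrM (_ : - (p - 1)^-1 * (1 - p) = 1) ?powRr1 ?ltW//.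
by field; rewrite gt_eqF// exponent_gt1.
Qed.

(** The Jacobian turns the kernel k into kappa: -(d-1)p/(p-1) + (d-1) = -(d-1)/(p-1). *)
Lemma inv_pow_kappa r : 0 < r -> 0 < eta_pos r ->
  (inv_pow p (r `^ (d.-1%:R * p) * eta_pos r) * (r ^+ d.-1)%:E = (kappa r)%:E)%E.
Proof.
move=> r0 e0; have rd0 : 0 < r ^+ d.-1 by rewrite exprn_gt0.
rewrite inv_pow_gt0 ?mulr_gt0 ?powR_gt0// -EFinM /kappa /radial_weight mulr_gt0//; congr EFin.
have q0 := exponent_gt1; rewrite !powRM ?powR_ge0 ?ltW// mulrAC; congr (_ * _).
have -> : r ^+ d.-1 = r `^ d.-1%:R by rewrite powR_mulrn// ltW.
have rn0 : r != 0 by rewrite gt_eqF.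
rewrite -!powRrM -powRD ?rn0 ?implybT//; congr (r `^ _).
by field; rewrite gt_eqF.
Qed.

(** [inv_pow] is infinite at 0 and an integrable function is finite almost everywhere, so [eta]
    vanishes at most on a null set of each rational interval of integrability. *)
Lemma regular_ae : exists2 N : set R, measurable N /\ mu N = 0%E &
  forall r, I r -> ~ N r -> 0 < eta_pos r /\ eta r = eta_pos r.
Proof.
have [N0 [mN0 N00] HN0] := eta_pos_ae.
have Hq (q : rat * rat) : exists N : set R, (measurable N /\ mu N = 0%E) /\
    (mu.-integrable (`]ratr q.1, ratr q.2[%classic : set R) (fun s => inv_pow p (eta s)) ->
     forall r : R, ratr q.1 < r < ratr q.2 -> ~ N r -> eta r != 0).
  have [qi|qi] := pselect (mu.-integrable (`]ratr q.1, ratr q.2[%classic : set R) (fun s => inv_pow p (eta s))); last first.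
    by exists set0; split => //; split => //; exact: measure0.
  have mq : measurable (`]ratr q.1, ratr q.2[%classic : set (measurableTypeR R)) by [].
  have [N [mN N'0 HN]] := integrable_ae mq qi.
  exists N; split => // _ r rq Nr; apply/eqP => e0; apply: Nr; apply: HN => /= H.
  by have := H ltac:(by rewrite /= in_itv); rewrite e0 inv_pow0.
have [N HN] := choice Hq.
have NN : measurable (\bigcup_q N q) /\ mu (\bigcup_q N q) = 0%E.
  by apply: (@null_set_bigcup _ (measurableTypeR R) R mu (rat * rat)%type N) => q; have [] := HN q.
exists (N0 `|` \bigcup_q N q).
  by split; [apply: measurableU => //; exact: NN.1|apply: null_set_setU => //; [exact: NN.1|exact: NN.2]].
move=> r Ir /not_orP[Nr NNr].
have r0 : 0 < r by have := regular_set_sub Ir; rewrite /= in_itv/= => /andP[/(le_lt_trans ha)].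
have e := HN0 r (ltW r0) Nr; split => //; rewrite -e lt_neqAle e eta_pos_ge0 andbT -e eq_sym.
have [_ [x x0 xi]] := Ir.
have [q1 /itvP q1P] := @rat_in_itvoo R (r - x) r ltac:(lra).
have [q2 /itvP q2P] := @rat_in_itvoo R r (r + x) ltac:(lra).
have [_ H] := HN (q1, q2); apply: H.
- by apply: integrableS xi => //; apply: subset_itv; rewrite bnd_simp ltW ?q1P ?q2P.
- by rewrite /= q1P q2P.
- by move=> Nq; apply: NNr; exists (q1, q2).
Qed.

Lemma integrable_kappa x y : `[x, y] `<=` I -> mu.-integrable `[x, y] (EFin \o kappa).
Proof.
move=> xyI; apply: locally_integrable_itv => r rI.
have Ir : I r by apply: xyI; rewrite /= in_itv.
have [N [mN N0] HN] := regular_ae.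
have r0 : 0 < r by have := regular_set_sub Ir; rewrite /= in_itv/= => /andP[/(le_lt_trans ha)].
have /nbhs_ballP[e1 /= e10 He1] : nbhs r I by apply: open_nbhs_nbhs; split => //; exact: open_regular_set.
have [_ [e2 e20 e2i]] := Ir.
(* The bound by r / 2 keeps the factor [s ^+ d.-1] away from 0, so that kappa is at most a constant
   times [inv_pow p (eta s)]. *)
pose e := Num.min (r / 2) (Num.min e1 e2).
have e0 : 0 < e by rewrite /e !lt_min divr_gt0// e10.
have er : e <= r / 2 by rewrite /e ge_min lexx.
have ee1 : e <= e1 by rewrite /e !ge_min lexx orbT.
have ee2 : e <= e2 by rewrite /e !ge_min lexx !orbT.
exists e => //.
have sub2 : (`]r - e, r + e[%classic : set R) `<=` `]r - e2, r + e2[.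
  by apply: subset_itv; rewrite bnd_simp; lra.
have ei : mu.-integrable `]r - e, r + e[ (fun s => inv_pow p (eta s)) by exact: integrableS e2i.
pose C : R := ((r / 2) ^+ d.-1) `^ (- (p - 1)^-1).
have C0 : 0 <= C by exact: powR_ge0.
apply/integrableP; split.
  by apply/measurable_EFinP; apply: measurable_funTS; exact: measurable_kappa.
have mi : measurable_fun `]r - e, r + e[ (fun s => inv_pow p (eta s)) := measurable_int _ ei.
apply: (@le_lt_trans _ _ (\int[mu]_(s in `](r - e)%R, (r + e)%R[) (C%:E * `|inv_pow p (eta s)|))%E); last first.
  rewrite ge0_integralZl//; last exact: measurableT_comp.
  by rewrite lte_mul_pinfty ?lee_fin//; have /integrableP[] := ei.
apply: (@ge0_le_integral_off_null _ (measurableTypeR R) R mu _ N _ _ mN N0).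
- by move=> s _; exact: abse_ge0.
- by move=> s _; rewrite mule_ge0 ?lee_fin.
move=> s; rewrite /= in_itv/= => /andP[s1 s2] Ns.
have Is : I s by apply: He1; rewrite /ball/= ltr_norml; apply/andP; split; lra.
have [es0 es] := HN s Is Ns; have s0 : 0 < s by lra.
rewrite es inv_pow_gt0//= (ger0_norm (ltW (kappa_gt0 s))) ger0_norm ?powR_ge0//.
rewrite -EFinM lee_fin /kappa /radial_weight mulr_gt0 ?exprn_gt0// powRM ?exprn_ge0 ?(ltW s0) ?(ltW es0)//.
rewrite ler_wpM2r ?powR_ge0// /C !powRN lef_pV2 ?posrE ?powR_gt0 ?exprn_gt0 ?divr_gt0//.
have q0 := exponent_gt1; rewrite ge0_ler_powR ?nnegrE ?exprn_ge0 ?invr_ge0 ?(ltW q0) ?(ltW s0)//.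
  by rewrite divr_ge0// ltW.
by apply: lerXn2r; rewrite ?nnegrE; lra.
Qed.

End kappa.

Section signed_primitive.
Context {R : realType}.
Local Notation mu := (@lebesgue_measure R).

Lemma Rintegral_itv_ge (f : R -> R) (x y : R) : y <= x -> \int[mu]_(r in `[x, y]) f r = 0.
Proof.
rewrite le_eqVlt => /predU1P[->|yx]; first by rewrite set_itv1 Rintegral_set1.
by rewrite set_itv_ge ?Rintegral_set0// bnd_simp -ltNge.
Qed.

(** The signed integral from m to r: one of the two segments is empty or a point. *)
Definition primitive_from (m : R) (f : R -> R) (r : R) : R :=
  \int[mu]_(t in `[m, r]) f t - \int[mu]_(t in `[r, m]) f t.

Lemma primitive_from_on (c1 c2 m : R) (f : R -> R) : c1 < m < c2 ->
  (forall x y, `[x, y] `<=` `]c1, c2[ -> mu.-integrable `[x, y] (EFin \o f)) ->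
  primitive_on `]c1, c2[ (primitive_from m f) f.
Proof.
move=> /andP[c1m mc2] fi x y xy xyJ; split; first exact: fi.
have /andP[c1x xc2] : c1 < x < c2 by have := xyJ x; rewrite /= !in_itv/= lexx xy; exact.
have /andP[c1y yc2] : c1 < y < c2 by have := xyJ y; rewrite /= !in_itv/= lexx xy; exact.
have sub s t : c1 < s -> t < c2 -> mu.-integrable `[s, t] (EFin \o f).
  by move=> h1 h2; apply: fi; apply: subset_itv; rewrite bnd_simp.
rewrite /primitive_from; have [ym|my] := leP y m.
  rewrite (Rintegral_itv_ge _ ym) (Rintegral_itv_ge _ (le_trans xy ym)).
  by rewrite (@Rintegral_itv_cat _ f x y m)//; [ring|exact: sub].
have [xm|mx] := leP x m.
  rewrite (Rintegral_itv_ge _ xm) (Rintegral_itv_ge _ (ltW my)).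
  rewrite (@Rintegral_itv_cat _ f x m y) ?(ltW my)//; first by ring.
  exact: sub.
rewrite (Rintegral_itv_ge _ (ltW mx)) (Rintegral_itv_ge _ (ltW my)).
rewrite (@Rintegral_itv_cat _ f m x y) ?(ltW mx)//; first by ring.
exact: sub.
Qed.

End signed_primitive.

(** * The weight on a component, and equality in X *)

Section weight.
Context {R : realType}.
Local Notation mu := (@lebesgue_measure R).
Variables (d : nat) (p a b : R) (eta : R -> R) (Omega : set 'rV[R]_d) (s : seq (R * R)).
Hypotheses (hd : (0 < d)%N) (hp : 1 < p) (ha : 0 <= a) (hab : a < b).
Hypothesis hOmega : Omega = eball b \/ Omega = annulus a b.
Hypothesis eta_ge0 : {ae mu, forall r : R, 0 <= r -> 0 <= eta r}.
Hypothesis eta_L1loc : L1loc_halfline eta.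
Local Notation I := (regular_set p a b eta).
Hypothesis cI : open_cells I s.
Hypothesis sE : forall c, regular_components p a b eta c <-> c \in s.
Local Notation ka := (kappa d p eta).
Local Notation sigma := (sphere_area d : R).

Lemma sigma_gt0 : 0 < sigma. Proof. exact: sphere_area_gt0. Qed.

Lemma I_OmegaE : I_Omega p a b eta Omega = enorm @^-1` I.
Proof.
apply/seteqP; split => [x []//|x Ix]; split => //.
have := regular_set_sub Ix; rewrite /= in_itv/= => /andP[h1 h2].
by case: hOmega => ->; rewrite /eball /annulus /= ?h1.
Qed.

Lemma b_gt0 : 0 < b. Proof. exact: le_lt_trans hab. Qed.

Lemma I_pos r : I r -> 0 < r < b.
Proof.
by move=> /regular_set_sub; rewrite /= in_itv/= => /andP[/(le_lt_trans ha) -> ->].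
Qed.

Lemma I_sub0b : I `<=` `]0, b[. Proof. by move=> r /I_pos; rewrite /= in_itv. Qed.

Lemma measurable_I : measurable I.
Proof. by apply: open_measurable; exact: open_regular_set. Qed.

Lemma measurable_IO : measurable (@enorm R d @^-1` I).
Proof. by apply: open_measurable_rV; apply: open_enorm_preimage; exact: open_regular_set. Qed.

Lemma measurable_Omega : measurable Omega.
Proof.
case: hOmega => ->; first exact: measurable_eball.
have := @measurable_enorm R d measurableT `]a, b[%classic (measurable_itv _).
by rewrite setTI; congr (measurable _); apply/seteqP; split => x; rewrite /annulus /= in_itv.
Qed.

Lemma leb_Omega_lty : (leb d Omega < +oo)%E.
Proof.
have sub : Omega `<=` eball b.
  by case: hOmega => -> // x; rewrite /eball /annulus /= => /andP[].
apply: (@le_lt_trans _ _ (leb d (eball b))).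
  apply: le_measure; rewrite ?inE//; first exact: measurable_Omega.
  exact: measurable_eball.
rewrite leb_eballZ ?b_gt0// lte_mul_pinfty ?lee_fin ?exprn_ge0 ?ltW ?b_gt0//.
exact: leb_eball1_lty.
Qed.

Lemma ka_gt0 r : 0 < ka r. Proof. exact: kappa_gt0. Qed.

Lemma Ika x y : `[x, y] `<=` I -> mu.-integrable `[x, y] (EFin \o ka).
Proof. exact: integrable_kappa. Qed.


Lemma regular_ae_I : exists2 N : set R, measurable N /\ mu N = 0%E &
  forall r, I r -> ~ N r -> 0 < eta_pos eta r /\ eta r = eta_pos eta r.
Proof. exact: regular_ae. Qed.

Lemma inv_int_kE al be : al < be -> `[al, be] `<=` I ->
  inv_int_k p a b eta Omega al be = ((sigma * \int[mu]_(r in `[al, be]) ka r)^-1)%:E.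
Proof.
move=> albe sub; have ki := Ika sub.
have K0 : 0 < \int[mu]_(r in `[al, be]) ka r.
  by apply: (Rint_ka_gt0 ka_gt0 _ albe ki); exact: measurable_kappa.
have sub' : `]al, be[ `<=` I by apply: subset_trans sub; apply: subset_itvW.
have [N [mN N0] HN] := regular_ae_I.
rewrite /inv_int_k; have -> : I_shell p a b eta Omega al be = enorm @^-1` `]al, be[.
  rewrite /I_shell I_OmegaE; apply/seteqP; split => x /=; first by move=> [_]; rewrite in_itv.
  by rewrite in_itv/= => h; split => //; apply: sub'; rewrite /= in_itv.
rewrite /kernel_k.
have mal : measurable (`]al, be[%classic : set R) by [].
rewrite (@integral_radial_ae R d `]al, be[ N (fun r => inv_pow p (r `^ (d.-1%:R * p) * eta r)) ka hd mal _ mN N0).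
- have -> : (\int[mu]_(r in `]al, be[) (ka r)%:E = (\int[mu]_(r in `[al, be]) ka r)%:E)%E.
    rewrite Rintegral_itvcc_itvoo// fineK//; apply: integrable_fin_num => //.
    by apply: integrableS ki => //; apply: subset_itvW.
  by rewrite -EFinM inver mulf_eq0 !gt_eqF// sigma_gt0.
- by move=> r /sub' /I_pos; rewrite /= in_itv/= => /andP[->].
- by apply: measurable_funTS; exact: measurable_kappa.
- by move=> r _; rewrite ltW// ka_gt0.
- move=> r /sub' Ir Nr; have [e0 ->] := HN r Ir Nr; apply: inv_pow_kappa => //.
  by have /andP[] := I_pos Ir.
Qed.

Local Notation what_p := (what_profile p a b eta Omega).

Definition cell_mid (c : R * R) : R := (c.1 + c.2) / 2.
Definition cell_q1 (c : R * R) : R := (3 * c.1 + c.2) / 4.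
Definition cell_q2 (c : R * R) : R := (c.1 + 3 * c.2) / 4.

Definition cell_mass (c : R * R) (r : R) : R :=
  if r <= cell_q1 c then \int[mu]_(t in `[r, cell_mid c]) ka t
  else if r < cell_q2 c then \int[mu]_(t in `[cell_q1 c, cell_q2 c]) ka t
  else \int[mu]_(t in `[cell_mid c, r]) ka t.

Lemma cell_segment c x y : c \in s -> c.1 < x -> y < c.2 -> `[x, y] `<=` I.
Proof.
move=> cs h1 h2; have [_ _ Hs _] := cI; have [_ cJ _ _] := Hs _ cs.
by apply: subset_trans cJ; apply: subset_itv; rewrite bnd_simp.
Qed.

Lemma cell_lt c : c \in s -> c.1 < c.2.
Proof. by have [_ _ Hs _] := cI => /Hs[]. Qed.

Lemma cell_inj c c' r : c \in s -> c' \in s -> c.1 < r < c.2 -> c'.1 < r < c'.2 -> c = c'.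
Proof.
move=> cs c's /andP[h1 h2] /andP[h3 h4]; apply/eqP; apply: contrapT => /negP cc.
by have [|] := cells_order cI cs c's cc; lra.
Qed.

Lemma what_profileE c r : c \in s -> c.1 < r < c.2 ->
  what_p r = ((sigma * cell_mass c r)^-1)%:E.
Proof.
move=> cs cr; have c12 := cell_lt cs; have /andP[c1r rc2] := cr.
rewrite /what_profile asboolT; last by exists c => //; apply/sE.
have : [set c | regular_components p a b eta c /\ c.1 < r < c.2]
    (get [set c | regular_components p a b eta c /\ c.1 < r < c.2]).
  by apply: getPex; exists c; split => //; apply/sE.
move=> [/sE gs gr]; rewrite (cell_inj gs cs gr cr).
rewrite /what_inside /what_left /what_right /cell_mass /cell_mid /cell_q1 /cell_q2.
case: ifPn => [h|_]; last case: ifPn => [h|h].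
- by apply: inv_int_kE; [lra|apply: (cell_segment cs); lra].
- by apply: inv_int_kE; [lra|apply: (cell_segment cs); lra].
- by rewrite -leNgt in h; apply: inv_int_kE; [lra|apply: (cell_segment cs); lra].
Qed.

Lemma Rint_ka_le x y x' y' : x' <= x -> y <= y' -> `[x', y'] `<=` I ->
  \int[mu]_(t in `[x, y]) ka t <= \int[mu]_(t in `[x', y']) ka t.
Proof.
move=> h1 h2 sub; have sb : (`[x, y]%classic : set R) `<=` `[x', y'] by apply: subset_itv; rewrite bnd_simp.
have ki := Ika sub; have mxy : measurable (`[x, y]%classic : set (measurableTypeR R)) by [].
have mxy' : measurable (`[x', y']%classic : set (measurableTypeR R)) by [].
rewrite /Rintegral fine_le//.
- exact: (integrable_fin_num mxy (integrableS mxy' mxy sb ki)).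
- exact: (integrable_fin_num mxy' ki).
- apply: ge0_subset_integral => //.
    by apply/measurable_EFinP; apply: measurable_funTS; exact: measurable_kappa.
  by move=> t _; rewrite lee_fin ltW// ka_gt0.
Qed.

(** The integral of kappa between r and the midpoint, on whichever side r lies: the other term is
    zero. *)
Definition span_mass (c : R * R) (r : R) : R :=
  \int[mu]_(t in `[r, cell_mid c]) ka t + \int[mu]_(t in `[cell_mid c, r]) ka t.

(** The first bound, independent of r, makes the weight bounded; the second one balances the growth
    that Hoelder's inequality allows for a profile between the midpoint and r. *)
Lemma cell_mass_ge c r : c \in s -> c.1 < r < c.2 ->
  Num.min (\int[mu]_(t in `[cell_q1 c, cell_mid c]) ka t)
          (\int[mu]_(t in `[cell_mid c, cell_q2 c]) ka t) <= cell_mass c r /\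
  span_mass c r <= cell_mass c r.
Proof.
move=> cs /andP[c1r rc2]; have c12 := cell_lt cs.
rewrite /span_mass /cell_mass ge_min /cell_mid /cell_q1 /cell_q2.
case: ifPn => [h|]; last rewrite -ltNge => h; last case: ifPn => [h'|]; last rewrite -leNgt => h'.
- split; first by apply/orP; left; apply: Rint_ka_le => //; apply: (cell_segment cs); lra.
  by rewrite (@Rintegral_itv_ge _ _ _ r) ?addr0//; lra.
- split; first by apply/orP; left; apply: Rint_ka_le; [lra..|apply: (cell_segment cs); lra].
  have [h2|h2] := leP r ((c.1 + c.2) / 2).
    by rewrite (@Rintegral_itv_ge _ _ _ r) ?addr0//; apply: Rint_ka_le; [lra..|apply: (cell_segment cs); lra].
  by rewrite (@Rintegral_itv_ge _ _ r) ?add0r; [apply: Rint_ka_le; [lra..|apply: (cell_segment cs); lra]|lra].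
- split; first by apply/orP; right; apply: Rint_ka_le => //; apply: (cell_segment cs); lra.
  by rewrite (@Rintegral_itv_ge _ _ r) ?add0r//; lra.
Qed.

Lemma cell_mass_min_gt0 c : c \in s ->
  0 < Num.min (\int[mu]_(t in `[cell_q1 c, cell_mid c]) ka t)
          (\int[mu]_(t in `[cell_mid c, cell_q2 c]) ka t).
Proof.
move=> cs; have c12 := cell_lt cs; have mk := measurable_kappa d p eta_L1loc.
rewrite lt_min /cell_mid /cell_q1 /cell_q2; apply/andP; split.
  by apply: (Rint_ka_gt0 ka_gt0 mk); [lra|apply: Ika; apply: (cell_segment cs); lra].
by apply: (Rint_ka_gt0 ka_gt0 mk); [lra|apply: Ika; apply: (cell_segment cs); lra].
Qed.

Let mI0 : measurable [set false]. Proof. by []. Qed.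

Lemma measurable_cell_mass c : c \in s -> measurable_fun `]c.1, c.2[ (cell_mass c).
Proof.
move=> cs; have c12 := cell_lt cs.
have Pm : primitive_on `]c.1, c.2[ (primitive_from (cell_mid c) ka) ka.
  apply: primitive_from_on; first by rewrite /cell_mid; lra.
  move=> x y sub; apply: Ika; apply: (subset_trans sub).
  by have [_ _ Hs _] := cI; have [] := Hs _ cs.
have mP : measurable_fun `]c.1, c.2[ (primitive_from (cell_mid c) ka).
  by apply: primitive_measurable Pm; exact: interval_open.
apply: (@eq_measurable_fun _ _ (measurableTypeR R) _ _ (fun r => if r <= cell_q1 c then - primitive_from (cell_mid c) ka r
  else if r < cell_q2 c then \int[mu]_(t in `[cell_q1 c, cell_q2 c]) ka t
  else primitive_from (cell_mid c) ka r)).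
  move=> r _; rewrite /cell_mass /primitive_from; case: ifPn => [h|].
    by rewrite (@Rintegral_itv_ge _ _ (cell_mid c)) ?sub0r ?opprK//; move: h; rewrite /cell_mid /cell_q1; lra.
  case: ifPn => // h' _.
  by rewrite (@Rintegral_itv_ge _ _ r) ?subr0//; move: h'; rewrite /cell_mid /cell_q2; lra.
pose C : set (measurableTypeR R) := `]c.1, c.2[%classic.
have mC : measurable C by rewrite /C; exact: measurable_itv.
have mS A (g : measurableTypeR R -> R) : measurable_fun C g -> measurable_fun (C `&` A) g.
  by move=> mg; exact: (measurable_funS mC (@subIsetl _ _ _) mg).
have mN : measurable_fun C (fun r => - primitive_from (cell_mid c) ka r).
  exact: (measurableT_comp (@oppr_measurable R setT) mP).
apply: (measurable_fun_if mC).
- by apply: measurable_fun_ler => //.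
- exact: mS.
- have mC2 : measurable (C `&` (fun r => r <= cell_q1 c) @^-1` [set false]).
    have mle : measurable_fun C (fun r : R => r <= cell_q1 c) by apply: measurable_fun_ler.
    exact: (mle mC [set false] mI0).
  apply: (measurable_fun_if mC2) => //.
  + exact: measurable_fun_ltr.
  + by rewrite -setIA; exact: mS.
Qed.

Definition what_at (r : R) : R := fine (what_p r).

Lemma weightE (x : 'rV[R]_d) : weight p a b eta Omega x = what_at (enorm x) `^ (p - 1).
Proof. by []. Qed.

Lemma what_at_cell c r : c \in s -> c.1 < r < c.2 -> what_at r = (sigma * cell_mass c r)^-1.
Proof. by move=> cs cr; rewrite /what_at (what_profileE cs cr). Qed.

Lemma I_cell r : I r -> exists2 c, c \in s & c.1 < r < c.2.
Proof. by have [_ _ _] := cI => H /H. Qed.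

Lemma cell_I c r : c \in s -> c.1 < r < c.2 -> I r.
Proof. by have [_ _ Hs _] := cI => cs cr; have [_ + _ _] := Hs _ cs; apply; rewrite /= in_itv. Qed.

Lemma cell_mass_gt0 c r : c \in s -> c.1 < r < c.2 -> 0 < cell_mass c r.
Proof.
move=> cs cr; have [h _] := cell_mass_ge cs cr.
exact: lt_le_trans (cell_mass_min_gt0 cs) h.
Qed.

Lemma what_at_gt0 r : I r -> 0 < what_at r.
Proof.
move=> /I_cell[c cs cr]; rewrite (what_at_cell cs cr) invr_gt0 mulr_gt0 ?sigma_gt0//.
exact: cell_mass_gt0.
Qed.

Lemma what_at_span c r : c \in s -> c.1 < r < c.2 -> what_at r * (sigma * span_mass c r) <= 1.
Proof.
move=> cs cr; rewrite (what_at_cell cs cr) mulrC ler_pdivrMr ?(mulr_gt0 sigma_gt0 (cell_mass_gt0 cs cr))//.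
by rewrite mul1r ler_wpM2l ?(ltW sigma_gt0)//; have [] := cell_mass_ge cs cr.
Qed.

Lemma what_at_bounded : exists2 M, 0 < M & forall r, I r -> what_at r <= M.
Proof.
pose m c : R := (sigma * Num.min (\int[mu]_(t in `[cell_q1 c, cell_mid c]) ka t)
          (\int[mu]_(t in `[cell_mid c, cell_q2 c]) ka t))^-1.
have m0 c : c \in s -> 0 < m c.
  by move=> cs; rewrite invr_gt0 mulr_gt0 ?sigma_gt0 ?cell_mass_min_gt0.
exists (1 + \sum_(c <- s) `|m c|); first by rewrite ltr_pwDl// sumr_ge0.
move=> r /I_cell[c cs cr]; rewrite (what_at_cell cs cr).
have [h _] := cell_mass_ge cs cr.
apply: (@le_trans _ _ (m c)).
  rewrite lef_pV2 ?posrE ?(mulr_gt0 sigma_gt0 (cell_mass_gt0 cs cr)) ?(mulr_gt0 sigma_gt0 (cell_mass_min_gt0 cs))//.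
  by rewrite ler_wpM2l ?(ltW sigma_gt0).
rewrite (perm_big _ (perm_to_rem cs)) big_cons (le_trans (ler_norm _))// addrCA lerDl addr_ge0// sumr_ge0//.
Qed.

Lemma measurable_what_at : measurable_fun I what_at.
Proof.
move=> _ A mA.
have -> : I `&` what_at @^-1` A = \bigcup_(c in [set` s]) (`]c.1, c.2[ `&` what_at @^-1` A).
  apply/seteqP; split => r.
    by move=> [/I_cell[c cs cr] Ar]; exists c => //; split => //=; rewrite in_itv.
  by move=> [c /= cs []]; rewrite in_itv/= => cr Ar; split => //; exact: cell_I cr.
apply: fin_bigcup_measurable; first exact: finite_seq.
move=> c /= cs; have mC : measurable (`]c.1, c.2[%classic : set (measurableTypeR R)) by [].
suff : measurable_fun (`]c.1, c.2[%classic : set (measurableTypeR R)) what_at by apply.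
apply: (@eq_measurable_fun _ _ _ _ _ (fun r => (sigma * cell_mass c r) `^ (-1))).
  move=> r /set_mem/=; rewrite in_itv/= => cr; rewrite (what_at_cell cs cr) powR_inv1//.
  by rewrite ltW// (mulr_gt0 sigma_gt0 (cell_mass_gt0 cs cr)).
have mm : measurable_fun (`]c.1, c.2[%classic : set (measurableTypeR R)) (fun r => sigma * cell_mass c r).
  by apply: measurable_funM => //; exact: measurable_cell_mass.
exact: (@measurableT_comp _ _ _ _ _ _ (fun x : R => x `^ (-1)) _ _ (measurable_powR _) mm).
Qed.

Lemma what_at_out r : ~ I r -> (forall c, c \in s -> r != c.1 /\ r != c.2) -> what_at r = 0.
Proof.
move=> Ir Hr; rewrite /what_at /what_profile asboolF; last first.
  by move=> [c /sE cs cr]; apply: Ir; exact: cell_I cr.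
rewrite asboolF; last by move=> [c /sE/Hr[/eqP h _] /esym].
by rewrite asboolF//; move=> [c /sE/Hr[_ /eqP h] /esym].
Qed.

(** The radii where the weight takes its limit values; they are finitely many, so the integrals
    ignore them. *)
Definition endpoints : set R := [set r | exists2 c, c \in s & r = c.1 \/ r = c.2].

Lemma endpoints_null : measurable endpoints /\ mu endpoints = 0%E.
Proof.
have fs : finite_set [set` s] by exact: finite_seq.
have -> : endpoints = \bigcup_(c in [set` s]) [set c.1; c.2].
  apply/seteqP; split => r; first by move=> [c cs h]; exists c.
  by move=> [c cs h]; exists c.
split.
  apply: fin_bigcup_measurable => // c _; apply: measurableU; exact: measurable_set1.
apply: countable_lebesgue_measure0; apply: finite_set_countable.
apply: bigcup_finite => // c _; rewrite finite_setU; split; exact: finite_set1.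
Qed.

Definition weight_at (r : R) : R := what_at r `^ (p - 1).


Lemma weight_at_gt0 r : I r -> 0 < weight_at r.
Proof. by move=> Ir; rewrite powR_gt0// what_at_gt0. Qed.

Lemma weight_at_out r : ~ I r -> ~ endpoints r -> weight_at r = 0.
Proof.
move=> Ir er; rewrite /weight_at what_at_out ?powR0 ?gt_eqF ?subr_gt0// => c cs.
by split; apply/eqP => rc; apply: er; exists c => //; [left|right].
Qed.

Lemma measurable_weight_at : measurable_fun I weight_at.
Proof. exact: (@measurableT_comp _ _ _ _ _ _ _ _ _ (measurable_powR (p - 1)) measurable_what_at). Qed.

Lemma measurable_weight_at_enorm : measurable_fun (@enorm R d @^-1` I) (fun x => weight_at (enorm x)).
Proof.
move=> _ A mA; have := measurable_weight_at measurable_I mA => mB.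
rewrite (_ : _ `&` _ = enorm @^-1` (I `&` weight_at @^-1` A)); last by apply/seteqP; split.
by rewrite -[X in measurable X]setTI; exact: measurable_enorm.
Qed.

Lemma weight_at_bounded : exists2 M, 0 < M & forall r, I r -> weight_at r <= M.
Proof.
have [M M0 HM] := what_at_bounded; exists (M `^ (p - 1)); first exact: powR_gt0.
move=> r Ir; rewrite ge0_ler_powR ?nnegrE ?subr_ge0 ?(ltW hp) ?(ltW M0) ?(ltW (what_at_gt0 Ir))//.
exact: HM.
Qed.

Local Notation IO := (@enorm R d @^-1` I).

Lemma IO_sub : IO `<=` Omega.
Proof. by rewrite -I_OmegaE => x []. Qed.

Lemma int_powE u : int_pow p a b eta Omega u =
  (\int[leb d]_(x in IO) (`|u x| `^ p * weight_at (enorm x))%:E)%E.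
Proof.
have [mE E0] := endpoints_null; have [mN N0] := null_set_enorm hd mE E0.
rewrite /int_pow [LHS]integral_mkcond [RHS]integral_mkcond.
apply: (eq_integral_off_null mN N0) => x _ Nx; rewrite !patchE.
have [Ix|Ix] := pselect (IO x).
  by rewrite (mem_set Ix) mem_set//; exact: IO_sub.
rewrite (memNset Ix); case: ifPn => // _.
by rewrite weightE -/(weight_at _) weight_at_out// mulr0.
Qed.

(** The weight is positive on [IO], so a set that is null for it meets [IO] in a Lebesgue null
    set. *)
Lemma eqXP (u u' : 'rV[R]_d -> R) : eqX p a b eta Omega u u' ->
  exists2 N : set 'rV[R]_d, measurable N /\ leb d N = 0%E &
    forall x, IO x -> ~ N x -> u x = u' x.
Proof.
move=> [N [mN N0 HN]]; exists (IO `&` N); last first.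
  by move=> x Ix INx; apply: contrapT => h; apply: INx; split => //; apply: HN => //; exact: IO_sub.
have mIN : measurable (IO `&` N) by apply: measurableI => //; exact: measurable_IO.
split => //; apply/eqP; rewrite eq_le measure_ge0 andbT leNgt; apply/negP => pos.
have mw : measurable_fun (IO `&` N) (fun x => weight_at (enorm x)).
  by apply: measurable_funS measurable_weight_at_enorm; [exact: measurable_IO|exact: subIsetl].
have : (0 < \int[leb d]_(x in IO `&` N) (weight_at (enorm x))%:E)%E.
  by apply: integral_gt0 => // x [Ix _]; exact: weight_at_gt0.
rewrite lt_neqAle => /andP[/negP + _]; apply; apply/eqP; rewrite -[LHS]N0.
have [mE E0] := endpoints_null; have [mN' N'0] := null_set_enorm hd mE E0.
rewrite [LHS]integral_mkcond [RHS]integral_mkcond.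
apply: (eq_integral_off_null mN' N'0) => x _ Nx; rewrite !patchE weightE -/(weight_at _).
have [Ix|Ix] := pselect (IO x).
  by congr (if _ then _ else _); apply/idP/idP => /set_mem[h1 h2]; apply: mem_set; split => //; exact: IO_sub.
rewrite [X in _ = if X then _ else _]memNset; last by move=> [].
by case: ifPn => // _; rewrite weight_at_out.
Qed.

(** The converse: off [IO] the weight vanishes almost everywhere, so the values there are free. *)
Lemma eqX_off_null (u u' : 'rV[R]_d -> R) N : measurable N -> leb d N = 0%E ->
  (forall x, IO x -> ~ N x -> u x = u' x) -> eqX p a b eta Omega u u'.
Proof.
move=> mN N0 HN; exists (Omega `\` IO `|` N); split.
- by apply: measurableU => //; apply: measurableD; [exact: measurable_Omega|exact: measurable_IO].
- have [mE E0] := endpoints_null; have [mN' N'0] := null_set_enorm hd mE E0.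
  have mU : measurable (N `|` enorm @^-1` endpoints) by exact: measurableU.
  have U0 : leb d (N `|` enorm @^-1` endpoints) = 0%E by exact: null_set_setU.
  rewrite (eq_integral_off_null mU U0 (g := cst 0%E)); first by rewrite integral0.
  move=> x [Ox [[_ Ix]|Nx]] /not_orP[h1 h2]//; rewrite weightE -/(weight_at _) weight_at_out//.
- by move=> x Ox uu'; have [Ix|Ix] := pselect (IO x); [right|left; split => //];
    apply: contrapT => Nx; apply: uu'; exact: HN.
Qed.

End weight.

(** * Lower semicontinuity *)

Section energy_limit.
Context {R : realType}.
Local Notation mu := (@lebesgue_measure R).
Variables (p : R) (ka : R -> R).
Hypothesis p1 : 1 < p.
Hypothesis ka0 : forall r, 0 < ka r.
Hypothesis mka : measurable_fun setT ka.
Local Notation penergy := (penergy p ka).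

(* Either [x <= L K], or [x = x^p x^(1-p)] with [x^(1-p) <= (L K)^(1-p)]. *)
Lemma le_powR_split (x K P L : R) : 0 <= x -> 0 < K -> 0 < L -> 0 <= P ->
  x `^ p <= P * K `^ (p - 1) -> x <= L * K + L `^ (1 - p) * P.
Proof.
move=> x0 K0 L0 P0 h; have [xLK|LKx] := leP x (L * K).
  by rewrite (le_trans xLK)// lerDl mulr_ge0 ?powR_ge0.
have LK0 : 0 < L * K by rewrite mulr_gt0.
have x0' : 0 < x := lt_trans LK0 LKx.
have q0 : 0 < p - 1 by rewrite subr_gt0.
apply: (@le_trans _ _ (L `^ (1 - p) * P)); last by rewrite lerDr mulr_ge0// ltW.
have e : x = x `^ p * (x `^ (p - 1))^-1.
  by rewrite -powRN -powRD ?gt_eqF ?implybT// (_ : p + - (p - 1) = 1) ?powRr1 ?ltW//; ring.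
rewrite e ler_pdivrMr ?powR_gt0//; apply: (le_trans h).
rewrite [leRHS]mulrAC mulrC ler_wpM2r//.
have -> : K `^ (p - 1) = L `^ (1 - p) * (L * K) `^ (p - 1).
  rewrite powRM ?ltW// mulrA -powRD; last by rewrite (gt_eqF L0) implybT.
  by rewrite (_ : 1 - p + (p - 1) = 0) ?powRr0 ?mul1r//; ring.
rewrite ler_wpM2l ?powR_ge0//.
by rewrite ge0_ler_powR ?nnegrE ?ltW.
Qed.

Lemma penergy_subset (f : R -> R) (D D' : set R) : measurable D -> measurable D' ->
  measurable_fun D' f -> D `<=` D' -> (penergy f D <= penergy f D')%E.
Proof.
move=> mD mD' mf DD'; apply: ge0_subset_integral => //.
  exact: measurable_penergy.
by move=> r _; rewrite lee_fin mulr_ge0// powR_ge0.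
Qed.

Lemma sum_penergy_le (I : choiceType) (s : seq I) (F : I -> set R) (f : R -> R) (D : set R) : uniq s ->
  (forall i, measurable (F i)) -> trivIset [set` s] F -> measurable D ->
  (forall i, i \in s -> F i `<=` D) ->
  measurable_fun D f -> (\sum_(i <- s) penergy f (F i) <= penergy f D)%E.
Proof.
move=> us mF tF mD FD mf; have UD : \big[setU/set0]_(i <- s) F i `<=` D.
  by rewrite big_seq; elim/big_ind : _ => [|B C BA CA|k ks]; [exact: sub0set|rewrite subUset|exact: FD].
have mU : measurable (\big[setU/set0]_(i <- s) F i) by apply: bigsetU_measurable.
rewrite /penergy -ge0_integral_bigsetU//=.
- exact: penergy_subset.
- by apply: measurable_penergy => //; exact: measurable_funS mf.
- by move=> r _; rewrite lee_fin mulr_ge0// powR_ge0.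
Qed.

Lemma penergy_itvoo (f : R -> R) (x y : R) : measurable_fun `[x, y] f ->
  penergy f `]x, y[ = penergy f `[x, y].
Proof.
move=> mf; have [xy|yx] := leP y x.
  rewrite /penergy set_itv_ge ?bnd_simp -?leNgt// integral_set0.
  move: xy; rewrite le_eqVlt => /predU1P[->|yx]; first by rewrite set_itv1 integral_set1.
  by rewrite set_itv_ge ?bnd_simp -?ltNge// integral_set0.
have m1 : measurable_fun `]x, y] f by apply: measurable_funS mf => //; apply: subset_itvr; rewrite bnd_simp.
rewrite /penergy integral_itv_bndo_bndc ?integral_itv_obnd_cbnd//.
  exact: measurable_penergy.
by apply: measurable_penergy => //; apply: measurable_funS m1 => //; apply: subset_itvl; rewrite bnd_simp.
Qed.

Lemma osc_powR (f v : R -> R) (x y : R) : x < y -> primitive_on `[x, y] v f ->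
  mu.-integrable `[x, y] (EFin \o ka) ->
  ((`|v y - v x| `^ p)%:E <= penergy f `[x, y] * ((\int[mu]_(r in `[x, y]) ka r) `^ (p - 1))%:E)%E.
Proof.
move=> xy pv ki; have [fi ->] := pv x y (ltW xy) (fun _ => id).
exact: jensen_powR.
Qed.

Section limit.
Variables (x y E : R) (v : R -> R) (vn fn : nat -> R -> R).
Hypotheses (xy : x < y) (ki : mu.-integrable `[x, y] (EFin \o ka)).
Hypothesis pv : forall n, primitive_on `[x, y] (vn n) (fn n).
Hypothesis En : forall n, (penergy (fn n) `[x, y] <= E%:E)%E.
Hypothesis vnv : forall r, x <= r <= y -> vn n r @[n --> \oo] --> v r.

Let mfn n : measurable_fun `[x, y] (fn n).
Proof. by have [/measurable_int/measurable_EFinP] := pv n (ltW xy) (fun _ => id). Qed.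

(** By [le_powR_split] the sum of the oscillations of [vn m] is at most L times that of the
    primitive of [ka], plus L^(1-p) times the energy. L is chosen large first, then the total length
    small, uniformly in m. *)
Lemma limit_acc : acc x y v.
Proof.
have E0 : 0 <= E by rewrite -lee_fin (le_trans (penergy_ge0 _ _ _ _) (En 0)).
have q0 : 0 < p - 1 by rewrite subr_gt0.
(* Chosen so that L^(1-p) = 1/A and E/A < e/2. *)
move=> e e0; pose A := 2 * (E + 1) / e; have A0 : 0 < A by rewrite divr_gt0 ?mulr_gt0// ltr_wpDl.
pose L := A `^ (p - 1)^-1; have L0 : 0 < L by rewrite powR_gt0.
have LE : L `^ (1 - p) * E < e / 2.
  have -> : L `^ (1 - p) = A^-1.
    rewrite /L -powRrM (_ : _ * _ = -1) ?powR_inv1 ?ltW//.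
    by field; rewrite gt_eqF.
  rewrite mulrC ltr_pdivrMr//.
  have -> : e / 2 * A = E + 1 by rewrite /A; field; rewrite gt_eqF.
  by rewrite ltrDl.
pose K t := \int[mu]_(r in `[x, t]) ka r.
have pK : primitive_on `[x, y] K ka.
  move=> s t st sub; split; first exact: integrableS ki.
  have := sub s; have := sub t; rewrite /= !in_itv/= !lexx st /=.
  move=> /(_ isT)/andP[_ yc] /(_ isT)/andP[cx _].
  rewrite /K (@Rintegral_itv_cat _ ka x s t)//; first by rewrite addrAC subrr add0r.
  by apply: integrableS ki => //; apply: subset_itvl; rewrite bnd_simp.
have [d d0 Hd] := primitive_acc xy pK (divr_gt0 e0 (mulr_gt0 (ltr0n _ 4) L0)).
exists d => // n s t st tst std.
have {Hd}HK := Hd n s t st tst std.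
suff H m : \sum_(i < n) `|vn m (t i) - vn m (s i)| <= L * (e / (4 * L)) + L `^ (1 - p) * E.
  apply: (@le_lt_trans _ _ (L * (e / (4 * L)) + L `^ (1 - p) * E)); last first.
    by rewrite (_ : L * _ = e / 4); [lra|field; rewrite gt_eqF].
  have cv : \sum_(i < n) `|vn m (t i) - vn m (s i)| @[m --> \oo] --> \sum_(i < n) `|v (t i) - v (s i)|.
    apply: cvg_big => [|i _]; first exact: add_continuous.
    have [h1 [h2 h3]] := st i.
    by apply: cvg_norm; apply: cvgB; apply: vnv; rewrite ?(le_trans h1)// ?(le_trans h2) ?h1.
  rewrite -(cvg_lim _ cv)//; apply: limr_le; first exact: cvgP cv.
  exact: nearW.
have pi (i : 'I_n) : penergy (fn m) `]s i, t i[ \is a fin_num.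
  rewrite ge0_fin_numE ?penergy_ge0//; apply: (le_lt_trans _ (ltry E)); apply: le_trans (En m).
  have [h1 [h2 h3]] := st i.
  by apply: penergy_subset => //; apply: subset_itv; rewrite bnd_simp.
apply: (@le_trans _ _ (\sum_(i < n) (L * `|K (t i) - K (s i)| + L `^ (1 - p) * fine (penergy (fn m) `]s i, t i[)))).
  apply: ler_sum => i _; have [h1 [h2 h3]] := st i.
  have P0 : 0 <= fine (penergy (fn m) `]s i, t i[) by rewrite fine_ge0// penergy_ge0.
  move: h2; rewrite le_eqVlt => /predU1P[->|h2].
    rewrite !subrr !normr0 mulr0 add0r mulr_ge0 ?powR_ge0//.
    by rewrite fine_ge0// penergy_ge0.
  have sub : (`[s i, t i]%classic : set R) `<=` `[x, y] by apply: subset_itv; rewrite bnd_simp.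
  have kst : mu.-integrable `[s i, t i] (EFin \o ka) by exact: integrableS ki.
  have Kst : K (t i) - K (s i) = \int[mu]_(r in `[s i, t i]) ka r.
    by have [] := pK _ _ (ltW h2) sub.
  have K0 : 0 < K (t i) - K (s i) by rewrite Kst; exact: (Rint_ka_gt0 ka0 mka h2).
  rewrite (gtr0_norm K0); apply: le_powR_split => //.
  rewrite -lee_fin EFinM fineK// penergy_itvoo; last by apply: measurable_funS (mfn m).
  by rewrite Kst; apply: osc_powR => //; exact: primitive_onS (pv m).
rewrite big_split/= -!mulr_sumr lerD// ler_wpM2l ?powR_ge0 ?(ltW L0)//.
  exact: ltW.
rewrite -lee_fin -sumEFin (eq_bigr (fun i => penergy (fn m) `]s i, t i[)); last first.
  by move=> i _; rewrite fineK.
apply: le_trans (En m); apply: sum_penergy_le => //.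
- exact: index_enum_uniq.
- by apply: sub_trivIset tst.
- by move=> i _; have [h1 [h2 h3]] := st i; apply: subset_itv; rewrite bnd_simp.
Qed.

End limit.

Lemma cvg_psum (x y : R) (v : R -> R) (vn : nat -> R -> R) m : x < y ->
  (forall r, x <= r <= y -> vn n r @[n --> \oo] --> v r) ->
  psum p ka x y (vn n) m @[n --> \oo] --> psum p ka x y v m.
Proof.
move=> xy vnv; apply: cvg_big => [|k _]; first exact: add_continuous.
apply: cvgM; last exact: cvg_cst.
have nd j : (j <= 2 ^ m)%N -> x <= node x y m j <= y.
  move=> jm; have := @node_le _ _ _ xy m _ _ (leq0n j); have := @node_le _ _ _ xy m _ _ jm.
  by rewrite node0 node_last => -> ->.
apply: (continuous_cvg _ (continuous_powR (lt_trans ltr01 p1) (x := incr x y v m k))).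
by apply: cvgB; apply: vnv; apply: nd => //; exact: ltnW.
Qed.

Section limit_cells.
Variables (J : set R) (s : seq (R * R)) (E : R) (v : R -> R) (vn fn : nat -> R -> R).
Hypothesis cJ : open_cells J s.
Hypothesis ki : forall x y, `[x, y] `<=` J -> mu.-integrable `[x, y] (EFin \o ka).
Hypothesis pv : forall n, primitive_on J (vn n) (fn n).
Hypothesis mf : forall n, measurable_fun J (fn n).
Hypothesis En : forall n, (penergy (fn n) J <= E%:E)%E.
Hypothesis vnv : forall r, J r -> vn n r @[n --> \oo] --> v r.

Let oJ : open J. Proof. by have [] := cJ. Qed.
Let mJ : measurable J. Proof. exact: open_measurable. Qed.

Lemma measurable_limit : measurable_fun setT (v \_ J).
Proof.
apply/(measurable_restrictT _ _).1 => //.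
apply: (@measurable_fun_cvg _ _ _ _ vn) => //.
by move=> n; exact: primitive_measurable (pv n).
Qed.

Lemma limit_primitive : primitive_on J (v \_ J) (rderiv (v \_ J)).
Proof.
apply: acc_primitive; first exact: measurable_limit.
move=> x y xy sub; apply: (limit_acc (E := E) (vn := vn) (fn := fn)) => //.
- exact: ki.
- by move=> n; exact: primitive_onS (pv n).
- by move=> n; apply: le_trans (En n); exact: penergy_subset.
- move=> r rxy; have Jr : J r by apply: sub; rewrite /= in_itv.
  by rewrite patchE mem_set//; exact: vnv.
Qed.

Let core h : set R := [set r | exists2 c, c \in s & (c.1 + h < r < c.2 - h)%R].

Let core_le h h' : h' <= h -> core h `<=` core h'.
Proof. by move=> hh r [c cs /andP[h1 h2]]; exists c => //; apply/andP; split; lra. Qed.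

Let open_core h : open (core h).
Proof.
have -> : core h = \bigcup_(c in [set` s]) `]c.1 + h, c.2 - h[%classic.
  apply/seteqP; split => r; first by move=> [c cs h']; exists c => //=; rewrite in_itv.
  by move=> [c /= cs]; rewrite in_itv/= => h'; exists c.
by apply: bigcup_open => c _; exact: interval_open.
Qed.

(** On shrunk cells, whose closures lie in [J], a dyadic sum of the limit is the limit of the dyadic
    sums of [vn], each at most the energy bound. *)
Let penergy_core h : 0 < h -> (forall c, c \in s -> 4 * h <= c.2 - c.1) ->
  (penergy (rderiv (v \_ J)) (core h) <= E%:E)%E.
Proof.
move=> h0 Hh; have [_ us Hs _] := cJ.
have sub c : c \in s -> (`[c.1 + h, c.2 - h]%classic : set R) `<=` J.
  by move=> cs; have [_ H _ _] := Hs _ cs; apply: subset_trans H; apply: subset_itv; rewrite bnd_simp; lra.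
have lt c : c \in s -> c.1 + h < c.2 - h by move=> /Hh; lra.
pose sh := [seq (c.1 + h, c.2 - h) | c <- s].
have -> : core h = [set r | exists2 c, c \in sh & (c.1 < r < c.2)%R].
  apply/seteqP; split => r.
    by move=> [c cs hr]; exists (c.1 + h, c.2 - h) => //; exact: map_f.
  by move=> [_ /mapP[c cs ->] /= hr]; exists c.
apply: (penergy_le_psum p1 ka0 mka (f := fun _ => rderiv (v \_ J))).
  move=> _ /mapP[c cs ->] /=; split; first exact: lt.
    exact: (primitive_onS (sub _ cs) limit_primitive).
  exact: ki (sub _ cs).
move=> m; rewrite /sh big_map/=.
have cv : \sum_(c <- s) psum p ka (c.1 + h) (c.2 - h) (vn n) m @[n --> \oo] -->
    \sum_(c <- s) psum p ka (c.1 + h) (c.2 - h) (v \_ J) m.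
  rewrite big_seq; under eq_fun do rewrite big_seq.
  apply: cvg_big => [|c cs]; first exact: add_continuous.
  apply: cvg_psum; first exact: lt.
  move=> r rc; have Jr : J r by apply: (sub _ cs); rewrite /= in_itv.
  by rewrite patchE mem_set//; exact: vnv.
rewrite -(cvg_lim _ cv)//; apply: limr_le; first exact: cvgP cv.
apply: nearW => n; rewrite -lee_fin -sumEFin; apply: le_trans (En n).
apply: (@le_trans _ _ (\sum_(c <- s) penergy (fn n) `](c.1 + h)%R, (c.2 - h)%R[)%E).
  rewrite !big_seq; apply: lee_sum => c cs.
  have mc : measurable_fun `[c.1 + h, c.2 - h] (fn n) by apply: measurable_funS (mf n) => //; exact: sub.
  rewrite penergy_itvoo//.
  apply: (psum_le_penergy p1 ka0 mka (lt _ cs) (ki (sub _ cs))) => //.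
  exact: primitive_onS (sub _ cs) (pv n).
apply: sum_penergy_le => //.
- apply/trivIsetP => c c' cs c's cc'; rewrite -subset0 => r [].
  rewrite /= !in_itv/= => /andP[h1 h2] /andP[h3 h4].
  by have [|] := cells_order cJ cs c's cc'; lra.
- by move=> c cs; apply: subset_trans (sub _ cs); exact: subset_itvW.
Qed.

Lemma limit_energy : (penergy (rderiv (v \_ J)) J <= E%:E)%E.
Proof.
have [_ us Hs HJ] := cJ.
have [d [d0 Hd]] : exists d : R, 0 < d /\ forall c : R * R, c \in s -> 4 * d <= c.2 - c.1.
  have [d [d0 _ Hd]] := cells_margin (fun c cs => let: And4 h _ _ _ := Hs c cs in h) (@ltr01 R).
  by exists d.
(* The shrunk cells exhaust [J], and the bound on each of them passes to the union by monotone
   convergence. *)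
have JE : J = \bigcup_k core (d / k.+1%:R).
  apply/seteqP; split => r.
    move=> /HJ[c cs /andP[h1 h2]].
    pose e := Num.min (r - c.1) (c.2 - r).
    have e0 : 0 < e by rewrite lt_min !subr_gt0 h1.
    have [k Hk] : exists k : nat, d / k.+1%:R < e.
      exists (Num.trunc (d / e)); rewrite ltr_pdivrMr// mulrC -ltr_pdivrMr//.
      exact: truncnS_gt.
    exists k => //; exists c => //; move: (d / _) Hk => z; rewrite /e lt_min => /andP[h3 h4].
    by apply/andP; split; lra.
  move=> [k _ [c cs hr]]; have [_ H _ _] := Hs _ cs; apply: H; rewrite /= in_itv/=.
  have := divr_gt0 d0 (ltr0Sn R k); move: (d / _) hr => z /andP[h1 h2] z0.
  by apply/andP; split; lra.
rewrite [X in penergy _ X]JE.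
have mg (D : set R) : measurable_fun D (fun r => (`|rderiv (v \_ J) r| `^ p * ka r `^ (1 - p))%:E).
  apply: measurable_funTS; apply: measurable_penergy => //; apply: measurable_rderiv.
  exact: measurable_limit.
have cv := @ge0_nondecreasing_set_cvg_integral _ (measurableTypeR R) R (fun k => core (d / k.+1%:R))
  (fun r => (`|rderiv (v \_ J) r| `^ p * ka r `^ (1 - p))%:E) mu.
have {}cv := cv _ _ _ _.
rewrite /penergy -(cvg_lim _ (cv _ _ _ _))//; first last.
- by move=> i r _; rewrite lee_fin mulr_ge0// powR_ge0.
- by move=> i; exact: mg.
- by move=> i; apply: open_measurable; exact: open_core.
- move=> i j ij; apply/subsetPset; apply: core_le.
  by rewrite ler_wpM2l ?(ltW d0)// lef_pV2 ?posrE// ler_nat.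
apply: lime_le.
  apply: cvgP; apply: cv => [i j ij|i|i|i r _].
  - apply/subsetPset; apply: core_le.
    by rewrite ler_wpM2l ?(ltW d0)// lef_pV2 ?posrE// ler_nat.
  - by apply: open_measurable; exact: open_core.
  - exact: mg.
  - by rewrite lee_fin mulr_ge0// powR_ge0.
apply: nearW => k; apply: penergy_core; first by rewrite divr_gt0.
by move=> c /Hd; apply: le_trans; rewrite ler_wpM2l// ler_pdivrMr// ler_peMr ?(ltW d0)// ler1n.
Qed.

End limit_cells.

End energy_limit.

(** The integrals are summable, so the series of the functions has a finite sum almost everywhere,
    and its terms tend to 0 there. *)
Lemma cvg0_of_integral d (T : measurableType d) (R : realType) (mu : {measure set T -> \bar R})
    (D : set T) (g : nat -> T -> R) : measurable D ->
  (forall n, measurable_fun D (g n)) -> (forall n x, D x -> 0 <= g n x) ->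
  (forall n, (\int[mu]_(x in D) (g n x)%:E <= (1 / (2 ^ n.+1)%:R)%:E)%E) ->
  exists2 N : set T, measurable N /\ mu N = 0%E &
    forall x, D x -> ~ N x -> g n x @[n --> \oo] --> 0.
Proof.
move=> mD mg g0 Hg.
pose S (x : T) := (\sum_(0 <= n <oo) (g n x)%:E)%E.
have S0 x : D x -> (0 <= S x)%E.
  by move=> Dx; apply: nneseries_ge0 => n _ _; rewrite lee_fin g0.
have mS : measurable_fun D S.
  by apply: ge0_emeasurable_sum => [n x Dx _|n _]; [rewrite lee_fin g0|exact/measurable_EFinP].
have Si : mu.-integrable D S.
  apply/integrableP; split => //.
  rewrite (eq_integral S); last by move=> x /set_mem/S0 h; rewrite gee0_abs.
  have -> := @integral_nneseries _ _ _ mu D mD (fun n x => (g n x)%:E)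
    (fun n => (measurable_EFinP _ _).2 (mg n)) (fun n x Dx => g0 n x Dx).
  apply: (@le_lt_trans _ _ 1%E); last exact: ltry.
  apply: (le_trans _ (epsilon_trick0 xpredT ler01)).
  apply: lee_nneseries => // n _ _; apply: integral_ge0 => x Dx; by rewrite lee_fin g0.
have [N [mN N0 HN]] := integrable_ae mD Si; exists N => // x Dx Nx.
have Sfin : S x \is a fin_num by apply: contrapT => h; apply: Nx; apply: HN => /(_ Dx).
apply: cvg_series_cvg_0; apply: nondecreasing_is_cvgn.
  by apply/nondecreasing_seqP => n; rewrite /series/= big_nat_recr//= lerDl g0.
exists (fine (S x)) => _ [n _ <-]; rewrite -lee_fin fineK// /series/= -sumEFin.
by apply: nneseries_lim_ge => k _ _; rewrite lee_fin g0.
Qed.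

Lemma powR_normB_le (R : realType) (p x y : R) : 0 <= p ->
  `|x| `^ p <= 2 `^ p * (`|x - y| `^ p + `|y| `^ p).
Proof.
move=> p0; have h : `|x| <= 2 * Num.max `|x - y| `|y|.
  have := ler_normD (x - y) y; rewrite subrK => /le_trans; apply.
  by rewrite mulrDl !mul1r lerD// le_max lexx ?orbT.
apply: (@le_trans _ _ ((2 * Num.max `|x - y| `|y|) `^ p)).
  by rewrite ge0_ler_powR ?nnegrE// mulr_ge0// le_max normr_ge0.
rewrite powRM ?le_max ?normr_ge0// ler_wpM2l ?powR_ge0//.
by have [_|_] := leP `|x - y| `|y|; rewrite ?lerDl ?lerDr powR_ge0.
Qed.

(** * Profiles of elements of X and lower semicontinuity of their energy *)

Section profiles.
Context {R : realType}.
Local Notation mu := (@lebesgue_measure R).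
Variables (d : nat) (p a b : R) (eta : R -> R) (Omega : set 'rV[R]_d) (s : seq (R * R)).
Hypotheses (hd : (0 < d)%N) (hp : 1 < p) (ha : 0 <= a) (hab : a < b).
Hypothesis hOmega : Omega = eball b \/ Omega = annulus a b.
Hypothesis eta_ge0 : {ae mu, forall r : R, 0 <= r -> 0 <= eta r}.
Hypothesis eta_L1loc : L1loc_halfline eta.
Local Notation I := (regular_set p a b eta).
Hypothesis cI : open_cells I s.
Hypothesis sE : forall c, regular_components p a b eta c <-> c \in s.
Local Notation ka := (kappa d p eta).
Local Notation sigma := (sphere_area d : R).
Local Notation IO := (@enorm R d @^-1` I).
Local Notation weight_at := (weight_at p a b eta Omega).
Local Notation X := (X p a b eta Omega).
Local Notation int_pow := (int_pow p a b eta Omega).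

Let p0 : 0 < p. Proof. exact: lt_trans hp. Qed.
Let mI : measurable I. Proof. exact: measurable_I. Qed.
Let mka : measurable_fun setT ka. Proof. exact: measurable_kappa. Qed.
Let ka0 r : 0 < ka r. Proof. exact: kappa_gt0. Qed.
Let kai x y : `[x, y] `<=` I -> mu.-integrable `[x, y] (EFin \o ka).
Proof. exact: integrable_kappa. Qed.
Let sigma0 : 0 < sigma. Proof. exact: sphere_area_gt0. Qed.
Let mIO : measurable IO. Proof. exact: measurable_IO. Qed.
Let Ipos r : I r -> 0 < r < b. Proof. exact: I_pos. Qed.
Let Hreg : exists2 N : set R, measurable N /\ mu N = 0%E &
  forall r, I r -> ~ N r -> 0 < eta_pos eta r /\ eta r = eta_pos eta r.
Proof. exact: regular_ae. Qed.

Definition profile_energy (f : R -> R) : \bar R := (sigma%:E * penergy p ka f I)%E.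

Lemma energy_radial_field (f : R -> R) : measurable_fun I f ->
  energy p eta IO (radial_field f) = profile_energy f.
Proof.
move=> mf; have [N [mN N0] HN] := Hreg.
rewrite /energy /profile_energy /penergy.
rewrite -(@integral_radial_ae R d I N (fun r => (`|f r| `^ p * eta r)%:E)
  (fun r => `|f r| `^ p * ka r `^ (1 - p)) hd mI _ mN N0).
- apply: eq_integral => x /set_mem Ix; congr (_ `^ p * _)%:E.
  have /andP[x0 _] := Ipos Ix.
  by rewrite /radial_field enormZ normrM normfV (gtr0_norm x0) divfK// gt_eqF.
- by move=> r /Ipos; rewrite /= in_itv/= => /andP[->].
- by apply/measurable_EFinP; apply: measurable_penergy.
- by move=> r _; rewrite mulr_ge0 ?powR_ge0.
- move=> r Ir Nr; have [e0 ->] := HN r Ir Nr; rewrite -EFinM -mulrA; congr (_ * _)%:E.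
  have /andP[r0 _] := Ipos Ir.
  by rewrite kappa_rho /radial_weight 1?mulrC// mulr_gt0// exprn_gt0.
Qed.

Lemma integral_Dom_eta (f : R -> R) : measurable_fun I f ->
  (\int[mu]_(r in I) (r ^+ d.-1 * `|f r| `^ p * eta r)%:E)%E = penergy p ka f I.
Proof.
move=> mf; have [N [mN N0] HN] := Hreg.
apply: (@eq_integral_off_null _ (measurableTypeR R) R mu I N _ _ mN N0) => r Ir Nr.
have [e0 ->] := HN r Ir Nr; have /andP[r0 _] := Ipos Ir.
rewrite kappa_rho // /radial_weight ?mulr_gt0 ?exprn_gt0//; congr EFin; ring.
Qed.

Definition profile (u : 'rV[R]_d -> R) (v f : R -> R) :=
  [/\ primitive_on I v f, measurable_fun I f &
    exists2 N : set 'rV[R]_d, measurable N /\ leb d N = 0%E &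
      forall x, IO x -> ~ N x -> u x = v (enorm x)].

(** The functional G of the overview. *)
Definition relaxed (u : 'rV[R]_d -> R) : \bar R :=
  ereal_inf [set profile_energy f | f in [set f | exists v, profile u v f]].

Lemma leb_shell_gt0 (x y : R) : 0 <= x -> x < y -> (0 < leb d (@enorm R d @^-1` `]x, y[))%E.
Proof.
move=> x0 xy; have mxy : measurable (`]x, y[%classic : set R) by [].
have pos r : `]x, y[%classic r -> 0 < r by rewrite /= in_itv/= => /andP[/(le_lt_trans x0)].
have -> : leb d (@enorm R d @^-1` `]x, y[) = (\int[leb d]_(x in enorm @^-1` `]x, y[) 1)%E.
  rewrite integral_cst ?mul1e// -[X in measurable X]setTI; exact: measurable_enorm.
rewrite (@integral_radial_ae R d `]x, y[ set0 (cst 1%E) (fun r => r ^+ d.-1))//.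
- rewrite mule_gt0 ?lte_fin//; apply: integral_gt0 => //.
    apply: (@lt_le_trans _ _ (y - x)%:E); first by rewrite lte_fin subr_gt0.
    rewrite le_eqVlt; apply/orP; left; apply/eqP/esym.
    by apply: (etrans (lebesgue_measure_itv `]x, y[)); rewrite /= lte_fin xy.
  by move=> r /pos r0; rewrite exprn_gt0.
- by move=> r /pos r0; rewrite /= in_itv/= r0.
- by move=> r /pos r0; rewrite exprn_ge0// ltW.
- by move=> r _ _; rewrite mul1e.
Qed.


Lemma osc_bound (x y E : R) (v f K : R -> R) : primitive_on `[x, y] v f ->
  primitive_on `[x, y] K ka -> (penergy p ka f `[x, y] <= E%:E)%E ->
  forall q t, x <= q <= y -> x <= t <= y -> `|v q - v t| `^ p <= E * `|K q - K t| `^ (p - 1).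
Proof.
move=> pv pK En; have E0 : 0 <= E by rewrite -lee_fin (le_trans (penergy_ge0 _ _ _ _) En).
suff H q t : x <= q -> q < t -> t <= y -> `|v t - v q| `^ p <= E * `|K t - K q| `^ (p - 1).
  move=> q t /andP[xq qy] /andP[xt ty]; case: (ltgtP q t) => [qt|tq|->].
  - by rewrite distrC [X in _ <= _ * X `^ _]distrC; exact: H.
  - exact: H.
  - by rewrite !subrr !normr0 [leLHS]powR0 ?gt_eqF// mulr_ge0// powR_ge0.
move=> xq qt ty; have sub : (`[q, t]%classic : set R) `<=` `[x, y] by apply: subset_itv; rewrite bnd_simp.
have [fi _] := pv _ _ (le_trans xq (le_trans (ltW qt) ty)) (fun _ => id).
have [ki e] := pK _ _ (ltW qt) sub.
have := osc_powR hp ka0 mka qt (primitive_onS sub pv) ki; rewrite -e => h.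
have K0 : 0 < K t - K q by rewrite e; exact: (Rint_ka_gt0 ka0 mka qt).
rewrite (gtr0_norm K0) -lee_fin EFinM; apply: (le_trans h).
rewrite lee_wpmul2r ?lee_fin ?powR_ge0//; apply: le_trans En.
by apply: penergy_subset => //; move/measurable_int/measurable_EFinP : fi.
Qed.

Lemma exists_mem_off (A N : set 'rV[R]_d) : measurable A -> (0 < leb d A)%E ->
  measurable N -> leb d N = 0%E -> exists2 x, A x & ~ N x.
Proof.
move=> mA A0 mN N0; apply: contrapT => h.
have AN : A `<=` N by move=> x Ax; apply: contrapT => Nx; apply: h; exists x.
have : (leb d A <= leb d N)%E by apply: le_measure; rewrite ?inE.
by rewrite N0 leNgt A0.
Qed.

(** The integrals of |un - u|^p times the weight are summable, and the weight can be divided out on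
    [IO], where it is positive. *)
Lemma profile_vanishing (un : nat -> 'rV[R]_d -> R) (u : 'rV[R]_d -> R) : X u ->
  (forall n, X (un n)) ->
  (forall n, (int_pow (un n \- u)%R <= (1 / (2 ^ n.+1)%:R)%:E)%E) ->
  exists2 N : set 'rV[R]_d, measurable N /\ leb d N = 0%E &
    forall x, IO x -> ~ N x -> un n x @[n --> \oo] --> u x.
Proof.
move=> [mu' _] Xn Hn; have IOO : IO `<=` Omega by apply: IO_sub.
have mO : measurable Omega by apply: (measurable_Omega hOmega).
have muI : measurable_fun IO u by apply: measurable_funS mu'.
have mn n : measurable_fun IO (un n) by have [h _] := Xn n; apply: measurable_funS h.
have mg n : measurable_fun IO (fun x => `|un n x - u x| `^ p * weight_at (enorm x)).
  apply: measurable_funM; last exact: (measurable_weight_at_enorm hd hp ha hOmega eta_ge0 eta_L1loc cI sE).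
  apply: (@measurableT_comp _ _ _ _ _ _ (fun x : R => x `^ p)) => //.
  by apply: measurableT_comp => //; exact: measurable_funB.
have g0 n x : IO x -> 0 <= `|un n x - u x| `^ p * weight_at (enorm x).
  by move=> _; rewrite mulr_ge0// powR_ge0.
have Hg n : (\int[leb d]_(x in IO) (`|un n x - u x| `^ p * weight_at (enorm x))%:E <= (1 / (2 ^ n.+1)%:R)%:E)%E.
  have <- : int_pow (un n \- u)%R = (\int[leb d]_(x in IO) (`|un n x - u x| `^ p * weight_at (enorm x))%:E)%E.
    exact: (int_powE hd hp hOmega cI sE).
  exact: Hn.
have [N [mN N0] HN] := cvg0_of_integral mIO mg g0 Hg.
exists N => // x Ix Nx; have := HN x Ix Nx => cv.
have w0 : 0 < weight_at (enorm x) by exact: (weight_at_gt0 hd hp ha hOmega eta_ge0 eta_L1loc cI sE).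
apply/cvgrPdist_lt => e e0.
have ew : 0 < e `^ p * weight_at (enorm x) by rewrite mulr_gt0// powR_gt0.
move/cvgrPdist_lt : cv => /(_ _ ew); apply: filterS => n.
rewrite sub0r normrN ger0_norm ?mulr_ge0 ?powR_ge0// ltr_pM2r// distrC => h.
by rewrite ltNge; apply: contraL h => h; rewrite -leNgt ge0_ler_powR ?nnegrE ?(ltW p0) ?(ltW e0).
Qed.

(** Convergence is known at almost every x only; the uniform oscillation bound carries it to every
    radius of I, which the limit of increments and of dyadic sums requires. *)
Lemma profile_limit (un : nat -> 'rV[R]_d -> R) (u : 'rV[R]_d -> R) (vn fn : nat -> R -> R) (E : R) :
  X u -> (forall n, X (un n)) ->
  (forall n, (int_pow (un n \- u)%R <= (1 / (2 ^ n.+1)%:R)%:E)%E) ->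
  (forall n, profile (un n) (vn n) (fn n)) ->
  (forall n, (penergy p ka (fn n) I <= E%:E)%E) ->
  exists v f, profile u v f /\ (penergy p ka f I <= E%:E)%E.
Proof.
move=> Xu Xn Hn Pn En.
have [N0 [mN0 N00] HN0] := profile_vanishing Xu Xn Hn.
have /choice[Nn HNn] : forall n, exists Nn : set 'rV[R]_d, (measurable Nn /\ leb d Nn = 0%E) /\
    forall x, IO x -> ~ Nn x -> un n x = vn n (enorm x).
  by move=> n; have [_ _ [Nn h1 h2]] := Pn n; exists Nn.
have [mU U0] := @null_set_bigcup _ _ R (leb d) nat Nn (fun n => (HNn n).1).
have mN : measurable (N0 `|` \bigcup_n Nn n) by exact: measurableU.
have NN0 : leb d (N0 `|` \bigcup_n Nn n) = 0%E by exact: null_set_setU.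
have cvx x : IO x -> ~ (N0 `|` \bigcup_n Nn n) x -> vn n (enorm x) @[n --> \oo] --> u x.
  move=> Ix /not_orP[Nx0 Nxn]; have := HN0 x Ix Nx0.
  rewrite (_ : (fun n => un n x) = (fun n => vn n (enorm x)))//.
  by apply/funext => n; apply: (HNn n).2 => // h; apply: Nxn; exists n.
have [_ _ HsI HI] := cI.
have E0 : 0 <= E by rewrite -lee_fin (le_trans (penergy_ge0 _ _ _ _) (En 0)).
(* Near r there is a radius [enorm w] at which the profiles converge, and all of them oscillate by
   less than e / 2 between r and it. *)
have cvI r : I r -> cvgn (fun n => vn n r).
  move=> Ir; apply: cauchy_cvg; apply: cauchy_exP => e e0.
  have [c cs /andP[c1r rc2]] := HI r Ir.
  pose x := (c.1 + r) / 2; pose y := (r + c.2) / 2.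
  have xyI : `[x, y] `<=` I by apply: (cell_segment cI cs); rewrite /x /y; lra.
  have ki := kai xyI; have xr : x < r by rewrite /x; lra.
  have ry : r < y by rewrite /y; lra.
  pose K t := \int[mu]_(q in `[x, t]) ka q.
  have pK : primitive_on `[x, y] K ka.
    move=> q t st sub; split; first exact: integrableS ki.
    have := sub q; have := sub t; rewrite /= !in_itv/= !lexx st /=.
    move=> /(_ isT)/andP[_ yc] /(_ isT)/andP[cx _].
    rewrite /K (@Rintegral_itv_cat _ ka x q t)//; first by rewrite addrAC subrr add0r.
    by apply: integrableS ki => //; apply: subset_itvl; rewrite bnd_simp.
  (* Makes E de^(p-1) smaller than (e/2)^p. *)
  pose de := ((e / 2) `^ p / (E + 1)) `^ (p - 1)^-1.
  have e2 : 0 < (e / 2) `^ p / (E + 1) by rewrite divr_gt0 ?powR_gt0 ?divr_gt0 ?ltr_wpDl.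
  have de0 : 0 < de by rewrite powR_gt0.
  have cK : {for r, continuous K} by exact: (primitive_continuous pK).
  have [z z0 Hz] : exists2 z, 0 < z & forall t, `|r - t| < z -> x <= t <= y /\ `|K r - K t| < de.
    have h1 : \forall t \near r, x <= t <= y by exact: near_itvoo.
    have h2 : \forall t \near r, `|K r - K t| < de.
      by move/cvgrPdist_lt : cK => /(_ _ de0).
    have : \forall t \near r, x <= t <= y /\ `|K r - K t| < de by exact: filterI.
    move=> /nbhs_ballP[z /= z0 Hz].
    by exists z => // t rt; apply: Hz.
  (* The bound by r keeps the radii of the shell nonnegative, so its measure is positive. *)
  pose m := Num.min z r; have /andP[r0 _] := Ipos Ir.
  have m0 : 0 < m by rewrite lt_min z0.
  have mz : m <= z by rewrite ge_min lexx.
  have mr : m <= r by rewrite ge_min lexx orbT.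
  have mS : measurable (@enorm R d @^-1` `]r - m, r + m[).
    by rewrite -[X in measurable X]setTI; exact: measurable_enorm.
  have S0 : (0 < leb d (@enorm R d @^-1` `](r - m)%R, (r + m)%R[))%E by apply: leb_shell_gt0; lra.
  have [w wS Nw] := exists_mem_off mS S0 mN NN0.
  move: wS; rewrite /= in_itv/= => /andP[w1 w2].
  have [wxy Kw] : x <= enorm w <= y /\ `|K r - K (enorm w)| < de.
    by apply: Hz; rewrite ltr_norml; apply/andP; split; lra.
  have Iw : IO w by apply: xyI; rewrite /= in_itv.
  have osc n : `|vn n r - vn n (enorm w)| < e / 2.
    have pn : primitive_on `[x, y] (vn n) (fn n) by have [h _ _] := Pn n; exact: primitive_onS h.
    have Enxy : (penergy p ka (fn n) `[x, y] <= E%:E)%E.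
      by apply: le_trans (En n); apply: penergy_subset => //; have [_ h _] := Pn n.
    have rxy : x <= r <= y by rewrite (ltW xr) (ltW ry).
    have := osc_bound pn pK Enxy rxy wxy => h.
    rewrite ltNge; apply/negP => h'.
    have h2 : (e / 2) `^ p <= `|vn n r - vn n (enorm w)| `^ p.
      by rewrite ge0_ler_powR ?nnegrE ?divr_ge0 ?(ltW e0) ?(ltW p0).
    have h3 : `|K r - K (enorm w)| `^ (p - 1) <= de `^ (p - 1).
      by rewrite ge0_ler_powR ?nnegrE ?subr_ge0 ?(ltW hp) ?(ltW Kw) ?(ltW de0).
    have deE : de `^ (p - 1) = (e / 2) `^ p / (E + 1).
      by rewrite /de -powRrM mulVf ?powRr1 ?(ltW e2)// gt_eqF// subr_gt0.
    have h4 : (e / 2) `^ p <= E * ((e / 2) `^ p / (E + 1)).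
      by apply: (le_trans h2); apply: (le_trans h); rewrite -deE ler_wpM2l.
    have h5 : 0 < (e / 2) `^ p by rewrite powR_gt0 ?divr_gt0.
    move: h4; rewrite mulrA ler_pdivlMr ?ltr_wpDl// mulrC ler_pM2r//; lra.
  exists (u w).
  have := cvx _ Iw Nw => /cvgrPdist_lt/(_ (e / 2) ltac:(by rewrite divr_gt0)).
  apply: filterS => n h; rewrite /ball/=.
  rewrite -(subrK (vn n (enorm w)) (u w)) -addrA.
  apply: (le_lt_trans (ler_normD _ _)); rewrite [e]splitr ltrD// distrC; exact: osc.
pose v r := lim (vn n r @[n --> \oo]).
have vnv r : I r -> vn n r @[n --> \oo] --> v r by exact: cvI.
have pn n : primitive_on I (vn n) (fn n) by have [] := Pn n.
have mfn n : measurable_fun I (fn n) by have [] := Pn n.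
exists (v \_ I), (rderiv (v \_ I)); split; last first.
  by apply: (limit_energy hp ka0 mka cI kai pn mfn En vnv).
split.
- exact: (limit_primitive hp ka0 mka cI kai pn mfn En vnv).
- apply: measurable_funTS; apply: measurable_rderiv.
  exact: (measurable_limit cI pn vnv).
- exists (N0 `|` \bigcup_n Nn n) => // x Ix Nx; rewrite patchE mem_set//.
  exact: cvg_unique (cvx x Ix Nx) (vnv _ Ix).
Qed.

Lemma normX_lt (u : 'rV[R]_d -> R) (e : R) : 0 < e ->
  (normX p a b eta Omega u < (e `^ p^-1)%:E)%E -> (int_pow u <= e%:E)%E.
Proof.
move=> e0; rewrite /normX; have I0 : (0 <= int_pow u)%E.
  by apply: integral_ge0 => x _; rewrite lee_fin mulr_ge0 ?powR_ge0.
case: (int_pow u) I0 => [r|//|//]; rewrite ?lee_fin.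
  move=> r0; rewrite poweR_EFin lte_fin => h; rewrite leNgt; apply/negP => er.
  move: h; rewrite ltNge ge0_ler_powR ?nnegrE ?(ltW e0) ?(ltW er)//.
  by rewrite invr_ge0 ltW.
by move=> _; rewrite poweRE gt_eqF ?invr_gt0.
Qed.

(** If it failed, elements converging fast to u would have profiles of energy below some t' <
    [relaxed u], and [profile_limit] would give u itself such a profile, up to equality. *)
Lemma relaxed_lsc : lscX p a b eta Omega relaxed.
Proof.
move=> u Xu t tu; apply: contrapT => H.
(* The gap between t and t' lets the infimum defining [relaxed u'] be approached by an actual
   profile. *)
have [t' tt' t'u] : exists2 t' : R, t < t' & (t'%:E < relaxed u)%E.
  case: (relaxed u) tu => [r|_|//]; last by exists (t + 1); rewrite ?ltrDl ?ltry.
  rewrite lte_fin => tr; exists ((t + r) / 2); rewrite ?lte_fin; lra.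
have Hn n : exists q : ('rV[R]_d -> R) * (R -> R) * (R -> R),
    [/\ X q.1.1, (int_pow (q.1.1 \- u)%R <= (1 / (2 ^ n.+1)%:R)%:E)%E, profile q.1.1 q.1.2 q.2 &
        (profile_energy q.2 < t'%:E)%E].
  have e0 : 0 < (1 / (2 ^ n.+1)%:R : R) by rewrite divr_gt0// ltr0n expn_gt0.
  apply: contrapT => h; apply: H; exists ((1 / (2 ^ n.+1)%:R) `^ p^-1); first exact: powR_gt0.
  move=> u' Xu' nu; rewrite ltNge; apply/negP => ru'; apply: h.
  have /ereal_inf_lt[_ [f [v Pvf] <-] fE] : (relaxed u' < t'%:E)%E by apply: (le_lt_trans ru'); rewrite lte_fin.
  by exists (u', v, f); split => //; exact: normX_lt nu.
have [q Hq] := choice Hn.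
have [||||v [f [Pvf Ef]]] := @profile_limit (fun n => (q n).1.1) u (fun n => (q n).1.2)
  (fun n => (q n).2) (t' / sigma) Xu; try by move=> n; have [] := Hq n.
  move=> n; have [_ _ _ h] := Hq n.
  by rewrite EFinM lee_pdivlMr// muleC ltW.
move: t'u; rewrite ltNge => /negP; apply.
apply: (@le_trans _ _ (profile_energy f)).
  by apply: ereal_inf_lbound; exists f => //; exists v.
by rewrite /profile_energy muleC -lee_pdivlMr// -EFinM.
Qed.

End profiles.

Lemma primitive_derive_ae (R : realType) (J : set R) (v f : R -> R) : open J -> primitive_on J v f ->
  exists2 N : set R, measurable N /\ lebesgue_measure N = 0%E &
    forall r, J r -> ~ N r -> is_derive r 1 v (f r).
Proof.
move=> oJ pv.
have Hq (q : rat * rat) : exists N : set R, (measurable N /\ lebesgue_measure N = 0%E) /\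
    (`[ratr q.1, ratr q.2] `<=` J -> forall r : R, ratr q.1 < r < ratr q.2 -> ~ N r -> is_derive r 1 v (f r)).
  have [sub|] := pselect (`[ratr q.1, ratr q.2] `<=` J); last first.
    by move=> h; exists set0; split => //; split => //; exact: measure0.
  have [N h1 h2] := ae_is_derive_primitive (primitive_onS sub pv).
  by exists N; split => // _; exact: h2.
have [N HN] := choice Hq.
have [mN N0] : measurable (\bigcup_q N q) /\ lebesgue_measure (\bigcup_q N q) = 0%E.
  by apply: (@null_set_bigcup _ (measurableTypeR R) R lebesgue_measure (rat * rat)%type N) => q; have [] := HN q.
exists (\bigcup_q N q) => // r Jr Nr.
have [||al [be [alr rbe sub]]] := @open_segment_enlarge R J r r oJ; first by [].
  by move=> y; rewrite /= in_itv/= => /andP[h1 h2]; rewrite (_ : y = r)//; apply/eqP; rewrite eq_le h1 h2.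
have [q1 /itvP q1P] := @rat_in_itvoo R al r alr.
have [q2 /itvP q2P] := @rat_in_itvoo R r be rbe.
have [_ H] := HN (q1, q2); apply: H => /=.
- by apply: subset_trans sub; apply: subset_itv; rewrite bnd_simp ltW ?q1P ?q2P.
- by rewrite q1P q2P.
- by move=> Nq; apply: Nr; exists (q1, q2).
Qed.

Lemma near_eq_open (R : realType) (J : set R) (v V : R -> R) r : open J -> J r ->
  (forall t, J t -> V t = v t) -> \forall t \near r, V t = v t.
Proof. by move=> oJ Jr H; have : nbhs r J by [exact: open_nbhs_nbhs]; exact: filterS. Qed.

Section lower_bound.
Context {R : realType}.
Local Notation mu := (@lebesgue_measure R).
Variables (d : nat) (p a b : R) (eta : R -> R) (Omega : set 'rV[R]_d) (s : seq (R * R)).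
Hypotheses (hd : (0 < d)%N) (hp : 1 < p) (ha : 0 <= a) (hab : a < b).
Hypothesis hOmega : Omega = eball b \/ Omega = annulus a b.
Hypothesis eta_ge0 : {ae mu, forall r : R, 0 <= r -> 0 <= eta r}.
Hypothesis eta_L1loc : L1loc_halfline eta.
Local Notation I := (regular_set p a b eta).
Hypothesis cI : open_cells I s.
Hypothesis sE : forall c, regular_components p a b eta c <-> c \in s.
Local Notation ka := (kappa d p eta).
Local Notation sigma := (sphere_area d : R).
Local Notation IO := (@enorm R d @^-1` I).
Local Notation X := (X p a b eta Omega).
Local Notation F := (F p a b eta Omega).
Local Notation Fbar := (Fbar p a b eta Omega).
Local Notation relaxed := (relaxed p a b eta).

Let oI : open I. Proof. by have [] := cI. Qed.

Lemma eta_pos_enorm : exists2 N : set 'rV[R]_d, measurable N /\ leb d N = 0%E &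
  forall x, ~ N x -> eta (enorm x) = eta_pos eta (enorm x).
Proof.
have [N [mN N0] HN] : exists2 N : set R, measurable N /\ mu N = 0%E &
  forall r, 0 <= r -> ~ N r -> eta r = eta_pos eta r by exact: eta_pos_ae.
have [mN' N'0] := null_set_enorm hd mN N0.
by exists (@enorm R d @^-1` N) => // x Nx; apply: HN => //; exact: enorm_ge0.
Qed.

Lemma energy_eta_pos (U : set 'rV[R]_d) G : energy p eta U G =
  (\int[leb d]_(x in U) (enorm (G x) `^ p * eta_pos eta (enorm x))%:E)%E.
Proof.
have [N [mN N0] HN] := eta_pos_enorm.
by apply: (eq_integral_off_null mN N0) => x _ Nx; rewrite /w HN.
Qed.

(** Nothing is known of [v] outside []a, b[], not even measurability, hence the restriction to I,
    which does not affect segments inside I. *)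
Lemma abs_continuous_profile (v : R -> R) : abs_continuous a b v ->
  primitive_on I (v \_ I) (rderiv (v \_ I)).
Proof.
move=> acv; have cv r : I r -> {for r, continuous v}.
  move=> Ir; apply/cvgrPdist_lt => e e0; have [de de0 H] := acv e e0.
  have /andP[ar rb] : a < r < b by have := regular_set_sub Ir; rewrite /= in_itv.
  have H2 q t : a < q -> q <= t -> t < b -> t - q < de -> `|v t - v q| < e.
    move=> aq qt tb tq; have := H 1%N (fun _ => q) (fun _ => t).
    rewrite !big_ord_recl !big_ord0 !addr0; apply => //.
    by apply/trivIsetP => i j _ _; rewrite (ord1 i) (ord1 j) eqxx.
  near=> t.
  have tde : `|r - t| < de by near: t; exists de.
  have at_ : a < t.
    near: t; exists (r - a); rewrite /= ?subr_gt0// => t /=; rewrite ltr_norml; lra.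
  have tb : t < b.
    near: t; exists (b - r); rewrite /= ?subr_gt0// => t /=; rewrite ltr_norml; lra.
  have [rt|tr] := leP r t.
    by rewrite distrC; apply: H2 => //; move: tde; rewrite ltr_norml; lra.
  by apply: H2 => //; [exact: ltW|move: tde; rewrite ltr_norml; lra].
apply: acc_primitive.
  apply/(measurable_restrictT _ _).1; first exact: open_measurable.
  by apply: open_continuous_measurable_fun => // x /set_mem; exact: cv.
move=> x y xy sub; have ax : a < x.
  have /sub/regular_set_sub : `[x, y]%classic x by rewrite /= in_itv/= lexx ltW.
  by rewrite /= in_itv/= => /andP[].
have yb : y < b.
  have /sub/regular_set_sub : `[x, y]%classic y by rewrite /= in_itv/= lexx ltW.
  by rewrite /= in_itv/= => /andP[].
move=> e /(abs_continuous_acc acv ax yb)[de de0 H]; exists de => // n q t qt tqt sqt.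
have := H n q t qt tqt sqt; apply: le_lt_trans; apply: ler_sum => i _.
have [h1 [h2 h3]] := qt i.
by rewrite !patchE !mem_set//; apply: sub; rewrite /= in_itv/= ?h1 ?h3 ?(le_trans h1) ?(le_trans h2).
Unshelve. all: by end_near. Qed.

Lemma relaxed_le_F u : X u -> (relaxed u <= F u)%E.
Proof.
move=> Xu; apply: le_ereal_inf_tmp => _ [v [u' uu' [mu' _ acv u'v]] <-].
have pv := abs_continuous_profile acv.
have mV : measurable_fun setT (v \_ I).
  apply/(measurable_restrictT _ _).1; first exact: open_measurable.
  apply: (@eq_measurable_fun _ _ _ _ _ (v \_ I)).
    by move=> r rI; rewrite patchE rI.
  exact: primitive_measurable pv.
have mf : measurable_fun I (rderiv (v \_ I)) by apply: measurable_funTS; exact: measurable_rderiv.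
have [N [mN N0] HN] := eqXP hd hp ha hOmega eta_ge0 eta_L1loc cI sE uu'.
apply: (@le_trans _ _ (profile_energy d p a b eta (rderiv (v \_ I)))).
  apply: ereal_inf_lbound; exists (rderiv (v \_ I)) => //; exists (v \_ I); split => //.
  exists N => // x Ix Nx; rewrite (HN x Ix Nx) patchE mem_set//.
  by apply: u'v; split => //; exact: (IO_sub hOmega Ix).
rewrite -(energy_radial_field hd hp ha eta_ge0 eta_L1loc mf).
rewrite (energy_eta_pos IO) (energy_eta_pos Omega).
rewrite [leLHS]integral_mkcond [leRHS]integral_mkcond.
have [N' [mN' N'0] HN'] := primitive_derive_ae oI pv.
have [mN'' N''0] := null_set_enorm hd mN' N'0.
have g0 (x : 'rV[R]_d) G : (0 <= (enorm (G x : 'rV[R]_d) `^ p * eta_pos eta (enorm x))%:E)%E.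
  by rewrite lee_fin mulr_ge0 ?powR_ge0 ?eta_pos_ge0.
apply: (ge0_le_integral_off_null mN'' N''0).
- by move=> x _; rewrite patchE; case: ifPn.
- by move=> x _; rewrite patchE; case: ifPn.
move=> x _ Nx; rewrite !patchE; have [Ix|Ix] := pselect (IO x); last first.
  by rewrite memNset//; case: ifPn.
rewrite !mem_set//; last exact: (IO_sub hOmega Ix).
have := regular_set_sub Ix; rewrite /= in_itv/= => abx.
rewrite /radial_gradient abx /radial_field.
have dV := HN' _ Ix Nx.
have dv : is_derive (enorm x) 1 v (rderiv (v \_ I) (enorm x)).
  apply: near_eq_is_derive dV; apply: (@near_eq_open _ I) => // t It; by rewrite patchE mem_set.
by rewrite derive1E (@derive_val _ _ _ _ _ _ _ dv).
Qed.

Lemma Fbar_lsc : lscX p a b eta Omega Fbar.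
Proof.
move=> u Xu t /ereal_sup_gt[_ [G [Glsc GF] <-] tG].
have [e e0 H] := Glsc u Xu t tG; exists e => // u' Xu' uu'.
by apply: (lt_le_trans (H u' Xu' uu')); apply: ereal_sup_ubound; exists G.
Qed.

Lemma Fbar_le_F u : X u -> (Fbar u <= F u)%E.
Proof. by move=> Xu; apply: ge_ereal_sup => _ [G [_ GF] <-]; exact: GF. Qed.

Lemma relaxed_le_Fbar u : X u -> (relaxed u <= Fbar u)%E.
Proof.
move=> Xu; apply: ereal_sup_ubound; exists relaxed => //; split.
  exact: (relaxed_lsc hd hp ha hOmega eta_ge0 eta_L1loc cI sE).
exact: relaxed_le_F.
Qed.

Lemma int_pow_ge0 u : (0 <= int_pow p a b eta Omega u)%E.
Proof. by apply: integral_ge0 => x _; rewrite lee_fin mulr_ge0 ?powR_ge0. Qed.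

Lemma Fbar_le_lim u (t : R) : X u ->
  (forall e : R, 0 < e -> exists u', [/\ X u', (int_pow p a b eta Omega (u' \- u)%R < e%:E)%E &
     (Fbar u' <= t%:E)%E]) -> (Fbar u <= t%:E)%E.
Proof.
move=> Xu Hn; rewrite leNgt; apply/negP => /(Fbar_lsc Xu)[e e0 H].
have ep : 0 < e `^ p by rewrite powR_gt0.
have p0 : 0 < p by exact: lt_trans hp.
have [u' [Xu' uu' Fu']] := Hn _ ep.
suff /(H u' Xu') : (normX p a b eta Omega (u' \- u)%R < e%:E)%E by rewrite ltNge Fu'.
rewrite /normX.
case: (int_pow _ _ _ _ _ _) uu' (int_pow_ge0 (u' \- u)%R) => [r|//|//].
rewrite poweR_EFin !lte_fin lee_fin => re r0.
have -> : e = (e `^ p) `^ p^-1 by rewrite -powRrM divff ?powRr1 ?(ltW e0)// gt_eqF.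
by rewrite gt0_ltr_powR ?nnegrE ?powR_ge0// invr_gt0.
Qed.

End lower_bound.

(** * Recovery sequences *)

Section profile_bounds.
Context {R : realType}.
Local Notation mu := (@lebesgue_measure R).
Variables (d : nat) (p a b : R) (eta : R -> R) (Omega : set 'rV[R]_d) (s : seq (R * R)).
Hypotheses (hd : (0 < d)%N) (hp : 1 < p) (ha : 0 <= a) (hab : a < b).
Hypothesis hOmega : Omega = eball b \/ Omega = annulus a b.
Hypothesis eta_ge0 : {ae mu, forall r : R, 0 <= r -> 0 <= eta r}.
Hypothesis eta_L1loc : L1loc_halfline eta.
Local Notation I := (regular_set p a b eta).
Hypothesis cI : open_cells I s.
Hypothesis sE : forall c, regular_components p a b eta c <-> c \in s.
Local Notation ka := (kappa d p eta).
Local Notation sigma := (sphere_area d : R).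
Local Notation IO := (@enorm R d @^-1` I).
Local Notation X := (X p a b eta Omega).
Local Notation weight_at := (weight_at p a b eta Omega).
Local Notation int_pow := (int_pow p a b eta Omega).

Let p0 : 0 < p. Proof. exact: lt_trans hp. Qed.
Let mka : measurable_fun setT ka. Proof. exact: measurable_kappa. Qed.
Let ka0 r : 0 < ka r. Proof. exact: kappa_gt0. Qed.
Let kai x y : `[x, y] `<=` I -> mu.-integrable `[x, y] (EFin \o ka).
Proof. exact: integrable_kappa. Qed.
Let mI : measurable I. Proof. exact: measurable_I. Qed.

Let Rle x y x' y' : x' <= x -> y <= y' -> `[x', y'] `<=` I ->
  \int[mu]_(t in `[x, y]) ka t <= \int[mu]_(t in `[x', y']) ka t.
Proof. exact: Rint_ka_le. Qed.

Lemma span_mass_le c (r q : R) : c \in s -> c.1 < r < c.2 -> cell_mid c <= q <= r \/ r <= q <= cell_mid c ->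
  let x := Num.min q (cell_mid c) in let y := Num.max q (cell_mid c) in
  `[x, y] `<=` I /\ \int[mu]_(t in `[x, y]) ka t <= span_mass d p eta c r.
Proof.
move=> cs /andP[c1r rc2] hq x y; have c12 := cell_lt cI cs.
have k0 u v : 0 <= \int[mu]_(t in `[u, v]) ka t by apply: Rintegral_ge0 => t _; exact: ltW.
have hm : c.1 < cell_mid c < c.2 by rewrite /cell_mid; apply/andP; split; lra.
have /andP[h1 h2] := hm.
case: hq => /andP[q1 q2].
  have -> : x = cell_mid c by rewrite /x; apply/min_idPr.
  have -> : y = q by rewrite /y; apply/max_idPl.
  split; first by apply: (cell_segment cI cs) => //; lra.
  apply: (@le_trans _ _ (\int[mu]_(t in `[cell_mid c, r]) ka t)); last by rewrite /span_mass lerDr.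
  by apply: Rle => //; exact: (cell_segment cI cs).
have -> : x = q by rewrite /x; apply/min_idPl.
have -> : y = cell_mid c by rewrite /y; apply/max_idPr.
split; first by apply: (cell_segment cI cs) => //; lra.
apply: (@le_trans _ _ (\int[mu]_(t in `[r, cell_mid c]) ka t)); last by rewrite /span_mass lerDl.
by apply: Rle => //; exact: (cell_segment cI cs).
Qed.

Section bound.
Variables (v f : R -> R) (T : R).
Hypotheses (pv : primitive_on I v f) (mf : measurable_fun I f).
Hypothesis fT : (penergy p ka f I <= T%:E)%E.

(** With K the integral of kappa between the midpoint and q, Hoelder gives T K^(p-1), while
    [what_at r] times sigma K is at most 1: the powers of K cancel. *)
Lemma profile_osc c (r q : R) : c \in s -> c.1 < r < c.2 -> cell_mid c <= q <= r \/ r <= q <= cell_mid c ->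
  `|v q - v (cell_mid c)| `^ p * weight_at r <= T * (sigma^-1) `^ (p - 1).
Proof.
move=> cs cr hq; have [sub le] := span_mass_le cs cr hq.
have T0 : 0 <= T by rewrite -lee_fin (le_trans (penergy_ge0 _ _ _ _) fT).
have [->|qm] := eqVneq q (cell_mid c).
  by rewrite subrr normr0 powR0 ?gt_eqF// mul0r mulr_ge0// powR_ge0.
set x := Num.min _ _ in sub le; set y := Num.max _ _ in sub le.
have xy : x < y by rewrite /x /y; case: (ltgtP q (cell_mid c)) qm.
have e : `|v q - v (cell_mid c)| = `|v y - v x|.
  by rewrite /x /y; case: (ltgtP q (cell_mid c)) qm => // _ _; rewrite distrC.
have := osc_powR hp ka0 mka xy (primitive_onS sub pv) (kai sub).
have Exy : (penergy p ka f `[x, y] <= T%:E)%E.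
  by apply: le_trans fT; exact: penergy_subset.
set K := Rintegral _ _ _ in le * => h.
have K0 : 0 <= K by apply: Rintegral_ge0 => t _; exact: ltW.
have {}h : `|v y - v x| `^ p <= T * K `^ (p - 1).
  rewrite -lee_fin EFinM; apply: (le_trans h).
  by rewrite lee_wpmul2r// lee_fin powR_ge0.
rewrite e; apply: (@le_trans _ _ (T * K `^ (p - 1) * weight_at r)); first by rewrite ler_wpM2r// powR_ge0.
rewrite -mulrA ler_wpM2l// /weight_at.
have Ir : I r by exact: (cell_I cI cs cr).
have w0 := what_at_gt0 hd hp ha hOmega eta_ge0 eta_L1loc cI sE Ir.
have s0 : 0 < sigma by exact: sphere_area_gt0.
rewrite -powRM ?(ltW w0)// ge0_ler_powR ?nnegrE ?subr_ge0 ?(ltW hp) ?invr_ge0 ?(ltW s0) ?mulr_ge0 ?(ltW w0)//.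
rewrite -[leRHS]mul1r ler_pdivlMr//.
apply: le_trans (what_at_span hd hp ha hOmega eta_ge0 eta_L1loc cI sE cs cr).
rewrite (_ : _ * _ * _ = what_at p a b eta Omega r * (sigma * K)); last by ring.
by rewrite !ler_wpM2l// ltW.
Qed.

(** The point q is distinct from r because the recovery functions take at r a value of [v] at some
    point closer to the midpoint. *)
Lemma profile_bound : exists2 C, 0 <= C & forall c r q, c \in s -> c.1 < r < c.2 ->
  cell_mid c <= q <= r \/ r <= q <= cell_mid c -> `|v q| `^ p * weight_at r <= C.
Proof.
have [M M0 HM] := weight_at_bounded hd hp ha hOmega eta_ge0 eta_L1loc cI sE.
have T0 : 0 <= T by rewrite -lee_fin (le_trans (penergy_ge0 _ _ _ _) fT).
pose D := T * (sigma^-1) `^ (p - 1).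
have D0 : 0 <= D by rewrite mulr_ge0// powR_ge0.
pose C c := 2 `^ p * (D + `|v (cell_mid c)| `^ p * M).
have C0 c : 0 <= C c by rewrite mulr_ge0 ?powR_ge0// addr_ge0// mulr_ge0 ?powR_ge0// ltW.
exists (\sum_(c <- s) C c); first exact: sumr_ge0.
move=> c r q cs cr hq; apply: (@le_trans _ _ (C c)); last first.
  by rewrite (perm_big _ (perm_to_rem cs)) big_cons lerDl sumr_ge0.
have w0 : 0 <= weight_at r by exact: powR_ge0.
apply: (@le_trans _ _ (2 `^ p * (`|v q - v (cell_mid c)| `^ p + `|v (cell_mid c)| `^ p) * weight_at r)).
  by rewrite ler_wpM2r//; apply: powR_normB_le; exact: ltW.
rewrite -mulrA ler_wpM2l ?powR_ge0// mulrDl lerD//; first exact: profile_osc.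
by rewrite ler_wpM2l ?powR_ge0//; apply: HM; exact: (cell_I cI cs cr).
Qed.

Lemma profile_int_pow (u : 'rV[R]_d -> R) N : measurable N -> leb d N = 0%E ->
  (forall x, IO x -> ~ N x -> u x = v (enorm x)) -> (int_pow u < +oo)%E.
Proof.
move=> mN N0 HN; rewrite (int_powE hd hp hOmega cI sE).
have [C C0 HC] := profile_bound.
apply: (@le_lt_trans _ _ (\int[leb d]_(x in IO) C%:E)%E); last first.
  rewrite integral_cst; last exact: measurable_IO.
  rewrite lte_mul_pinfty ?lee_fin//; apply: le_lt_trans (leb_Omega_lty ha hab hOmega).
  apply: le_measure; rewrite ?inE; [exact: measurable_IO|exact: (measurable_Omega hOmega)|exact: (IO_sub hOmega)].
apply: (ge0_le_integral_off_null mN N0).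
- by move=> x _; rewrite lee_fin mulr_ge0 ?powR_ge0.
- by move=> x _; rewrite lee_fin.
move=> x Ix Nx; rewrite lee_fin (HN x Ix Nx).
have [c cs cr] := I_cell cI Ix; apply: (HC c) => //.
by have [h|h] := leP (enorm x) (cell_mid c); [right|left]; rewrite lexx ?h ?(ltW h).
Qed.

End bound.

Lemma transition_widen (l0 l1 l0' l1' : R) g : l0' <= l0 -> l1 <= l1' ->
  transition l0 l1 g -> transition l0' l1' g.
Proof.
move=> h0 h1 [gi g0 gz g1]; split => // r rl; apply: gz => /andP[r1 r2]; apply: rl.
by rewrite (le_lt_trans h0 r1) (lt_le_trans r2 h1).
Qed.

Lemma measurable_inv_pow (D : set R) : measurable D -> measurable_fun D eta ->
  measurable_fun D (fun t => inv_pow p (eta t)).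
Proof.
move=> mD me; have mq : measurable_fun D (fun t => eta t `^ (p - 1)^-1).
  exact: (measurableT_comp (measurable_powR _) me).
have -> : (fun t => inv_pow p (eta t)) = (fun t => if eta t `^ (p - 1)^-1 == 0 then +oo%E else
    (((eta t `^ (p - 1)^-1) `^ (-1))%:E)).
  by apply/funext => t; rewrite /inv_pow inver powR_inv1// powR_ge0.
apply: measurable_fun_if => //.
- exact: measurable_fun_eqr.
- apply/measurable_EFinP.
  apply: (measurable_funS mD (@subIsetl _ _ _)).
  exact: (measurableT_comp (measurable_powR _) mq).
Qed.

(** A radius outside I has zero capacity for the energy, so the passage from 0 to 1 around it can be
    made arbitrarily cheap. *)
Lemma cheap_transition (e de ep : R) : a <= e -> e <= b -> ~ I e -> 0 < de -> 0 < ep ->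
  exists2 g : R -> R, transition (e - de) (e + de) g &
    (\int[mu]_(r in `]a, b[) (g r `^ p * radial_weight d eta r)%:E < ep%:E)%E.
Proof.
move=> ae eb Ie de0 ep0.
have zero (g : R -> R) : (forall r, `]a, b[%classic r -> g r = 0) ->
    (\int[mu]_(r in `]a, b[) (g r `^ p * radial_weight d eta r)%:E < ep%:E)%E.
  move=> g0; rewrite (_ : (\int[mu]_(r in `]a, b[) (g r `^ p * radial_weight d eta r)%:E)%E = 0%E) ?lte_fin//.
  by apply: integral0_eq => r rab; rewrite g0// powR0 ?mul0r ?gt_eqF.
have [ea|ae'] := leP e a.
  have ee : e - de < e by rewrite ltrBlDr ltrDl.
  have tg := transition_indic ee.
  exists (fun r => (e - (e - de))^-1 * \1_`]e - de, e[ r).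
    by apply: transition_widen tg => //; rewrite lerDl ltW.
  apply: zero => r; rewrite /= in_itv/= => /andP[ar rb]; have [_ _ gz _] := tg.
  by apply: gz => /andP[_ re]; lra.
have [be|eb'] := leP b e.
  have ee : e < e + de by rewrite ltrDl.
  have tg := transition_indic ee.
  exists (fun r => (e + de - e)^-1 * \1_`]e, e + de[ r).
    by apply: transition_widen tg => //; rewrite gerBl ltW.
  apply: zero => r; rewrite /= in_itv/= => /andP[ar rb]; have [_ _ gz _] := tg.
  by apply: gz => /andP[re _]; lra.
(* The bound by e keeps the interval in the half-line, where [eta] is measurable. *)
pose z := Num.min de e; have e0 : 0 < e by exact: le_lt_trans ae'.
have z0 : 0 < z by rewrite lt_min de0.
have zde : z <= de by rewrite ge_min lexx.
have ze : z <= e by rewrite ge_min lexx orbT.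
pose D : set (measurableTypeR R) := `]e - z, e + z[%classic.
have mD : measurable D by exact: measurable_itv.
have Dpos r : D r -> 0 < r by rewrite /D/= in_itv/= => /andP[]; lra.
have me : measurable_fun D eta.
  have [me _] := eta_L1loc; apply: measurable_funS me => //.
  by move=> r /Dpos/ltW; rewrite /= in_itv/= andbT.
have mi := measurable_inv_pow mD me.
have i0 r : (0 <= inv_pow p (eta r))%E by rewrite /inv_pow inve_ge0 lee_fin powR_ge0.
have ioo : (\int[mu]_(r in D) inv_pow p (eta r) = +oo)%E.
  apply: contrapT => h; apply: Ie; split; first by rewrite ae'.
  exists z => //; apply/integrableP; split => //.
  have -> : (\int[mu]_(r in `](e - z)%R, (e + z)%R[) `|inv_pow p (eta r)| = \int[mu]_(r in D) inv_pow p (eta r))%E.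
    by apply: eq_integral => r _; rewrite gee0_abs.
  by rewrite ltey; apply/eqP.
have q0 : 0 < p - 1 by rewrite subr_gt0.
pose B := b ^+ d.-1; have b0 : 0 <= b by exact: ltW (b_gt0 ha hab).
have B0 : 0 <= B by rewrite exprn_ge0.
(* A lower bound for Z that makes the cost B Z^(1-p) at most ep B / (B + 1) < ep. *)
pose A := ((B + 1) / ep) `^ (p - 1)^-1.
have A0 : 0 < A by rewrite powR_gt0// divr_gt0// ltr_wpDl.
have : (A%:E < \int[mu]_(r in D) inv_pow p (eta r))%E by rewrite ioo ltry.
(* An infinite integral is a supremum over simple functions: one of them, bounded and hence
   integrable on [D], exceeds A. *)
rewrite (ge0_integralE mu (fun r _ => i0 r)) => /ereal_sup_gt[_ [h hle <-]].
rewrite -integralT_nnsfun => Ah.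
have hD r : ~ D r -> h r = 0.
  move=> Dr; have := hle r; rewrite patchE memNset// lee_fin => h'.
  by apply/eqP; rewrite eq_le h' fun_ge0.
have hi : mu.-integrable setT (EFin \o h).
  have mh : measurable_fun setT h by exact: measurable_funPT.
  have -> : EFin \o h = (EFin \o h) \_ D.
    apply/funext => r; rewrite patchE; case: ifPn => // /negP rD; rewrite /= hD// => Dr.
    by apply: rD; rewrite inE.
  apply/(integrable_mkcond _ mD).
  apply: (@measurable_bounded_integrable _ (measurableTypeR R) R mu h D mD).
  - apply: (@le_lt_trans _ _ (e + z - (e - z))%:E); last exact: ltry.
    have ez : e - z < e + z by lra.
    rewrite le_eqVlt; apply/orP; left; apply/eqP.
    by apply: (etrans (lebesgue_measure_itv `]e - z, e + z[)); rewrite /= lte_fin ez.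
  - exact: measurable_funTS.
  - have [M [Mr HM]] := simple_bounded h; exists M; split => // y My r Dr; exact: HM.
pose Z := \int[mu]_r h r.
have ZE : (\int[mu]_r (h r)%:E = Z%:E)%E.
  by rewrite /Z /Rintegral fineK//; exact: (integrable_fin_num measurableT hi).
have AZ : A < Z by rewrite -lte_fin -ZE.
have Z0 : 0 < Z by exact: lt_trans AZ.
exists (fun r => Z^-1 * h r).
  split.
  - have -> : EFin \o (fun r => Z^-1 * h r) = (fun r => Z^-1%:E * (EFin \o h) r)%E by [].
    exact: integrableZl.
  - by move=> r; rewrite mulr_ge0 ?invr_ge0 ?(ltW Z0)// fun_ge0.
  - move=> r rl; rewrite hD ?mulr0// /D/= in_itv/= => /andP[r1 r2]; apply: rl; apply/andP; split; lra.
  - by rewrite RintegralZl// -/Z mulVf// gt_eqF.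
have [N [mN N0] HN] : exists2 N : set R, measurable N /\ mu N = 0%E &
  forall r, 0 <= r -> ~ N r -> eta r = eta_pos eta r by exact: eta_pos_ae.
apply: (@le_lt_trans _ _ (\int[mu]_r ((B * Z `^ (- p))%:E * (h r)%:E))%E); last first.
  rewrite integralZl// ZE -EFinM lte_fin.
  have -> : B * Z `^ (- p) * Z = B * Z `^ (1 - p).
    rewrite -mulrA -[X in _ * (_ * X)](powRr1 (ltW Z0)) -powRD ?(gt_eqF Z0) ?implybT//.
    by rewrite addrC.
  apply: (@le_lt_trans _ _ (B * A `^ (1 - p))).
    rewrite ler_wpM2l// (_ : 1 - p = - (p - 1)); last by ring.
    have AZp : A `^ (p - 1) <= Z `^ (p - 1).
      by apply: ge0_ler_powR; rewrite ?nnegrE ?(ltW q0) ?(ltW A0) ?(ltW Z0) ?(ltW AZ).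
    by rewrite (powRN Z) (powRN A) lef_pV2// posrE powR_gt0.
  have -> : A `^ (1 - p) = ep / (B + 1).
    rewrite /A -powRrM (_ : (p - 1)^-1 * (1 - p) = -1); last by field; rewrite gt_eqF.
    by rewrite powR_inv1 ?invf_div// divr_ge0 ?addr_ge0// ltW.
  by rewrite mulrA ltr_pdivrMr ?ltr_wpDl// [ltRHS]mulrDr mulr1 mulrC ltrDl.
rewrite [leLHS]integral_mkcond.
apply: (@ge0_le_integral_off_null _ (measurableTypeR R) R mu _ N _ _ mN N0).
- move=> r _; rewrite patchE; case: ifPn => // /set_mem; rewrite /= in_itv/= => /andP[ar _].
  by rewrite lee_fin mulr_ge0 ?powR_ge0// rho_ge0// ltW// (le_lt_trans ha ar).
- by move=> r _; rewrite -EFinM lee_fin !mulr_ge0 ?powR_ge0// fun_ge0.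
move=> r _ Nr; rewrite patchE -EFinM; case: ifPn => [/set_mem|_]; last first.
  by rewrite lee_fin !mulr_ge0 ?powR_ge0// fun_ge0.
rewrite /= in_itv/= => /andP[ar rb]; have r0 : 0 < r by exact: le_lt_trans ar.
have h0 : 0 <= h r by exact: fun_ge0.
have e1 := HN r (ltW r0) Nr.
rewrite lee_fin powRM ?invr_ge0 ?(ltW Z0)// -(powR_inv1 (ltW Z0)) -powRrM mulN1r /radial_weight.
rewrite (_ : B * Z `^ (- p) * h r = Z `^ (- p) * (B * h r)); last by ring.
rewrite -mulrA ler_wpM2l ?powR_ge0// mulrCA; apply: ler_pM => //.
- by rewrite exprn_ge0// ltW.
- by rewrite mulr_ge0 ?powR_ge0 ?eta_pos_ge0.
- by rewrite /B lerXn2r ?nnegrE ?(ltW r0) ?(ltW rb).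
have [Dr|/hD ->] := pselect (D r); last by rewrite powR0 ?mul0r ?gt_eqF.
have ep0' := eta_pos_ge0 eta r.
move: ep0'; rewrite le_eqVlt => /predU1P[<-|et0]; first by rewrite mulr0.
have := hle r; rewrite patchE mem_set// e1 inv_pow_gt0// lee_fin => hr.
(* Since h is at most eta^(-1/(p-1)), the factor h^(p-1) eta is at most 1, and h^p eta at most h. *)
have -> : h r `^ p = h r * h r `^ (p - 1).
  move: h0; rewrite le_eqVlt => /predU1P[<-|h0]; first by rewrite mul0r powR0// gt_eqF.
  by rewrite -[X in X * _](powRr1 (ltW h0)) -powRD ?(gt_eqF h0) ?implybT//; congr (_ `^ _); ring.
rewrite -mulrA -[leRHS]mulr1 ler_wpM2l//.
apply: (@le_trans _ _ ((eta_pos eta r `^ (- (p - 1)^-1)) `^ (p - 1) * eta_pos eta r)).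
  by rewrite ler_wpM2r ?(ltW et0)// ge0_ler_powR ?nnegrE ?(ltW q0) ?powR_ge0.
rewrite -powRrM (_ : _ * (p - 1) = -1); last by field; rewrite gt_eqF.
by rewrite powR_inv1 ?(ltW et0)// mulVf// gt_eqF.
Qed.

End profile_bounds.

Lemma sum_powR_le (R : realType) (I : Type) (p : R) (s : seq I) : 0 < p -> exists2 K, 0 <= K &
  forall x : I -> R, (forall i, 0 <= x i) -> (\sum_(i <- s) x i) `^ p <= K * \sum_(i <- s) x i `^ p.
Proof.
move=> p0; elim: s => [|i s [K K0 HK]].
  by exists 0 => // x x0; rewrite !big_nil powR0 ?mul0r// gt_eqF.
exists (2 `^ p * (1 + K)); first by rewrite mulr_ge0 ?powR_ge0// addr_ge0.
move=> x x0; rewrite !big_cons.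
have S0 : 0 <= \sum_(j <- s) x j by rewrite sumr_ge0.
have Sp0 : 0 <= \sum_(j <- s) x j `^ p by rewrite sumr_ge0// => j _; exact: powR_ge0.
have := powR_normB_le (x i + \sum_(j <- s) x j) (\sum_(j <- s) x j) (ltW p0).
rewrite addrK !ger0_norm ?addr_ge0// => /le_trans; apply.
rewrite -mulrA ler_wpM2l ?powR_ge0//.
have xi := powR_ge0 (x i) p.
apply: (@le_trans _ _ (x i `^ p + K * \sum_(j <- s) x j `^ p)); first by rewrite lerD2l HK.
by rewrite mulrDl mul1r mulrDr; have := mulr_ge0 K0 xi; lra.
Qed.

Section recovery.
Context {R : realType}.
Local Notation mu := (@lebesgue_measure R).
Variables (d : nat) (p a b : R) (eta : R -> R) (Omega : set 'rV[R]_d) (s : seq (R * R)).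
Hypotheses (hd : (0 < d)%N) (hp : 1 < p) (ha : 0 <= a) (hab : a < b).
Hypothesis hOmega : Omega = eball b \/ Omega = annulus a b.
Hypothesis eta_ge0 : {ae mu, forall r : R, 0 <= r -> 0 <= eta r}.
Hypothesis eta_L1loc : L1loc_halfline eta.
Local Notation I := (regular_set p a b eta).
Hypothesis cI : open_cells I s.
Hypothesis sE : forall c, regular_components p a b eta c <-> c \in s.
Local Notation ka := (kappa d p eta).
Local Notation sigma := (sphere_area d : R).
Local Notation IO := (@enorm R d @^-1` I).
Local Notation X := (X p a b eta Omega).
Local Notation weight_at := (weight_at p a b eta Omega).
Local Notation int_pow := (int_pow p a b eta Omega).
Local Notation Fbar := (Fbar p a b eta Omega).

Let p0 : 0 < p. Proof. exact: lt_trans hp. Qed.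
Let mka : measurable_fun setT ka. Proof. exact: measurable_kappa. Qed.
Let oI : open I. Proof. by have [] := cI. Qed.
Let us : uniq s. Proof. by have [] := cI. Qed.
Let mI : measurable I. Proof. exact: measurable_I. Qed.
Let mIO : measurable IO. Proof. exact: measurable_IO. Qed.
Let b0 : 0 < b. Proof. exact: b_gt0 ha hab. Qed.
Let c12 (c : R * R) : c \in s -> c.1 < c.2. Proof. exact: cell_lt cI c. Qed.
Let sigma0 : 0 < sigma. Proof. exact: sphere_area_gt0. Qed.

Lemma cell_bounds (c : R * R) : c \in s -> [/\ a <= c.1, c.2 <= b, ~ I c.1 & ~ I c.2].
Proof.
move=> cs; have [_ _ Hs _] := cI; have [h1 sub h3 h4] := Hs _ cs.
have H r : c.1 < r < c.2 -> a < r < b.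
  by move=> rc; have := regular_set_sub (sub r ltac:(by rewrite /= in_itv)); rewrite /= in_itv.
split => //.
  rewrite leNgt; apply/negP => c1a; pose z := Num.min a c.2.
  have za : z <= a by rewrite ge_min lexx.
  have zc : z <= c.2 by rewrite ge_min lexx orbT.
  have cz : c.1 < z by rewrite lt_min c1a h1.
  by have /andP[] := H ((c.1 + z) / 2) ltac:(apply/andP; split; lra); lra.
rewrite leNgt; apply/negP => bc; pose z := Num.max b c.1.
have zb : b <= z by rewrite le_max lexx.
have zc : c.1 <= z by rewrite le_max lexx orbT.
have cz : z < c.2 by rewrite gt_max bc h1.
by have /andP[] := H ((c.2 + z) / 2) ltac:(apply/andP; split; lra); lra.
Qed.

Definition margin (h : R) : set 'rV[R]_d :=
  [set x | IO x /\ ~ exists2 c, c \in s & c.1 + h <= enorm x <= c.2 - h].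

Lemma measurable_margin h : measurable (margin h).
Proof.
have -> : margin h = IO `&` ~` (enorm @^-1` \bigcup_(c in [set` s]) `[c.1 + h, c.2 - h]%classic).
  apply/seteqP; split => x [Ix H]; split => //= -[c cs cr]; apply: H; exists c => //; by move: cr; rewrite /= in_itv.
apply: measurableI => //; apply: measurableC.
rewrite -[X in measurable X]setTI; apply: measurable_enorm => //.
by apply: fin_bigcup_measurable => //; exact: finite_seq.
Qed.

Lemma leb_IO_lty : (leb d IO < +oo)%E.
Proof.
apply: le_lt_trans (leb_Omega_lty ha hab hOmega).
apply: le_measure; rewrite ?inE//; [exact: (measurable_Omega hOmega)|exact: (IO_sub hOmega)].
Qed.

(** The margins decrease to the empty set inside a set of finite measure. *)
Lemma small_margin (h0 e : R) : 0 < h0 -> 0 < e ->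
  exists h, [/\ 0 < h, h <= h0 & (leb d (margin h) < e%:E)%E].
Proof.
move=> h00 e0; pose M n := margin (h0 / n.+1%:R).
have Mle h h' : h' <= h -> margin h' `<=` margin h.
  move=> hh x [Ix H]; split => // -[c cs /andP[h1 h2]]; apply: H; exists c => //.
  by apply/andP; split; lra.
have := @nonincreasing_cvg_mu _ _ R (leb d) M.
have -> : \bigcap_n M n = set0.
  apply/seteqP; split => // x Mx; have [Ix _] := Mx 0%N Logic.I.
  have [c cs /andP[h1 h2]] := I_cell cI Ix.
  pose z := Num.min (enorm x - c.1) (c.2 - enorm x).
  have z0 : 0 < z by rewrite lt_min !subr_gt0 h1.
  have Hk : h0 / (Num.trunc (h0 / z)).+1%:R < z.
    by rewrite ltr_pdivrMr// mulrC -ltr_pdivrMr//; exact: truncnS_gt.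
  have [_] := Mx (Num.trunc (h0 / z)) Logic.I; apply; exists c => //.
  have zl : z <= enorm x - c.1 by rewrite ge_min lexx.
  have zr : z <= c.2 - enorm x by rewrite ge_min lexx orbT.
  by move: (h0 / _) Hk => y yz; apply/andP; split; lra.
rewrite measure0 => H.
have {}H : (leb d \o M) x @[x --> \oo] --> 0%E.
  apply: H => //.
  - apply: le_lt_trans leb_IO_lty; apply: le_measure; rewrite ?inE//; first exact: measurable_margin.
    by move=> x [].
  - by move=> n; exact: measurable_margin.
  - move=> m n mn; apply/subsetPset; apply: Mle.
    by rewrite ler_wpM2l ?(ltW h00)// lef_pV2 ?posrE// ler_nat.
have [n _ /(_ n (leqnn n)) /= Hn] : \forall n \near \oo, (leb d (M n) < e%:E)%E.
  have : \forall y \near (0%E : \bar R), (y < e%:E)%E by apply: open_ereal_lt'; rewrite lte_fin.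
  by move=> /H.
exists (h0 / n.+1%:R); split => //; first by rewrite divr_gt0.
by rewrite ler_pdivrMr// ler_peMr ?(ltW h00)// ler1n.
Qed.

(** * The glued profile: constant at distance less than h of the ends, cut off within de *)

Section glue.
Variables (v f : R -> R) (h de : R) (gl gr : R * R -> R -> R).
Hypotheses (pv : primitive_on I v f) (mf : measurable_fun I f).
Hypotheses (de0 : 0 < de) (deh : de <= h).
Hypothesis hh : forall c : R * R, c \in s -> 4 * h <= c.2 - c.1.
Hypothesis tgl : forall c, c \in s -> transition (c.1 - de) (c.1 + de) (gl c).
Hypothesis tgr : forall c, c \in s -> transition (c.2 - de) (c.2 + de) (gr c).

Definition cell_left (c : R * R) : R := c.1 + h.
Definition cell_right (c : R * R) : R := c.2 - h.

Definition glue_density : R -> R := glued_density v f s cell_left cell_right gl gr.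
Definition glue : R -> R := cumul glue_density.

(** The transitions have width de but are declared up to the core at distance h; in between, the
    glued function keeps the value of [v] at the end of the core. *)
Let Hs (c : R * R) : c \in s -> [/\ cell_left c <= cell_right c, primitive_on `[cell_left c, cell_right c] v f,
  transition (c.1 - de) (cell_left c) (gl c) & transition (cell_right c) (c.2 + de) (gr c)].
Proof.
move=> cs; have hc := hh cs; have dp := de0; have dh := deh; rewrite /cell_left /cell_right; split.
- lra.
- by apply: primitive_onS pv; apply: (cell_segment cI cs); lra.
- by apply: transition_widen (tgl cs); lra.
- by apply: transition_widen (tgr cs); lra.
Qed.

Let Hl (c : R * R) : c \in s -> c.1 - de < cell_left c /\ cell_right c < c.2 + de.
Proof. by move=> cs; have dp := de0; have dh := deh; rewrite /cell_left /cell_right; split; lra. Qed.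

Let Hd (c c' : R * R) : c \in s -> c' \in s -> c != c' -> c'.2 + de <= cell_left c \/ cell_right c <= c'.1 - de.
Proof.
move=> cs c's cc; have dp := de0; have dh := deh; rewrite /cell_left /cell_right.
by have [k|k] := cells_order cI cs c's cc; [right|left]; lra.
Qed.

Lemma integrable_glue : mu.-integrable setT (EFin \o glue_density).
Proof. by have [] := integrable_glued Hs. Qed.

Lemma glue_sum x : glue x =
  \sum_(c <- s) cumul (cutoff_density v f (cell_left c) (cell_right c) (gl c) (gr c)) x.
Proof. by have [_] := integrable_glued Hs. Qed.

Lemma glue_inside c x : c \in s -> c.1 + h <= x <= c.2 - h -> glue x = v x /\ glue_density x = f x.
Proof. exact: (glued_inside us Hs Hl Hd). Qed.

(** Off the transitions the value is that of [v] at the point of the core nearest to x, which lies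
    between x and the midpoint, as [profile_bound] requires. *)
Lemma glue_between (c : R * R) x : c \in s -> c.1 + de <= x <= c.2 - de ->
  exists2 q, cell_mid c <= q <= x \/ x <= q <= cell_mid c & glue x = v q.
Proof.
move=> cs /andP[x1 x2]; have dp := de0; have dh := deh; rewrite glue_sum (bigD1_seq c)//= big1_seq ?addr0; last first.
  move=> c' /andP[cc c's]; have [h1 h2 h3 h4] := Hs c's; have [k1 k2] := Hl c's.
  apply: (cutoff_outside h1 h2 h3 h4).
  by have [k|k] := cells_order cI c's cs cc; [right|left]; split; lra.
have hc := hh cs; have [h1 h2 h3 h4] := Hs cs.
have [xl|lx] := leP x (cell_left c).
  exists (cell_left c); first by right; rewrite xl /cell_left /cell_mid; lra.
  by rewrite (cutoff_left h1 h2 h3 h4 xl) (transition_right (tgl cs)) ?mulr1.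
have [rx|xr] := leP (cell_right c) x.
  exists (cell_right c); first by left; rewrite rx /cell_right /cell_mid andbT; lra.
  by rewrite (cutoff_right h1 h2 h3 h4 rx) (transition_left (tgr cs)) ?subr0 ?mulr1.
exists x; first by have [k|k] := leP x (cell_mid c); [right|left]; rewrite lexx ?k ?(ltW k).
by rewrite (cutoff_inside h1 h2 h3 h4)// (ltW lx) (ltW xr).
Qed.

(** A crude bound within de of the ends, where transitions of two cells may overlap. It depends on h
    but not on de. *)
Definition glue_const : R := \sum_(c <- s) (`|v (cell_left c)| + `|v (cell_right c)|).

Lemma glue_le x : ~ (exists2 c, c \in s & c.1 + de <= x <= c.2 - de) -> `|glue x| <= glue_const.
Proof.
move=> xI; have dp := de0; have dh := deh; rewrite glue_sum (le_trans (ler_norm_sum _ _ _))// /glue_const big_seq [leRHS]big_seq.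
apply: ler_sum => c cs; have [h1 h2 h3 h4] := Hs cs.
have le1 (l r : R) g : transition l r g -> `|cumul g x| <= 1 /\ `|1 - cumul g x| <= 1.
  by move=> /(transition_itv x)/andP[k1 k2]; rewrite !ger0_norm ?subr_ge0//; split; lra.
have [xl|lx] := leP x (cell_left c).
  rewrite (cutoff_left h1 h2 h3 h4 xl) normrM (le_trans (ler_wpM2l _ (le1 _ _ _ h3).1))//.
  by rewrite mulr1 lerDl.
have [rx|xr] := leP (cell_right c) x.
  rewrite (cutoff_right h1 h2 h3 h4 rx) normrM (le_trans (ler_wpM2l _ (le1 _ _ _ h4).2))//.
  by rewrite mulr1 lerDr.
exfalso; apply: xI; exists c => //; move: lx xr; rewrite /cell_left /cell_right; lra.
Qed.

Definition glue_tail (r : R) : R :=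
  \sum_(c <- s) (`|v (cell_left c)| * gl c r + `|v (cell_right c)| * gr c r).

Lemma glue_density_le r : ~ (exists2 c, c \in s & c.1 + h <= r <= c.2 - h) ->
  `|glue_density r| <= glue_tail r.
Proof.
move=> rI; rewrite (le_trans (ler_norm_sum _ _ _))// /glue_tail big_seq [leRHS]big_seq.
apply: ler_sum => c cs; have [h1 h2 [_ l0 _ _] [_ r0 _ _]] := Hs cs.
rewrite /cutoff_density patchE memNset; last first.
  by rewrite /= in_itv/= => k; apply: rI; exists c.
rewrite add0r (le_trans (ler_normD _ _))// !normrM normrN.
by rewrite (ger0_norm (l0 r)) (ger0_norm (r0 r)).
Qed.

Section estimates.
Variables (C M T : R).
Hypothesis C0 : 0 <= C.
Hypothesis HC : forall (c : R * R) r q, c \in s -> c.1 < r < c.2 ->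
  cell_mid c <= q <= r \/ r <= q <= cell_mid c -> `|v q| `^ p * weight_at r <= C.
Hypotheses (M0 : 0 <= M) (HM : forall r, I r -> weight_at r <= M).

Let B0 : 0 <= glue_const.
Proof. by apply: sumr_ge0 => c _; exact: addr_ge0. Qed.

Let in_cell (c : R * R) r : c.1 + de <= r <= c.2 - de -> c.1 < r < c.2.
Proof. by move=> /andP[r1 r2]; have dp := de0; apply/andP; split; lra. Qed.

Lemma glue_weight r : I r -> `|glue r| `^ p * weight_at r <= C + glue_const `^ p * M.
Proof.
move=> Ir; have w0 : 0 <= weight_at r by exact: powR_ge0.
have B1 := mulr_ge0 (powR_ge0 glue_const p) M0.
have [[c cs cr]|nc] := pselect (exists2 c, c \in s & c.1 + de <= r <= c.2 - de).
  have [q hq ->] := glue_between cs cr.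
  by rewrite (le_trans (HC cs (in_cell cr) hq))// lerDl.
rewrite (@le_trans _ _ (glue_const `^ p * M))// ?lerDr//.
rewrite ler_pM ?powR_ge0//; last exact: HM.
by rewrite ge0_ler_powR ?nnegrE ?(ltW p0)//; exact: glue_le.
Qed.

Lemma glue_X : X (glue \o enorm).
Proof.
have mg : measurable_fun setT (glue \o @enorm R d).
  apply: measurableT_comp; last exact: measurable_enorm.
  exact: (measurable_cumul integrable_glue).
split; first by apply: measurable_funTS.
rewrite (int_powE hd hp hOmega cI sE).
apply: (@le_lt_trans _ _ (\int[leb d]_(x in IO) (C + glue_const `^ p * M)%:E)%E); last first.
  rewrite integral_cst// lte_mul_pinfty ?leb_IO_lty// lee_fin.
  by rewrite addr_ge0// mulr_ge0// powR_ge0.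
apply: (@ge0_le_integral_off_null _ _ R (leb d) IO set0) => //.
- by move=> x _; rewrite lee_fin mulr_ge0 ?powR_ge0.
- by move=> x _; rewrite lee_fin addr_ge0// mulr_ge0// powR_ge0.
- by move=> x Ix _; rewrite lee_fin; exact: glue_weight.
Qed.

(** The constant in front of the margin h does not depend on h, and the one in front of the margin
    de does not depend on de: both terms vanish if h is chosen first. *)
Lemma glue_error (u : 'rV[R]_d -> R) N : measurable N -> leb d N = 0%E ->
  (forall x, IO x -> ~ N x -> u x = v (enorm x)) ->
  (int_pow ((glue \o enorm) \- u)%R <=
   (2 `^ p * (C + C))%:E * leb d (margin h) +
   (2 `^ p * (glue_const `^ p * M + C))%:E * leb d (margin de))%E.
Proof.
move=> mN N0 HN; rewrite (int_powE hd hp hOmega cI sE).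
set C1 := 2 `^ p * (C + C); set C2 := 2 `^ p * (_ + C).
have B1 := mulr_ge0 (powR_ge0 glue_const p) M0.
have C10 : 0 <= C1 by rewrite mulr_ge0 ?powR_ge0// addr_ge0.
have C20 : 0 <= C2 by rewrite mulr_ge0 ?powR_ge0// addr_ge0.
have HZ (K t : R) : 0 <= K -> (\int[leb d]_(x in IO) (K%:E * (\1_(margin t) x)%:E) = K%:E * leb d (margin t))%E.
  move=> K0; rewrite ge0_integralZl//; last first.
    by apply/measurable_EFinP; apply: measurable_indic; exact: measurable_margin.
  rewrite integral_indic//; last exact: measurable_margin.
  by congr (_ * leb d _)%E; apply/setIidPl => x [].
rewrite -(HZ _ _ C10) -(HZ _ _ C20) -ge0_integralD//; last 4 first.
- by move=> x _; rewrite mule_ge0 ?lee_fin.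
- apply: measurable_funeM; apply/measurable_EFinP; apply: measurable_indic; exact: measurable_margin.
- by move=> x _; rewrite mule_ge0 ?lee_fin.
- apply: measurable_funeM; apply/measurable_EFinP; apply: measurable_indic; exact: measurable_margin.
apply: (ge0_le_integral_off_null mN N0).
- by move=> x _; rewrite lee_fin mulr_ge0 ?powR_ge0.
- by move=> x _; rewrite adde_ge0 ?mule_ge0 ?lee_fin.
move=> x Ix Nx; rewrite -!EFinM -EFinD lee_fin /= (HN x Ix Nx) !indicE.
have w0 : 0 <= weight_at (enorm x) by exact: powR_ge0.
have i0 t : 0 <= C1 * (x \in margin t)%:R by rewrite mulr_ge0.
have i1 t : 0 <= C2 * (x \in margin t)%:R by rewrite mulr_ge0.
have [[c cs cr]|nc] := pselect (exists2 c, c \in s & c.1 + h <= enorm x <= c.2 - h).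
  by have [-> _] := glue_inside cs cr; rewrite subrr normr0 powR0 ?gt_eqF// mul0r addr_ge0.
have vC : `|v (enorm x)| `^ p * weight_at (enorm x) <= C.
  have [c cs cr] := I_cell cI Ix; apply: (HC cs cr).
  by have [k|k] := leP (enorm x) (cell_mid c); [right|left]; rewrite lexx ?k ?(ltW k).
have split_le y : `|y - v (enorm x)| `^ p * weight_at (enorm x) <=
    2 `^ p * (`|y| `^ p * weight_at (enorm x) + C).
  apply: (@le_trans _ _ (2 `^ p * (`|y| `^ p + `|v (enorm x)| `^ p) * weight_at (enorm x))).
    rewrite ler_wpM2r//; have := powR_normB_le (y - v (enorm x)) (- v (enorm x)) (ltW p0).
    by rewrite opprK subrK normrN.
  by rewrite -mulrA ler_wpM2l ?powR_ge0// mulrDl lerD2l.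
rewrite (mem_set (_ : margin h x))// mulr1.
have [[c cs cr]|nc'] := pselect (exists2 c, c \in s & c.1 + de <= enorm x <= c.2 - de).
  have [q hq ->] := glue_between cs cr.
  rewrite (le_trans (split_le _))// (@le_trans _ _ C1) ?lerDl//.
  by rewrite ler_wpM2l ?powR_ge0// lerD2r; exact: (HC cs (in_cell cr) hq).
rewrite (mem_set (_ : margin de x))// mulr1.
rewrite (le_trans (split_le _))// (@le_trans _ _ C2) ?lerDr//.
rewrite ler_wpM2l ?powR_ge0// lerD2r ler_pM ?powR_ge0//; last exact: HM.
by rewrite ge0_ler_powR ?nnegrE ?(ltW p0)//; exact: glue_le.
Qed.

End estimates.

End glue.

End recovery.

Lemma powRD_le (R : realType) (p x y : R) : 0 <= p -> 0 <= x -> 0 <= y ->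
  (x + y) `^ p <= 2 `^ p * (x `^ p + y `^ p).
Proof.
move=> p0 x0 y0; have := powR_normB_le (x + y) y p0.
by rewrite addrK !ger0_norm// addr_ge0.
Qed.

Section glue_energy.
Context {R : realType}.
Local Notation mu := (@lebesgue_measure R).
Variables (d : nat) (p a b : R) (eta : R -> R) (Omega : set 'rV[R]_d) (s : seq (R * R)).
Hypotheses (hd : (0 < d)%N) (hp : 1 < p) (ha : 0 <= a) (hab : a < b).
Hypothesis hOmega : Omega = eball b \/ Omega = annulus a b.
Hypothesis eta_ge0 : {ae mu, forall r : R, 0 <= r -> 0 <= eta r}.
Hypothesis eta_L1loc : L1loc_halfline eta.
Local Notation I := (regular_set p a b eta).
Hypothesis cI : open_cells I s.
Hypothesis sE : forall c, regular_components p a b eta c <-> c \in s.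
Local Notation ka := (kappa d p eta).
Local Notation sigma := (sphere_area d : R).
Local Notation IO := (@enorm R d @^-1` I).
Local Notation X := (X p a b eta Omega).
Local Notation weight_at := (weight_at p a b eta Omega).
Local Notation int_pow := (int_pow p a b eta Omega).
Local Notation Fbar := (Fbar p a b eta Omega).
Local Notation rho := (radial_weight d eta).

Let p0 : 0 < p. Proof. exact: lt_trans hp. Qed.
Let mka : measurable_fun setT ka. Proof. exact: measurable_kappa. Qed.
Let mrho : measurable_fun setT rho. Proof. exact: measurable_rho. Qed.
Let mI : measurable I. Proof. exact: measurable_I. Qed.
Let b0 : 0 < b. Proof. exact: b_gt0 ha hab. Qed.
Let sigma0 : 0 < sigma. Proof. exact: sphere_area_gt0. Qed.
Let Isub : I `<=` `]a, b[. Proof. exact: regular_set_sub. Qed.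
Let rho0 r : `]a, b[%classic r -> 0 <= rho r.
Proof. by rewrite /= in_itv/= => /andP[ar _]; rewrite rho_ge0// ltW// (le_lt_trans ha). Qed.
Let mab : measurable (`]a, b[%classic : set (measurableTypeR R)).
Proof. exact: measurable_itv. Qed.

Let mpow (g : R -> R) (D : set R) : measurable_fun setT g -> measurable_fun D (fun r => (`|g r| `^ p * rho r)%:E).
Proof.
move=> mg; apply: measurable_funTS; apply/measurable_EFinP; apply: measurable_funM => //.
by apply: (@measurableT_comp _ _ _ _ _ _ (fun x : R => x `^ p)) => //; exact: measurableT_comp.
Qed.

Lemma energy_radial_gradient (g : R -> R) : mu.-integrable setT (EFin \o g) ->
  energy p eta Omega (radial_gradient a b (cumul g)) =
  (sigma%:E * \int[mu]_(r in `]a, b[) (`|g r| `^ p * rho r)%:E)%E.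
Proof.
move=> gi; have mg : measurable_fun setT g by move/measurable_int/measurable_EFinP : gi.
have [N1 [mN1 N10] HN1] := primitive_derive_ae openT (primitive_cumul gi).
have [N2 [mN2 N20] HN2] : exists2 N : set R, measurable N /\ mu N = 0%E &
  forall r, 0 <= r -> ~ N r -> eta r = eta_pos eta r by exact: eta_pos_ae.
have mN : measurable (N1 `|` N2) by exact: measurableU.
have N0 : mu (N1 `|` N2) = 0%E by exact: null_set_setU.
rewrite -(@integral_radial_ae R d `]a, b[ (N1 `|` N2)
  (fun r => (`|derive1 (cumul g) r| `^ p * eta r)%:E) (fun r => `|g r| `^ p * rho r) hd mab _ mN N0).
- rewrite /energy [LHS]integral_mkcond [RHS]integral_mkcond; apply: eq_integral => x _; rewrite !patchE.
  have [xab|xab] := pselect (`]a, b[%classic (enorm x)).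
    rewrite (mem_set (_ : (enorm @^-1` `]a, b[) x))// mem_set; last first.
      move: xab; rewrite /= in_itv/= => /andP[h1 h2].
      by case: hOmega => ->; rewrite /eball /annulus /= ?h1.
    congr (_ `^ p * _)%:E; move: xab; rewrite /= in_itv/= => xab.
    have x0 : 0 < enorm x by case/andP : xab => /(le_lt_trans ha).
    by rewrite /radial_gradient xab enormZ normrM normfV (gtr0_norm x0) divfK// gt_eqF.
  rewrite (memNset (_ : ~ (enorm @^-1` `]a, b[) x))//; case: ifPn => // _.
  rewrite /radial_gradient ifF; last by apply/negP => h; apply: xab; rewrite /= in_itv.
  have -> : enorm (0 : 'rV[R]_d) = 0 by rewrite -(scale0r (0 : 'rV[R]_d)) enormZ normr0 mul0r.
  by rewrite powR0 ?mul0r// gt_eqF.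
- by move=> r; rewrite /= !in_itv/= andbT => /andP[/(le_lt_trans ha)].
- by apply/measurable_EFinP; exact: mpow.
- by move=> r rab; rewrite mulr_ge0 ?powR_ge0// rho0.
- move=> r rab /not_orP[n1 n2]; have r0 : 0 < r by move: rab; rewrite /= in_itv/= => /andP[/(le_lt_trans ha)].
  have dg := HN1 r Logic.I n1.
  rewrite derive1E (@derive_val _ _ _ _ _ _ _ dg) (HN2 r (ltW r0) n2) -EFinM -mulrA.
  by rewrite /radial_weight [X in _ * X]mulrC.
Qed.

Lemma measurable_sum_seq (F : R * R -> R -> R) (l : seq (R * R)) :
  (forall c, measurable_fun setT (F c)) -> measurable_fun setT (fun r => \sum_(c <- l) F c r).
Proof.
move=> mF; elim: l => [|c l ih].
  by rewrite (_ : (fun r => _) = cst 0)//; apply/funext => r; rewrite big_nil.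
rewrite (_ : (fun r => _) = (fun r => F c r + \sum_(c <- l) F c r)); last by apply/funext => r; rewrite big_cons.
exact: measurable_funD.
Qed.

Section glue.
Variables (v f : R -> R) (h de ep : R) (gl gr : R * R -> R -> R).
Hypotheses (pv : primitive_on I v f) (mf : measurable_fun I f).
Hypotheses (de0 : 0 < de) (deh : de <= h).
Hypothesis hh : forall c : R * R, c \in s -> 4 * h <= c.2 - c.1.
Hypothesis tgl : forall c, c \in s -> transition (c.1 - de) (c.1 + de) (gl c).
Hypothesis tgr : forall c, c \in s -> transition (c.2 - de) (c.2 + de) (gr c).
Hypotheses (mgl : forall c, measurable_fun setT (gl c)) (mgr : forall c, measurable_fun setT (gr c)).
Hypotheses (gl0 : forall c r, 0 <= gl c r) (gr0 : forall c r, 0 <= gr c r).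
Hypothesis egl : forall c, (\int[mu]_(r in `]a, b[) (gl c r `^ p * rho r)%:E <= ep%:E)%E.
Hypothesis egr : forall c, (\int[mu]_(r in `]a, b[) (gr c r `^ p * rho r)%:E <= ep%:E)%E.
Local Notation G := (glue_tail s v h gl gr).
Local Notation g := (glue_density s v f h gl gr).

Let gi : mu.-integrable setT (EFin \o g).
Proof. exact: (integrable_glue cI pv de0 deh hh tgl tgr). Qed.

Lemma measurable_glue_tail : measurable_fun setT G.
Proof.
by apply: measurable_sum_seq => c; apply: measurable_funD; apply: measurable_funM.
Qed.

Lemma glue_tail_ge0 r : 0 <= G r.
Proof. by apply: sumr_ge0 => c _; rewrite addr_ge0// mulr_ge0. Qed.

(** On the cores the density is [f], and elsewhere it consists of transitions only, so the two
    contributions add without a constant in front of the energy of [f]. *)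
Lemma glue_density_energy :
  (\int[mu]_(r in `]a, b[) (`|g r| `^ p * rho r)%:E <=
   penergy p ka f I + \int[mu]_(r in `]a, b[) (`|G r| `^ p * rho r)%:E)%E.
Proof.
pose k : R -> \bar R := fun r => (`|f r| `^ p * ka r `^ (1 - p))%:E.
have k0 r : (0 <= (k \_ I) r)%E.
  by rewrite patchE; case: ifPn => // _; rewrite lee_fin mulr_ge0 ?powR_ge0.
have mk' : measurable_fun I k by apply: measurable_penergy.
have mk : measurable_fun setT (k \_ I) by exact: ((measurable_restrictT k mI).1 mk').
have kE : (\int[mu]_(r in `]a, b[) (k \_ I) r = penergy p ka f I)%E.
  rewrite /penergy [LHS]integral_mkcond [RHS]integral_mkcond; apply: eq_integral => r _; rewrite !patchE.
  have [Ir|Ir] := pselect (I r); first by rewrite mem_set; [|exact: Isub].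
  by rewrite (memNset Ir); case: ifPn.
have G0 r : `]a, b[%classic r -> (0 <= (`|G r| `^ p * rho r)%:E)%E.
  by move=> rab; rewrite lee_fin mulr_ge0 ?powR_ge0// rho0.
rewrite -kE -ge0_integralD//; last 2 first.
- exact: measurable_funTS.
- by apply: mpow; exact: measurable_glue_tail.
have [N [mN N0] HN] : exists2 N : set R, measurable N /\ mu N = 0%E &
  forall r, I r -> ~ N r -> 0 < eta_pos eta r /\ eta r = eta_pos eta r by exact: regular_ae.
apply: (@ge0_le_integral_off_null _ (measurableTypeR R) R mu _ N _ _ mN N0).
- by move=> r rab; rewrite lee_fin mulr_ge0 ?powR_ge0// rho0.
- by move=> r rab; rewrite adde_ge0// G0.
move=> r rab Nr.
have [[c cs cr]|nc] := pselect (exists2 c, c \in s & c.1 + h <= r <= c.2 - h).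
  have [_ ->] := glue_inside cI pv de0 deh hh tgl tgr cs cr.
  have Ir : I r.
    have dp := de0; have dh := deh.
    by apply: (cell_I cI cs); case/andP : cr => c1 c2; apply/andP; split; lra.
  have /andP[r0 _] := I_pos ha Ir.
  have [e0 _] := HN r Ir Nr.
  rewrite patchE mem_set// /k (kappa_rho hp) ?leeDl ?G0//.
  by rewrite /radial_weight mulr_gt0 ?exprn_gt0.
apply: (@le_trans _ _ (`|G r| `^ p * rho r)%:E); last by rewrite leeDr.
rewrite lee_fin ler_wpM2r ?rho0// ge0_ler_powR ?nnegrE ?(ltW p0)//.
rewrite (ger0_norm (glue_tail_ge0 _)).
exact: (glue_density_le cI pv de0 deh hh tgl tgr).
Qed.

Lemma glue_tail_energy (K : R) : 0 <= K ->
  (forall x : R * R -> R, (forall i, 0 <= x i) -> (\sum_(i <- s) x i) `^ p <= K * \sum_(i <- s) x i `^ p) ->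
  (\int[mu]_(r in `]a, b[) (`|G r| `^ p * rho r)%:E <=
   (K * 2 `^ p * (\sum_(c <- s) (`|v (cell_left h c)| `^ p + `|v (cell_right h c)| `^ p)) * ep)%:E)%E.
Proof.
move=> K0 HK.
pose A (c : R * R) := K * 2 `^ p * `|v (cell_left h c)| `^ p.
pose B (c : R * R) := K * 2 `^ p * `|v (cell_right h c)| `^ p.
have A0 c : 0 <= A c by rewrite !mulr_ge0 ?powR_ge0.
have B0 c : 0 <= B c by rewrite !mulr_ge0 ?powR_ge0.
pose k c r := ((A c)%:E * (gl c r `^ p * rho r)%:E + (B c)%:E * (gr c r `^ p * rho r)%:E)%E.
have ml c : measurable_fun `]a, b[ (fun r => (gl c r `^ p * rho r)%:E).
  rewrite (_ : (fun r => _) = (fun r => (`|gl c r| `^ p * rho r)%:E)); first exact: mpow.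
  by apply/funext => r; rewrite ger0_norm.
have mr c : measurable_fun `]a, b[ (fun r => (gr c r `^ p * rho r)%:E).
  rewrite (_ : (fun r => _) = (fun r => (`|gr c r| `^ p * rho r)%:E)); first exact: mpow.
  by apply/funext => r; rewrite ger0_norm.
have l0 c r : `]a, b[%classic r -> (0 <= (gl c r `^ p * rho r)%:E)%E.
  by move=> rab; rewrite lee_fin mulr_ge0 ?powR_ge0// rho0.
have r0 c r : `]a, b[%classic r -> (0 <= (gr c r `^ p * rho r)%:E)%E.
  by move=> rab; rewrite lee_fin mulr_ge0 ?powR_ge0// rho0.
apply: (@le_trans _ _ (\int[mu]_(r in `]a, b[) (\sum_(c <- s) k c r))%E).
  apply: (@ge0_le_integral_off_null _ (measurableTypeR R) R mu _ set0) => //.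
  - by move=> r rab; rewrite lee_fin mulr_ge0 ?powR_ge0// rho0.
  - by move=> r rab; apply: sume_ge0 => c _; rewrite adde_ge0// mule_ge0 ?lee_fin// -lee_fin ?l0 ?r0.
  move=> r rab _; rewrite /k; move: (rho r) (rho0 rab) => q q0.
  under eq_bigr do rewrite -!EFinM -EFinD.
  rewrite sumEFin lee_fin (ger0_norm (glue_tail_ge0 r)).
  under eq_bigr do rewrite !mulrA -mulrDl.
  rewrite -mulr_suml ler_wpM2r//.
  have x0 (c : R * R) : 0 <= `|v (cell_left h c)| * gl c r + `|v (cell_right h c)| * gr c r.
    by rewrite addr_ge0// mulr_ge0.
  rewrite (le_trans (HK _ x0))// mulr_sumr; apply: ler_sum => c _.
  have H := powRD_le (ltW p0) (mulr_ge0 (normr_ge0 (v (cell_left h c))) (gl0 c r))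
    (mulr_ge0 (normr_ge0 (v (cell_right h c))) (gr0 c r)).
  rewrite !powRM// in H *.
  apply: (le_trans (ler_wpM2l K0 H)); rewrite /A /B le_eqVlt; apply/orP; left; apply/eqP; ring.
have -> : (\int[mu]_(r in `]a, b[) (\sum_(c <- s) k c r) = \sum_(c <- s) \int[mu]_(r in `]a, b[) k c r)%E.
  apply: (@ge0_integral_sum _ (measurableTypeR R) R mu _ mab _ k).
    by move=> c; apply: emeasurable_funD; [exact: (measurable_funeM (A c)%:E (ml c))|exact: (measurable_funeM (B c)%:E (mr c))].
  by move=> c r rab; rewrite /k adde_ge0// mule_ge0 ?lee_fin// -lee_fin ?l0 ?r0.
rewrite mulr_sumr mulr_suml -sumEFin; apply: lee_sum => c _; rewrite /k.
rewrite ge0_integralD//; last 4 first.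
- by move=> r rab; rewrite mule_ge0 ?lee_fin// -lee_fin l0.
- exact: (measurable_funeM (A c)%:E (ml c)).
- by move=> r rab; rewrite mule_ge0 ?lee_fin// -lee_fin r0.
- exact: (measurable_funeM (B c)%:E (mr c)).
rewrite !ge0_integralZl//; try by move=> r rab; rewrite ?l0 ?r0.
rewrite (_ : K * 2 `^ p * _ * ep = A c * ep + B c * ep); last by rewrite /A /B; ring.
rewrite EFinD (EFinM (A c)) (EFinM (B c)); apply: leeD; apply: lee_wpmul2l; rewrite ?lee_fin//.
- exact: mr.
- by rewrite lee_fin; exact: B0.
- exact: ml.
- by rewrite lee_fin; exact: A0.
Qed.

Lemma glue_F : X (glue s v f h gl gr \o enorm) ->
  (F p a b eta Omega (glue s v f h gl gr \o enorm) <=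
   sigma%:E * \int[mu]_(r in `]a, b[) (`|g r| `^ p * rho r)%:E)%E.
Proof.
move=> [mU _]; rewrite -(energy_radial_gradient gi); apply: ereal_inf_lbound.
exists (cumul g) => //; exists (glue s v f h gl gr \o enorm).
  by apply: (eqX_off_null hd hp hOmega cI sE (N := set0)).
split => //.
- exists (radial_field g); rewrite (I_OmegaE _ _ hOmega).
  apply: (primitive_weak_gradient hd b0 (I_sub0b ha) cI).
    by apply: measurable_funTS; move/measurable_int/measurable_EFinP : gi.
  exact: primitive_onS (subsetT _) (primitive_cumul gi).
- exact: integral_abs_continuous gi (primitive_onS (subsetT _) (primitive_cumul gi)).
Qed.

End glue.

Lemma choose_transition (e : R * R -> R) (de ep : R) : 0 < de -> 0 < ep ->
  (forall c, c \in s -> [/\ a <= e c, e c <= b & ~ I (e c)]) ->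
  exists g : R * R -> R -> R, [/\ forall c, c \in s -> transition (e c - de) (e c + de) (g c),
    forall c, measurable_fun setT (g c), forall c r, 0 <= g c r &
    forall c, (\int[mu]_(r in `]a, b[) (g c r `^ p * rho r)%:E <= ep%:E)%E].
Proof.
move=> de0 ep0 He.
have H c : exists g : R -> R, [/\ c \in s -> transition (e c - de) (e c + de) g,
    measurable_fun setT g, forall r, 0 <= g r &
    (\int[mu]_(r in `]a, b[) (g r `^ p * rho r)%:E <= ep%:E)%E].
  case: (boolP (c \in s)) => [cs|ncs]; last first.
    exists (cst 0); split => //; rewrite integral0_eq ?lee_fin ?(ltW ep0)// => r _.
    by rewrite powR0 ?mul0r// gt_eqF.
  have [h1 h2 h3] := He c cs.
  have [g tg eg] := @cheap_transition _ d _ _ _ _ hp ha hab eta_ge0 eta_L1loc _ _ _ h1 h2 h3 de0 ep0.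
  by exists g; have [gi g0 _ _] := tg; split => //; [by move/measurable_int/measurable_EFinP : gi|exact: ltW].
have [g Hg] := choice H.
by exists g; split => c; have [? ? ? ?] := Hg c.
Qed.

(** The glued functions approach u in X at an extra cost below any [e2]; lower semicontinuity of
    [Fbar] then transfers the bound to u. *)
Lemma recovery u v f (T : R) : X u -> profile p a b eta u v f ->
  penergy p ka f I = T%:E -> (Fbar u <= (sigma * T)%:E)%E.
Proof.
move=> Xu [pv mf [N [mN N0] HN]] fT; rewrite -[leRHS]adde0; apply/lee_addgt0Pr => e2 e20.
rewrite adde0 -EFinD; apply: (Fbar_le_lim hp Xu) => e e0.
have fT' : (penergy p ka f I <= T%:E)%E by rewrite fT.
have [C C0 HC] := profile_bound hd hp ha hOmega eta_ge0 eta_L1loc cI sE pv mf fT'.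
have [M M0 HM] := weight_at_bounded hd hp ha hOmega eta_ge0 eta_L1loc cI sE.
have [h0 [h00 _ Hh0]] := cells_margin (fun (c : R * R) cs => cell_lt cI cs) (@ltr01 R).
(* The bound on the measure of a margin that makes its error term, of constant K, less than e / 2; K
   may be 0. *)
have small (K : R) : 0 <= K -> 0 < e / 2 / (K + 1) by move=> K0; rewrite !divr_gt0// ltr_wpDl.
have fin (K : R) t : 0 <= K -> (leb d (margin p a b eta s t) < (e / 2 / (K + 1))%:E)%E ->
    (K%:E * leb d (margin p a b eta s t) <= (e / 2 * (K / (K + 1)))%:E)%E.
  move=> K0 /ltW lt; apply: (le_trans (lee_wpmul2l _ lt)); first by rewrite lee_fin.
  by rewrite -EFinM lee_fin le_eqVlt; apply/orP; left; apply/eqP; field; rewrite gt_eqF// ltr_wpDl.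
have C10 : 0 <= 2 `^ p * (C + C) by rewrite mulr_ge0 ?powR_ge0// addr_ge0.
have [h [hpos hh0 mh]] := small_margin ha hab hOmega cI h00 (small _ C10).
(* Available only now that h is fixed; de is chosen against it. *)
pose B := glue_const s v h.
have C20 : 0 <= 2 `^ p * (B `^ p * M + C).
  by rewrite mulr_ge0 ?powR_ge0// addr_ge0// mulr_ge0 ?powR_ge0// ltW.
have [de [de0 deh mde]] := small_margin ha hab hOmega cI hpos (small _ C20).
have hh (c : R * R) : c \in s -> 4 * h <= c.2 - c.1.
  by move=> /Hh0; apply: le_trans; rewrite ler_wpM2l.
have [K K0 HK] := sum_powR_le s p0.
pose S := K * 2 `^ p * \sum_(c <- s) (`|v (cell_left h c)| `^ p + `|v (cell_right h c)| `^ p).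
have S0 : 0 <= S.
  by rewrite !mulr_ge0 ?powR_ge0// sumr_ge0// => c _; rewrite addr_ge0 ?powR_ge0.
pose ep := e2 / (sigma * (S + 1)).
have ep0 : 0 < ep by rewrite divr_gt0// mulr_gt0// ltr_wpDl.
have [gl [tgl mgl gl0 egl]] := @choose_transition (fun c => c.1) de ep de0 ep0
  (fun c cs => let: And4 h1 h2 h3 h4 := cell_bounds cI cs in
     And3 h1 (le_trans (ltW (cell_lt cI cs)) h2) h3).
have [gr [tgr mgr gr0 egr]] := @choose_transition (fun c => c.2) de ep de0 ep0
  (fun c cs => let: And4 h1 h2 h3 h4 := cell_bounds cI cs in
     And3 (le_trans h1 (ltW (cell_lt cI cs))) h2 h4).
have XU := glue_X hd hp ha hab hOmega cI sE pv de0 deh hh tgl tgr C0 HC (ltW M0) HM.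
exists (glue s v f h gl gr \o enorm); split => //.
  apply: (le_lt_trans (glue_error hd hp hOmega cI sE pv de0 deh hh tgl tgr C0 HC (ltW M0) HM mN N0 HN)).
  apply: (le_lt_trans (leeD (fin _ _ C10 mh) (fin _ _ C20 mde))).
  have lt1 (L : R) : 0 <= L -> e / 2 * (L / (L + 1)) < e / 2.
    move=> L0; rewrite -[ltRHS]mulr1 ltr_pM2l ?divr_gt0// ltr_pdivrMr ?ltr_wpDl//.
    by rewrite mul1r ltrDl.
  by rewrite -EFinD lte_fin [ltRHS]splitr ltrD// lt1.
apply: (le_trans (Fbar_le_F XU)).
apply: (le_trans (glue_F pv de0 deh hh tgl tgr XU)).
have s0 : (0 <= sigma%:E)%E by rewrite lee_fin ltW.
have H1 := glue_density_energy pv mf de0 deh hh tgl tgr mgl mgr gl0 gr0.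
have H2 : (\int[mu]_(r in `]a, b[) (`|glue_tail s v h gl gr r| `^ p * rho r)%:E <= (S * ep)%:E)%E.
  by apply: glue_tail_energy.
apply: (le_trans (lee_wpmul2l s0 H1)); rewrite fT.
apply: (le_trans (lee_wpmul2l s0 (leeD2l _ H2))); rewrite -EFinD -EFinM lee_fin mulrDr lerD2l /ep.
have -> : sigma * (S * (e2 / (sigma * (S + 1)))) = e2 * (S / (S + 1)).
  by field; rewrite !gt_eqF// ltr_wpDl.
rewrite -[leRHS]mulr1 ler_wpM2l ?(ltW e20)// ler_pdivrMr ?ltr_wpDl// mul1r lerDl//.
Qed.

End glue_energy.

(** * The representation formula *)

Section representation.
Context {R : realType}.
Local Notation mu := (@lebesgue_measure R).
Variables (d : nat) (p a b : R) (eta : R -> R) (Omega : set 'rV[R]_d) (s : seq (R * R)).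
Hypotheses (hd : (0 < d)%N) (hp : 1 < p) (ha : 0 <= a) (hab : a < b).
Hypothesis hOmega : Omega = eball b \/ Omega = annulus a b.
Hypothesis eta_ge0 : {ae mu, forall r : R, 0 <= r -> 0 <= eta r}.
Hypothesis eta_L1loc : L1loc_halfline eta.
Local Notation I := (regular_set p a b eta).
Hypothesis cI : open_cells I s.
Hypothesis sE : forall c, regular_components p a b eta c <-> c \in s.
Local Notation ka := (kappa d p eta).
Local Notation IO := (@enorm R d @^-1` I).
Local Notation X := (X p a b eta Omega).
Local Notation Fbar := (Fbar p a b eta Omega).
Local Notation Dom := (classes_of p a b eta Omega (Dom_rw p a b eta Omega)).

Let mI : measurable I. Proof. exact: measurable_I. Qed.
Let b0 : 0 < b. Proof. exact: b_gt0 ha hab. Qed.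

Lemma Dom_profile u : Dom u -> exists v f, profile p a b eta u v f /\ (penergy p ka f I < +oo)%E.
Proof.
move=> [mu' [u' uu' [mu'' [v [f vf fE] u'v]]]].
have mf : measurable_fun I f by have [_ [? _ _] _] := vf.
have [v0 pv [N [mN N0] HN]] := weak_derivative_primitive vf.
have [N1 [mN1 N10] HN1] := eqXP hd hp ha hOmega eta_ge0 eta_L1loc cI sE uu'.
have [mN2 N20] := null_set_enorm hd mN N0.
exists v0, f; rewrite -(integral_Dom_eta _ hp ha eta_ge0 mf); split => //; split => //.
exists (N1 `|` enorm @^-1` N).
  by split; [exact: measurableU|exact: null_set_setU].
move=> x Ix /not_orP[n1 n2]; rewrite (HN1 x Ix n1) -(HN _ Ix n2); apply: u'v.
  exact: (IO_sub hOmega Ix).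
by have := regular_set_sub Ix; rewrite /= in_itv.
Qed.

Lemma profile_Dom u v f : measurable_fun Omega u -> profile p a b eta u v f ->
  (penergy p ka f I < +oo)%E -> Dom u.
Proof.
move=> mu' [pv mf [N [mN N0] HN]] fE; split => //.
have oI : open I by have [] := cI.
have mV : measurable_fun setT (v \_ I).
  by apply/(measurable_restrictT _ _).1 => //; exact: primitive_measurable pv.
exists ((v \_ I) \o enorm).
  apply: (eqX_off_null hd hp hOmega cI sE mN N0) => x Ix Nx.
  by rewrite (HN x Ix Nx) /= patchE mem_set.
split; first by apply: measurable_funTS; apply: measurableT_comp => //; exact: measurable_enorm.
exists (v \_ I) => //; exists f; last by rewrite (integral_Dom_eta _ hp ha eta_ge0 mf).
apply: (primitive_weak_derivative b0 (I_sub0b ha) cI mf) => x y xy sub.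
have [fi e] := pv x y xy sub; split => //; rewrite -e !patchE !mem_set//; apply: sub; rewrite /= in_itv/= lexx xy//.
Qed.

Lemma profile_weak_gradient u v f : measurable_fun Omega u -> profile p a b eta u v f ->
  weak_gradient IO u (radial_field f).
Proof.
move=> mu' [pv mf [N [mN N0] HN]].
apply: (@weak_gradient_ae _ _ _ (v \o enorm) _ _ N) => //.
- by move=> x Ix Nx; rewrite (HN x Ix Nx).
- by apply: measurable_funS mu'; [exact: (measurable_Omega hOmega)|exact: (IO_sub hOmega)].
- exact: (primitive_weak_gradient hd b0 (I_sub0b ha) cI mf pv).
Qed.

(** The left side does not involve the profile: this is how two profiles of u are compared. *)
Lemma weak_gradient_energy u v f G : measurable_fun Omega u -> profile p a b eta u v f ->
  weak_gradient IO u G -> energy p eta IO G = profile_energy d p a b eta f.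
Proof.
move=> mu' P wG; have [_ mf _] := P.
have [N [mN N0] HN] := weak_gradient_unique wG (profile_weak_gradient mu' P).
rewrite -(energy_radial_field hd hp ha eta_ge0 eta_L1loc mf).
by apply: (eq_integral_off_null mN N0) => x Ix Nx; rewrite (HN x Ix Nx).
Qed.

Lemma Fbar_profile u v f : X u -> profile p a b eta u v f -> (penergy p ka f I < +oo)%E ->
  Fbar u = profile_energy d p a b eta f.
Proof.
move=> Xu P fE; have [mu' _] := Xu; apply/eqP; rewrite eq_le; apply/andP; split.
  have fT : penergy p ka f I = (fine (penergy p ka f I))%:E.
    by rewrite fineK// ge0_fin_numE// penergy_ge0.
  by rewrite /profile_energy fT -EFinM; exact: (recovery hd hp ha hab hOmega eta_ge0 eta_L1loc cI sE Xu P fT).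
apply: le_trans (relaxed_le_Fbar hd hp ha hOmega eta_ge0 eta_L1loc cI sE Xu).
apply: le_ereal_inf_tmp => _ [f2 [v2 P2] <-].
rewrite -(weak_gradient_energy mu' P (profile_weak_gradient mu' P2)).
by rewrite (weak_gradient_energy mu' P2 (profile_weak_gradient mu' P2)).
Qed.

Lemma Fbar_Dom u : X u -> (Fbar u < +oo)%E -> Dom u.
Proof.
move=> Xu Fu; have [mu' _] := Xu.
have := le_lt_trans (relaxed_le_Fbar hd hp ha hOmega eta_ge0 eta_L1loc cI sE Xu) Fu.
move=> /ereal_inf_lt[_ [f [v P] <-] fE]; apply: (profile_Dom mu' P).
have s0 : 0 < (sphere_area d : R) by exact: sphere_area_gt0.
have := penergy_ge0 p ka f I; move: fE; rewrite /profile_energy.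
by case: (penergy _ _ _ _) => [r _ _|+ _|//]; [exact: ltry|rewrite gt0_muley ?lte_fin].
Qed.

(** Finite energy forces finite norm, by the pointwise bound on |v|^p times the weight; this is what
    makes the domain all of [Dom] rather than its trace on [X]. *)
Lemma Dom_X u : Dom u -> X u.
Proof.
move=> /[dup] -[mu' _] /Dom_profile[v [f [[pv mf [N [mN N0] HN]] fE]]]; split => //.
have fT : (penergy p ka f I <= (fine (penergy p ka f I))%:E)%E.
  by rewrite fineK// ge0_fin_numE// penergy_ge0.
exact: (profile_int_pow hd hp ha hab hOmega eta_ge0 eta_L1loc cI sE pv mf fT mN N0 HN).
Qed.

End representation.

Theorem theorem4p1 (R : realType) (d : nat) (p a b : R) (eta : R -> R)
    (Omega : set 'rV[R]_d)
    (hd : (1 <= d)%N) (hp : 1 < p) (ha : 0 <= a) (hab : a < b)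
    (hOmega : Omega = eball b \/ Omega = annulus a b)
    (eta_ge0 : {ae lebesgue_measure, forall r : R, 0 <= r -> 0 <= eta r})
    (eta_L1loc : L1loc_halfline eta)
    (eta_supp : ess_support eta = `[a, b]%classic)
    (eta_fin : finitely_degenerate p a b eta) :
  [/\ [set u | X p a b eta Omega u /\ (Fbar p a b eta Omega u < +oo)%E] =
        classes_of p a b eta Omega (Dom_rw p a b eta Omega),
      forall u, X p a b eta Omega u ->
        classes_of p a b eta Omega (Dom_rw p a b eta Omega) u ->
        (exists G, weak_gradient (I_Omega p a b eta Omega) u G) /\
        forall G, weak_gradient (I_Omega p a b eta Omega) u G ->
          Fbar p a b eta Omega u =
            energy p eta (I_Omega p a b eta Omega) G &
      forall u, X p a b eta Omega u ->
        ~ classes_of p a b eta Omega (Dom_rw p a b eta Omega) u ->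
        Fbar p a b eta Omega u = +oo%E].
Proof.
have [s cI sE] := regular_open_cells eta_fin.2.
have DomP u := @Dom_profile R d p a b eta Omega s hd hp ha hOmega eta_ge0 eta_L1loc cI sE u.
have DomX u := @Dom_X R d p a b eta Omega s hd hp ha hab hOmega eta_ge0 eta_L1loc cI sE u.
have FDom u := @Fbar_Dom R d p a b eta Omega s hd hp ha hab hOmega eta_ge0 eta_L1loc cI sE u.
have FE u v f := @Fbar_profile R d p a b eta Omega s hd hp ha hab hOmega eta_ge0 eta_L1loc cI sE u v f.
split.
- apply/seteqP; split => u; first by move=> [Xu]; exact: FDom.
  move=> Du; have Xu := DomX u Du; split => //.
  have [v [f [P fE]]] := DomP u Du; rewrite (FE u v f Xu P fE) /profile_energy.
  by rewrite lte_mul_pinfty// lee_fin ltW// sphere_area_gt0.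
- move=> u Xu Du; have [v [f [P fE]]] := DomP u Du; have [mu _] := Xu.
  rewrite (I_OmegaE _ _ hOmega); split.
    exists (radial_field f); exact: (profile_weak_gradient hd ha hab hOmega cI mu P).
  move=> G wG; rewrite (FE u v f Xu P fE); apply/esym.
  exact: (weak_gradient_energy hd hp ha hab hOmega eta_ge0 eta_L1loc cI mu P wG).
- move=> u Xu nDu; apply: contrapT => Fu; apply: nDu; apply: FDom => //.
  by rewrite ltey; apply/eqP.
Qed.
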